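(* Let $R_0,\rho_{\ell,*},c_{\ell,*},\rho_{g,*},c_{g,*},\sigma_*>0$. Assume that $\rho_\alpha\ge\rho_{\alpha,*}>0$ and $c_\alpha\ge c_{\alpha,*}>0$ for $\alpha\in\{\ell,g\}$, and $0<\sigma\le\sigma_*$. For every admissible initial datum $\mathcal I^{(0)}=(V_\ell^{[0]},V_g^{[0]},V_\ell^{[1]},V_g^{[1]},\eta_0^{(0)},\zeta_0^{(0)})\in\mathcal X_m^{(0)}$ (the class defined in the context), the $Y_0^0$ system $$\partial_{tt}v_g-c_g^2\partial_{rr}v_g=0\quad(0<r<R_0),\qquad \partial_{tt}v_\ell-c_\ell^2\partial_{rr}v_\ell=0\quad(r>R_0),\qquad v_g(0,t)=0,$$ $$v_\ell(R_0,t)-v_g(R_0,t)=\frac{2\sigma}{R_0}\eta^{(0)}(t),$$ $$\frac1{\rho_gR_0^2}\bigl(R_0\partial_rv_g(R_0,t)-v_g(R_0,t)\bigr)=\frac1{\rho_\ell R_0^2}\bigl(R_0\partial_rv_\ell(R_0,t)-v_\ell(R_0,t)\bigr)=-\frac{d^2}{dt^2}\eta^{(0)}(t),$$ with initial data $v_\alpha(\cdot,0)=V_\alpha^{[0]}$, $\partial_tv_\alpha(\cdot,0)=V_\alpha^{[1]}$, $\eta^{(0)}(0)=\eta_0^{(0)}$, $\frac{d}{dt}\eta^{(0)}(0)=\zeta_0^{(0)}$, admits a unique weighted solution in the following sense: $$\frac{d}{dt}\eta^{(0)}\in H^m_\gamma(0,\infty),\qquad \eta^{(0)}\in H^m_\gamma(0,\infty),\qquad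 v_g(R_0,\cdot),\ v_\ell(R_0,\cdot)\in H^m_\gamma(0,\infty),$$ and, for $\alpha\in\{\ell,g\}$, $$\partial_t^jv_\alpha\in L^2_\gamma(0,\infty;L^2(I_\alpha)),\qquad 0\le j\le m.$$ Here $\gamma>\widetilde\gamma_*$, where $\widetilde\gamma_*>0$ is a fixed threshold depending on $R_0,\rho_{\ell,*},c_{\ell,*},\rho_{g,*},c_{g,*},\sigma_*$. Moreover, if $m\ge1$, then for $\alpha\in\{g,\ell\}$ $$\partial_t^{j-1}v_\alpha\in L^2_\gamma(0,\infty;H^1(I_\alpha)),\qquad 1\le j\le m.$$
   Context: $I_g=(0,R_0)$ and $I_\ell=(R_0,\infty)$. The system is the spherically symmetric sector of a linearized gas-bubble model: $v_\alpha=rp_\alpha^{(0)}$, where $p_\alpha^{(0)}(r,t)$ is the coefficient of the spherical harmonic $Y_0^0$ of the pressure perturbation in phase $\alpha$ ($\ell$ = liquid, $g$ = gas), $\eta^{(0)}(t)$ is the $Y_0^0$ coefficient of the normal interface displacement, $\sigma$ is the surface tension, $\rho_\alpha$ and $K_\alpha$ are the equilibrium density and bulk modulus, and $c_\alpha=\sqrt{K_\alpha/\rho_\alpha}$. Weighted spaces: for an integer $m\ge0$, $\|f\|_{H^m_\gamma(0,\infty)}^2=\sum_{j=0}^m\int_0^\infty e^{-\gamma t}|\partial_t^jf(t)|^2\,dt$; $L^2_\gamma(0,\infty;X)$ is the space of $X$-valued functions that are square integrable in time with the same weight. Data class $\mathcal X_m^{(0)}$, for an integer $m\ge1$: let $V_\alpha^{[0]}=rp^{(0)}_{\alpha,0}$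 and $V_\alpha^{[1]}=rq^{(0)}_{\alpha,0}$, where $p^{(0)}_{\alpha,0}$, $q^{(0)}_{\alpha,0}$ are the initial values of $p^{(0)}_\alpha$, $\partial_tp^{(0)}_\alpha$, and define recursively $V_\alpha^{[j+2]}:=c_\alpha^2\frac{d^2}{dr^2}V_\alpha^{[j]}$ for $j\ge0$. Put $\mathcal B_\alpha\phi:=\frac1{\rho_\alpha R_0^2}\bigl(R_0\phi'(R_0)-\phi(R_0)\bigr)$. The datum belongs to $\mathcal X_m^{(0)}$ if $V_\alpha^{[0]}\in H^{m+1}(I_\alpha)$, $V_\alpha^{[1]}\in H^m(I_\alpha)$ for $\alpha\in\{\ell,g\}$, $\eta_0^{(0)},\zeta_0^{(0)}\in\mathbb R$, and the following compatibility conditions hold for $0\le j\le m$: $$V_g^{[j]}(0)=0,\qquad E_0:=\eta_0^{(0)},\quad E_1:=\zeta_0^{(0)},\quad E_{j+2}:=-\mathcal B_gV_g^{[j]}=-\mathcal B_\ell V_\ell^{[j]},\qquad V_\ell^{[j]}(R_0)-V_g^{[j]}(R_0)=\frac{2\sigma}{R_0}E_j .$$ *)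

(* Defs.v *)
From HB Require Import structures.
From mathcomp Require Import all_boot all_order all_algebra.
From mathcomp Require Import all_classical all_reals all_analysis.

Set Implicit Arguments.
Unset Strict Implicit.
Unset Printing Implicit Defensive.

Import Order.TTheory GRing.Theory Num.Theory.
Import numFieldNormedType.Exports.

Local Open Scope classical_set_scope.
Local Open Scope ring_scope.

Notation leb := (@lebesgue_measure _).

(** * Distributions and Sobolev spaces on an open interval [I] *)

(* [C_c^oo(I)], each function being extended by zero to the real line. *)
Definition test_fun {R : realType} (I : set R) (phi : R -> R) : Prop :=
  (forall n x, derivable (derive1n n phi) x 1) /\
  (exists K : set R, [/\ compact K, K `<=` I & forall x, ~ K x -> phi x = 0]).

Definition is_wderiv {R : realType} (k : nat) (I : set R) (f g : R -> R)
    : Prop :=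
  [/\ locally_integrable I f, locally_integrable I g &
      forall phi, test_fun I phi ->
        \int[leb]_(x in I) (f x * derive1n k phi x) =
        (-1) ^+ k * \int[leb]_(x in I) (g x * phi x)].

(* A representative of the [k]-th weak derivative; it is meaningful only when
   that derivative exists, and is then determined almost everywhere. *)
Definition wderiv {R : realType} (k : nat) (I : set R) (f : R -> R) : R -> R :=
  get [set g | is_wderiv k I f g].

(* [L^2(I; w dx)] and [H^k(I; w dx)]. *)
Definition L2 {R : realType} (w : R -> R) (I : set R) (f : R -> R) : Prop :=
  measurable_fun I f /\
  leb.-integrable I (fun x => (w x * f x ^+ 2)%:E).

Definition Sobolev {R : realType} (w : R -> R) (k : nat) (I : set R)
    (f : R -> R) : Prop :=
  forall j, (j <= k)%N -> exists2 g, is_wderiv j I f g & L2 w I g.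

Definition Hk {R : realType} (k : nat) (I : set R) (f : R -> R) : Prop :=
  Sobolev (cst 1) k I f.

(* The boundary value at [b] of a function having a representative that is
   continuous up to the boundary, e.g. of any [f] in [H^1(I)]. *)
Definition is_trace {R : realType} (I : set R) (b : R) (f : R -> R) (y : R)
    : Prop :=
  exists F : R -> R, [/\ {within closure I, continuous F},
    {ae leb, forall x, I x -> F x = f x} & F b = y].

Definition trace {R : realType} (I : set R) (b : R) (f : R -> R) : R :=
  get [set y | is_trace I b f y].

(** * Functions of [(r, t)] *)

Definition time {R : realType} : set R := `]0, +oo[%classic.

Definition weight {R : realType} (gamma : R) : R -> R :=
  fun t => expR (- gamma * t).

Definition Hgamma {R : realType} (gamma : R) (m : nat) (f : R -> R) : Prop :=
  Sobolev (weight gamma) m time f.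

(* [L^2_gamma(0, oo; L^2(I))], whose elements are identified, as usual, with
   jointly measurable functions. *)
Definition L2gamma_L2 {R : realType} (gamma : R) (I : set R) (v : R -> R -> R)
    : Prop :=
  measurable_fun (I `*` time) (fun z : R * R => v z.1 z.2) /\
  (leb \x leb)%E.-integrable (I `*` time)
    (fun z : R * R => (weight gamma z.2 * v z.1 z.2 ^+ 2)%:E).

(* [L^2_gamma(0, oo; H^1(I))]. *)
Definition L2gamma_H1 {R : realType} (gamma : R) (I : set R) (v : R -> R -> R)
    : Prop :=
  L2gamma_L2 gamma I v /\
  exists2 w, L2gamma_L2 gamma I w &
    {ae leb, forall t, time t -> is_wderiv 1 I (v^~ t) (w^~ t)}.

(* [<v(r, .), theta>] as a function of [r], and [<v(., t), psi>] as a function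
   of [t]. *)
Definition pair_t {R : realType} (v : R -> R -> R) (theta : R -> R) : R -> R :=
  fun r => \int[leb]_(t in time) (v r t * theta t).

Definition pair_r {R : realType} (I : set R) (v : R -> R -> R) (psi : R -> R)
    : R -> R :=
  fun t => \int[leb]_(r in I) (v r t * psi r).

(* [w = \partial_t^j v] as [L^2(I)]-valued distributions on [(0, oo)]. *)
Definition is_dt {R : realType} (j : nat) (I : set R) (v w : R -> R -> R)
    : Prop :=
  forall theta, test_fun time theta ->
    {ae leb, forall r, I r ->
      pair_t v (derive1n j theta) r = (-1) ^+ j * pair_t w theta r}.

(** * The radial two-phase system *)

Inductive phase := liquid | gas.

Definition dom {R : realType} (R0 : R) (a : phase) : set R :=
  match a with
  | liquid => `]R0, +oo[%classic
  | gas => `]0, R0[%classic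
  end.

(* [B_a phi = (R0 phi'(R0) - phi(R0)) / (rho_a R0^2)], for [phi] in
   [H^2(dom R0 a)]. *)
Definition flux {R : realType} (R0 : R) (rho : phase -> R) (a : phase)
    (phi : R -> R) : R :=
  (rho a * R0 ^+ 2)^-1 *
  (R0 * trace (dom R0 a) R0 (wderiv 1 (dom R0 a) phi)
   - trace (dom R0 a) R0 phi).

Fixpoint Vseq {R : realType} (R0 : R) (c : phase -> R) (V0 V1 : phase -> R -> R)
    (a : phase) (j : nat) : R -> R :=
  match j with
  | 0 => V0 a
  | 1 => V1 a
  | j'.+2 => fun r =>
      c a ^+ 2 * wderiv 2 (dom R0 a) (Vseq R0 c V0 V1 a j') r
  end.

Definition Eseq {R : realType} (R0 : R) (rho c : phase -> R)
    (V0 V1 : phase -> R -> R) (eta0 zeta0 : R) (j : nat) : R :=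
  match j with
  | 0 => eta0
  | 1 => zeta0
  | j'.+2 => - flux R0 rho gas (Vseq R0 c V0 V1 gas j')
  end.

(* The data class [X_m]. Membership only gives [V^[j]] in [H^(m+1-j)], so that
   for [j = m] the flux of [V^[j]] need not exist. Each flux condition is
   imposed when both sides make sense, which is automatic for [j < m]. *)
Definition data_class {R : realType} (R0 sigma : R) (rho c : phase -> R)
    (m : nat) (V0 V1 : phase -> R -> R) (eta0 zeta0 : R) : Prop :=
  let V := Vseq R0 c V0 V1 in
  let E := Eseq R0 rho c V0 V1 eta0 zeta0 in
  [/\ forall a, Hk m.+1 (dom R0 a) (V0 a),
      forall a, Hk m (dom R0 a) (V1 a) &
      forall j, (j <= m)%N ->
        [/\ trace (dom R0 gas) 0 (V gas j) = 0,
            Hk 2 (dom R0 gas) (V gas j) -> Hk 2 (dom R0 liquid) (V liquid j) ->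
              - flux R0 rho gas (V gas j) = - flux R0 rho liquid (V liquid j) &
            trace (dom R0 liquid) R0 (V liquid j)
            - trace (dom R0 gas) R0 (V gas j) = 2 * sigma / R0 * E j]].

(* The equations hold in the sense of distributions in [t]: for [theta] in
   [C_c^oo(0, oo)] the wave equation makes [<v_a, theta>] an element of
   [H^2(dom R0 a)], which has boundary values and a boundary flux. *)
Definition solves_system {R : realType} (R0 sigma : R) (rho c : phase -> R)
    (v : phase -> R -> R -> R) (eta : R -> R) : Prop :=
  forall theta, test_fun time theta ->
  [/\ forall a phi, test_fun (dom R0 a) phi ->
        \int[leb]_(r in dom R0 a) (pair_t (v a) (derive1n 2 theta) r * phi r)
        - c a ^+ 2 *
          \int[leb]_(r in dom R0 a) (pair_t (v a) theta r * derive1n 2 phi r) = 0,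
      trace (dom R0 gas) 0 (pair_t (v gas) theta) = 0,
      trace (dom R0 liquid) R0 (pair_t (v liquid) theta)
      - trace (dom R0 gas) R0 (pair_t (v gas) theta)
      = 2 * sigma / R0 * \int[leb]_(t in time) (eta t * theta t) &
      forall a, flux R0 rho a (pair_t (v a) theta)
        = - \int[leb]_(t in time) (eta t * derive1n 2 theta t)].

(* [v_a(., 0) = V0 a] and [\partial_t v_a(., 0) = V1 a] as distributions on
   [dom R0 a]: for [psi] in [C_c^oo(dom R0 a)] the function [<v_a, psi>] is
   [H^2] in time near [t = 0], by the wave equation. *)
Definition initial_conditions {R : realType} (R0 : R)
    (V0 V1 : phase -> R -> R) (eta0 zeta0 : R)
    (v : phase -> R -> R -> R) (eta : R -> R) : Prop :=
  [/\ forall a psi, test_fun (dom R0 a) psi ->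
        trace time 0 (pair_r (dom R0 a) (v a) psi)
          = \int[leb]_(r in dom R0 a) (V0 a r * psi r) /\
        trace time 0 (wderiv 1 time (pair_r (dom R0 a) (v a) psi))
          = \int[leb]_(r in dom R0 a) (V1 a r * psi r),
      trace time 0 eta = eta0 &
      trace time 0 (wderiv 1 time eta) = zeta0].

Definition solution_regularity {R : realType} (R0 gamma : R) (m : nat)
    (v : phase -> R -> R -> R) (eta : R -> R) : Prop :=
  [/\ exists2 deta, is_wderiv 1 time eta deta & Hgamma gamma m deta,
      Hgamma gamma m eta,
      (* [h] is [v_a(R0, .)] *)
      forall a, exists2 h, Hgamma gamma m h &
        forall theta, test_fun time theta ->
          trace (dom R0 a) R0 (pair_t (v a) theta)
            = \int[leb]_(t in time) (h t * theta t) &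
      forall a, L2gamma_L2 gamma (dom R0 a) (v a) /\
        forall j, (j <= m)%N -> exists2 w,
          is_dt j (dom R0 a) (v a) w & L2gamma_L2 gamma (dom R0 a) w].

Definition weighted_solution {R : realType} (R0 sigma : R) (rho c : phase -> R)
    (gamma : R) (m : nat) (V0 V1 : phase -> R -> R) (eta0 zeta0 : R)
    (v : phase -> R -> R -> R) (eta : R -> R) : Prop :=
  [/\ solution_regularity R0 gamma m v eta,
      solves_system R0 sigma rho c v eta &
      initial_conditions R0 V0 V1 eta0 zeta0 v eta].

(* Main.v *)
Require Import Defs.
From HB Require Import structures.
From mathcomp Require Import all_boot all_order all_algebra.
From mathcomp Require Import all_classical all_reals all_analysis.
From mathcomp Require Import measurable_realfun lebesgue_integral ring lra.

Set Implicit Arguments.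
Unset Strict Implicit.
Unset Printing Implicit Defensive.

Import Order.TTheory GRing.Theory Num.Theory.
Import numFieldNormedType.Exports.

Local Open Scope classical_set_scope.
Local Open Scope ring_scope.

(** Existence. By d'Alembert's formula the gas field is [F(t + r/c) - F(t - r/c)]
    and the liquid field is an incoming wave, known from the data, plus an outgoing
    one, which the jump condition expresses through [F] and [eta]. The two flux
    conditions then form a system in which the top derivative of [F(t + R0/c_g)]
    solves a causal fixed-point equation; it is a contraction for a weight
    [e^(lambda t)], and the compatibility conditions make the successive primitives
    match the data at [t = 0]. The energy of the gas, corrected by a trace term, plus
    [y^2] and [eta'^2], where [y] is the liquid trace, grows at a rate [kappa] that
    depends on the lower bounds of the coefficients only, whence the threshold.

    Uniqueness. The Laplace transform in time of a solution with zero data satisfies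
    [X'' = (s/c)^2 X], the boundary data of [X] being the transforms of the traces
    and fluxes. This has to be read off test functions vanishing near [t = 0]: the
    part of [e^(- s t)] supported in [[0, 1/n]] contributes to the boundary values
    through a strip of width [1/n] only, hence negligibly. In the liquid [X] decays,
    in the gas it is a multiple of [sinh(s r / c_g)], so for large [s] the two traces
    have opposite signs relative to the transform of [eta], and the jump condition
    forces everything to vanish. Lerch's theorem along [s + n] concludes. *)

(** * Calculus on the line *)

(** Traces and initial values exist only after pairing with a test function in the other variable,
    so neither e^(- s t) nor the values at the corner r = R0, t = 0 are directly accessible. The
    existence half works with C^1 functions on the whole line: profiles and waves are extended
    arbitrarily beyond the region where they have a meaning, every trace becomes a point value, and
    only what holds for t >= 0 and r in the domain enters the weak formulation.

    The gas reflects at the origin, so F at t + T is tied to F at t - T, where T = R0/c_g; the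
    liquid is unbounded and its outgoing wave never returns. This loss appears in the energy
    identity as a negative multiple of y'^2. It pays for the incoming wave and gives the square
    integrability of the highest derivative of y, for which no pointwise bound is at hand. Surface
    tension enters without a favourable sign; its contribution is a multiple of eta'^2, absorbed by
    the growth rate, and weighting eta'^2 by sigma_* in the energy keeps this rate bounded as sigma
    varies. Uniqueness needs s large for the inertia of the liquid to dominate surface tension. *)

Section real_integrable.
Context d (T : measurableType d) {R : realType}.
Variables (mu : {measure set T -> \bar R}) (D : set T).
Hypothesis mD : measurable D.
Implicit Types (f g : T -> R).

Lemma integrable_realD f g : mu.-integrable D (EFin \o f) ->
  mu.-integrable D (EFin \o g) ->
  mu.-integrable D (EFin \o (fun x => f x + g x)).
Proof. by move=> If Ig; exact: (integrableD mD If Ig). Qed.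

Lemma integrable_realB f g : mu.-integrable D (EFin \o f) ->
  mu.-integrable D (EFin \o g) ->
  mu.-integrable D (EFin \o (fun x => f x - g x)).
Proof. by move=> If Ig; exact: (integrableB mD If Ig). Qed.

Lemma integrable_realZ k f : mu.-integrable D (EFin \o f) ->
  mu.-integrable D (EFin \o (fun x => k * f x)).
Proof. by move=> If; exact: (integrableZl mD k If). Qed.

Lemma integrable_real_le f g : measurable_fun D f ->
  mu.-integrable D (EFin \o g) -> (forall x, D x -> `|f x| <= g x) ->
  mu.-integrable D (EFin \o f).
Proof.
move=> mf Ig fg; apply: (le_integrable mD _ _ Ig); first exact/measurable_EFinP.
move=> x Dx /=; rewrite lee_fin (le_trans (fg x Dx))//.
exact: ler_norm.
Qed.

Lemma integrable_real_measurable f : mu.-integrable D (EFin \o f) ->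
  measurable_fun D f.
Proof. by move=> /integrableP[/measurable_EFinP]. Qed.

Lemma Rintegral_EFin f : mu.-integrable D (EFin \o f) ->
  (\int[mu]_(x in D) f x)%:E = (\int[mu]_(x in D) (f x)%:E)%E.
Proof. by move=> If; rewrite /Rintegral fineK//; exact: integrable_fin_num. Qed.

End real_integrable.

Section continuity_rules.
Context {R : realType}.
Implicit Types (f g : R -> R) (c k m x : R).

Lemma contD f g : continuous f -> continuous g -> continuous (fun x => f x + g x).
Proof. by move=> cf cg x; apply: continuousD; [exact: cf|exact: cg]. Qed.

Lemma contB f g : continuous f -> continuous g -> continuous (fun x => f x - g x).
Proof. by move=> cf cg x; apply: continuousB; [exact: cf|exact: cg]. Qed.

Lemma contM f g : continuous f -> continuous g -> continuous (fun x => f x * g x).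
Proof. by move=> cf cg x; apply: continuousM; [exact: cf|exact: cg]. Qed.

Lemma contZ c f : continuous f -> continuous (fun x => c * f x).
Proof. by move=> cf x; apply: continuousM; [exact: cst_continuous|exact: cf]. Qed.

Lemma cont_comp f g : continuous f -> continuous g -> continuous (fun x => f (g x)).
Proof. by move=> cf cg x; apply: continuous_comp; [exact: cg|exact: cf]. Qed.

Lemma cont_cst (c : R) : continuous (fun _ : R => c).
Proof. by move=> x; exact: cst_continuous. Qed.

Lemma cont_id : continuous (fun x : R => x).
Proof. by move=> x; exact: cvg_id. Qed.

Lemma cont_affine f k m : continuous f -> continuous (fun x : R => f (k * x + m)).
Proof.
move=> cf; apply: (@cont_comp f (fun x : R => k * x + m)) => //.
by apply: contD; [apply: contZ; exact: cont_id|exact: cont_cst].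
Qed.

Lemma cont_sq f : continuous f -> continuous (fun x : R => f x ^+ 2).
Proof. by move=> cf; rewrite (_ : (fun x => _) = (fun x => f x * f x)) //; exact: contM. Qed.

Lemma cont_expR : continuous (@expR R).
Proof. exact: continuous_expR. Qed.

End continuity_rules.

Section derivative_rules.
Context {R : realType}.
Implicit Types (f g : R -> R) (x a b : R).

Lemma derD f g x a b : is_derive x 1 f a -> is_derive x 1 g b ->
  is_derive x 1 (fun t => f t + g t) (a + b).
Proof. by move=> Hf Hg; exact: is_deriveD. Qed.

Lemma derB f g x a b : is_derive x 1 f a -> is_derive x 1 g b ->
  is_derive x 1 (fun t => f t - g t) (a - b).
Proof. by move=> Hf Hg; exact: is_deriveB. Qed.

Lemma derZ f x a c : is_derive x 1 f a -> is_derive x 1 (fun t => c * f t) (c * a).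
Proof. by move=> Hf; exact: is_deriveZ. Qed.

Lemma derM f g x a b : is_derive x 1 f a -> is_derive x 1 g b ->
  is_derive x 1 (fun t => f t * g t) (a * g x + f x * b).
Proof.
move=> Hf Hg; have := is_deriveM Hf Hg.
by rewrite /GRing.scale /= addrC [g x * a]mulrC.
Qed.

Lemma der_cst x c : is_derive x 1 (fun=> c : R) (0 : R).
Proof. exact: is_derive_cst. Qed.

Lemma der_comp f g x a b : is_derive (g x) 1 f a -> is_derive x 1 g b ->
  is_derive x 1 (fun t => f (g t)) (a * b).
Proof. by move=> Hf Hg; exact: is_derive1_comp. Qed.

Lemma der_affine x k m : is_derive x 1 (fun t => k * t + m) k.
Proof.
have := derD (derZ k (is_derive_id x 1)) (der_cst x m).
by rewrite mulr1 addr0.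
Qed.

Lemma der_comp_affine f x a k m : is_derive (k * x + m) 1 f a ->
  is_derive x 1 (fun t => f (k * t + m)) (k * a).
Proof.
move=> Hf; rewrite mulrC.
exact: (@der_comp f (fun t => k * t + m) _ _ _ Hf (der_affine _ _ _)).
Qed.

Lemma der_eq f x a b : is_derive x 1 f a -> a = b -> is_derive x 1 f b.
Proof. by move=> ? <-. Qed.

Lemma der_continuous f x a : is_derive x 1 f a -> {for x, continuous f}.
Proof.
move=> [df _]; apply: differentiable_continuous; exact/derivable1_diffP.
Qed.

Lemma der_continuousT f f' : (forall x, is_derive x 1 f (f' x)) -> continuous f.
Proof. by move=> H x; exact: der_continuous. Qed.

End derivative_rules.

Lemma near_gt {R : realType} (a x : R) : a < x -> \forall y \near x, a < y.
Proof. by move=> ax; apply: open_nbhs_nbhs; split; [exact: open_gt|]. Qed.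

Lemma near_ge {R : realType} (a x : R) : a < x -> \forall y \near x, a <= y.
Proof. by move=> /near_gt; apply: filterS => y /ltW. Qed.

Lemma near_le {R : realType} (a x : R) : x < a -> \forall y \near x, y <= a.
Proof.
move=> xa; have : \forall y \near x, y < a by apply: open_nbhs_nbhs; split; [exact: open_lt|].
by apply: filterS => y /ltW.
Qed.

Lemma near_lt {R : realType} (a x : R) : x < a -> \forall y \near x, y < a.
Proof. by move=> ax; apply: open_nbhs_nbhs; split; [exact: open_lt|]. Qed.

Section monotone.
Context {R : realType}.
Implicit Types (f g : R -> R) (x y a b : R).

Lemma der_mvt f f' a b : (forall x, is_derive x 1 f (f' x)) -> a <= b ->
  exists2 c, a <= c <= b & f b - f a = f' c * (b - a).
Proof.
move=> H ab; have [|c cab ->] := @MVT_segment R f f' a b ab (fun x _ => H x).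
  by apply: continuous_subspaceT; exact: der_continuousT H.
by exists c => //; move: cab; rewrite in_itv.
Qed.

Lemma der_nondecreasing f f' a : (forall x, is_derive x 1 f (f' x)) ->
  (forall x, a <= x -> 0 <= f' x) -> forall x y, a <= x -> x <= y -> f x <= f y.
Proof.
move=> H pos x y ax xy; have [c /andP[xc cy] e] := der_mvt H xy.
by rewrite -subr_ge0 e mulr_ge0 ?subr_ge0// pos// (le_trans ax).
Qed.

Lemma der_ge0_le f g f' g' a : (forall x, is_derive x 1 f (f' x)) ->
  (forall x, is_derive x 1 g (g' x)) -> f a <= g a ->
  forall b, (forall x, a <= x <= b -> f' x <= g' x) -> a <= b -> f b <= g b.
Proof.
move=> Hf Hg fga b fg ab.
have H x : is_derive x 1 (fun t => g t - f t) (g' x - f' x) by exact: derB.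
have [c cab e] := der_mvt H ab.
have : 0 <= (g b - f b) - (g a - f a) by rewrite e mulr_ge0 ?subr_ge0// fg.
lra.
Qed.

Lemma der_unique_ge f g f' g' a : (forall x, is_derive x 1 f (f' x)) ->
  (forall x, is_derive x 1 g (g' x)) -> f a = g a ->
  (forall x, a <= x -> f' x = g' x) -> forall x, a <= x -> f x = g x.
Proof.
move=> Hf Hg fga fg x ax; apply/eqP; rewrite eq_le; apply/andP; split.
  by apply: (der_ge0_le Hf Hg _ _ ax); rewrite ?fga// => y /andP[? _]; rewrite fg.
by apply: (der_ge0_le Hg Hf _ _ ax); rewrite ?fga// => y /andP[? _]; rewrite fg.
Qed.

Lemma der_unique f g f' a : (forall x, is_derive x 1 f (f' x)) ->
  (forall x, is_derive x 1 g (f' x)) -> f a = g a -> forall x, f x = g x.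
Proof.
move=> Hf Hg fga x; have [ax|xa] := leP a x.
  exact: (der_unique_ge Hf Hg fga).
have H y : is_derive y 1 (fun t => g t - f t) (f' y - f' y) by exact: derB.
have [c _] := der_mvt H (ltW xa); rewrite subrr mul0r fga; lra.
Qed.

End monotone.

Section primitive.
Context {R : realType}.
Implicit Types (f g F : R -> R) (a b c x : R).

(** Applied to [g \_ I] this is stronger than local integrability on I: segments may reach the ends
    of I. It makes the primitive of [g \_ I] continuous up to the boundary, where traces are
    read. *)
Definition loc_int f := forall a b, leb.-integrable `[a, b] (EFin \o f).

(** Signed and total, so that it can be differentiated on both sides of the initial time 0 and no
    domain condition has to be carried along. *)
Definition prim f x : R :=
  if 0 <= x then \int[leb]_(t in `[0, x]) f t
  else - \int[leb]_(t in `[x, 0]) f t.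

Lemma integral_itv_split f a b c : a <= b -> b <= c -> loc_int f ->
  \int[leb]_(t in `[a, c]) f t =
  \int[leb]_(t in `[a, b]) f t + \int[leb]_(t in `[b, c]) f t.
Proof.
move=> ab bc lf.
have := @Rintegral_itvB R f (BLeft a) (BRight c) b (lf a c).
rewrite !bnd_simp => /(_ ab bc) /eqP; rewrite subr_eq => /eqP ->.
rewrite addrC; congr (_ + _).
apply: Rintegral_itv_obnd_cbnd.
by apply: integrableS (lf b c) => //; apply: subset_itvr; rewrite bnd_simp.
Qed.

Lemma prim_sub f a b : a <= b -> loc_int f ->
  prim f b - prim f a = \int[leb]_(t in `[a, b]) f t.
Proof.
move=> ab lf; rewrite /prim.
have [a0|a0] := leP 0 a.
  rewrite (le_trans a0 ab) (integral_itv_split a0 ab lf); ring.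
have [b0|b0] := leP 0 b.
  rewrite (integral_itv_split (ltW a0) b0 lf); ring.
rewrite (integral_itv_split ab (ltW b0) lf); ring.
Qed.

Lemma prim0 f : prim f 0 = 0.
Proof. by rewrite /prim lexx set_itv1 Rintegral_set1. Qed.

Lemma continuous_loc_int f : continuous f -> loc_int f.
Proof.
move=> cf a b; apply: continuous_compact_integrable; first exact: segment_compact.
exact: continuous_subspaceT.
Qed.

Lemma loc_intZ c f : loc_int f -> loc_int (fun x => c * f x).
Proof. by move=> lf a b; exact: integrable_realZ. Qed.

Lemma prim_continuous f : loc_int f -> continuous (prim f).
Proof.
move=> lf x.
pose a := x - 1; pose b := x + 1.
have ab : a <= b by rewrite /a /b; lra.
have /continuous_within_itvP : {within `[a, b], continuous (fun y => parameterized_integral leb a y f)}.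
  exact: parameterized_integral_continuous.
have ltab : a < b by rewrite /a /b; lra.
move=> /(_ ltab)[+ _ _].
have xab : x \in `]a, b[ by rewrite in_itv/= /a /b; lra.
move=> /(_ x xab) cx.
have E : forall y, a <= y -> prim f y = prim f a + parameterized_integral leb a y f.
  by move=> y ay; rewrite /parameterized_integral -prim_sub// addrC subrK.
have c2 : {for x, continuous (fun y => prim f a + parameterized_integral leb a y f)}.
  by apply: continuousD; [exact: cst_continuous|exact: cx].
rewrite /continuous_at E; last by rewrite /a; lra.
apply: cvg_trans c2.
apply: near_eq_cvg; near=> y.
rewrite [RHS]E//.
by near: y; apply: near_ge; rewrite /a; lra.
Unshelve. all: by end_near. Qed.

Lemma prim_is_derive f x : loc_int f -> {for x, continuous f} ->
  is_derive x 1 (prim f) (f x).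
Proof.
move=> lf cf.
pose a := x - 1.
have ax : a < x by rewrite /a; lra.
have xu : x < x + 1 by lra.
have [d e] := @continuous_FTC1 R f (BLeft a) x (x + 1) xu (lf _ _)
  ax cf.
have E : forall y, a <= y -> prim f y = prim f a + \int[leb]_(t in `[a, y]) f t.
  by move=> y ay; rewrite -prim_sub// addrC subrK.
pose G y := \int[leb]_(t in `[a, y]) f t.
have HG : is_derive x 1 G (f x) by apply: DeriveDef; [exact: d|rewrite -derive1E; exact: e].
have H : is_derive x 1 (fun y => prim f a + G y) (f x).
  by rewrite -[f x]add0r; exact: (@derD _ (fun=> prim f a) G _ _ _ (der_cst _ _) HG).
apply: (near_eq_is_derive _ H).
near=> y; rewrite [RHS]E//.
by near: y; exact: near_ge.
Unshelve. all: by end_near. Qed.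

Lemma prim_is_deriveT f : continuous f -> forall x, is_derive x 1 (prim f) (f x).
Proof. by move=> cf x; apply: prim_is_derive; [exact: continuous_loc_int|exact: cf]. Qed.

Lemma prim_is_prim f F : continuous f -> (forall x, is_derive x 1 F (f x)) ->
  forall x, F x = F 0 + prim f x.
Proof.
move=> cf HF; apply: (@der_unique _ _ _ f 0) => //.
- move=> x; rewrite -[f x]add0r.
  exact: (@derD _ (fun=> F 0) _ _ _ _ (der_cst _ _) (prim_is_deriveT cf x)).
- by rewrite prim0 addr0.
Qed.

Lemma FTC_segment f F a b : continuous f -> (forall x, is_derive x 1 F (f x)) ->
  a <= b -> \int[leb]_(t in `[a, b]) f t = F b - F a.
Proof.
move=> cf HF ab; rewrite -prim_sub//; last exact: continuous_loc_int.
by rewrite (prim_is_prim cf HF b) (prim_is_prim cf HF a); ring.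
Qed.

Lemma prim_le f g a b : continuous f -> continuous g -> a <= b ->
  (forall x, a <= x <= b -> f x <= g x) -> prim f b - prim f a <= prim g b - prim g a.
Proof.
move=> cf cg ab fg.
have H := derB (prim_is_deriveT cg _) (prim_is_deriveT cf _).
have [c cab e] := der_mvt H ab.
have : 0 <= (g c - f c) * (b - a) by rewrite mulr_ge0 ?subr_ge0// fg.
rewrite -e; lra.
Qed.

Lemma prim_mono f a b : continuous f -> (forall x, 0 <= f x) -> a <= b ->
  prim f a <= prim f b.
Proof.
move=> cf f0 ab.
by apply: (@der_nondecreasing _ _ f a (prim_is_deriveT cf)).
Qed.

Lemma primD f g : continuous f -> continuous g ->
  forall x, prim (fun t => f t + g t) x = prim f x + prim g x.
Proof.
move=> cf cg; have cfg : continuous (fun t => f t + g t).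
  by move=> x; apply: continuousD; [exact: cf|exact: cg].
apply: (@der_unique _ _ _ _ 0 (prim_is_deriveT cfg)); last by rewrite !prim0 addr0.
by move=> x; apply: derD; exact: prim_is_deriveT.
Qed.

Lemma primZ c f : continuous f -> forall x, prim (fun t => c * f t) x = c * prim f x.
Proof.
move=> cf; have cfg : continuous (fun t => c * f t).
  by move=> x; apply: continuousM; [exact: cst_continuous|exact: cf].
apply: (@der_unique _ _ _ _ 0 (prim_is_deriveT cfg)); last by rewrite !prim0 mulr0.
by move=> x; apply: derZ; exact: prim_is_deriveT.
Qed.

End primitive.

(** * Smooth functions *)

Section gluing.
Context {R : realType}.
Implicit Types (f g : R -> R) (x y a b : R).

Lemma caratheodoryP f x a : is_derive x 1 f a <->
  exists g, [/\ forall z, f z - f x = g z * (z - x),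
                {for x, continuous g} & g x = a].
Proof. by split=> [|h]; [move/is_derive1_caratheodory|apply/is_derive1_caratheodory]. Qed.

Lemma continuous_glue f g x : {for x, continuous f} -> {for x, continuous g} ->
  f x = g x -> {for x, continuous (fun y => if y <= x then f y else g y)}.
Proof.
move=> cf cg e; apply/cvgrPdist_lt => /= eps e0; rewrite lexx.
move/cvgrPdist_lt: cf => /(_ _ e0) /= cf.
move/cvgrPdist_lt: cg => /(_ _ e0) /= cg.
by near=> y; case: ifPn => _; [|rewrite e]; near: y.
Unshelve. all: by end_near. Qed.

Lemma der_glue_pt f g x a : is_derive x 1 f a -> is_derive x 1 g a ->
  f x = g x -> is_derive x 1 (fun y => if y <= x then f y else g y) a.
Proof.
move=> /caratheodoryP[p [p1 p2 p3]] /caratheodoryP[q [q1 q2 q3]] e.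
apply/caratheodoryP; exists (fun y => if y <= x then p y else q y); split.
- by move=> z; rewrite lexx; case: ifPn => _ //; rewrite e.
- by apply: continuous_glue => //; rewrite p3 q3.
- by rewrite lexx.
Qed.

Lemma der_glue f g f' g' b : (forall x, is_derive x 1 f (f' x)) ->
  (forall x, is_derive x 1 g (g' x)) -> f b = g b -> f' b = g' b ->
  forall x, is_derive x 1 (fun y => if y <= b then f y else g y)
    (if x <= b then f' x else g' x).
Proof.
move=> Hf Hg e e' x; have [xb|xb|->] := ltgtP x b.
- apply: (near_eq_is_derive _ (Hf x)); near=> y.
  by rewrite ltW//; near: y; exact: near_lt.
- apply: (near_eq_is_derive _ (Hg x)); near=> y.
  by rewrite leNgt ifF//; apply/negbTE; rewrite negbK; near: y; exact: near_gt.
- by apply: der_glue_pt => //; rewrite e'.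
Unshelve. all: by end_near. Qed.

(** For a point where the formula defining f changes: a quadratic bound gives the derivative there
    without differentiating either piece. *)
Lemma der_quadratic f x C : f x = 0 ->
  (forall y, `|f y| <= C * (y - x) ^+ 2) -> is_derive x 1 f 0.
Proof.
move=> fx0 H; apply/caratheodoryP; exists (fun y => f y / (y - x)); split.
- move=> z; rewrite fx0 subr0; have [->|zx] := eqVneq z x.
    by rewrite fx0 mul0r mul0r.
  by rewrite divfK// subr_eq0.
- have g_le y : `|f y / (y - x)| <= C * `|y - x|.
    have [->|yx] := eqVneq y x; first by rewrite fx0 mul0r normr0 subrr normr0 mulr0.
    rewrite normrM normfV ler_pdivrMr ?normr_gt0 ?subr_eq0//.
    by rewrite -mulrA -expr2 real_normK// num_real.
  apply/cvgrPdist_le => /= e e0; near=> y.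
  rewrite subrr invr0 mulr0 sub0r normrN (le_trans (g_le y))//.
  have C0 : 0 <= `|C| + 1 by rewrite addr_ge0.
  have C1 : 0 < `|C| + 1 by rewrite ltr_wpDl.
  apply: (@le_trans _ _ ((`|C| + 1) * `|y - x|)).
    by rewrite ler_wpM2r// (le_trans (ler_norm _))// lerDl.
  rewrite mulrC -ler_pdivlMr// distrC.
  near: y; apply: (@cvgr_dist_le _ R^o _ _ _ id x); first exact: cvg_id.
  by rewrite divr_gt0.
- by rewrite subrr invr0 mulr0.
Unshelve. all: by end_near. Qed.

End gluing.

Section smooth_functions.
Context {R : realType}.
Implicit Types (f g : R -> R) (x y a b : R).

Record smooth f : Prop := Smooth
  { smooth_derivable : forall n x, derivable (derive1n n f) x 1 }.

(** Derivatives are peeled off from the inside, unlike in [derive1n], so that closure under sums and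
    products is an induction on n with the functions generalised. *)
Fixpoint Cn n f : Prop := (forall x, derivable f x 1) /\
  (if n is k.+1 then Cn k (derive1 f) else True).

Lemma smoothP f : smooth f <-> forall n, Cn n f.
Proof.
split=> [[sf] n|Cf].
- elim: n f sf => [|n IH] f sf; split => //; first exact: (sf 0%N).
    exact: (sf 0%N).
  by apply: IH => k x; have := sf k.+1 x; rewrite /derive1n iterSr.
- suff H : forall n f, Cn n f -> forall x, derivable (derive1n n f) x 1.
    by split=> n; exact: H.
  elim=> [|n IH] {Cf}f [d Cf]; first exact: d.
  by move=> x; rewrite /derive1n iterSr; exact: IH.
Qed.

Lemma derive1_is f f' : (forall x, is_derive x 1 f (f' x)) -> derive1 f = f'.
Proof. by move=> H; apply/funext => x; rewrite derive1E; apply: derive_val. Qed.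

Lemma derivable_is f : (forall x, derivable f x 1) ->
  forall x, is_derive x 1 f (derive1 f x).
Proof. by move=> H x; apply: DeriveDef; [exact: H|rewrite derive1E]. Qed.

Lemma CnW n f : Cn n.+1 f -> Cn n f.
Proof. by elim: n f => [|n IH] f [d Cf]; split => //; exact: IH. Qed.

Lemma CnD n f g : Cn n f -> Cn n g -> Cn n (fun x => f x + g x).
Proof.
elim: n f g => [|n IH] f g [df Cf] [dg Cg].
  by split; [move=> x; have [? _] := derD (derivable_is df x) (derivable_is dg x)|].
split; first by move=> x; have [? _] := derD (derivable_is df x) (derivable_is dg x).
rewrite (derive1_is (fun x => derD (derivable_is df x) (derivable_is dg x))).
exact: IH.
Qed.

Lemma CnM n f g : Cn n f -> Cn n g -> Cn n (fun x => f x * g x).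
Proof.
elim: n f g => [|n IH] f g.
  move=> [df _] [dg _].
  by split; [move=> x; have [? _] := derM (derivable_is df x) (derivable_is dg x)|].
move=> Cf Cg; have [df Cf'] := Cf; have [dg Cg'] := Cg.
split; first by move=> x; have [? _] := derM (derivable_is df x) (derivable_is dg x).
rewrite (derive1_is (fun x => derM (derivable_is df x) (derivable_is dg x))).
by apply: CnD; apply: IH => //; exact: CnW.
Qed.

Lemma Cn_cst n (c : R) : Cn n (fun=> c).
Proof.
elim: n c => [|n IH] c; split => //; try by move=> x; have [] := der_cst x c.
by rewrite (derive1_is (fun x => der_cst x c)).
Qed.

Lemma Cn_comp_affine n f k m : Cn n f -> Cn n (fun x => f (k * x + m)).
Proof.
elim: n f => [|n IH] f [df Cf].
  by split; [move=> x; have [? _] := der_comp_affine (derivable_is df (k * x + m))|].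
split; first by move=> x; have [? _] := der_comp_affine (derivable_is df (k * x + m)).
rewrite (derive1_is (fun x => der_comp_affine (derivable_is df (k * x + m)))).
by apply: CnM; [exact: Cn_cst|exact: IH].
Qed.

Lemma smoothD f g : smooth f -> smooth g -> smooth (fun x => f x + g x).
Proof. by move=> /smoothP sf /smoothP sg; apply/smoothP => n; exact: CnD. Qed.

Lemma smoothM f g : smooth f -> smooth g -> smooth (fun x => f x * g x).
Proof. by move=> /smoothP sf /smoothP sg; apply/smoothP => n; exact: CnM. Qed.

Lemma smooth_cst c : smooth (fun=> c).
Proof. by apply/smoothP => n; exact: Cn_cst. Qed.

Lemma smoothZ c f : smooth f -> smooth (fun x => c * f x).
Proof. by move=> sf; apply: (@smoothM (fun=> c) f) sf; exact: smooth_cst. Qed.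

Lemma smoothB f g : smooth f -> smooth g -> smooth (fun x => f x - g x).
Proof.
move=> sf sg; rewrite (_ : (fun x => _) = fun x => f x + (- 1) * g x).
  by apply: (@smoothD f (fun x => - 1 * g x)) => //; exact: (@smoothZ (- 1) g).
by apply/funext => x; rewrite mulN1r.
Qed.

Lemma smooth_comp_affine f k m : smooth f -> smooth (fun x => f (k * x + m)).
Proof. by move=> /smoothP sf; apply/smoothP => n; exact: Cn_comp_affine. Qed.

(** Avoids formulas for iterated derivatives: the stability of a class under one differentiation is
    enough. *)
Lemma smooth_class (P : (R -> R) -> Prop) :
  (forall f, P f -> exists2 f', P f' & forall x, is_derive x 1 f (f' x)) ->
  forall f, P f -> smooth f.
Proof.
move=> HP f Pf; split=> n.
have Pn : P (derive1n n f).
  elim: n => [//|n IH]; rewrite /derive1n iterS -/(derive1n n f).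
  by have [f' Pf' H] := HP _ IH; rewrite (derive1_is H).
by have [f' _ H] := HP _ Pn; move=> x; have [] := H x.
Qed.

Lemma smooth_expR : smooth (@expR R).
Proof.
apply: (@smooth_class (fun f => f = expR)) => // f ->.
by exists expR => // x; exact: is_derive_expR.
Qed.

Lemma smooth_is_derive f n x : smooth f ->
  is_derive x 1 (derive1n n f) (derive1n n.+1 f x).
Proof. by move=> [sf]; apply: DeriveDef; [exact: sf|rewrite derive1nS derive1E]. Qed.

Lemma smooth_continuous f n : smooth f -> continuous (derive1n n f).
Proof. by move=> sf; apply: der_continuousT => x; exact: smooth_is_derive. Qed.

Lemma smooth_prim f F : smooth f -> (forall x, is_derive x 1 F (f x)) -> smooth F.
Proof.
move=> [sf] H; split=> -[|n] x; first by have [] := H x.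
by rewrite /derive1n iterSr (derive1_is H); exact: sf.
Qed.

End smooth_functions.

(** * A smooth bump function built from e^(-1/x) *)

Section hat.
Context {R : realType}.
Implicit Types (p : {poly R}) (x y : R).

(** For n > 0, raise e^(y/n) >= y/n to the power n. *)
Lemma expR_monomial_le n y : 0 <= y -> y ^+ n * expR (- y) <= n%:R ^+ n.
Proof.
move=> y0; case: n => [|n]; first by rewrite !expr0 mul1r expR_le1// oppr_le0.
have n0 : (0 : R) < n.+1%:R by rewrite ltr0n.
have h : y / n.+1%:R <= expR (y / n.+1%:R).
  by apply: le_trans (expR_ge1Dx _); rewrite lerDr.
rewrite expRN ler_pdivrMr ?expR_gt0//.
have -> : expR y = expR (y / n.+1%:R) ^+ n.+1.
  by rewrite -expRM_natl mulrC divfK// gt_eqF.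
rewrite -exprMn lerXn2r// ?nnegrE ?mulr_ge0 ?expR_ge0//.
by rewrite mulrC -ler_pdivrMr.
Qed.

Lemma poly_exp_bound p : exists C : R, forall y, 0 <= y -> `|p.[y] * expR (- y)| <= C.
Proof.
(* The power y^k absorbs the variable when the induction passes from p to p X + c. *)
suff H : forall k, exists C, forall y, 0 <= y -> `|y ^+ k * p.[y] * expR (- y)| <= C.
  by have [C HC] := H 0%N; exists C => y y0; have := HC y y0; rewrite expr0 mul1r.
elim/poly_ind: p => [|p c IH] k.
  by exists 0 => y _; rewrite hornerC mulr0 mul0r normr0.
have [C HC] := IH k.+1.
exists (C + `|c| * k%:R ^+ k) => y y0.
rewrite !hornerE (_ : _ * _ = y ^+ k.+1 * p.[y] * expR (- y) + c * (y ^+ k * expR (- y))); last first.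
  by rewrite exprSr; ring.
rewrite (le_trans (ler_normD _ _))// lerD ?HC// normrM ler_wpM2l//.
rewrite ger0_norm ?mulr_ge0 ?exprn_ge0 ?expR_ge0//.
exact: expR_monomial_le.
Qed.

(** The functions p(1/x) e^(-1/x), extended by 0 to the left, form a family stable under
    differentiation: p becomes X^2 (p - p'). The case p = 1 is the classical flat function, which is
    therefore smooth. *)
Definition expinv p x : R := if x <= 0 then 0 else p.[x^-1] * expR (- x^-1).

Lemma expinv_is_derive p x :
  is_derive x 1 (expinv p) (expinv ('X^2 * (p - p^`())) x).
Proof.
have [x0|x0|->] := ltgtP x 0.
- rewrite {2}/expinv ltW//; apply: (near_eq_is_derive _ (der_cst x 0)).
  near=> y; rewrite /expinv ltW//; near: y; exact: near_lt.
- rewrite {2}/expinv leNgt x0/=.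
  have xn0 : x != 0 by rewrite gt_eqF.
  have dinv : is_derive x 1 (fun y : R => y^-1) (- x ^- 2).
    by apply: der_eq; first exact: (is_deriveV (f := id) xn0 (is_derive_id x 1));
    rewrite /GRing.scale/= mulr1.
  have dp : is_derive x 1 (fun y => p.[y^-1]) (p^`().[x^-1] * - x ^- 2).
    apply: (@der_comp _ (fun y => p.[y]) (fun y => y^-1)) => //.
    exact: is_derive_poly.
  have de : is_derive x 1 (fun y => expR (- y^-1)) (expR (- x^-1) * x ^- 2).
    have dn : is_derive x 1 (fun y : R => - y^-1) (x ^- 2).
      by rewrite -[x ^- 2]opprK; apply: is_deriveN; exact: dinv.
    exact: (@der_comp _ expR (fun y => - y^-1) x _ _ (is_derive_expR _) dn).
  apply: (@near_eq_is_derive _ _ _ (fun y => p.[y^-1] * expR (- y^-1))).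
    by near=> y; rewrite /expinv leNgt ifF//; apply/negbTE; rewrite negbK; near: y; exact: near_gt.
  apply: (der_eq (derM dp de)).
  rewrite hornerM hornerXn hornerD hornerN -!exprVn.
  by set e := expR _; set y := x^-1; ring.
(* At 0, the extra factor X^2, evaluated at 1/x, turns the boundedness of polynomial times
   exponential into a bound by C x^2. *)
- have [C HC] := poly_exp_bound ('X^2 * p).
  rewrite {2}/expinv lexx; apply: (@der_quadratic _ _ _ `|C|).
    by rewrite /expinv lexx.
  move=> y; rewrite subr0 /expinv; case: ifPn => [_|].
    by rewrite normr0 mulr_ge0// sqr_ge0.
  rewrite -ltNge => y0.
  have yi : 0 <= y^-1 by rewrite invr_ge0 ltW.
  have h := HC _ yi; rewrite hornerM hornerXn in h.
  suff le : `|p.[y^-1] * expR (- y^-1)| <= C * y ^+ 2.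
    by apply: (le_trans le); rewrite ler_wpM2r ?sqr_ge0 ?ler_norm.
  have e : p.[y^-1] * expR (- y^-1) = (y^-1 ^+ 2 * p.[y^-1] * expR (- y^-1)) * y ^+ 2.
    by rewrite exprVn [RHS]mulrC -[_ * p.[_] * _]mulrA mulVKf// expf_neq0// gt_eqF.
  by rewrite e normrM [`|y ^+ 2|]ger0_norm ?sqr_ge0// ler_wpM2r ?sqr_ge0.
Unshelve. all: by end_near. Qed.

Definition flat x : R := expinv 1 x.

Lemma smooth_flat : smooth flat.
Proof.
apply: (@smooth_class _ (fun f => exists p, f = expinv p)); last by exists 1.
move=> f [p ->]; exists (expinv ('X^2 * (p - p^`()))); first by eexists.
exact: expinv_is_derive.
Qed.

Lemma flat_le0 x : x <= 0 -> flat x = 0.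
Proof. by rewrite /flat /expinv => ->. Qed.

Lemma flatE x : 0 < x -> flat x = expR (- x^-1).
Proof. by rewrite /flat /expinv leNgt => ->; rewrite hornerE mul1r. Qed.

Lemma flat_gt0 x : 0 < x -> 0 < flat x.
Proof. by move=> x0; rewrite flatE// expR_gt0. Qed.

Lemma flat_ge0 x : 0 <= flat x.
Proof. by have [/flat_le0 ->|/flat_gt0/ltW] := leP x 0. Qed.

Lemma flat_le1 x : flat x <= 1.
Proof.
have [/flat_le0 ->//|x0] := leP x 0.
by rewrite flatE// expR_le1// oppr_le0 invr_ge0 ltW.
Qed.

Definition hat (a b x : R) : R := flat (x - a) * flat (b - x).

Lemma smooth_hat a b : smooth (hat a b).
Proof.
apply: smoothM.
  rewrite (_ : (fun x => _) = fun x => flat (1 * x + - a)); last first.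
    by apply/funext => x; rewrite mul1r.
  by apply: smooth_comp_affine; exact: smooth_flat.
rewrite (_ : (fun x => _) = fun x => flat (- 1 * x + b)); last first.
  by apply/funext => x; rewrite mulN1r addrC.
by apply: smooth_comp_affine; exact: smooth_flat.
Qed.

Lemma hat_out a b x : ~ (a < x < b) -> hat a b x = 0.
Proof.
move=> /negP; rewrite negb_and -!leNgt => /orP[xa|bx]; rewrite /hat.
  by rewrite flat_le0 ?mul0r// subr_le0.
by rewrite [flat (b - x)]flat_le0 ?mulr0// subr_le0.
Qed.

Lemma hat_gt0 a b x : a < x < b -> 0 < hat a b x.
Proof. by move=> /andP[ax xb]; rewrite mulr_gt0// flat_gt0// subr_gt0. Qed.

Lemma hat_ge0 a b x : 0 <= hat a b x.
Proof. by rewrite mulr_ge0// flat_ge0. Qed.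

End hat.

(** * Test functions and weak derivatives *)

Section almost_everywhere.
Context d (T : measurableType d) {R : realType} (mu : {measure set T -> \bar R}).
Implicit Types (P Q S : T -> Prop).

Lemma ae_imp P Q : {ae mu, forall x, P x} -> (forall x, P x -> Q x) ->
  {ae mu, forall x, Q x}.
Proof.
by move=> HP PQ; apply: filterS HP.
Qed.

Lemma ae_imp2 P Q S : {ae mu, forall x, P x} -> {ae mu, forall x, Q x} ->
  (forall x, P x -> Q x -> S x) -> {ae mu, forall x, S x}.
Proof.
by move=> HP HQ PQS; apply: filterS2 HP HQ.
Qed.

End almost_everywhere.

Section integral_tools.
Context d (T : measurableType d) {R : realType} (mu : {measure set T -> \bar R}).
Implicit Types (A B D : set T) (f g : T -> R).

Lemma Rintegral_supp A B f : (forall x, A x -> ~ B x -> f x = 0) ->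
  (forall x, B x -> ~ A x -> f x = 0) ->
  \int[mu]_(x in A) f x = \int[mu]_(x in B) f x.
Proof.
move=> AB BA; rewrite Rintegral_mkcond [RHS]Rintegral_mkcond.
congr (Rintegral mu setT _); apply/funext => x; rewrite !patchE.
case: ifPn => [/set_mem Ax|/negP nAx]; case: ifPn => [/set_mem Bx|/negP nBx] //.
- by apply: AB => // Bx; apply: nBx; exact: mem_set.
- by rewrite BA// => Ax; apply: nAx; exact: mem_set.
Qed.

Lemma integrable_supp A B f : measurable A -> measurable B ->
  (forall x, A x -> ~ B x -> f x = 0) -> (forall x, B x -> ~ A x -> f x = 0) ->
  mu.-integrable A (EFin \o f) -> mu.-integrable B (EFin \o f).
Proof.
move=> mA mB AB BA /(integrable_mkcond _ mA) H; apply/(integrable_mkcond _ mB).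
rewrite (_ : _ \_ B = (EFin \o f) \_ A)//; apply/funext => x; rewrite !patchE.
case: ifPn => [/set_mem Bx|/negP nBx]; case: ifPn => [/set_mem Ax|/negP nAx] //=.
- by rewrite BA// => Ax; apply: nAx; exact: mem_set.
- by rewrite AB// => Bx; apply: nBx; exact: mem_set.
Qed.

Lemma ae_eq_Rintegral D f g : measurable D -> measurable_fun D f ->
  measurable_fun D g -> {ae mu, forall x, D x -> f x = g x} ->
  \int[mu]_(x in D) f x = \int[mu]_(x in D) g x.
Proof.
move=> mD mf mg fg; congr fine; apply: ae_eq_integral => //.
- exact/measurable_EFinP.
- exact/measurable_EFinP.
- by apply: filterS fg => x H Dx; rewrite H.
Qed.

Lemma dominated_Rintegral D (f_ : nat -> T -> R) f g : measurable D ->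
  (forall n, measurable_fun D (f_ n)) -> (forall x, D x -> f_ ^~ x @ \oo --> f x) ->
  mu.-integrable D (EFin \o g) -> (forall n x, D x -> `|f_ n x| <= g x) ->
  mu.-integrable D (EFin \o f) /\
  (fun n => \int[mu]_(x in D) f_ n x) @ \oo --> \int[mu]_(x in D) f x.
Proof.
move=> mD mf_ f_f Ig fg.
have mf : measurable_fun D f.
  exact: (measurable_fun_cvg mf_).
have f_f' x : D x -> (EFin \o f_ n) x @[n --> \oo] --> (EFin \o f) x.
  by move=> Dx; apply: cvg_EFin; [exact: nearW|exact: f_f].
have [If _ H] := @dominated_convergence _ _ _ mu D mD (fun n => EFin \o f_ n)
  (EFin \o f) (EFin \o g) (fun n => (measurable_EFinP _ _).2 (mf_ n))
  ((measurable_EFinP _ _).2 mf) (aeW _ f_f') Ig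
  (aeW _ (fun x n Dx => fg n x Dx)).
split => //; apply: (@fine_cvg _ _ _ _ (fun n => \int[mu]_(x in D) (f_ n x)%:E)%E).
by rewrite Rintegral_EFin.
Qed.

End integral_tools.

Section test_functions.
Context {R : realType}.
Implicit Types (I : set R) (f g phi psi : R -> R) (x a b : R).

Lemma test_smooth I phi : test_fun I phi -> smooth phi.
Proof. by move=> [s _]; split. Qed.

Lemma test_out I phi x : test_fun I phi -> ~ I x -> phi x = 0.
Proof. by move=> [_ [K [_ KI H]]] nIx; apply: H => Kx; apply: nIx; exact: KI. Qed.

Lemma derive1_zero_near phi (A : set R) : open A -> (forall x, A x -> phi x = 0) ->
  forall x, A x -> derive1 phi x = 0.
Proof.
move=> oA H x Ax; rewrite derive1E.
have : is_derive x 1 phi 0.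
  apply: (near_eq_is_derive _ (der_cst x 0)).
  by apply: filterS (open_nbhs_nbhs (conj oA Ax)) => y Ay; rewrite H.
by move=> [].
Qed.

Lemma test_derive1 I phi : test_fun I phi -> test_fun I (derive1 phi).
Proof.
move=> [s [K [cK KI H]]]; split.
  by move=> n x; have := s n.+1 x; rewrite /derive1n iterSr.
exists K; split => // x nKx.
apply: (@derive1_zero_near phi (~` K)) => //.
by apply: closed_openC; apply: compact_closed => //; exact: Rhausdorff.
Qed.

Lemma test_derive1n I phi n : test_fun I phi -> test_fun I (derive1n n phi).
Proof. by elim: n => [//|n IH] /IH /test_derive1; rewrite /derive1n iterS. Qed.

Lemma test_is_derive I phi x : test_fun I phi -> is_derive x 1 phi (derive1 phi x).
Proof. by move=> /test_smooth s; exact: (smooth_is_derive 0 x s). Qed.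

Lemma test_continuous I phi : test_fun I phi -> continuous phi.
Proof. by move=> t; apply: der_continuousT => x; exact: (test_is_derive x t). Qed.

Lemma test_segment I phi : is_interval I -> I !=set0 -> test_fun I phi ->
  exists a b, [/\ a <= b, `[a, b] `<=` I & forall x, ~ (a <= x <= b) -> phi x = 0].
Proof.
move=> iI [z Iz] [_ [K [cK KI H]]].
have [[k Kk]|K0] := pselect (K !=set0); last first.
  exists z, z; split => // [|x _]; first by rewrite set_itv1 => _ ->.
  by apply: H => Kx; apply: K0; exists x.
have cid : {within K, continuous (@id R)} by apply: continuous_subspaceT => x; exact: cvg_id.
have [a aK amin] := compact_EVT_min (ex_intro _ k Kk) cK cid.
have [b bK bmax] := compact_EVT_max (ex_intro _ k Kk) cK cid.
exists a, b; split.
- by apply: amin; exact: bK.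
- move=> x /=; rewrite in_itv/= => /andP[ax xb]; apply: (iI a b).
  + by apply: KI; exact: set_mem.
  + by apply: KI; exact: set_mem.
  + by rewrite ax xb.
- move=> x nx; apply: H => Kx; apply: nx.
  by rewrite amin ?bmax//; exact: mem_set.
Qed.

Lemma test_bounded_supp I phi : test_fun I phi ->
  exists2 M, 0 < M & forall x, ~ (- M <= x <= M) -> phi x = 0.
Proof.
move=> [_ [K [cK KI H]]].
have /ex_strict_bound_gt0[M M0 HM] := compact_bounded cK.
exists M => // x nx; apply: H => /HM h; apply: nx.
by rewrite -ler_norml ltW.
Qed.

Lemma test_segment_fun I phi a b : smooth phi -> `[a, b] `<=` I ->
  (forall x, ~ (a <= x <= b) -> phi x = 0) -> test_fun I phi.
Proof.
move=> s abI H; split; first exact: smooth_derivable.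
exists `[a, b]%classic; split => //; first exact: segment_compact.
Qed.

Lemma test_smoothM I phi psi : smooth psi -> test_fun I phi ->
  test_fun I (fun x => psi x * phi x).
Proof.
move=> sp tp; split; first exact: smooth_derivable (smoothM sp (test_smooth tp)).
have [_ [K [cK KI H]]] := tp.
by exists K; split => // x /H ->; rewrite mulr0.
Qed.

Lemma testZ I phi c : test_fun I phi -> test_fun I (fun x => c * phi x).
Proof. by apply: test_smoothM; exact: smooth_cst. Qed.

Lemma testD I phi psi : test_fun I phi -> test_fun I psi ->
  test_fun I (fun x => phi x + psi x).
Proof.
move=> tf tg; split.
  exact: smooth_derivable (smoothD (test_smooth tf) (test_smooth tg)).
have [_ [K [cK KI H]]] := tf; have [_ [L [cL LI H']]] := tg.
exists (K `|` L); split => //; first exact: compactU.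
- by move=> x [/KI|/LI].
- by move=> x nx; rewrite H ?H' ?addr0// => h; apply: nx; [right|left].
Qed.

Lemma test_hat I a b : `[a, b] `<=` I -> test_fun I (hat a b).
Proof.
move=> abI; apply: (@test_segment_fun _ _ a b) => //; first exact: smooth_hat.
by move=> x nx; apply: hat_out => /andP[ax xb]; apply: nx; rewrite !ltW.
Qed.

Lemma Rintegral_test I phi f M : measurable I -> test_fun I phi ->
  (forall x, ~ (- M <= x <= M) -> phi x = 0) ->
  \int[leb]_(x in I) (f x * phi x) = \int[leb]_(x in `[- M, M]) (f x * phi x).
Proof.
move=> mI tp H; apply: Rintegral_supp => x.
  by move=> _ nx; rewrite H ?mulr0//; move: nx => /=; rewrite in_itv.
by move=> _ nx; rewrite (test_out tp)// mulr0.
Qed.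

Lemma test_by_parts I phi f f' : open I -> test_fun I phi -> continuous f' ->
  (forall x : R, is_derive x 1 f (f' x)) ->
  \int[leb]_(x in I) (f x * derive1 phi x) = - \int[leb]_(x in I) (f' x * phi x).
Proof.
move=> oI tp cf' Hf.
have mI : measurable I by exact: open_measurable.
have [M M0 HM] := test_bounded_supp tp.
pose N := M + 1.
have HN x : ~ (- N < x < N) -> phi x = 0.
  by move=> nx; apply: HM => /andP[h1 h2]; apply: nx; rewrite /N; lra.
have HN' x : ~ (- N <= x <= N) -> phi x = 0.
  by move=> nx; apply: HN => /andP[h1 h2]; apply: nx; rewrite !ltW.
have HN1 x : ~ (- N <= x <= N) -> derive1 phi x = 0.
  move=> nx; apply: (@derive1_zero_near phi (~` `[- N, N])).
  - by apply: closed_openC; exact: itv_closed.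
  - by move=> y /= ny; apply: HN' => h; apply: ny; rewrite in_itv.
  - by move=> /=; rewrite in_itv.
rewrite (Rintegral_test _ mI (test_derive1 tp) HN1) (Rintegral_test _ mI tp HN').
have cf := der_continuousT Hf.
have cphi := test_continuous tp; have cphi' := test_continuous (test_derive1 tp).
have c1 : continuous (fun x => f x * derive1 phi x).
  by move=> x; apply: continuousM; [exact: cf|exact: cphi'].
have c2 : continuous (fun x => f' x * phi x).
  by move=> x; apply: continuousM; [exact: cf'|exact: cphi].
apply/eqP; rewrite -subr_eq0 opprK addrC -RintegralD//; last 2 first.
- exact: continuous_loc_int.
- exact: continuous_loc_int.
have c3 : continuous (fun x => f' x * phi x + f x * derive1 phi x).
  exact: (contD c2 c1).
have NN : - N <= N by rewrite /N; lra.
have -> := FTC_segment c3 (fun x => derM (Hf x) (test_is_derive x tp)) NN.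
by rewrite !HN ?mulr0 ?subrr// ltxx ?andbF.
Qed.

End test_functions.

Lemma Rintegral_itv_oo {R : realType} (f : R -> R) a b : loc_int f ->
  \int[leb]_(t in `]a, b[) f t = \int[leb]_(t in `[a, b]) f t.
Proof.
move=> lf.
have ocS : `]a, b] `<=` `[a, b] by apply: subset_itvr; rewrite bnd_simp.
have ooS : `]a, b[ `<=` `[a, b] by exact: subset_itv_oo_cc.
rewrite -[RHS]Rintegral_itv_obnd_cbnd; last by apply: integrableS (lf a b).
by rewrite -[RHS]Rintegral_itv_bndo_bndc//; apply: integrableS (lf a b).
Qed.

Lemma prim_const {R : realType} (f : R -> R) a b : loc_int f -> a <= b ->
  (forall t, a < t < b -> f t = 0) -> prim f a = prim f b.
Proof.
move=> lf ab H; apply/esym/eqP; rewrite -subr_eq0 prim_sub// -Rintegral_itv_oo//.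
rewrite (@Rintegral_supp _ _ _ leb _ set0) ?Rintegral_set0//.
by move=> x /=; rewrite in_itv/= => /H.
Qed.

Section weak_derivatives.
Context {R : realType}.
Implicit Types (I : set R) (f g phi psi : R -> R) (x a b : R).

Lemma continuous_locally_integrable I f : open I -> continuous f -> locally_integrable I f.
Proof.
move=> oI cf; split => //.
  by apply: measurable_funTS; exact: continuous_measurable_fun.
move=> K _ cK.
have /integrableP[] : leb.-integrable K (EFin \o f).
  by apply: continuous_compact_integrable => //; exact: continuous_subspaceT.
by move=> _; under eq_integral do rewrite /=.
Qed.

Lemma wderiv0 I f : locally_integrable I f -> is_wderiv 0 I f f.
Proof. by move=> lf; split => // phi _; rewrite expr0 mul1r. Qed.

Lemma wderivS k I f g h : is_wderiv 1 I f g -> is_wderiv k I g h ->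
  is_wderiv k.+1 I f h.
Proof.
move=> [lf _ Hf] [_ lh Hg]; split => // phi tp.
have := Hf _ (test_derive1n k tp).
rewrite -[derive1n 1 _]/(derive1n k.+1 phi) => ->.
by rewrite (Hg _ tp) expr1 exprS mulrA.
Qed.

Lemma wderiv_der I f f' : open I -> continuous f' ->
  (forall x : R, is_derive x 1 f (f' x)) -> is_wderiv 1 I f f'.
Proof.
move=> oI cf' Hf; split.
- by apply: continuous_locally_integrable => //; exact: der_continuousT Hf.
- exact: continuous_locally_integrable.
- by move=> phi tp; rewrite /derive1n/= (test_by_parts oI tp cf' Hf) expr1 mulN1r.
Qed.

Lemma wderiv_chain k I (F : nat -> R -> R) : open I ->
  (forall j, (j < k)%N -> forall x : R, is_derive x 1 (F j) (F j.+1 x)) ->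
  continuous (F k) -> is_wderiv k I (F 0%N) (F k).
Proof.
move=> oI; elim: k F => [|k IH] F HF cF.
  by apply: wderiv0; exact: continuous_locally_integrable.
apply: (@wderivS _ _ _ (F 1%N)).
  apply: wderiv_der => //; last exact: HF.
  case: k {IH} cF HF => [//|k] cF HF.
  by apply: der_continuousT => x; exact: (HF 1%N).
by apply: (IH (fun j => F j.+1)) => // j jk; exact: HF.
Qed.

Lemma locally_integrable_segment I f a b : locally_integrable I f ->
  `[a, b] `<=` I -> leb.-integrable `[a, b] (EFin \o f).
Proof.
move=> [mf oI H] abI; apply/integrableP; split.
  by apply/measurable_EFinP; apply: measurable_funS abI mf => //; exact: open_measurable.
exact: (H _ abI (@segment_compact _ _ _)).
Qed.

(** Segments with rational ends inside I are countably many and their interiors cover I, so the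
    exceptional sets have a null union. [unpickle] enumerates the pairs of ends. *)
Lemma ae_exhaust I (P : R -> Prop) : open I ->
  (forall a b, a < b -> `[a, b] `<=` I ->
     {ae leb, forall x : R, a < x < b -> P x}) ->
  {ae leb, forall x : R, I x -> P x}.
Proof.
move=> oI H.
pose Q n x := if unpickle n is Some (p, q) then
  (ratr p : R) < ratr q -> `[ratr p, (ratr q : R)] `<=` I -> ratr p < x < ratr q -> P x
  else True.
have : {ae leb, forall x : R, forall n, Q n x}.
  apply: ae_foralln => n; rewrite /Q; case: unpickle => [[p q]|]; last exact: aeW.
  have [pq|] := pselect ((ratr p : R) < ratr q); last first.
    by move=> npq; apply: aeW => x /npq.
  have [pqI|] := pselect (`[ratr p, (ratr q : R)] `<=` I); last first.
    by move=> npq; apply: aeW => x _ /npq.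
  by apply: ae_imp (H _ _ pq pqI) _ => x h _ _.
move=> HQ; apply: ae_imp HQ _ => x Qx Ix.
have /nbhs_ballP[e /= e0 He] : nbhs x I by apply: open_nbhs_nbhs.
have [|p] := @rat_in_itvoo R (x - e) x; first by rewrite ltrBlDr ltrDl.
have [|q] := @rat_in_itvoo R x (x + e); first by rewrite ltrDl.
rewrite !in_itv/= => /andP[xq qe] /andP[ep px].
have := Qx (pickle (p, q)); rewrite /Q pickleK; apply.
- exact: lt_trans xq.
- move=> y /=; rewrite in_itv/= => /andP[py yq]; apply: He.
  rewrite /ball/= ltr_distlC; apply/andP; split.
    by rewrite (lt_le_trans ep).
  by rewrite (le_lt_trans yq).
- by rewrite px xq.
Qed.

(** By the Lebesgue differentiation theorem f is almost everywhere the derivative of its primitive,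
    which is constant here. *)
Lemma ae_zero_prim f a b : a < b -> leb.-integrable `[a, b] (EFin \o f) ->
  (forall x, a <= x <= b -> \int[leb]_(t in `[a, x]) f t = 0) ->
  {ae leb, forall x : R, a < x < b -> f x = 0}.
Proof.
move=> ab If H.
pose g := f \_ `[a, b].
have lg : locally_integrable [set: R] g by exact: integrable_locally_restrict.
have Ig y : leb.-integrable [set` Interval (BLeft a) (BRight y)] (EFin \o g).
  apply: (@integrableS _ _ _ leb setT) => //.
  by rewrite /g -restrict_EFin; apply: (integrable_mkcond _ _).1.
apply: ae_imp (FTC1 Ig lg) _ => x Hx /andP[ax xb].
have {}Hx := Hx ltac:(by rewrite lte_fin); have [_] := Hx.
rewrite {2}/g patchE mem_set; last by rewrite /= in_itv/= !ltW.
move=> <-.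
apply: (@derive1_zero_near _ _ `]a, b[) => //; last by rewrite /= in_itv/= ax xb.
move=> y /=; rewrite in_itv/= => /andP[ay yb].
rewrite -[RHS](H y); last by rewrite !ltW.
apply: eq_Rintegral => t; rewrite inE/= in_itv/= => /andP[at_ ty].
by rewrite /g patchE mem_set// /= in_itv/= at_ (le_trans ty)// ltW.
Qed.

Lemma flat_cvg1 (c : R) : 0 < c -> flat (n.+1%:R * c) @[n --> \oo] --> (1 : R).
Proof.
move=> c0.
rewrite (_ : (fun n => _) = fun n => expR (- (c^-1 * n.+1%:R^-1))); last first.
  by apply/funext => n; rewrite flatE ?mulr_gt0// invfM mulrC.
rewrite -[X in _ --> X]expR0 -[X in expR X]oppr0 -(mulr0 c^-1).
apply: continuous_cvg; first exact: continuous_expR.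
by apply: cvgN; apply: cvgMr; exact: cvg_harmonic.
Qed.

(** The test functions [phi n] are bounded by 1 and tend to 1 on ]a, c[, so dominated convergence
    makes the integral of f vanish over every segment of I. *)
Lemma fundamental_lemma I f : locally_integrable I f ->
  (forall phi, test_fun I phi -> \int[leb]_(x in I) (f x * phi x) = 0) ->
  {ae leb, forall x : R, I x -> f x = 0}.
Proof.
move=> lf H; have [mf oI _] := lf.
have mI : measurable I by exact: open_measurable.
apply: ae_exhaust => // a b ab abI.
have Iab := locally_integrable_segment lf abI.
apply: ae_zero_prim => // c /andP[ac cb].
have acab : `[a, c] `<=` `[a, b] by apply: subset_itvl; rewrite bnd_simp.
have Iac : leb.-integrable `[a, c] (EFin \o f) by exact: integrableS Iab.
pose phi n x := flat (n.+1%:R * (x - a)) * flat (n.+1%:R * (c - x)).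
have tphi n : test_fun I (phi n).
  apply: (@test_segment_fun _ _ _ a c).
  - apply: smoothM.
      rewrite (_ : (fun x => _) = fun x => flat (n.+1%:R * x + - (n.+1%:R * a))).
        exact: smooth_comp_affine smooth_flat.
      by apply/funext => x; rewrite mulrBr.
    rewrite (_ : (fun x => _) = fun x => flat (- n.+1%:R * x + n.+1%:R * c)).
      exact: smooth_comp_affine smooth_flat.
    by apply/funext => x; rewrite mulrBr mulNr addrC.
  - exact: subset_trans abI.
  - move=> x /negP; rewrite negb_and -!ltNge /phi => /orP[xa|cx].
      by rewrite flat_le0 ?mul0r// pmulr_rle0// subr_le0 ltW.
    by rewrite [X in _ * X]flat_le0 ?mulr0// pmulr_rle0// subr_le0 ltW.
have mac : measurable_fun `[a, c] f by exact: integrable_real_measurable Iac.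
have mphi n : measurable_fun `[a, c] (phi n).
  by apply: measurable_funTS; apply: continuous_measurable_fun; exact: test_continuous (tphi n).
have ooS : `]a, c[ `<=` `[a, c] by exact: subset_itv_oo_cc.
have [||||_ cv] := @dominated_Rintegral _ _ _ leb `]a, c[ (fun n x => f x * phi n x)
  f (fun x => `|f x|) (measurable_itv _).
- by move=> n; apply: measurable_funS (measurable_funM mac (mphi n)).
- move=> x /=; rewrite in_itv/= => /andP[ax xc].
  rewrite -[X in _ --> X]mulr1 -[X in _ * X]mulr1.
  by apply: cvgMr; apply: cvgM; apply: flat_cvg1; rewrite subr_gt0.
- by apply: integrableS (integrable_norm Iac).
- move=> n x _; rewrite normrM ler_piMr// ger0_norm ?mulr_ge0 ?flat_ge0//.
  by rewrite mulr_ile1 ?flat_ge0 ?flat_le1.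
have ocS : `]a, c] `<=` `[a, c] by apply: subset_itvr; rewrite bnd_simp.
have ooS' : `]a, c[ `<=` `]a, c] by apply: subset_itvl; rewrite bnd_simp.
rewrite -Rintegral_itv_obnd_cbnd; last by apply: integrableS Iac.
rewrite -Rintegral_itv_bndo_bndc; last by apply: integrableS Iac.
apply: (@cvg_unique _ (@Rhausdorff R)) cv _.
rewrite (_ : (fun n => _) = fun=> 0); first exact: cvg_cst.
apply/funext => n; rewrite -[RHS](H _ (tphi n)).
have out x : ~ (a < x < c) -> phi n x = 0.
  move=> /negP; rewrite negb_and -!leNgt /phi => /orP[xa|cx].
    by rewrite flat_le0 ?mul0r// pmulr_rle0// subr_le0.
  by rewrite [X in _ * X]flat_le0 ?mulr0// pmulr_rle0// subr_le0.
apply: Rintegral_supp => x.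
- by move=> /ooS/acab/abI.
- by move=> _ /= nx; rewrite out ?mulr0//; move: nx; rewrite in_itv.
Qed.

Lemma testB I phi psi : test_fun I phi -> test_fun I psi ->
  test_fun I (fun x => phi x - psi x).
Proof.
move=> tf tg; rewrite (_ : (fun x => _) = fun x => phi x + (- 1) * psi x).
  by apply: testD => //; exact: testZ.
by apply/funext => x; rewrite mulN1r.
Qed.

Lemma integrable_test I f phi : locally_integrable I f -> test_fun I phi ->
  leb.-integrable I (EFin \o (fun x => f x * phi x)).
Proof.
move=> [mf oI lf] tp; have mI : measurable I by exact: open_measurable.
have [_ [K [cK KI H]]] := tp.
have mK : measurable K by exact: compact_measurable.
have [M [_ HM]] := compact_bounded (continuous_compact (continuous_subspaceT (test_continuous tp)) cK).
have IK : leb.-integrable K (EFin \o f).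
  apply/integrableP; split; last exact: lf.
  by apply/measurable_EFinP; exact: measurable_funS mf.
apply: (@integrable_supp _ _ _ leb K I) => //.
- by move=> x /KI.
- by move=> x _ /H ->; rewrite mulr0.
- apply: (@integrable_real_le _ _ _ leb K mK _ (fun x => (M + 1) * `|f x|)).
  + apply: measurable_funM; first exact: measurable_funS mf.
    by apply: measurable_funTS; apply: continuous_measurable_fun; exact: test_continuous tp.
  + by apply: integrable_realZ => //; exact: integrable_norm IK.
  + move=> x Kx; rewrite normrM mulrC ler_wpM2r//.
    by apply: (HM (M + 1)); [rewrite ltrDl|exists x].
Qed.

Lemma is_wderiv_ae_unique k I f g h : is_wderiv k I f g -> is_wderiv k I f h ->
  {ae leb, forall x : R, I x -> g x = h x}.
Proof.
move=> [_ lg Hg] [_ lh Hh].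
have := fundamental_lemma (locally_integrableB lg lh) _.
move=> H; apply: ae_imp (H _) _.
  move=> phi tp; rewrite (_ : (fun x => _) = fun x => g x * phi x - h x * phi x); last first.
    by apply/funext => x; rewrite /= mulrBl.
  rewrite (_ : \int[leb]_(x in I) _ = \int[leb]_(x in I) (g x * phi x) - \int[leb]_(x in I) (h x * phi x)); last first.
    have [_ oI _] := lg.
    by apply: RintegralB; [exact: open_measurable|exact: integrable_test|exact: integrable_test].
  have s0 : (-1) ^+ k != 0 :> R by rewrite signr_eq0.
  apply: (mulfI s0); rewrite mulr0 mulrBr -Hg// -Hh// subrr //.
by move=> x e Ix; apply/eqP; rewrite -subr_eq0 [X in X == _]e.
Qed.

Lemma test_antiderivative I psi : is_interval I -> I !=set0 -> test_fun I psi ->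
  \int[leb]_(x in I) psi x = 0 -> exists2 phi, test_fun I phi & derive1 phi = psi.
Proof.
move=> iI I0 tp.
have [a [b [ab abI H]]] := test_segment iI I0 tp.
have cp := test_continuous tp.
rewrite (@Rintegral_supp _ _ _ leb I `[a, b]); last 2 first.
- by move=> x _ nx; apply: H; move: nx => /=; rewrite in_itv.
- by move=> x _; exact: test_out.
rewrite -prim_sub//; last exact: continuous_loc_int.
move=> e.
have d x : is_derive x 1 (fun x => prim psi x - prim psi a) (psi x).
  by rewrite -[psi x]subr0; exact: (derB (prim_is_deriveT cp x) (der_cst x (prim psi a))).
exists (fun x => prim psi x - prim psi a); last exact: derive1_is d.
apply: (@test_segment_fun _ _ _ a b) => //.
  exact: smooth_prim (test_smooth tp) d.
have lp := continuous_loc_int cp.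
move=> x /negP; rewrite negb_and -!ltNge => /orP[xa|bx].
  rewrite (@prim_const _ psi x a) ?subrr ?(ltW xa)// => y /andP[_ ya].
  by apply: H => /andP[]; rewrite leNgt ya.
rewrite -(@prim_const _ psi b x) ?(ltW bx)// => y /andP[yb _].
by apply: H => /andP[_]; rewrite leNgt yb.
Qed.

(* du Bois-Reymond: [psi - (\int psi) chi] is the derivative of a test function. *)
Lemma test_decompose I : open I -> is_interval I -> I !=set0 ->
  exists2 chi, test_fun I chi & forall psi, test_fun I psi ->
    exists2 phi, test_fun I phi &
      forall x, psi x = (\int[leb]_(t in I) psi t) * chi x + derive1 phi x.
Proof.
move=> oI iI [z Iz].
have /nbhs_ballP[e /= e0 He] : nbhs z I by apply: open_nbhs_nbhs.
pose a := z - e / 2; pose b := z + e / 2.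
have abI : `[a, b] `<=` I.
  move=> y /=; rewrite in_itv/= => /andP[ay yb]; apply: He.
  by rewrite /ball/= ltr_distlC; apply/andP; split; move: ay yb; rewrite /a /b; lra.
have ab : a < b by rewrite /a /b; lra.
have th := test_hat abI; have mI : measurable I by exact: open_measurable.
have It f : test_fun I f -> leb.-integrable I (EFin \o f).
  move=> tf; have := integrable_test (continuous_locally_integrable oI (@cont_cst R 1)) tf.
  by under [X in _.-integrable _ (EFin \o X)]eq_fun do rewrite mul1r.
pose m := \int[leb]_(t in I) hat a b t.
have ch : continuous (hat a b) by exact: test_continuous th.
have m0 : 0 < m.
  rewrite /m (@Rintegral_supp _ _ _ leb I `[a, b]); last 2 first.
  - move=> x _ /= nx; apply: hat_out => /andP[ax xb]; apply: nx.
    by rewrite in_itv/= !ltW.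
  - by move=> x _; exact: test_out.
  rewrite -prim_sub ?(ltW ab)//; last exact: continuous_loc_int.
  have [|c] := @MVT R (prim (hat a b)) (hat a b) a b ab (fun x _ => prim_is_deriveT ch x).
    by apply: continuous_subspaceT; exact: prim_continuous (continuous_loc_int ch).
  by rewrite in_itv/= => cab ->; rewrite mulr_gt0 ?subr_gt0// hat_gt0.
have tchi := testZ m^-1 th.
exists (fun x => m^-1 * hat a b x) => // psi tpsi.
pose k := \int[leb]_(t in I) psi t.
have t1 := testB tpsi (testZ k tchi).
have [|phi tphi dphi] := test_antiderivative iI (ex_intro _ z Iz) t1.
  rewrite RintegralB//; [|exact: It|exact: It (testZ k tchi)].
  rewrite !RintegralZl//; [|exact: It|exact: It tchi].
  by rewrite -/m -/k mulVf ?gt_eqF// mulr1 subrr.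
by exists phi => // x; rewrite dphi addrC subrK.
Qed.

(** Two continuous representatives that differ at b also differ throughout a small ball inside I
    near b, and a ball has positive measure. *)
Lemma is_trace_unique I b f y z : open I -> closure I b ->
  is_trace I b f y -> is_trace I b f z -> y = z.
Proof.
move=> oI clb [F [cF Ff <-]] [G [cG Gf <-]].
have FG : {ae leb, forall x : R, I x -> F x = G x}.
  by apply: ae_imp2 Ff Gf _ => x e1 e2 Ix; rewrite e1// e2.
apply/eqP/negP => /negP neq.
pose e := `|F b - G b|; have e0 : 0 < e by rewrite normr_gt0 subr_eq0.
have e2 : 0 < e / 2 by rewrite divr_gt0.
have nF : \forall x \near within (closure I) (nbhs b), `|F b - F x| < e / 2.
  by move/subspace_continuousP: cF => /(_ b clb)/cvgrPdist_lt/(_ _ e2).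
have nG : \forall x \near within (closure I) (nbhs b), `|G b - G x| < e / 2.
  by move/subspace_continuousP: cG => /(_ b clb)/cvgrPdist_lt/(_ _ e2).
have nFG : nbhs b [set x | closure I x -> `|F b - F x| < e / 2 /\ `|G b - G x| < e / 2].
  have nF' : nbhs b [set x | closure I x -> `|F b - F x| < e / 2] by exact: nF.
  have nG' : nbhs b [set x | closure I x -> `|G b - G x| < e / 2] by exact: nG.
  by apply: filterS2 nF' nG' => x h1 h2 cx; split; [exact: h1|exact: h2].
have /nbhs_ballP[r /= r0 Hr] := nFG.
have [w [Iw bw]] : I `&` ball b r !=set0 by apply: clb; exact: nbhsx_ballx.
have /nbhs_ballP[s /= s0 Hs] : nbhs w (I `&` ball b r).
  by apply: filterI; [exact: open_nbhs_nbhs|apply: open_nbhs_nbhs; split => //; exact: ball_open].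
have [N [mN N0 HN]] := FG.
have : (0 < leb (ball w s))%E by rewrite lebesgue_measure_ball ?(ltW s0)// lte_fin mulrn_wgt0.
suff : (leb (ball w s) <= leb N)%E by move=> h1 h2; have := lt_le_trans h2 h1; rewrite N0 ltxx.
apply: le_measure; rewrite ?inE//; first exact: measurable_ball.
move=> u /Hs[Iu bu]; apply: HN => /= /(_ Iu) E.
have [h1 h2] := Hr u bu (subset_closure Iu).
move: h1 h2 => /=; rewrite E => h1 h2.
have : e < e.
  rewrite {1}/e (_ : F b - G b = (F b - G u) - (G b - G u)); last by ring.
  apply: le_lt_trans (ler_normB _ _) _.
  by rewrite [X in _ < X](splitr e) ltrD.
by rewrite ltxx.
Qed.

Lemma traceE I b f y : open I -> closure I b -> is_trace I b f y -> trace I b f = y.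
Proof.
move=> oI clb H; apply: (is_trace_unique oI clb _ H).
by rewrite /trace; apply: (@getPex _ [set y | is_trace I b f y]); exists y.
Qed.

Lemma continuous_is_trace I b F f : continuous F ->
  {ae leb, forall x, I x -> F x = f x} -> is_trace I b f (F b).
Proof. by move=> cF H; exists F; split => //; exact: continuous_subspaceT. Qed.

Lemma wderiv_is k I f g : is_wderiv k I f g -> is_wderiv k I f (wderiv k I f).
Proof. by move=> H; apply: (@getPex _ [set g | is_wderiv k I f g]); exists g. Qed.

End weak_derivatives.

(** Meant for the partial integrals in Fubini's theorem, which are finite only almost everywhere:
    [fine] sends infinite values to 0, at no cost for the integral. *)
Lemma fine_integrable d (T : measurableType d) (R : realType)
    (mu : {measure set T -> \bar R}) D (h : T -> \bar R) : measurable D ->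
  mu.-integrable D h ->
  mu.-integrable D (EFin \o (fun x => fine (h x))) /\
  (\int[mu]_(x in D) (fine (h x))%:E = \int[mu]_(x in D) h x)%E.
Proof.
move=> mD Ih; have mh := measurable_int _ Ih.
have mf : measurable_fun D (fun x => fine (h x)).
  exact: measurableT_comp mh.
split.
  apply: (le_integrable mD _ _ Ih); first exact/measurable_EFinP.
  by move=> x _ /=; case: (h x) => //= *; rewrite leey.
apply: ae_eq_integral => //; first exact/measurable_EFinP.
by apply: ae_imp (integrable_ae mD Ih) _ => x H Dx /=; rewrite fineK// H.
Qed.

Lemma eqRint {R : realType} (D : set R) (g f : R -> R) :
  (forall x, D x -> f x = g x) -> \int[leb]_(x in D) f x = \int[leb]_(x in D) g x.
Proof. by move=> H; apply: eq_Rintegral => x /set_mem /H. Qed.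

(** * Fubini's theorem for real-valued functions on rectangles *)

Section fubini_real.
Context {R : realType}.
Implicit Types (A B : set R) (f : R * R -> R).

Lemma RFubini A B f : measurable A -> measurable B ->
  (leb \x leb)%E.-integrable (A `*` B) (EFin \o f) ->
  [/\ leb.-integrable A (EFin \o (fun x => \int[leb]_(y in B) f (x, y))),
      leb.-integrable B (EFin \o (fun y => \int[leb]_(x in A) f (x, y))),
      {ae leb, forall x : R, A x -> leb.-integrable B (EFin \o (fun y => f (x, y)))},
      {ae leb, forall y : R, B y -> leb.-integrable A (EFin \o (fun x => f (x, y)))} &
      \int[leb]_(x in A) (\int[leb]_(y in B) f (x, y)) =
      \int[leb]_(y in B) (\int[leb]_(x in A) f (x, y))].
Proof.
move=> mA mB If.
have mAB : measurable (A `*` B) by exact: measurableX.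
pose g : R * R -> \bar R := (EFin \o f) \_ (A `*` B).
have Ig : (leb \x leb)%E.-integrable setT g by apply: (integrable_mkcond _ _).1.
have g1 x y : g (x, y) = if x \in A then if y \in B then (f (x, y))%:E else 0%E else 0%E.
  rewrite /g patchE; case: (boolP (x \in A)) => [/set_mem Ax|/negP nAx].
    case: (boolP (y \in B)) => [/set_mem By|/negP nBy]; first by rewrite mem_set.
    by rewrite memNset// => -[_ /= /mem_set].
  by rewrite memNset// => -[/= /mem_set].
have gA x : A x -> (fun y => g (x, y)) = (EFin \o (fun y => f (x, y))) \_ B.
  by move=> Ax; apply/funext => y; rewrite g1 mem_set// patchE.
have gB y : B y -> (fun x => g (x, y)) = (EFin \o (fun x => f (x, y))) \_ A.
  by move=> By; apply/funext => x; rewrite g1 [y \in B]mem_set// patchE.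
have gnA x : ~ A x -> (fun y => g (x, y)) = cst 0%E.
  by move=> nA; apply/funext => y; rewrite g1 memNset.
have gnB y : ~ B y -> (fun x => g (x, y)) = cst 0%E.
  by move=> nB; apply/funext => x; rewrite g1 [y \in B]memNset//; case: ifP.
have a1 : {ae leb, forall x : R, A x -> leb.-integrable B (EFin \o (fun y => f (x, y)))}.
  apply: ae_imp (ae_integrable1 Ig) _ => x + Ax; rewrite gA// => h.
  exact: (integrable_mkcond _ _).2.
have a2 : {ae leb, forall y : R, B y -> leb.-integrable A (EFin \o (fun x => f (x, y)))}.
  apply: ae_imp (ae_integrable2 Ig) _ => x + Ax; rewrite gB// => h.
  exact: (integrable_mkcond _ _).2.
have e1 x : A x -> \int[leb]_(y in B) f (x, y) = fine (fubini_F leb g x).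
  move=> Ax; rewrite /Rintegral /fubini_F integral_mkcond.
  by rewrite (gA _ Ax).
have e2 y : B y -> \int[leb]_(x in A) f (x, y) = fine (fubini_G leb g y).
  move=> By; rewrite /Rintegral /fubini_G integral_mkcond.
  by rewrite (gB _ By).
have IF := integrable_fubini_F Ig.
have IFA : leb.-integrable A (fubini_F leb g) by exact: integrableS IF.
have [F1 F2] := @fine_integrable _ _ R leb A _ mA IFA.
have IG : leb.-integrable setT (fubini_G leb g).
  apply/integrableP; split; first exact: (measurable_fubini_G Ig).
  apply: le_lt_trans ((@integrable21ltyP _ _ _ _ R leb leb g (measurable_int _ Ig)).1 Ig).
  apply: ge0_le_integral => //.
  - by apply: measurableT_comp => //; exact: (measurable_fubini_G Ig).
  - apply: (@measurable_fun_fubini_tonelli_G _ _ _ _ R leb (abse \o g)) => //=.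
    by apply: measurableT_comp => //; exact: measurable_int Ig.
  - move=> y _; apply: le_abse_integral => //.
    by apply: measurableT_comp => //; exact: measurable_int Ig.
have IGB : leb.-integrable B (fubini_G leb g) by exact: integrableS IG.
have [G1 G2] := @fine_integrable _ _ R leb B _ mB IGB.
split => //.
- by apply: eq_integrable F1 => // x /set_mem Ax /=; rewrite e1.
- by apply: eq_integrable G1 => // x /set_mem Ax /=; rewrite e2.
rewrite (@eqRint R _ (fun x => fine (fubini_F leb g x)) _ e1).
rewrite [RHS](@eqRint R _ (fun x => fine (fubini_G leb g x)) _ e2).
congr fine; rewrite [LHS]F2 [RHS]G2.
rewrite integral_mkcond [RHS]integral_mkcond.
transitivity (\int[leb]_x fubini_F leb g x)%E.
  apply: eq_integral => x _; rewrite patchE; case: ifPn => // /negP nA.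
  rewrite /fubini_F (_ : (fun y => g (x, y)) = cst 0%E) ?integral0// gnA// => Ax.
  by apply: nA; exact: mem_set.
transitivity (\int[leb]_x fubini_G leb g x)%E; last first.
  apply: eq_integral => x _; rewrite patchE; case: ifPn => // /negP nA.
  rewrite /fubini_G (_ : (fun y => g (y, x)) = cst 0%E) ?integral0// gnB// => Ax.
  by apply: nA; exact: mem_set.
exact: Fubini.
Qed.

Lemma measurable_fun_snd A B (h : R -> R) : measurable B -> measurable_fun B h ->
  measurable_fun (A `*` B) (fun z : R * R => h z.2).
Proof.
move=> mB mh; apply: (@measurable_comp _ _ _ _ _ _ B h (A `*` B) snd) => //.
  by move=> _ [[x y] [_ /= By] <-].
exact: measurable_funTS measurable_snd.
Qed.

Lemma measurable_fun_fst A B (h : R -> R) : measurable A -> measurable_fun A h ->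
  measurable_fun (A `*` B) (fun z : R * R => h z.1).
Proof.
move=> mA mh; apply: (@measurable_comp _ _ _ _ _ _ A h (A `*` B) fst) => //.
  by move=> _ [[x y] [/= Ax _] <-].
exact: measurable_funTS measurable_fst.
Qed.

Lemma integrable_tensor A B (a b : R -> R) : measurable A -> measurable B ->
  leb.-integrable A (EFin \o a) -> leb.-integrable B (EFin \o b) ->
  (leb \x leb)%E.-integrable (A `*` B) (EFin \o (fun z => a z.1 * b z.2)).
Proof.
move=> mA mB Ia Ib.
have mAB : measurable (A `*` B) by exact: measurableX.
apply/integrable_mkcond => //.
pose a' := a \_ A; pose b' := b \_ B.
have Ia' : leb.-integrable setT (EFin \o a').
  by rewrite /a' -restrict_EFin; apply: (integrable_mkcond _ _).1.
have Ib' : leb.-integrable setT (EFin \o b').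
  by rewrite /b' -restrict_EFin; apply: (integrable_mkcond _ _).1.
rewrite (_ : _ \_ _ = (EFin \o (fun z : R * R => a' z.1 * b' z.2))); last first.
  apply/funext => -[x y]; rewrite /a' /b' /= !patchE.
  case: (boolP (x \in A)) => [/set_mem Ax|/negP nAx].
    case: (boolP (y \in B)) => [/set_mem By|/negP nBy]; first by rewrite mem_set.
    by rewrite memNset ?mulr0// => -[_ /= /mem_set].
  by rewrite memNset ?mul0r// => -[/= /mem_set].
have ma : measurable_fun setT a' by exact: integrable_real_measurable Ia'.
have mb : measurable_fun setT b' by exact: integrable_real_measurable Ib'.
have mf : measurable_fun setT (EFin \o (fun z : R * R => a' z.1 * b' z.2)).
  apply/measurable_EFinP; apply: measurable_funM.
    exact: measurableT_comp ma measurable_fst.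
  exact: measurableT_comp mb measurable_snd.
apply: (@integrable12ltyP _ _ _ _ R leb leb _ mf).2 => /=.
have /integrableP[_ Ha] := Ia'; have /integrableP[mb' Hb] := Ib'.
under eq_integral do under eq_integral do rewrite normrM EFinM.
have E x : (\int[leb]_y (`|a' x|%:E * `|b' y|%:E) = `|a' x|%:E * \int[leb]_y `|b' y|%:E)%E.
  rewrite ge0_integralZl//.
  by apply/measurable_EFinP; apply: measurableT_comp.
under eq_integral do rewrite E.
rewrite ge0_integralZr//; last 2 first.
- by apply/measurable_EFinP; apply: measurableT_comp.
- exact: integral_ge0.
rewrite lte_mul_pinfty//; first exact: integral_ge0.
by rewrite ge0_fin_numE//; exact: integral_ge0.
Qed.

End fubini_real.

(** * Integration by parts for primitives of integrable functions, and recovery of primitives from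
    weak derivatives *)

Section primitives_of_integrable_functions.
Context {R : realType}.
Implicit Types (I : set R) (f g phi psi : R -> R) (x a b : R).

Lemma derive1_out I phi M x : test_fun I phi ->
  (forall y, ~ (- M <= y <= M) -> phi y = 0) -> ~ (- M <= x <= M) -> derive1 phi x = 0.
Proof.
move=> tp HM nx; apply: (@derive1_zero_near _ phi (~` `[- M, M])).
- by apply: closed_openC; exact: itv_closed.
- by move=> y /= ny; apply: HM => h; apply: ny; rewrite in_itv.
- by move=> /=; rewrite in_itv.
Qed.

(** Turns the triangle v <= u into a measurable factor on a square, so that Fubini's theorem can
    perform an integration by parts. *)
Lemma measurable_below_diagonal : exists2 chi : R * R -> R, measurable_fun setT chi &
  (forall u v, v <= u -> chi (u, v) = 1) /\ (forall u v, u < v -> chi (u, v) = 0).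
Proof.
have mS : measurable [set w : R * R | w.2 <= w.1].
  rewrite (_ : [set _ | _] = (fun w : R * R => w.1 - w.2) @^-1` `[0, +oo[); last first.
    by apply/seteqP; split => -[u v] /=; rewrite in_itv/= andbT subr_ge0.
  rewrite -[X in measurable X]setTI.
  by apply: (measurable_funB measurable_fst measurable_snd) => //; exact: measurable_itv.
exists (\1_[set w : R * R | w.2 <= w.1]); first exact: measurable_indic.
split=> u v uv; rewrite indicE.
  by rewrite mem_set.
by rewrite memNset//=; apply/negP; rewrite -ltNge.
Qed.

Lemma integrable_mul_continuous f g a b : leb.-integrable `[a, b] (EFin \o f) ->
  continuous g -> leb.-integrable `[a, b] (EFin \o (fun x => f x * g x)).
Proof.
move=> If cg.
have [L [_ HL]] := compact_bounded (continuous_compact (continuous_subspaceT cg) (@segment_compact _ a b)).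
apply: (@integrable_real_le _ _ R leb _ (measurable_itv _) _ (fun x => (L + 1) * `|f x|)).
- apply: measurable_funM; first exact: integrable_real_measurable If.
  by apply: measurable_funTS; exact: continuous_measurable_fun.
- by apply: integrable_realZ => //; exact: integrable_norm If.
- move=> x Mx; rewrite normrM mulrC ler_wpM2r//.
  by apply: (HL (L + 1)); [rewrite ltrDl|exists x].
Qed.

(** G is merely integrable, so [prim G] has no pointwise derivative to which the product rule would
    apply. Fubini's theorem is used instead, for G(y) q'(x) on the triangle y <= x. *)
Lemma prim_ibp G q q' a b : a <= b -> loc_int G -> continuous q' ->
  (forall x : R, is_derive x 1 q (q' x)) ->
  \int[leb]_(x in `[a, b]) (G x * q x) =
  prim G b * q b - prim G a * q a - \int[leb]_(x in `[a, b]) (prim G x * q' x).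
Proof.
move=> ab lg cq' dq; have cq := der_continuousT dq.
have [chi mchi [chi1 chi0]] := measurable_below_diagonal.
have chi_le z : `|chi z| <= 1.
  case: z => u v; have [vu|uv] := leP v u; first by rewrite chi1 ?normr1.
  by rewrite chi0 ?normr0.
pose K (z : R * R) : R := (G z.2 * chi z) * q' z.1.
have mJ : measurable `[a, b]%classic by exact: measurable_itv.
have IG : leb.-integrable `[a, b] (EFin \o G) by exact: lg.
have Iq' : leb.-integrable `[a, b] (EFin \o q') by exact: continuous_loc_int.
have mG := integrable_real_measurable IG.
have IK : (leb \x leb)%E.-integrable (`[a, b] `*` `[a, b]) (EFin \o K).
  have mprod : measurable (`[a, b] `*` `[a, b] : set (R * R)) by exact: measurableX.
  apply: (@integrable_real_le _ _ R (leb \x leb)%E _ mprod _ _ _ (integrable_tensor mJ mJ (integrable_norm Iq') (integrable_norm IG))).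
    apply: measurable_funM; last first.
      apply: measurable_funTS; apply: measurableT_comp measurable_fst.
      exact: continuous_measurable_fun.
    by apply: measurable_funM; [exact: measurable_fun_snd|exact: measurable_funTS].
  move=> [x y] _ /=; rewrite /K /= !normrM mulrC ler_wpM2l// ler_piMr//.
have [_ _ _ _ EK] := RFubini mJ mJ IK.
have inner x : a <= x <= b -> \int[leb]_(y in `[a, b]) K (x, y) = (prim G x - prim G a) * q' x.
  move=> /andP[ax xb].
  have IGc : leb.-integrable `[a, b] (EFin \o (fun y => G y * chi (x, y))).
    apply: (@integrable_real_le _ _ R leb _ mJ _ _ _ (integrable_norm IG)).
      apply: measurable_funM => //; apply: measurable_funTS; apply: (measurableT_comp mchi).
      exact: pair1_measurable.
    by move=> y _ /=; rewrite normrM ler_piMr.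
  rewrite /K /= RintegralZr//; congr (_ * _).
  rewrite prim_sub// [RHS](@eqRint R _ (fun y => G y * chi (x, y))); last first.
    by move=> y; rewrite /= in_itv/= => /andP[_ yx]; rewrite chi1 ?mulr1.
  apply: Rintegral_supp => y /=; rewrite !in_itv/=.
    move=> /andP[h _] nh; have xy : x < y by rewrite ltNge; apply/negP => yx; apply: nh; rewrite h.
    by rewrite chi0 ?mulr0.
  by move=> /andP[h yx] nh; exfalso; apply: nh; rewrite h (le_trans yx xb).
have outer y : a <= y <= b -> \int[leb]_(x in `[a, b]) K (x, y) = G y * (q b - q y).
  move=> /andP[ay yb].
  rewrite (@eqRint R _ (fun x => G y * (chi (x, y) * q' x))); last by move=> x _; rewrite /K /= mulrA.
  have Ic : leb.-integrable `[a, b] (EFin \o (fun x => chi (x, y) * q' x)).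
    apply: (@integrable_real_le _ _ R leb _ mJ _ _ _ (integrable_norm Iq')).
      apply: measurable_funM; last exact: integrable_real_measurable Iq'.
      apply: measurable_funTS; apply: (measurableT_comp mchi).
      exact: pair2_measurable.
    by move=> x _ /=; rewrite normrM ler_piMl.
  rewrite RintegralZl//; congr (_ * _).
  rewrite -(FTC_segment cq' dq yb) [RHS](@eqRint R _ (fun x => chi (x, y) * q' x)); last first.
    by move=> x; rewrite /= in_itv/= => /andP[yx _]; rewrite chi1 ?mul1r.
  apply: Rintegral_supp => x /=; rewrite !in_itv/=.
    move=> /andP[_ h] nh; have xy : x < y by rewrite ltNge; apply/negP => yx; apply: nh; rewrite h yx.
    by rewrite chi0 ?mul0r.
  by move=> /andP[yx h] nh; exfalso; apply: nh; rewrite h (le_trans ay yx).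
have cpG := prim_continuous lg.
have i1 : leb.-integrable `[a, b] (EFin \o (fun x => prim G x * q' x)).
  by apply: continuous_loc_int; exact: contM.
have i2 : leb.-integrable `[a, b] (EFin \o (fun x => G x * q x)) by exact: integrable_mul_continuous.
move: EK; rewrite [LHS](@eqRint R _ (fun x => prim G x * q' x - prim G a * q' x)); last first.
  by move=> x; rewrite /= in_itv/= => h; rewrite inner// mulrBl.
rewrite [RHS](@eqRint R _ (fun y => q b * G y - G y * q y)); last first.
  by move=> y; rewrite /= in_itv/= => h; rewrite outer// mulrBr mulrC.
rewrite RintegralB//; last by apply: integrable_realZ.
rewrite RintegralB//; last by apply: integrable_realZ.
rewrite !RintegralZl// (FTC_segment cq' dq ab) -(prim_sub ab lg).
set A := \int[leb]_(x in _) _; set B := \int[leb]_(x in _) _; move=> h.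
have -> : B = q b * (prim G b - prim G a) - (A - prim G a * (q b - q a)) by rewrite h; ring.
by ring.
Qed.

Lemma prim_by_parts I phi g : open I -> test_fun I phi -> loc_int (g \_ I) ->
  \int[leb]_(x in I) (prim (g \_ I) x * derive1 phi x) =
  - \int[leb]_(x in I) (g x * phi x).
Proof.
move=> oI tp lg; have mI : measurable I by exact: open_measurable.
have [M0 M00 HM0] := test_bounded_supp tp.
pose M := M0 + 1.
have HM x : ~ (- M <= x <= M) -> phi x = 0.
  by move=> nx; apply: HM0 => /andP[h1 h2]; apply: nx; rewrite /M; lra.
have HM' x : ~ (- M < x < M) -> phi x = 0.
  by move=> nx; apply: HM0 => /andP[h1 h2]; apply: nx; rewrite /M; lra.
have MM : - M <= M by rewrite /M; lra.
have pM : phi M = 0 by apply: HM'; rewrite ltxx andbF.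
have pNM : phi (- M) = 0 by apply: HM'; rewrite ltxx.
have HM1 x : ~ (- M <= x <= M) -> derive1 phi x = 0 by exact: derive1_out tp HM.
have eG : \int[leb]_(x in I) (g x * phi x) = \int[leb]_(x in `[- M, M]) ((g \_ I) x * phi x).
  rewrite -(Rintegral_test _ mI tp HM); apply: eqRint => x xI.
  by rewrite patchE mem_set.
rewrite eG (Rintegral_test _ mI (test_derive1 tp) HM1).
rewrite (prim_ibp MM lg (test_continuous (test_derive1 tp)) (fun x => test_is_derive x tp)).
by rewrite pM pNM !mulr0 subr0 sub0r opprK.
Qed.

(** The difference q = f - F is orthogonal to all derivatives of test functions, and
    [test_decompose] leaves only the component of a test function along chi, where q acts like the
    constant c. *)
Lemma wderiv1_const I f F g : is_interval I -> I !=set0 ->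
  is_wderiv 1 I f g -> is_wderiv 1 I F g ->
  exists C, {ae leb, forall x : R, I x -> f x = C + F x}.
Proof.
move=> iI I0 [lf _ Hf] [lF _ HF].
have [_ oI _] := lf; have mI : measurable I by exact: open_measurable.
have [chi tchi dec] := test_decompose oI iI I0.
pose q x := f x - F x.
have lq : locally_integrable I q by exact: locally_integrableB.
have q0 phi : test_fun I phi -> \int[leb]_(x in I) (q x * derive1 phi x) = 0.
  move=> tp; have tp' := test_derive1 tp.
  rewrite (@eqRint R _ (fun x => f x * derive1 phi x - F x * derive1 phi x)); last first.
    by move=> x _; rewrite /q mulrBl.
  rewrite RintegralB//; [|exact: integrable_test|exact: integrable_test].
  by rewrite (Hf phi tp) (HF phi tp) subrr.
pose c := \int[leb]_(x in I) (q x * chi x).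
have lqc : locally_integrable I (fun x => q x - c).
  by apply: locally_integrableB => //; apply: continuous_locally_integrable => //; exact: cont_cst.
exists c; apply: ae_imp (fundamental_lemma lqc _) _; last first.
  by move=> x H Ix; have := H Ix; rewrite /q; lra.
move=> psi tpsi; have [phi tphi dphi] := dec psi tpsi.
set k := \int[leb]_(t in I) psi t in dphi.
have tk := testZ k tchi; have tphi' := test_derive1 tphi.
have Ipsi : leb.-integrable I (EFin \o psi).
  have := integrable_test (continuous_locally_integrable oI (@cont_cst R 1)) tpsi.
  by under [X in _.-integrable _ (EFin \o X)]eq_fun do rewrite mul1r.
rewrite (@eqRint R _ (fun x => q x * psi x - c * psi x)); last by move=> x _; rewrite mulrBl.
rewrite RintegralB//; [|exact: integrable_test|exact: integrable_realZ].
rewrite RintegralZl// -/k.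
rewrite (@eqRint R _ (fun x => k * (q x * chi x) + q x * derive1 phi x)); last first.
  by move=> x _; rewrite dphi; ring.
rewrite RintegralD//; [|by apply: integrable_realZ => //; exact: integrable_test|exact: integrable_test].
rewrite RintegralZl ?q0//; last exact: integrable_test.
by rewrite -/c; ring.
Qed.

Lemma prim_wderiv I g : open I -> locally_integrable I g -> loc_int (g \_ I) ->
  is_wderiv 1 I (prim (g \_ I)) g.
Proof.
move=> oI lg lg'; split => //.
  by apply: continuous_locally_integrable => //; exact: prim_continuous.
by move=> phi tp; rewrite /derive1n/= (prim_by_parts oI tp lg') expr1 mulN1r.
Qed.

Lemma wderiv2_wderiv1 I f g : is_interval I -> I !=set0 ->
  is_wderiv 2 I f g -> loc_int (g \_ I) ->
  exists B, is_wderiv 1 I f (fun x => B + prim (g \_ I) x).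
Proof.
move=> iI I0 [lf lg Hf] lg'.
have [_ oI _] := lf; have mI : measurable I by exact: open_measurable.
have [chi tchi dec] := test_decompose oI iI I0.
pose G := prim (g \_ I); have cG : continuous G by exact: prim_continuous.
have lG : locally_integrable I G by exact: continuous_locally_integrable.
pose a := \int[leb]_(x in I) (f x * derive1 chi x).
pose b := \int[leb]_(x in I) (G x * chi x).
(* The constant is forced by testing against chi, whose integral is 1: - a must equal the constant
   plus b. *)
exists (- a - b); split => //.
  by apply: continuous_locally_integrable => //; apply: contD => //; exact: cont_cst.
move=> psi tpsi; have [phi tphi dphi] := dec psi tpsi.
rewrite expr1 mulN1r /derive1n/=.
set k := \int[leb]_(t in I) psi t in dphi.
have tphi' := test_derive1 tphi; have tphi'' := test_derive1 tphi'.
have tchi' := test_derive1 tchi.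
have Ipsi : leb.-integrable I (EFin \o psi).
  have := integrable_test (continuous_locally_integrable oI (@cont_cst R 1)) tpsi.
  by under [X in _.-integrable _ (EFin \o X)]eq_fun do rewrite mul1r.
have dpsi x : derive1 psi x = k * derive1 chi x + derive1 (derive1 phi) x.
  rewrite (_ : psi = fun x => k * chi x + derive1 phi x); last exact/funext.
  by rewrite (derive1_is (fun x => derD (derZ k (test_is_derive x tchi)) (test_is_derive x tphi'))).
rewrite (@eqRint R _ (fun x => k * (f x * derive1 chi x) + f x * derive1 (derive1 phi) x)); last first.
  by move=> x _; rewrite dpsi; ring.
rewrite RintegralD//; [|by apply: integrable_realZ => //; exact: integrable_test|exact: integrable_test].
rewrite RintegralZl//; last exact: integrable_test.
have := Hf phi tphi; rewrite expr2 mulrNN mul1r mul1r /derive1n /= => ->.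
have e1 := prim_by_parts oI tphi lg'.
rewrite -/G in e1.
have e2 : \int[leb]_(x in I) (G x * psi x) = k * b - \int[leb]_(x in I) (g x * phi x).
  rewrite (@eqRint R _ (fun x => k * (G x * chi x) + G x * derive1 phi x)); last first.
    by move=> x _; rewrite dphi; ring.
  rewrite RintegralD//; [|by apply: integrable_realZ => //; exact: integrable_test|exact: integrable_test].
  by rewrite RintegralZl// ?e1//; exact: integrable_test.
rewrite -/a [X in _ = - X](@eqRint R _ (fun x => (- a - b) * psi x + G x * psi x)); last first.
  by move=> x _; rewrite mulrDl.
rewrite RintegralD//; [|exact: integrable_realZ|exact: integrable_test].
by rewrite RintegralZl// e2 -/k; ring.
Qed.

End primitives_of_integrable_functions.

(** * The delay equation at the interface *)

Section fixed_point.
Context {R : realType}.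
Implicit Types (X Y : R -> R) (t C M N lam : R).

(** The intervals [u n - r n, u n + r n], with r n = 2 C 2^(-n), are nested. The supremum of their
    left ends lies in all of them, which gives a limit together with an explicit error. *)
Lemma geometric_limit (u : nat -> R) C : 0 <= C ->
  (forall n, `|u n.+1 - u n| <= C * 2^-1 ^+ n) ->
  exists l, forall n, `|l - u n| <= 2 * C * 2^-1 ^+ n.
Proof.
move=> C0 H.
pose r n : R := 2 * C * 2^-1 ^+ n.
have r0 n : 0 <= r n by rewrite !mulr_ge0// exprn_ge0// invr_ge0.
have rS n : r n = 2 * r n.+1.
  by rewrite /r exprS; field.
have rE n : C * 2^-1 ^+ n = r n.+1 by rewrite /r exprS; field.
have Hu n : u n - r n <= u n.+1 - r n.+1 /\ u n.+1 + r n.+1 <= u n + r n.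
  have := H n; rewrite rE ler_norml => /andP[h1 h2].
  by have := rS n; have := r0 n.+1; split; lra.
have mon n k : u n - r n <= u (n + k)%N - r (n + k)%N /\
    u (n + k)%N + r (n + k)%N <= u n + r n.
  elim: k => [|k [IH1 IH2]]; first by rewrite addn0.
  by rewrite addnS; have [h1 h2] := Hu (n + k)%N; split; [exact: le_trans IH1 h1|exact: le_trans h2 IH2].
have cross m n : u m - r m <= u n + r n.
  have [h1 _] := mon m n; have [_ h2] := mon n m; rewrite addnC in h2.
  by apply: (le_trans h1); apply: le_trans h2; have := r0 (m + n)%N; lra.
pose S := [set u n - r n | n in setT].
have hS : has_sup S.
  split; first by exists (u 0%N - r 0%N); exists 0%N.
  by exists (u 0%N + r 0%N) => _ [n _ <-]; exact: cross.
exists (sup S) => n; rewrite ler_norml; apply/andP; split.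
- have : u n - r n <= sup S by apply: sup_upper_bound => //; exists n.
  rewrite -/(r n); lra.
- have : sup S <= u n + r n.
    by apply: ge_sup => [|_ [m _ <-]]; [exact: hS.1|exact: cross].
  rewrite -/(r n); lra.
Qed.

Lemma half_pow_small (e K : R) : 0 < e -> exists n, K * 2^-1 ^+ n <= e.
Proof.
move=> e0.
have [n Hn] : exists n : nat, K / e < n%:R.
  exists (Num.bound `|K / e|); apply: (@le_lt_trans _ _ `|K / e|); first exact: ler_norm.
  exact: archi_boundP.
exists n; rewrite exprVn ler_pdivrMr ?exprn_gt0//.
have h : n%:R <= 2 ^+ n :> R by rewrite -natrX ler_nat ltnW// ltn_expl.
apply: (@le_trans _ _ (e * n%:R)); last by rewrite ler_wpM2l// ltW.
by rewrite mulrC -ler_pdivrMr// ltW.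
Qed.

Lemma continuous_bounded_segment (f : R -> R) a b : continuous f ->
  exists2 M, 0 <= M & forall t, a <= t <= b -> `|f t| <= M.
Proof.
move=> cf.
have [L [_ HL]] := compact_bounded (continuous_compact (continuous_subspaceT cf) (@segment_compact _ a b)).
exists (`|L| + 1); first by rewrite addr_ge0.
move=> t ht; apply: (HL (`|L| + 1)); first by rewrite (le_lt_trans (ler_norm _))// ltrDl.
by exists t.
Qed.

(** Picard iteration without a function space. On each window [0, N] the distance weighted by e^(-
    lam t) is halved, while the first increment [M N] may grow with N, so there is no global norm.
    The limit is taken point by point, and the explicit error on each window gives its continuity
    and the fixed-point equation. *)
Lemma causal_fixed_point (X0 : R -> R) (T : (R -> R) -> R -> R) lam :
  0 < lam -> continuous X0 ->
  (forall X, continuous X -> continuous (T X)) ->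
  (forall X t, t <= 0 -> T X t = X0 t) ->
  (forall X Y M N, continuous X -> continuous Y ->
     (forall t, t <= 0 -> X t = Y t) -> 0 <= M ->
     (forall t, 0 <= t <= N -> `|X t - Y t| <= M * expR (lam * t)) ->
     forall t, 0 <= t <= N -> `|T X t - T Y t| <= M / 2 * expR (lam * t)) ->
  exists X, [/\ continuous X, forall t, t <= 0 -> X t = X0 t &
                forall t, T X t = X t].
Proof.
move=> lam0 cX0 cT T0 contr.
pose u n := iter n T X0.
have cu n : continuous (u n) by elim: n => [//|n IH]; exact: cT.
have u0 n t : t <= 0 -> u n t = X0 t by case: n => [//|n]; exact: T0.
have exM N : exists m : R, 0 <= m /\ forall t, 0 <= t <= N -> `|u 1%N t - u 0%N t| <= m.
  by have [m m0 Hm] := continuous_bounded_segment 0 N (contB (cu 1%N) (cu 0%N)); exists m.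
pose M N := sval (cid (exM N)).
have HM N : 0 <= M N /\ forall t, 0 <= t <= N -> `|u 1%N t - u 0%N t| <= M N.
  exact: svalP (cid (exM N)).
have M0 N : 0 <= M N by have [] := HM N.
have step N n t : 0 <= t <= N ->
    `|u n.+1 t - u n t| <= M N * 2^-1 ^+ n * expR (lam * t).
  elim: n t => [|n IH] t ht.
    rewrite expr0 mulr1; apply: (le_trans ((HM N).2 t ht)).
    rewrite ler_peMr//; have /andP[t0 _] := ht.
    by rewrite -expR0 ler_expR mulr_ge0// ltW.
  have -> : M N * 2^-1 ^+ n.+1 = (M N * 2^-1 ^+ n) / 2 by rewrite exprSr; ring.
  apply: (contr (u n.+1) (u n) _ N) => //.
  - by move=> s s0; rewrite !u0.
  - by rewrite mulr_ge0// exprn_ge0// invr_ge0.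
have exX t : exists x : R, (t <= 0 -> x = X0 t) /\
    (forall N n, 0 <= t <= N -> `|x - u n t| <= 2 * M N * 2^-1 ^+ n * expR (lam * t)).
  have [t0|t0] := leP t 0.
    exists (X0 t); split => // N n _.
    by rewrite u0// subrr normr0 !mulr_ge0 ?expR_ge0// exprn_ge0// invr_ge0.
  have [||l Hl] := @geometric_limit (fun n => u n t) (M t * expR (lam * t)).
    - by rewrite mulr_ge0 ?expR_ge0.
    - move=> n; rewrite mulrAC; apply: step; by rewrite (ltW t0) lexx.
  exists l; split => [|N n /andP[_ tN]]; first by [].
  have [||l' Hl'] := @geometric_limit (fun n => u n t) (M N * expR (lam * t)).
    - by rewrite mulr_ge0 ?expR_ge0.
    - move=> k; rewrite mulrAC; apply: step; by rewrite (ltW t0) tN.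
  (* The limit must not depend on the window used to estimate it: [exX] asks for the error bound in
     all windows at once. *)
  have -> : l = l'.
    apply/eqP; rewrite -subr_eq0 -normr_eq0 eq_le normr_ge0 andbT.
    rewrite leNgt; apply/negP => pos.
    pose K := 2 * (M t * expR (lam * t)) + 2 * (M N * expR (lam * t)).
    have [k Hk] := half_pow_small K (divr_gt0 pos (ltr0n _ 2)).
    have := Hl k; have := Hl' k => h1 h2.
    have : `|l - l'| <= K * 2^-1 ^+ k.
      have -> : l - l' = (l - u k t) - (l' - u k t) by ring.
      apply: (le_trans (ler_normB _ _)); rewrite /K mulrDl; exact: lerD.
    move: pos Hk; lra.
  by have := Hl' n; rewrite !mulrA mulrAC -!mulrA [_ * expR _]mulrC.
pose X t := sval (cid (exX t)).
have HX t : (t <= 0 -> X t = X0 t) /\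
    (forall N n, 0 <= t <= N -> `|X t - u n t| <= 2 * M N * 2^-1 ^+ n * expR (lam * t)).
  exact: svalP (cid (exX t)).
have X_neg t : t <= 0 -> X t = X0 t by have [] := HX t.
have X_pos t N n : 0 <= t <= N -> `|X t - u n t| <= 2 * M N * 2^-1 ^+ n * expR (lam * t).
  by have [_] := HX t; apply.
have cX : continuous X.
  move=> t; apply/cvgrPdist_le => /= e e0.
  pose N := `|t| + 1; pose K := 2 * M N * expR (lam * N).
  have K0 : 0 <= K by rewrite !mulr_ge0 ?expR_ge0.
  have e3 : 0 < e / 3 by rewrite divr_gt0.
  have [n Hn] := half_pow_small K e3.
  have close s : s <= N -> `|X s - u n s| <= e / 3.
    move=> sN; have [s0|s0] := leP s 0.
      by rewrite X_neg// u0// subrr normr0 ltW.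
    apply: le_trans Hn; apply: (le_trans (X_pos s N n _)); first by rewrite (ltW s0).
    rewrite /K mulrAC ler_wpM2r ?exprn_ge0 ?invr_ge0//.
    by rewrite ler_wpM2l ?mulr_ge0// ler_expR ler_wpM2l// ltW.
  have tN : t < N by rewrite /N (le_lt_trans (ler_norm _))// ltrDl.
  have cun : \forall y \near t, `|u n t - u n y| <= e / 3.
    by have /cvgrPdist_le/(_ _ e3) := cu n t.
  near=> y.
  have -> : X t - X y = (X t - u n t) + (u n t - u n y) - (X y - u n y) by ring.
  apply: (le_trans (ler_normB _ _)); rewrite (_ : e = e / 3 + e / 3 + e / 3); last by field.
  apply: lerD; last by apply: close; near: y; apply: near_le; exact: tN.
  apply: (le_trans (ler_normD _ _)); apply: lerD; first by apply: close; exact: ltW.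
  by near: y.
exists X; split => // t.
have [t0|t0] := leP t 0; first by rewrite T0// X_neg.
apply/eqP; rewrite -subr_eq0 -normr_eq0 eq_le normr_ge0 andbT leNgt; apply/negP => pos.
pose K := 2 * M t * expR (lam * t).
have [n Hn] := half_pow_small K (divr_gt0 pos (ltr0n _ 2)).
have ht : 0 <= t <= t by rewrite (ltW t0) lexx.
have h1 := X_pos t t n.+1 ht.
have h2 : `|T X t - u n.+1 t| <= 2 * M t * 2^-1 ^+ n / 2 * expR (lam * t).
  apply: (contr X (u n) _ t) => //.
  - by move=> s s0; rewrite X_neg// u0.
  - by rewrite !mulr_ge0// exprn_ge0// invr_ge0.
  - by move=> s hs; exact: X_pos.
have : `|T X t - X t| <= K * 2^-1 ^+ n.
  have -> : T X t - X t = (T X t - u n.+1 t) - (X t - u n.+1 t) by ring.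
  apply: (le_trans (ler_normB _ _)); apply: (le_trans (lerD h2 h1)).
  rewrite exprSr /K; set A := expR _; set B := _ ^+ n; rewrite le_eqVlt; apply/orP; left; apply/eqP.
  by field.
move: pos Hn; lra.
Unshelve. all: by end_near. Qed.

End fixed_point.

(** * The equation for the highest derivative of the gas wave *)

Section top_level_system.
Context {R : realType}.
Implicit Types (X Y f g : R -> R) (t C M N lam : R).

(** Integration gains a factor 1/lam in the exponentially weighted norm; this makes the integral
    terms contractive for large lam. *)
Lemma prim_diff_bound f g M N lam : continuous f -> continuous g -> 0 < lam ->
  (forall t, 0 <= t <= N -> `|f t - g t| <= M * expR (lam * t)) ->
  0 <= M -> forall t, 0 <= t <= N -> `|prim f t - prim g t| <= M / lam * expR (lam * t).
Proof.
move=> cf cg lam0 H M0 t /andP[t0 tN].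
have dE (x : R) : is_derive x 1 (fun s => M / lam * expR (lam * s)) (M * expR (lam * x)).
  have := derZ (M / lam) (der_comp_affine (k := lam) (m := 0) (is_derive_expR (lam * x + 0))).
  have -> : M / lam * (lam * expR (lam * x + 0)) = M * expR (lam * x).
    by rewrite addr0; field; rewrite gt_eqF.
  by under [X in is_derive _ _ X]eq_fun do rewrite addr0.
have Q0 : 0 <= M / lam * expR (lam * 0) by rewrite mulr_ge0 ?expR_ge0// divr_ge0// ltW.
have bnd (p q : R -> R) : continuous p -> continuous q ->
    (forall x, 0 <= x <= t -> p x - q x <= M * expR (lam * x)) ->
    prim p t - prim q t <= M / lam * expR (lam * t).
  move=> cp cq Hpq.
  have d x := derB (prim_is_deriveT cp x) (prim_is_deriveT cq x).
  by apply: (der_ge0_le d dE _ Hpq t0); rewrite !prim0 subrr.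
have Hle x : 0 <= x <= t -> `|f x - g x| <= M * expR (lam * x).
  by move=> /andP[x0 xt]; apply: H; rewrite x0 (le_trans xt).
rewrite ler_norml; apply/andP; split.
- rewrite -lerN2 opprK opprB; apply: bnd => // x hx.
  by apply: le_trans (Hle x hx); rewrite -normrN opprB; exact: ler_norm.
- by apply: bnd => // x hx; apply: le_trans (Hle x hx); exact: ler_norm.
Qed.

Variables (T q tau s k1 u0 e1 e0 : R) (X0 H : R -> R).
Hypotheses (T0 : 0 < T) (q0 : 0 < q) (tau0 : 0 < tau).
Hypotheses (cX0 : continuous X0) (cH : continuous H).

Let delay X : R -> R := fun t => X (1 * t + - (2 * T)).

(** X(t) stands for the derivative of order M + 1 of F at t + T, so [delay X] is the same derivative
    at t - T. Then [top_u] is the gas trace at order M, [top_w] and [top_e] are the derivatives of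
    eta of orders M + 1 and M, obtained by integrating the gas flux condition, and [top_form] is the
    liquid flux condition solved for X, with q = rho_l / rho_g and k1 = 1 / (rho_g R0^2). *)
Definition top_u X : R -> R := fun t => u0 + prim (fun t => X t - delay X t) t.
Definition top_w X : R -> R :=
  fun t => e1 - k1 * prim (fun t => T * (X t + delay X t) - top_u X t) t.
Definition top_e X : R -> R := fun t => e0 + prim (top_w X) t.
Definition top_form X : R -> R := fun t => (tau + T * q)^-1 *
  ((tau - T * q) * delay X t + (q - 1) * top_u X t
   - s * (tau * top_w X t + top_e X t) + 2 * tau * H t).

Let cont_prim f : continuous f -> continuous (prim f).
Proof. by move=> cf; apply: prim_continuous; exact: continuous_loc_int. Qed.

Let cdelay X : continuous X -> continuous (delay X).
Proof. exact: cont_affine. Qed.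

Lemma top_u0 X : top_u X 0 = u0.
Proof. by rewrite /top_u prim0 addr0. Qed.

Lemma top_w0 X : top_w X 0 = e1.
Proof. by rewrite /top_w prim0 mulr0 subr0. Qed.

Lemma top_e0 X : top_e X 0 = e0.
Proof. by rewrite /top_e prim0 addr0. Qed.

Lemma top_u_cont X : continuous X -> continuous (top_u X).
Proof.
move=> cX; apply: contD; first exact: cont_cst.
by apply: cont_prim; apply: contB => //; exact: cdelay.
Qed.

Lemma top_w_cont X : continuous X -> continuous (top_w X).
Proof.
move=> cX; apply: contB; first exact: cont_cst.
apply: contZ; apply: cont_prim; apply: contB; last exact: top_u_cont.
by apply: contZ; apply: contD => //; exact: cdelay.
Qed.

Lemma top_e_cont X : continuous X -> continuous (top_e X).
Proof.
by move=> cX; apply: contD; [exact: cont_cst|apply: cont_prim; exact: top_w_cont].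
Qed.

Lemma top_form_cont X : continuous X -> continuous (top_form X).
Proof.
move=> cX; apply: contZ; apply: contD; last exact: contZ.
apply: contB; last by apply: contZ; apply: contD; [apply: contZ; exact: top_w_cont|exact: top_e_cont].
by apply: contD; apply: contZ; [exact: cdelay|exact: top_u_cont].
Qed.

(** Every term of [top_form] is Lipschitz with a constant of order 1/lam: the integral terms by
    [prim_diff_bound], the delayed one because e^(- 2 T lam) <= 1/(2 T lam). K collects these
    constants, and lam = 1 + 2 K brings K/lam below 1/2. *)
Lemma top_contraction : exists2 lam, 0 < lam &
  forall X Y M N, continuous X -> continuous Y ->
     (forall t, t <= 0 -> X t = Y t) -> 0 <= M ->
     (forall t, 0 <= t <= N -> `|X t - Y t| <= M * expR (lam * t)) ->
     forall t, 0 <= t <= N -> `|top_form X t - top_form Y t| <= M / 2 * expR (lam * t).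
Proof.
pose a := tau + T * q; have a0 : 0 < a by rewrite addr_gt0// mulr_gt0.
pose K := a^-1 * (`|tau - T * q| / (2 * T) + `|q - 1| * 2 + `|s| * (tau + 1) * (`|k1| * (2 * T + 2))).
have K0 : 0 <= K.
  by rewrite mulr_ge0 ?invr_ge0 ?(ltW a0)// !addr_ge0// ?mulr_ge0// ?invr_ge0 ?mulr_ge0// ?addr_ge0// ?mulr_ge0// ltW.
pose lam := 1 + 2 * K.
have lam1 : 1 <= lam by rewrite /lam lerDl mulr_ge0.
have lam0 : 0 < lam by exact: lt_le_trans lam1.
exists lam => // X Y M N cX cY XY0 M0 HM t ht.
have E0 x : 0 <= expR (lam * x) by exact: expR_ge0.
have cdX := cdelay cX; have cdY := cdelay cY.
have dly x : 0 <= x <= N -> `|delay X x - delay Y x| <= M / (2 * T * lam) * expR (lam * x).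
  move=> /andP[x0 xN]; rewrite /delay mul1r.
  have [h|h] := leP (x + - (2 * T)) 0.
    by rewrite XY0// subrr normr0 mulr_ge0// divr_ge0// !mulr_ge0// ltW.
  apply: (le_trans (HM _ _)).
    by rewrite (ltW h)/= (le_trans _ xN)// gerDl oppr_le0 mulr_ge0// ltW.
  rewrite mulrDr expRD [expR (lam * x) * _]mulrC mulrA ler_wpM2r// ler_wpM2l//.
  rewrite mulrN expRN lef_pV2 ?posrE ?expR_gt0 ?mulr_gt0//.
  by rewrite mulrC (le_trans _ (expR_ge1Dx _))// lerDr.
have dly1 x : 0 <= x <= N -> `|delay X x - delay Y x| <= M * expR (lam * x).
  move=> /andP[x0 xN]; rewrite /delay mul1r.
  have [h|h] := leP (x + - (2 * T)) 0.
    by rewrite XY0// subrr normr0 mulr_ge0.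
  apply: (le_trans (HM _ _)).
    by rewrite (ltW h)/= (le_trans _ xN)// gerDl oppr_le0 mulr_ge0// ltW.
  by rewrite ler_wpM2l// ler_expR ler_wpM2l ?(ltW lam0)// gerDl oppr_le0 mulr_ge0// ltW.
have bu x : 0 <= x <= N -> `|top_u X x - top_u Y x| <= 2 * M / lam * expR (lam * x).
  move=> hx; rewrite /top_u opprD addrACA subrr add0r.
  apply: (@prim_diff_bound _ _ _ N) => //; try exact: contB.
  - move=> y hy; rewrite (_ : _ - _ = (X y - Y y) - (delay X y - delay Y y)); last by ring.
    apply: (le_trans (ler_normB _ _)); rewrite -mulrA mulr_natl mulr2n.
    by apply: lerD; [exact: HM|exact: dly1].
  - by rewrite mulr_ge0.
have bu1 x : 0 <= x <= N -> `|top_u X x - top_u Y x| <= 2 * M * expR (lam * x).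
  move=> hx; apply: (le_trans (bu x hx)); rewrite ler_wpM2r//.
  by rewrite ler_pdivrMr// ler_peMr// mulr_ge0.
have bw x : 0 <= x <= N -> `|top_w X x - top_w Y x| <= `|k1| * ((2 * T + 2) * M / lam * expR (lam * x)).
  move=> hx; rewrite /top_w.
  rewrite (_ : forall p r : R, e1 - k1 * p - (e1 - k1 * r) = k1 * (r - p)); last by move=> p r; ring.
  rewrite normrM ler_wpM2l// distrC.
  apply: (@prim_diff_bound _ _ _ N) => //.
  - by apply: contB; [apply: contZ; exact: contD|exact: top_u_cont].
  - by apply: contB; [apply: contZ; exact: contD|exact: top_u_cont].
  - move=> y hy.
    rewrite (_ : _ - _ = T * ((X y - Y y) + (delay X y - delay Y y)) - (top_u X y - top_u Y y)); last by ring.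
    apply: (le_trans (ler_normB _ _)).
    rewrite (_ : _ * M * _ = T * (M * expR (lam * y) + M * expR (lam * y)) + 2 * M * expR (lam * y)); last by ring.
    apply: lerD; last exact: bu1.
    rewrite normrM gtr0_norm// ler_wpM2l ?(ltW T0)// (le_trans (ler_normD _ _))//.
    by apply: lerD; [exact: HM|exact: dly1].
  - by rewrite mulr_ge0// addr_ge0// mulr_ge0// ltW.
have be x : 0 <= x <= N -> `|top_e X x - top_e Y x| <= `|k1| * ((2 * T + 2) * M / lam) * expR (lam * x).
  move=> hx; rewrite /top_e opprD addrACA subrr add0r.
  apply: (@le_trans _ _ (`|k1| * ((2 * T + 2) * M / lam) / lam * expR (lam * x))).
    apply: (@prim_diff_bound _ _ _ N) => //; try exact: top_w_cont.
    - by move=> y hy; rewrite -[X in _ <= X]mulrA; exact: bw.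
    - by rewrite mulr_ge0// !mulr_ge0 ?invr_ge0 ?(ltW lam0)// addr_ge0// mulr_ge0// ltW.
  rewrite ler_wpM2r// ler_pdivrMr// ler_peMr// mulr_ge0// !mulr_ge0 ?invr_ge0 ?(ltW lam0)//.
  by rewrite addr_ge0// mulr_ge0// ltW.
rewrite /top_form -mulrBr -/a normrM gtr0_norm ?invr_gt0//.
rewrite mulrC ler_pdivrMr//.
have alg (A B h dX dY uX uY wX wY eX eY : R) :
    A * dX + B * uX - s * (tau * wX + eX) + h - (A * dY + B * uY - s * (tau * wY + eY) + h) =
    A * (dX - dY) + B * (uX - uY) - s * (tau * (wX - wY) + (eX - eY)) by ring.
rewrite alg.
have S1 := dly t ht; have S2 := bu t ht; have S3 := bw t ht; have S4 := be t ht.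
set E := expR (lam * t) in S1 S2 S3 S4 *.
apply: (@le_trans _ _ (`|tau - T * q| * (M / (2 * T * lam) * E) + `|q - 1| * (2 * M / lam * E)
  + `|s| * (tau * (`|k1| * ((2 * T + 2) * M / lam * E)) + `|k1| * ((2 * T + 2) * M / lam) * E))).
  apply: (le_trans (ler_normB _ _)); apply: lerD.
    apply: (le_trans (ler_normD _ _)); rewrite !normrM.
    by apply: lerD; rewrite ler_wpM2l.
  rewrite normrM ler_wpM2l// (le_trans (ler_normD _ _))// normrM gtr0_norm//.
  by apply: lerD => //; rewrite ler_wpM2l// ltW.
rewrite [X in X <= _](_ : _ = (a * K) * (M * E / lam)); last first.
  rewrite /K; field; do ?[apply/andP; split]; rewrite gt_eqF//.
rewrite (_ : M / 2 * E * a = a * ((lam / 2) * (M * E / lam))); last first.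
  by field; rewrite gt_eqF.
rewrite -mulrA ler_wpM2l ?(ltW a0)// ler_wpM2r//.
  by rewrite divr_ge0 ?mulr_ge0// ?expR_ge0// ltW.
by rewrite /lam; have := K0; lra.
Qed.

Lemma top_solution : X0 0 = top_form X0 0 ->
  exists X, [/\ continuous X, forall t, t <= 0 -> X t = X0 t &
    forall t, 0 <= t -> X t = top_form X t].
Proof.
move=> compat.
have d0 : 1 * 0 + - (2 * T) <= 0 by rewrite mulr0 add0r oppr_le0 mulr_ge0// ltW.
have form0 X Y : (forall t, t <= 0 -> X t = Y t) -> top_form X 0 = top_form Y 0.
  move=> XY; have dXY : delay X 0 = delay Y 0 by exact: XY d0.
  by rewrite /top_form !top_u0 !top_w0 !top_e0 dXY.
(* Clamping at 0 pastes the prescribed history to the equation. Subtracting the value at 0 makes the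
   result continuous for every X; compatibility is what cancels this term at the end. *)
pose S X t := X0 (Num.min t 0) + top_form X (Num.max t 0) - top_form X 0.
have [lam lam0 contr] := top_contraction.
have cmin : continuous (fun t : R => Num.min t 0).
  by move=> t; apply: (@continuous_min _ R); [exact: cvg_id|exact: cst_continuous].
have cmax : continuous (fun t : R => Num.max t 0).
  by move=> t; apply: (@continuous_max _ R); [exact: cvg_id|exact: cst_continuous].
have [|||X [cX Xneg XS]] := @causal_fixed_point _ X0 S lam lam0 cX0.
- move=> X cX; apply: contB; last exact: cont_cst.
  by apply: contD; [exact: (cont_comp cX0 cmin)|exact: (cont_comp (top_form_cont cX) cmax)].
- by move=> X t t0; rewrite /S min_l// max_r// addrK.
- move=> X Y M N cX cY XY M0 HM t ht; have /andP[t0 _] := ht.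
  rewrite /S max_l// (form0 X Y)//.
  have alg (p r x y : R) : p + x - r - (p + y - r) = x - y by ring.
  by rewrite alg; exact: contr ht.
exists X; split => // t t0; rewrite -[LHS]XS /S min_r// max_l// (form0 X X0)//.
by rewrite -compat addrC addKr.
Qed.

End top_level_system.

(** * Energy estimate *)

Section energy.
Context {R : realType}.
Implicit Types (f g : R -> R) (t a b : R).

(** The integral of (f' - l)^2 is nonnegative; l is the mean slope of f. *)
Lemma cauchy_schwarz_prim f f' a b : continuous f' -> (forall t : R, is_derive t 1 f (f' t)) ->
  a <= b -> (f b - f a) ^+ 2 <= (b - a) * (prim (fun t => f' t ^+ 2) b - prim (fun t => f' t ^+ 2) a).
Proof.
move=> cf' Hf; rewrite le_eqVlt => /predU1P[->|ab].
  by rewrite !subrr mul0r expr0n.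
set S := prim _.
have ba : 0 < b - a by rewrite subr_gt0.
pose l := (f b - f a) / (b - a).
have HS t : is_derive t 1 S (f' t ^+ 2) by apply: prim_is_deriveT; exact: cont_sq.
have d t : is_derive t 1 (fun t => S t - 2 * l * f t + (l ^+ 2 * t + 0)) ((f' t - l) ^+ 2).
  apply: der_eq (derD (derB (HS t) (derZ (2 * l) (Hf t))) (der_affine t (l ^+ 2) 0)) _.
  by ring.
have := der_nondecreasing d (fun x _ => sqr_ge0 _) (lexx a) (ltW ab).
have lE : l * (b - a) = f b - f a by rewrite /l divfK// gt_eqF.
move=> h.
have h2 : 0 <= (S b - S a) - 2 * l * (f b - f a) + l ^+ 2 * (b - a) by move: h; lra.
have h3 := mulr_ge0 (ltW ba) h2.
rewrite -subr_ge0 (_ : _ - _ = (b - a) * (S b - S a - 2 * l * (f b - f a) + l ^+ 2 * (b - a)))//.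
rewrite -lE; ring.
Qed.

Variables (T R0 cg rg rl tau sg K kap A : R).
Variables (f f' e e' e'' h : R -> R).
Hypotheses (cg0 : 0 < cg) (R00 : 0 < R0) (rg0 : 0 < rg) (rl0 : 0 < rl)
  (tau0 : 0 < tau) (sg0 : 0 < sg) (K0 : 0 < K) (TE : T = R0 / cg).
Hypotheses (kap2 : 2 <= kap)
  (kapE : (sg + K) ^+ 2 * (5 * tau + 1) <= kap * K * (rl * R0 ^+ 3)).
Hypotheses (df : forall t : R, is_derive t 1 f (f' t)) (cf' : continuous f')
  (de : forall t : R, is_derive t 1 e (e' t)) (de' : forall t : R, is_derive t 1 e' (e'' t))
  (ce'' : continuous e'') (ch : continuous h).

Let s := 2 * sg / R0.
Definition gas_trace t := f (1 * t + T) - f (1 * t + - T).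
Definition gas_trace' t := f' (1 * t + T) - f' (1 * t + - T).
Definition liq_trace t := gas_trace t + s * e t.
Definition liq_trace' t := gas_trace' t + s * e' t.

Hypothesis gas_eq : forall t, 0 <= t ->
  T * (f' (1 * t + T) + f' (1 * t + - T)) - gas_trace t + rg * R0 ^+ 2 * e'' t = 0.
Hypothesis liq_eq : forall t, 0 <= t ->
  tau * liq_trace' t + liq_trace t - rl * R0 ^+ 2 * e'' t - 2 * tau * h t = 0.
Hypothesis h_bound : forall t, 0 <= t -> prim (fun s => h s ^+ 2) t <= A.

Let T0 : 0 < T. Proof. by rewrite TE divr_gt0. Qed.
Let S := prim (fun t => f' t ^+ 2).
Let dS t : is_derive t 1 S (f' t ^+ 2).
Proof. by apply: prim_is_deriveT; exact: cont_sq. Qed.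

Lemma gas_trace_der t : is_derive t 1 gas_trace (gas_trace' t).
Proof.
apply: der_eq (derB (der_comp_affine (df (1 * t + T))) (der_comp_affine (df (1 * t + - T)))) _.
by rewrite /gas_trace'; ring.
Qed.

Lemma liq_trace_der t : is_derive t 1 liq_trace (liq_trace' t).
Proof. exact: (derD (gas_trace_der t) (derZ s (de t))). Qed.

Let ce' : continuous e' := der_continuousT de'.

Lemma gas_trace'_cont : continuous gas_trace'.
Proof. by apply: contB; exact: cont_affine. Qed.

Lemma liq_trace'_cont : continuous liq_trace'.
Proof. by apply: contD; [exact: gas_trace'_cont|exact: contZ]. Qed.

Let Q t := S (1 * t + T) - S (1 * t + - T).
(* Acoustic energy of the gas, corrected by the trace term that the spherical
   geometry produces, plus the squares of the liquid trace and of [eta']. *)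
Definition energy t := rg^-1 * (cg^-1 * Q t - (2 * R0)^-1 * gas_trace t ^+ 2)
  + (2 * rl * R0)^-1 * liq_trace t ^+ 2 + K * e' t ^+ 2.
Definition energy' t := rg^-1 * (cg^-1 * (f' (1 * t + T) ^+ 2 - f' (1 * t + - T) ^+ 2)
    - R0^-1 * gas_trace t * gas_trace' t)
  + (rl * R0)^-1 * liq_trace t * liq_trace' t + 2 * K * e' t * e'' t.

Lemma der_sq (g : R -> R) (g' t : R) : is_derive t 1 g g' -> is_derive t 1 (fun t => g t ^+ 2) (2 * g t * g').
Proof. by move=> Hg; apply: der_eq (derM Hg Hg) _; ring. Qed.

Lemma energy_der t : is_derive t 1 energy (energy' t).
Proof.
have dQ : is_derive t 1 Q (f' (1 * t + T) ^+ 2 - f' (1 * t + - T) ^+ 2).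
  apply: der_eq (derB (der_comp_affine (dS (1 * t + T))) (der_comp_affine (dS (1 * t + - T)))) _.
  by rewrite !mul1r.
have d1 := derZ rg^-1 (derB (derZ cg^-1 dQ) (derZ (2 * R0)^-1 (der_sq (gas_trace_der t)))).
have d2 := derZ (2 * rl * R0)^-1 (der_sq (liq_trace_der t)).
have d3 := derZ K (der_sq (de' t)).
apply: der_eq (derD (derD d1 d2) d3) _.
rewrite /energy'; set a := f' _; set b := f' _; set u := gas_trace t; set u' := gas_trace' t.
set y := liq_trace t; set y' := liq_trace' t; field.
by rewrite !gt_eqF.
Qed.

(** The gas equation turns the derivative of the gas energy into - R0 eta'' u', where u is the gas
    trace. Then eta'' is eliminated by the liquid equation and u' = y' - s eta'. What remains is a
    quadratic form in y', h, y and p = (sg + K) eta' / R0, whose term - tau y'^2 is the energy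
    radiated into the liquid. Completing squares keeps half of that term; p^2 is absorbed through
    [kapE] and y^2 through 2 <= kap. *)
Lemma energy'_le t : 0 <= t ->
  energy' t <= kap * energy t - tau / (2 * rl * R0) * liq_trace' t ^+ 2
    + 8 * tau / (rl * R0) * h t ^+ 2.
Proof.
move=> t0; have := gas_eq t0; have := liq_eq t0.
have CS : gas_trace t ^+ 2 <= (2 * T) * Q t.
  have tt : 1 * t + - T <= 1 * t + T by rewrite lerD2l; move: (T0); lra.
  have := cauchy_schwarz_prim cf' df tt.
  by rewrite -/S /gas_trace /Q (_ : 1 * t + T - (1 * t + - T) = 2 * T)//; ring.
(* The trace correction never exceeds the acoustic energy: u^2 <= 2 T Q by Cauchy-Schwarz on a
   window of length 2 T, and 2 T / (2 R0) = 1/cg. *)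
have Eg : 0 <= rg^-1 * (cg^-1 * Q t - (2 * R0)^-1 * gas_trace t ^+ 2).
  rewrite mulr_ge0 ?invr_ge0 ?(ltW rg0)// subr_ge0 mulrC ler_pdivrMr ?mulr_gt0//.
  apply: (le_trans CS); rewrite TE le_eqVlt; apply/orP; left; apply/eqP.
  by field; rewrite gt_eqF.
have liq'E : liq_trace' t = gas_trace' t + s * e' t by [].
have gas'E : gas_trace' t = f' (1 * t + T) - f' (1 * t + - T) by [].
rewrite /energy /energy'.
move: Eg liq'E gas'E.
set a := f' (1 * t + T); set b := f' (1 * t + - T); set u := gas_trace t.
set u' := gas_trace' t; set y := liq_trace t; set Y := liq_trace' t; set w := e' t; set z := e'' t.
set Eg := rg^-1 * _; set hh := h t.
move=> Eg0 YE uE lq gs.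
have zE : z = (tau * Y + y - 2 * tau * hh) / (rl * R0 ^+ 2).
  by apply: (mulIf (_ : rl * R0 ^+ 2 != 0)); rewrite ?divfK ?mulf_neq0 ?expf_neq0 ?gt_eqF//; lra.
have zE2 : T * (a + b) - u = - (rg * R0 ^+ 2 * z) by lra.
pose p := (sg + K) / R0 * w.
have e1 : rg^-1 * (cg^-1 * (a ^+ 2 - b ^+ 2) - R0^-1 * u * u') = - (R0 * z * u').
  rewrite (_ : _ - _ = R0^-1 * u' * (T * (a + b) - u)); last first.
    by rewrite uE TE; field; rewrite !gt_eqF.
  by rewrite zE2; field; rewrite !gt_eqF.
have u'E : u' = Y - s * w by rewrite YE; ring.
have -> : rg^-1 * (cg^-1 * (a ^+ 2 - b ^+ 2) - R0^-1 * u * u') + (rl * R0)^-1 * y * Y + 2 * K * w * z =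
   (rl * R0)^-1 * (- tau * Y ^+ 2 + 2 * tau * hh * Y + 2 * p * (tau * Y + y - 2 * tau * hh)).
  by rewrite e1 u'E zE /p /s; field; rewrite !gt_eqF.
have rR : 0 < rl * R0 by rewrite mulr_gt0.
(* The difference of the two sides is a sum of four squares. The constants are read off from it: 5
   tau + 1 = 4 tau + tau + 1 in front of p^2, and 8 tau = 4 tau + 4 tau in front of h^2. *)
have main : - tau * Y ^+ 2 + 2 * tau * hh * Y + 2 * p * (tau * Y + y - 2 * tau * hh) <=
   - (tau / 2) * Y ^+ 2 + 8 * tau * hh ^+ 2 + y ^+ 2 + (5 * tau + 1) * p ^+ 2.
  rewrite -subr_ge0 (_ : _ - _ = tau * (Y / 2 - 2 * hh) ^+ 2 + tau * (Y / 2 - 2 * p) ^+ 2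
     + (y - p) ^+ 2 + tau * (2 * hh + p) ^+ 2); last by field.
  have q (x : R) : 0 <= tau * x ^+ 2 by rewrite mulr_ge0 ?sqr_ge0// ltW.
  by rewrite !addr_ge0 ?q ?sqr_ge0.
have p2 : (5 * tau + 1) * p ^+ 2 <= rl * R0 * (kap * (K * w ^+ 2)).
  rewrite (_ : _ * _ = ((sg + K) ^+ 2 * (5 * tau + 1)) * (w ^+ 2 / R0 ^+ 2)); last first.
    by rewrite /p; field; rewrite gt_eqF.
  rewrite (_ : rl * R0 * _ = (kap * K * (rl * R0 ^+ 3)) * (w ^+ 2 / R0 ^+ 2)); last first.
    by field; rewrite gt_eqF.
  by rewrite ler_wpM2r// divr_ge0 ?sqr_ge0.
have y2 : y ^+ 2 <= rl * R0 * (kap * ((2 * rl * R0)^-1 * y ^+ 2)).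
  rewrite (_ : rl * R0 * _ = kap / 2 * y ^+ 2); last by field; rewrite !gt_eqF.
  by rewrite ler_peMl ?sqr_ge0//; move: kap2; lra.
have kEg : 0 <= rl * R0 * (kap * Eg).
  by rewrite mulr_ge0 ?(ltW rR)// mulr_ge0//; move: kap2; lra.
rewrite mulrC ler_pdivrMr//.
apply: (le_trans main).
rewrite (_ : (_ + _) * (rl * R0) = rl * R0 * (kap * Eg) + rl * R0 * (kap * ((2 * rl * R0)^-1 * y ^+ 2))
  + rl * R0 * (kap * (K * w ^+ 2)) - tau / 2 * Y ^+ 2 + 8 * tau * hh ^+ 2); last first.
  by field; rewrite !gt_eqF.
rewrite mulNr; move: p2 y2 kEg; lra.
Qed.

Let ex t : R := expR (- kap * t + 0).
Let dex t : is_derive t 1 ex (- kap * ex t).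
Proof. exact: (der_comp_affine (is_derive_expR (- kap * t + 0))). Qed.
Let cex : continuous ex := der_continuousT dex.

Lemma energy_bound : exists2 C, 0 <= C & forall t, 0 <= t ->
  [/\ liq_trace t ^+ 2 <= C * expR (kap * t), e' t ^+ 2 <= C * expR (kap * t),
      prim (fun s => expR (- kap * s) * liq_trace' s ^+ 2) t <= C &
      Q t <= C * expR (kap * t) + T^-1 * gas_trace t ^+ 2].
Proof.
pose d := tau / (2 * rl * R0); pose c1 := 8 * tau / (rl * R0).
have d0 : 0 < d by rewrite divr_gt0// !mulr_gt0.
have c10 : 0 < c1 by rewrite divr_gt0// !mulr_gt0.
have cY2 : continuous (fun s => ex s * liq_trace' s ^+ 2).
  by apply: contM => //; apply: cont_sq; exact: liq_trace'_cont.
have ch2 : continuous (fun s => ex s * h s ^+ 2) by apply: contM => //; exact: cont_sq.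
(* Nonincreasing for t >= 0 by [energy'_le]: the exponential removes kap times the energy, and the
   two integrals account for the dissipation and for the incoming wave. *)
pose Psi t := ex t * energy t + d * prim (fun s => ex s * liq_trace' s ^+ 2) t
   - c1 * prim (fun s => ex s * h s ^+ 2) t.
have dPsi t : is_derive t 1 Psi (ex t * (energy' t - kap * energy t + d * liq_trace' t ^+ 2 - c1 * h t ^+ 2)).
  apply: der_eq (derB (derD (derM (dex t) (energy_der t)) (derZ d (prim_is_deriveT cY2 t))) (derZ c1 (prim_is_deriveT ch2 t))) _.
  by ring.
have ex0 t : 0 < ex t by exact: expR_gt0.
have ex1 t : 0 <= t -> ex t <= 1.
  by move=> t0; rewrite /ex addr0 mulNr expR_le1// oppr_le0 mulr_ge0//; move: kap2; lra.
have Psi_le t : 0 <= t -> Psi t <= Psi 0.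
  move=> t0; have z (x : R) : is_derive x 1 (fun=> Psi 0) 0 by exact: der_cst.
  apply: (der_ge0_le dPsi z (lexx _) _ t0) => x /andP[x0 _].
  by rewrite pmulr_rle0//; have := energy'_le x0; rewrite -/d -/c1; lra.
have hI t : 0 <= t -> prim (fun s => ex s * h s ^+ 2) t <= A.
  move=> t0; apply: le_trans (h_bound t0).
  have := @prim_le _ (fun s => ex s * h s ^+ 2) (fun s => h s ^+ 2) 0 t ch2 (cont_sq ch) t0.
  rewrite !prim0 !subr0; apply => x /andP[x0 _].
  by rewrite ler_piMl ?sqr_ge0// ex1.
have Ib t : 0 <= t -> 0 <= prim (fun s => ex s * liq_trace' s ^+ 2) t.
  move=> t0; rewrite -(prim0 (fun s => ex s * liq_trace' s ^+ 2)).
  by apply: prim_mono => // x; rewrite mulr_ge0 ?sqr_ge0// ltW.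
have CS t : gas_trace t ^+ 2 <= (2 * T) * Q t.
  have tt : 1 * t + - T <= 1 * t + T by rewrite lerD2l; move: (T0); lra.
  have := cauchy_schwarz_prim cf' df tt.
  by rewrite -/S /gas_trace /Q (_ : 1 * t + T - (1 * t + - T) = 2 * T)//; ring.
have Eg t : 0 <= rg^-1 * (cg^-1 * Q t - (2 * R0)^-1 * gas_trace t ^+ 2).
  rewrite mulr_ge0 ?invr_ge0 ?(ltW rg0)// subr_ge0 mulrC ler_pdivrMr ?mulr_gt0//.
  apply: (le_trans (CS t)); rewrite TE le_eqVlt; apply/orP; left; apply/eqP.
  by field; rewrite gt_eqF.
have A0 : 0 <= A by have := h_bound (lexx 0); rewrite prim0.
pose C0 := Psi 0 + c1 * A.
have key t : 0 <= t -> ex t * energy t + d * prim (fun s => ex s * liq_trace' s ^+ 2) t <= C0.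
  move=> t0; have := Psi_le t t0; have := ler_wpM2l (ltW c10) (hI t t0).
  by rewrite /C0 {1}/Psi; lra.
have e_ge0 t : 0 <= energy t.
  rewrite /energy !addr_ge0 ?Eg//; first by rewrite mulr_ge0 ?sqr_ge0// invr_ge0 !mulr_ge0// ltW.
  by rewrite mulr_ge0 ?sqr_ge0// ltW.
have C00 : 0 <= C0.
  apply: le_trans (key 0 (lexx 0)); rewrite prim0 mulr0 addr0 mulr_ge0//; exact: ltW.
have Et t : 0 <= t -> energy t <= C0 * expR (kap * t).
  move=> t0; have := key t t0; have := mulr_ge0 (ltW d0) (Ib t t0) => h1 h2.
  have h3 : ex t * energy t <= C0 by lra.
  have -> : expR (kap * t) = (ex t)^-1 by rewrite /ex addr0 mulNr expRN invrK.
  by rewrite ler_pdivlMr// mulrC.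
pose C := C0 * (2 * rl * R0 + K^-1 + rg * cg) + C0 / d.
have h0 : [/\ 0 <= 2 * rl * R0, 0 <= K^-1, 0 <= rg * cg & 0 <= C0 / d].
  by split; rewrite ?mulr_ge0 ?invr_ge0// ltW// !mulr_gt0.
have [h01 h02 h03 h04] := h0.
exists C; first by rewrite /C addr_ge0// mulr_ge0// !addr_ge0.
move=> t t0; have E0 := expR_ge0 (kap * t); have := Et t t0.
have Cle q : 0 <= q -> q <= 2 * rl * R0 + K^-1 + rg * cg -> C0 * expR (kap * t) * q <= C * expR (kap * t).
  move=> q0 hq; rewrite mulrAC ler_wpM2r// /C.
  by apply: (@le_trans _ _ (C0 * (2 * rl * R0 + K^-1 + rg * cg))); rewrite ?ler_wpM2l// lerDl.
rewrite /energy; set a1 := rg^-1 * _; set a2 := (2 * rl * R0)^-1 * _; set a3 := K * _ => hE.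
have p1 : 0 <= a1 by exact: Eg.
have p2 : 0 <= a2 by rewrite mulr_ge0 ?sqr_ge0// invr_ge0.
have p3 : 0 <= a3 by rewrite mulr_ge0 ?sqr_ge0// ltW.
have r1 : a1 <= C0 * expR (kap * t) by lra.
have r2 : a2 <= C0 * expR (kap * t) by lra.
have r3 : a3 <= C0 * expR (kap * t) by lra.
split.
- apply: le_trans (Cle (2 * rl * R0) h01 _); last by lra.
  apply: le_trans (ler_wpM2r h01 r2); rewrite /a2 le_eqVlt; apply/orP; left; apply/eqP.
  by field; rewrite !gt_eqF.
- apply: le_trans (Cle K^-1 h02 _); last by lra.
  apply: le_trans (ler_wpM2r h02 r3); rewrite /a3 le_eqVlt; apply/orP; left; apply/eqP.
  by field; rewrite !gt_eqF.
- have := key t t0; have := mulr_ge0 (ltW (ex0 t)) (e_ge0 t) => k1 k2.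
  have : prim (fun s => ex s * liq_trace' s ^+ 2) t <= C0 / d.
    by rewrite ler_pdivlMr// mulrC; lra.
  have -> : (fun s => expR (- kap * s) * liq_trace' s ^+ 2) = (fun s => ex s * liq_trace' s ^+ 2).
    by apply/funext => x; rewrite /ex addr0.
  move=> k3; apply: (le_trans k3); rewrite /C lerDr mulr_ge0// !addr_ge0//.
- have := Cle (rg * cg) h03 _; have := ler_wpM2r h03 r1.
  have -> : a1 * (rg * cg) = Q t - (2 * T)^-1 * gas_trace t ^+ 2.
    by rewrite /a1 TE; field; rewrite !gt_eqF.
  have TR : 0 <= T^-1 * gas_trace t ^+ 2 by rewrite mulr_ge0 ?sqr_ge0// invr_ge0 ltW.
  have -> : (2 * T)^-1 * gas_trace t ^+ 2 = (T^-1 * gas_trace t ^+ 2) / 2 by field; rewrite gt_eqF.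
  move=> q1 q2; have := q2 ltac:(lra); lra.
Qed.

End energy.

(** * All time derivatives of the interface equations *)

Section chain.
Context {R : realType}.
Variables (T R0 rg rl tau sg : R) (M : nat) (F0 H : nat -> R -> R) (E : nat -> R).
Hypotheses (T0 : 0 < T) (R00 : 0 < R0) (rg0 : 0 < rg) (rl0 : 0 < rl) (tau0 : 0 < tau).
Let s := 2 * sg / R0.

(* The two flux conditions for [v_g = F(t + r/c) - F(t - r/c)], with [T = R0/c_g],
   [tau = R0/c_l] and [h] the derivative of the incoming wave in the liquid. *)
Definition gas_residual (f f' e'' : R -> R) t : R :=
  T * (f' (1 * t + T) + f' (1 * t + - T)) - gas_trace T f t + rg * R0 ^+ 2 * e'' t.
Definition liq_residual (f f' e e' e'' h : R -> R) t : R :=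
  tau * liq_trace' T R0 sg f' e' t + liq_trace T R0 sg f e t
  - rl * R0 ^+ 2 * e'' t - 2 * tau * h t.

(** [F j] and [e j] are the time derivatives of order j of the gas wave and of eta. Eta has one
    order more, since the flux conditions express e'' through F'. For t <= T the wave is prescribed
    by [F0]: these are the values the gas sees up to time 0. *)
Record wave_chain (F e : nat -> R -> R) : Prop := WaveChain {
  chain_F : forall j, (j <= M)%N -> forall t : R, is_derive t 1 (F j) (F j.+1 t);
  chain_Fcont : continuous (F M.+1);
  chain_F0 : forall j t, (j <= M.+1)%N -> t <= T -> F j t = F0 j t;
  chain_e : forall j, (j <= M.+1)%N -> forall t : R, is_derive t 1 (e j) (e j.+1 t);
  chain_econt : continuous (e M.+2);
  chain_e0 : forall j, (j <= M.+2)%N -> e j 0 = E j;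
  chain_gas : forall j t, (j <= M)%N -> 0 <= t ->
    gas_residual (F j) (F j.+1) (e j.+2) t = 0;
  chain_liq : forall j t, (j <= M)%N -> 0 <= t ->
    liq_residual (F j) (F j.+1) (e j) (e j.+1) (e j.+2) (H j.+1) t = 0 }.

Hypotheses
  (dF0 : forall j, (j <= M)%N -> forall t : R, is_derive t 1 (F0 j) (F0 j.+1 t))
  (cF0 : continuous (F0 M.+1))
  (dH : forall j, (j <= M)%N -> forall t : R, is_derive t 1 (H j) (H j.+1 t))
  (cH : continuous (H M.+1)).
Hypotheses
  (compat_gas : forall j, (j <= M)%N -> T * (F0 j.+1 T + F0 j.+1 (- T))
     - (F0 j T - F0 j (- T)) + rg * R0 ^+ 2 * E j.+2 = 0)
  (compat_liq : forall j, (j <= M)%N ->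
     tau * (F0 j.+1 T - F0 j.+1 (- T) + s * E j.+1) + (F0 j T - F0 j (- T) + s * E j)
     - rl * R0 ^+ 2 * E j.+2 - 2 * tau * H j.+1 0 = 0).

Let k1 := (rg * R0 ^+ 2)^-1.
Let q := rl / rg.
Let u0 := F0 M T - F0 M (- T).
Let X0 := fun t => F0 M.+1 (1 * t + T).

(** The two compatibility conditions at level M, with [E M.+2] eliminated between them, say that the
    history satisfies the fixed-point equation at t = 0. *)
Lemma chain_top_compat : X0 0 = top_form T q tau s k1 u0 (E M.+1) (E M) (H M.+1) X0 0.
Proof.
have c1 := compat_gas (leqnn M); have c2 := compat_liq (leqnn M).
rewrite /top_form /top_e /top_w /top_u !prim0 /X0 !mulr0 !add0r.
rewrite (_ : 1 * - (2 * T) + T = - T); last by ring.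
have d0 : tau + T * q != 0 by rewrite gt_eqF// addr_gt0// mulr_gt0// divr_gt0.
apply: (mulfI d0); rewrite [RHS]mulrA mulfV// mul1r !subr0 !addr0.
have e2 : E M.+2 = k1 * (u0 - T * (F0 M.+1 T + F0 M.+1 (- T))).
  rewrite /k1 /u0; apply: (mulfI (_ : rg * R0 ^+ 2 != 0)); first by rewrite gt_eqF// mulr_gt0// exprn_gt0.
  rewrite [RHS]mulrA mulfV ?mul1r; first by move: c1; lra.
  by rewrite gt_eqF// mulr_gt0// exprn_gt0.
move: c2; rewrite e2 (_ : rl * R0 ^+ 2 * (k1 * _) = q * (u0 - T * (F0 M.+1 T + F0 M.+1 (- T)))); last first.
  by rewrite /k1 /q; field; rewrite !gt_eqF.
rewrite -/u0 => c2'; apply/eqP; rewrite -subr_eq0 -[X in _ == X]c2'; apply/eqP; ring.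
Qed.

Section construct.
Variable X : R -> R.
Hypotheses (cX : continuous X) (X_neg : forall t, t <= 0 -> X t = X0 t)
  (X_pos : forall t, 0 <= t ->
     X t = top_form T q tau s k1 u0 (E M.+1) (E M) (H M.+1) X t).

(** Indexed from the top: [Fup k] is the derivative of order M.+1 - k, continued beyond t = T by
    integration from the data value at T, which makes the pasting in [Fsol] differentiable. *)
Fixpoint Fup k : R -> R := match k with
  | 0 => fun x => X (1 * x + - T)
  | k.+1 => fun x => F0 (M - k) T + (prim (Fup k) x - prim (Fup k) T) end.

Let cFup k : continuous (Fup k).
Proof.
elim: k => [|k IH] /=; first exact: cont_affine.
apply: contD; first exact: cont_cst.
by apply: contB; [exact: prim_continuous (continuous_loc_int IH)|exact: cont_cst].
Qed.

Let dFup k (t : R) : is_derive t 1 (Fup k.+1) (Fup k t).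
Proof.
apply: der_eq (derD (der_cst t _) (derB (prim_is_deriveT (@cFup k) t) (der_cst t _))) _.
by rewrite subr0 add0r.
Qed.

Definition Fsol j t := if t <= T then F0 j t else Fup (M.+1 - j) t.

Let FupT k : (k <= M.+1)%N -> Fup k T = F0 (M.+1 - k) T.
Proof.
case: k => [_|k kM] /=; last by rewrite subrr addr0 subSS.
rewrite mul1r subrr X_neg// /X0 mulr0 add0r subn0//.
Qed.

Let FsolT j t : (j <= M.+1)%N -> t <= T -> Fsol j t = F0 j t.
Proof. by move=> _ h; rewrite /Fsol h. Qed.

Let dFsol j : (j <= M)%N -> forall t : R, is_derive t 1 (Fsol j) (Fsol j.+1 t).
Proof.
move=> jM t.
have jE : (M.+1 - j = (M.+1 - j.+1).+1)%N by rewrite subSS subSn.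
rewrite /Fsol jE.
apply: der_glue => [x|x||]; [exact: dF0|exact: dFup| |].
  by rewrite -jE FupT ?leq_subr// subKn// ltnW.
by rewrite FupT ?leq_subr// subKn.
Qed.

Let FsolM t : Fsol M.+1 t = X (1 * t + - T).
Proof.
rewrite /Fsol subnn /=; case: ifPn => // tT.
rewrite X_neg /X0; last by move: tT; lra.
by congr (F0 _ _); ring.
Qed.

Fixpoint Eup k : R -> R := match k with
  | 0 => fun t => - k1 * (T * (X t + X (1 * t + - (2 * T))) - top_u T u0 X t)
  | k.+1 => fun t => E (M.+1 - k) + prim (Eup k) t end.

Let ctu : continuous (top_u T u0 X). Proof. exact: top_u_cont. Qed.
Let cEup k : continuous (Eup k).
Proof.
elim: k => [|k IH] /=.
  apply: contZ; apply: contB => //; apply: contZ; apply: contD => //; exact: cont_affine.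
by apply: contD; [exact: cont_cst|exact: prim_continuous (continuous_loc_int IH)].
Qed.

Definition Esol j := Eup (M.+2 - j).

Let dEsol j : (j <= M.+1)%N -> forall t : R, is_derive t 1 (Esol j) (Esol j.+1 t).
Proof.
move=> jM t; rewrite /Esol subSn//.
apply: der_eq (derD (der_cst t _) (prim_is_deriveT (@cEup _) t)) _.
by rewrite add0r.
Qed.

Let top_uE t : gas_trace T (Fsol M) t = top_u T u0 X t.
Proof.
apply: (@der_unique _ _ _ (fun t => X t - X (1 * t + - (2 * T))) 0) => {t} [t|t|].
- apply: der_eq (derB (der_comp_affine (dFsol (leqnn M) _)) (der_comp_affine (dFsol (leqnn M) _))) _.
  rewrite !FsolM !mul1r; congr (_ - _); first by congr X; ring.
  by congr X; ring.
- have cc : continuous (fun t => X t - X (1 * t + - (2 * T))) by apply: contB => //; exact: cont_affine.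
  apply: der_eq (derD (der_cst t _) (prim_is_deriveT cc t)) _.
  by rewrite add0r.
- rewrite /gas_trace /top_u prim0 !mulr0 !add0r addr0 !FsolT//.
  by move: T0; lra.
Qed.

Let FsolMp t : Fsol M.+1 (1 * t + T) = X t.
Proof. by rewrite FsolM; congr X; ring. Qed.
Let FsolMm t : Fsol M.+1 (1 * t + - T) = X (1 * t + - (2 * T)).
Proof. by rewrite FsolM; congr X; ring. Qed.

Let e_top t : Esol M.+1 t = top_w T k1 u0 (E M.+1) X t.
Proof.
rewrite /Esol subSnn /= subn0 /top_w primZ ?mulNr//.
by apply: contB => //; apply: contZ; apply: contD => //; exact: cont_affine.
Qed.
Let e_bot t : Esol M t = top_e T k1 u0 (E M.+1) (E M) X t.
Proof.
rewrite /Esol (_ : M.+2 - M = 2)%N; last by rewrite -[M.+2]add2n addnK.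
rewrite /top_e (_ : top_w T k1 u0 (E M.+1) X = Eup 1); last first.
  by apply/funext => x; rewrite -e_top /Esol subSnn.
have -> : Eup 2 t = E (M.+1 - 1) + prim (Eup 1) t by [].
by rewrite subn1.
Qed.

Let gas_top t : gas_residual (Fsol M) (Fsol M.+1) (Esol M.+2) t = 0.
Proof.
rewrite /gas_residual top_uE FsolMp FsolMm /Esol subnn /= /k1.
by field; rewrite !gt_eqF.
Qed.

Let liq_top t : 0 <= t ->
  liq_residual (Fsol M) (Fsol M.+1) (Esol M) (Esol M.+1) (Esol M.+2) (H M.+1) t = 0.
Proof.
move=> t0; rewrite /liq_residual /liq_trace /liq_trace' top_uE /gas_trace' FsolMp FsolMm e_bot e_top.
rewrite /Esol subnn /= -/s.
have d0 : tau + T * q != 0 by rewrite gt_eqF// addr_gt0// mulr_gt0// divr_gt0.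
have := X_pos t0; rewrite /top_form => /(congr1 (fun x => (tau + T * q) * x)).
rewrite [in X in _ = X]mulrA mulfV// [1 * (_ + _)]mul1r.
move: (X t) (X (1 * t + _)) (top_u _ _ _ _) (top_w _ _ _ _ _ _) (top_e _ _ _ _ _ _ _) (H _ _) => x y u w e h hE.
rewrite (_ : rl * R0 ^+ 2 * _ = - q * (T * (x + y) - u)); last by rewrite /q /k1; field; rewrite !gt_eqF.
transitivity ((tau + T * q) * x - ((tau - T * q) * y + (q - 1) * u - s * (tau * w + e) + 2 * tau * h)).
  by ring.
by rewrite hE subrr.
Qed.

Let EsolO j : (j <= M.+2)%N -> Esol j 0 = E j.
Proof.
rewrite leq_eqVlt => /orP[/eqP ->|jM].
  have := gas_top 0; rewrite /gas_residual /gas_trace !mulr0 !add0r !FsolT//; [|move: T0; lra..].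
  have := compat_gas (leqnn M); rewrite -/u0 => h1 h2.
  apply: (mulfI (_ : rg * R0 ^+ 2 != 0)); first by rewrite gt_eqF// mulr_gt0// exprn_gt0.
  move: h1 h2; rewrite /u0; lra.
rewrite /Esol subSn// /= prim0 addr0; congr E; rewrite subKn//.
Qed.

(** Descending induction on the level j = M - k: the derivative of the residual at level j is the
    residual at level j.+1, and the residual at t = 0 is a compatibility condition on the data. *)
Let residual_gas k j t : (j + k = M)%N -> 0 <= t ->
  gas_residual (Fsol j) (Fsol j.+1) (Esol j.+2) t = 0.
Proof.
elim: k j t => [|k IH] j t; first by rewrite addn0 => ->.
move=> jk; have jM : (j <= M)%N by rewrite -jk leq_addr.
have jM' : (j.+1 <= M)%N by rewrite -jk addnS ltnS leq_addr.
have e : (j.+1 + k = M)%N by rewrite addSnnS.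
have z (x : R) : is_derive x 1 (fun=> 0 : R) 0 by exact: der_cst.
have d (x : R) : is_derive x 1 (gas_residual (Fsol j) (Fsol j.+1) (Esol j.+2))
    (gas_residual (Fsol j.+1) (Fsol j.+2) (Esol j.+3) x).
  have jM3 : (j.+2 <= M.+1)%N by [].
  apply: der_eq (derD (derB (derZ T (derD (der_comp_affine (dFsol jM' _)) (der_comp_affine (dFsol jM' _))))
    (derB (der_comp_affine (dFsol jM _)) (der_comp_affine (dFsol jM _)))) (derZ _ (dEsol jM3 _))) _.
  by rewrite !(mul1r (Fsol _ _)).
apply: (der_unique_ge d z) => [|x x0]; last exact: IH.
rewrite /gas_residual /gas_trace !mulr0 !add0r !FsolT ?EsolO ?ltnS//; try by rewrite ltnW.
by apply: compat_gas. all: by move: T0; lra.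
Qed.

Let residual_liq k j t : (j + k = M)%N -> 0 <= t ->
  liq_residual (Fsol j) (Fsol j.+1) (Esol j) (Esol j.+1) (Esol j.+2) (H j.+1) t = 0.
Proof.
elim: k j t => [|k IH] j t; first by rewrite addn0 => ->; exact: liq_top.
move=> jk; have jM : (j <= M)%N by rewrite -jk leq_addr.
have jM' : (j.+1 <= M)%N by rewrite -jk addnS ltnS leq_addr.
have e : (j.+1 + k = M)%N by rewrite addSnnS.
have z (x : R) : is_derive x 1 (fun=> 0 : R) 0 by exact: der_cst.
have d (x : R) : is_derive x 1 (liq_residual (Fsol j) (Fsol j.+1) (Esol j) (Esol j.+1) (Esol j.+2) (H j.+1))
    (liq_residual (Fsol j.+1) (Fsol j.+2) (Esol j.+1) (Esol j.+2) (Esol j.+3) (H j.+2) x).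
  have jM4 : (j.+2 <= M.+1)%N by [].
  have jM2 : (j <= M.+1)%N by exact: leqW.
  have jM3 : (j.+1 <= M.+1)%N by exact: leqW.
  apply: der_eq (derB (derB (derD (derZ tau (derD (derB (der_comp_affine (dFsol jM' _)) (der_comp_affine (dFsol jM' _)))
    (derZ _ (dEsol jM3 _))))
    (derD (derB (der_comp_affine (dFsol jM _)) (der_comp_affine (dFsol jM _))) (derZ _ (dEsol jM2 _)))) (derZ _ (dEsol jM4 _)))
    (derZ _ (dH jM' _))) _.
  by rewrite !(mul1r (Fsol _ _)).
apply: (der_unique_ge d z) => [|x x0]; last exact: IH.
rewrite /liq_residual /liq_trace /liq_trace' /gas_trace /gas_trace' !mulr0 !add0r !FsolT ?EsolO ?ltnS//; try by rewrite ltnW.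
by apply: compat_liq. all: by [move: T0; lra|rewrite ltnW// ltnW// ltnS|rewrite leqW// leqW].
Qed.

Lemma chain_constructed : wave_chain Fsol Esol.
Proof.
split=> //.
- rewrite (_ : Fsol M.+1 = (fun t => X (1 * t + - T))); first exact: cont_affine.
  by apply/funext.
- exact: cEup.
- by move=> j t jM; apply: (@residual_gas (M - j)%N); rewrite subnKC.
- by move=> j t jM; apply: (@residual_liq (M - j)%N); rewrite subnKC.
Qed.
End construct.

Lemma chain_solution : exists F e, wave_chain F e.
Proof.
have q0 : 0 < q by rewrite divr_gt0.
have cX0 : continuous X0 by exact: cont_affine.
have [X [cX Xn Xp]] := top_solution T0 q0 tau0 cX0 cH chain_top_compat.
by exists (Fsol X), (Esol X); exact: chain_constructed.
Qed.

End chain.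

(** * Sobolev data *)

Section lebesgue_integrable.
Context {R : realType}.
Variables (D : set R).
Hypothesis mD : measurable D.
Implicit Types (f g : R -> R).

Lemma lebZ k f : leb.-integrable D (EFin \o f) -> leb.-integrable D (EFin \o (fun x => k * f x)).
Proof. by move=> If; apply: integrable_realZ. Qed.

Lemma lebD f g : leb.-integrable D (EFin \o f) -> leb.-integrable D (EFin \o g) ->
  leb.-integrable D (EFin \o (fun x => f x + g x)).
Proof. by move=> If Ig; apply: integrable_realD. Qed.

Lemma lebB f g : leb.-integrable D (EFin \o f) -> leb.-integrable D (EFin \o g) ->
  leb.-integrable D (EFin \o (fun x => f x - g x)).
Proof. by move=> If Ig; apply: integrable_realB. Qed.

Lemma leb_le f g : measurable_fun D f -> leb.-integrable D (EFin \o g) ->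
  (forall x, D x -> `|f x| <= g x) -> leb.-integrable D (EFin \o f).
Proof. by move=> mf Ig fg; apply: (@integrable_real_le _ _ R leb D mD f g). Qed.

Lemma leb_eq f g : (forall x, D x -> f x = g x) -> leb.-integrable D (EFin \o f) ->
  leb.-integrable D (EFin \o g).
Proof. by move=> fg; apply: eq_integrable => // x /set_mem Dx /=; rewrite fg. Qed.

End lebesgue_integrable.

Section sobolev.
Context {R : realType}.
Implicit Types (I : set R) (f g h : R -> R) (x a b : R).

Lemma wderiv_congr k I f f1 g g1 : is_wderiv k I f g -> locally_integrable I f1 ->
  locally_integrable I g1 -> {ae leb, forall x : R, I x -> f x = f1 x} ->
  {ae leb, forall x : R, I x -> g x = g1 x} -> is_wderiv k I f1 g1.
Proof.
move=> [lf lg H] lf1 lg1 ff gg; split => // phi tp.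
have [_ oI _] := lf; have mI : measurable I by exact: open_measurable.
have tp' := test_derive1n k tp.
have mm h psi : locally_integrable I h -> test_fun I psi -> measurable_fun I (fun x => h x * psi x).
  by move=> lh ts; exact: (integrable_real_measurable (integrable_test lh ts)).
have -> : \int[leb]_(x in I) (f1 x * derive1n k phi x) = \int[leb]_(x in I) (f x * derive1n k phi x).
  apply: (@ae_eq_Rintegral _ _ _ leb I _ _ mI (mm _ _ lf1 tp') (mm _ _ lf tp')).
  by apply: ae_imp ff _ => x e Ix; rewrite e.
have -> : \int[leb]_(x in I) (g1 x * phi x) = \int[leb]_(x in I) (g x * phi x).
  apply: (@ae_eq_Rintegral _ _ _ leb I _ _ mI (mm _ _ lg1 tp) (mm _ _ lg tp)).
  by apply: ae_imp gg _ => x e Ix; rewrite e.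
exact: H.
Qed.

Lemma locally_integrableZ I c f : locally_integrable I f ->
  locally_integrable I (fun x => c * f x).
Proof.
move=> [mf oI H]; split => //; first by apply: measurable_funM => //; exact: measurable_cst.
move=> K KI cK.
have mK : measurable K by exact: compact_measurable.
have IK : leb.-integrable K (EFin \o f).
  apply/integrableP; split; last exact: H.
  by apply/measurable_EFinP; apply: measurable_funS KI mf; exact: open_measurable.
by have /integrableP[_] := lebZ mK c IK.
Qed.

Lemma L2_integrable I f : L2 (cst 1) I f -> leb.-integrable I (EFin \o (fun x => f x ^+ 2)).
Proof. by move=> [_]; under eq_fun do rewrite /= mul1r. Qed.

Lemma L2_intro I f : measurable_fun I f -> leb.-integrable I (EFin \o (fun x => f x ^+ 2)) ->
  L2 (cst 1) I f.
Proof. by move=> mf If; split => //; under eq_fun do rewrite /= mul1r. Qed.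

Lemma L2_loc_int I f : measurable I -> L2 (cst 1) I f -> loc_int (f \_ I).
Proof.
move=> mI L; have [mf _] := L; have If2 := L2_integrable L.
move=> a b; have mab : measurable `[a, b]%classic by exact: measurable_itv.
have If2' : leb.-integrable `[a, b] (EFin \o ((fun x => f x ^+ 2) \_ I)).
  apply: (@integrableS _ _ _ leb setT) => //.
  by rewrite -restrict_EFin; apply: (integrable_mkcond _ _).1.
have mres : measurable_fun `[a, b] (f \_ I).
  by apply: measurable_funTS; apply/(measurable_restrictT f).
have i1 := continuous_loc_int (@cont_cst R 1) a b.
apply: (leb_le mab mres (lebD mab i1 If2')).
move=> x _; rewrite !patchE; case: ifP => _; last by rewrite normr0 addr0.
have := sqr_ge0 (`|f x| - 1); have := normr_ge0 (f x); have := real_normK (num_real (f x)).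
move: `|f x| (f x ^+ 2) => p q <-; rewrite sqrrB1; lra.
Qed.

Lemma L2_ae I f g : measurable I -> L2 (cst 1) I f -> measurable_fun I g ->
  {ae leb, forall x : R, I x -> f x = g x} -> L2 (cst 1) I g.
Proof.
move=> mI L mg fg; have [mf _] := L; have /integrableP[m1 fin] := L2_integrable L.
apply: L2_intro => //; apply/integrableP; split.
  by apply/measurable_EFinP; exact: measurable_funX.
apply: le_lt_trans fin; rewrite le_eqVlt; apply/orP; left; apply/eqP.
apply: ge0_ae_eq_integral => //.
- by apply: measurableT_comp => //; apply/measurable_EFinP; exact: measurable_funX.
- by apply: measurableT_comp.
- by apply: ae_imp fg _ => x e Ix /=; rewrite e.
Qed.

Lemma Hk_wderiv2 k I c f : Hk k.+2 I f -> Hk k I (fun x => c * wderiv 2 I f x).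
Proof.
move=> Hf j jk; have [g2 w2 _] := Hf 2%N isT; have [g wg Lg] := Hf j.+2 jk.
have [_ l2 H2] := wderiv_is w2; have [lf lg H] := wg.
exists (fun x => c * g x); last first.
  have [mg Ig] := Lg; split; first by apply: measurable_funM => //; exact: measurable_cst.
  have [_ oI _] := lf; have mI : measurable I by exact: open_measurable.
  apply: leb_eq (lebZ mI (c ^+ 2) (L2_integrable Lg)) => // x _.
  by rewrite mul1r exprMn.
split; [exact: locally_integrableZ|exact: locally_integrableZ|] => phi tp.
have [_ oI _] := lf; have mI : measurable I by exact: open_measurable.
rewrite (@eqRint R _ (fun x => c * (wderiv 2 I f x * derive1n j phi x))); last by move=> x _; ring.
rewrite [in RHS](@eqRint R _ (fun x => c * (g x * phi x))); last by move=> x _; ring.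
rewrite !RintegralZl//; [|exact: integrable_test|by apply: integrable_test => //; exact: test_derive1n].
have := H2 _ (test_derive1n j tp); rewrite expr2 mulrNN !mul1r => <-.
rewrite (_ : derive1n 2 (derive1n j phi) = derive1n j.+2 phi) ?H//.
  by rewrite -addn2 exprD expr2 mulrNN !mulr1; ring.
Qed.

Lemma prim_restrict I g y x : is_interval I -> continuous g -> I y -> I x ->
  loc_int (g \_ I) -> prim (g \_ I) x - prim (g \_ I) y = prim g x - prim g y.
Proof.
move=> iI cg; wlog yx : x y / y <= x => [hw Iy Ix lI|Iy Ix lI].
  have [yx|/ltW xy] := leP y x; first exact: hw.
  by apply: oppr_inj; rewrite !opprB; exact: hw.
rewrite !prim_sub//; last exact: continuous_loc_int.
apply: eqRint => t /=; rewrite in_itv/= patchE => tI; rewrite mem_set//.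
by apply: iI tI.
Qed.

(** The zero extension of g is replaced by g itself, at the price of another constant. The
    representative of the first derivative is then differentiable on the whole line, the ends of I
    included. *)
Lemma wderiv2_continuous I f g : is_interval I -> I !=set0 -> continuous g ->
  is_wderiv 2 I f g -> loc_int (g \_ I) ->
  exists B, is_wderiv 1 I f (fun x => B + prim g x).
Proof.
move=> iI I0 cg w lI; have [B wB] := wderiv2_wderiv1 iI I0 w lI.
have [y Iy] := I0; have [lf lD _] := wB; have [_ oI _] := lf.
have cp : continuous (prim g) by exact: prim_continuous (continuous_loc_int cg).
exists (B + prim (g \_ I) y - prim g y); apply: (wderiv_congr wB).
- exact: lf.
- by apply: continuous_locally_integrable => //; apply: contD => //; exact: cont_cst.
- by apply: aeW.
- by apply: aeW => x Ix; have := prim_restrict iI cg Iy Ix lI; lra.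
Qed.

Lemma wderiv1_continuous I f D : is_interval I -> I !=set0 -> continuous D ->
  is_wderiv 1 I f D -> exists C, {ae leb, forall x : R, I x -> f x = C + prim D x}.
Proof.
move=> iI I0 cD w; have [[_ oI _] _ _] := w.
apply: (wderiv1_const iI I0 w); apply: wderiv_der => // x.
exact: prim_is_deriveT.
Qed.

End sobolev.

(** * Continuous representatives of the data at all levels *)

Section profile.
Context {R : realType}.
Variables (I : set R) (c : R) (M : nat) (V : nat -> R -> R).
Hypotheses (iI : is_interval I) (I0 : I !=set0) (oI : open I) (c0 : 0 < c).
Hypotheses (VS : forall j, V j.+2 = fun x => c ^+ 2 * wderiv 2 I (V j) x)
  (H0 : Hk M.+2 I (V 0%N)) (H1 : Hk M.+1 I (V 1%N)).

Lemma Vseq_Hk j k : (j + k = M.+2)%N -> Hk k I (V j).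
Proof.
suff : forall k, ((j + k = M.+2)%N -> Hk k I (V j)) /\ ((j.+1 + k = M.+2)%N -> Hk k I (V j.+1)).
  by move=> /(_ k)[].
elim: j => [|j IH] {}k; split; rewrite ?add0n ?add1n.
- by move=> ->.
- by case=> ->.
- by have [_] := IH k.
- move=> e; rewrite VS; apply: Hk_wderiv2; have [+ _] := IH k.+2; apply.
  by rewrite -e !addSn !addnS.
Qed.

(** W and D are continuous representatives of [V j] and of its derivative, and W2 is the
    representative at level j + 2. They live on the whole line; on I they are determined, outside it
    they are some continuation in which the relations W' = D and D' = c^(-2) W2 still hold. *)
Record profile_at (W D W2 : R -> R) j : Prop := ProfileAt {
  prof_cont : continuous W;
  prof_ae : {ae leb, forall x : R, I x -> V j x = W x};
  prof_L2 : L2 (cst 1) I W;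
  prof_der : (j <= M)%N -> [/\ forall x : R, is_derive x 1 W (D x), continuous D,
     is_wderiv 1 I (V j) D & L2 (cst 1) I D];
  prof_der2 : (j < M)%N -> forall x : R, is_derive x 1 D (c ^- 2 * W2 x) }.

Let mI : measurable I. Proof. exact: open_measurable. Qed.

(** [V j] is in H^(M + 2 - j). For j < M its second derivative is the continuous c^(-2) W2; for j =
    M the second derivative is only square integrable, which still makes D continuous; for j = M.+1
    the first derivative is only square integrable and W alone is continuous. *)
Lemma profile_one j W2 : (j <= M.+1)%N ->
  ((j < M)%N -> [/\ continuous W2, {ae leb, forall x : R, I x -> V j.+2 x = W2 x} & L2 (cst 1) I W2]) ->
  exists W D, profile_at W D W2 j.
Proof.
move=> jM HW2.
have HV := Vseq_Hk (subnKC (leqW jM)).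
have [g0 w0 L0] := HV 0%N isT.
have V0g0 : {ae leb, forall x : R, I x -> V j x = g0 x}.
  by have [lf _ _] := w0; exact: is_wderiv_ae_unique (wderiv0 lf) w0.
have Hc W : continuous W -> {ae leb, forall x : R, I x -> V j x = W x} -> L2 (cst 1) I W.
  move=> cW e; apply: (L2_ae mI L0).
    by apply: measurable_funTS; exact: continuous_measurable_fun.
  by apply: ae_imp2 V0g0 e _ => x h1 h2 Ix; rewrite -h1// h2.
have [g1 w1 L1] := HV 1%N ltac:(by rewrite subSn).
have HD D : continuous D -> is_wderiv 1 I (V j) D -> L2 (cst 1) I D.
  move=> cD wD; apply: (L2_ae mI L1); last exact: is_wderiv_ae_unique w1 wD.
  by apply: measurable_funTS; exact: continuous_measurable_fun.
have build D : continuous D -> is_wderiv 1 I (V j) D ->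
    ((j < M)%N -> forall x : R, is_derive x 1 D (c ^- 2 * W2 x)) ->
    exists W D, profile_at W D W2 j.
  move=> cD wD dD; have [C HC] := wderiv1_continuous iI I0 cD wD.
  have cW : continuous (fun x => C + prim D x).
    by apply: contD; [exact: cont_cst|exact: prim_continuous (continuous_loc_int cD)].
  exists (fun x => C + prim D x), D; split => //; first exact: Hc.
  move=> _; split => //; last exact: HD.
  by move=> x; apply: der_eq (derD (der_cst x C) (prim_is_deriveT cD x)) _; rewrite add0r.
have [jM1|jM1|jM1] := ltngtP j M.
- have [cW2 ae2 L2'] := HW2 jM1.
  have [g2 w2 _] := HV 2%N ltac:(by rewrite ltn_subRL addn1 !ltnS ltnW).
  have cg : continuous (fun x => c ^- 2 * W2 x) by exact: contZ.
  have Lg : L2 (cst 1) I (fun x => c ^- 2 * W2 x).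
    apply: L2_intro; first by apply: measurable_funTS; exact: continuous_measurable_fun.
    by apply: leb_eq (lebZ mI ((c ^- 2) ^+ 2) (L2_integrable L2')) => // x _; rewrite exprMn.
  have wg : is_wderiv 2 I (V j) (fun x => c ^- 2 * W2 x).
    apply: (wderiv_congr (wderiv_is w2)).
    + by have [] := w2.
    + exact: continuous_locally_integrable.
    + by apply: aeW.
    + apply: ae_imp ae2 _ => x e Ix; rewrite -e// VS mulrA mulVf ?mul1r//.
      by rewrite gt_eqF// exprn_gt0.
  have [B wB] := wderiv2_continuous iI I0 cg wg (L2_loc_int mI Lg).
  apply: (build _ _ wB) => [|_ x].
    by apply: contD; [exact: cont_cst|exact: prim_continuous (continuous_loc_int cg)].
  by apply: der_eq (derD (der_cst x B) (prim_is_deriveT cg x)) _; rewrite add0r.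
- have jE : j = M.+1 by apply/eqP; rewrite eqn_leq jM.
  have lg := L2_loc_int mI L1; have [lV lg1 _] := w1.
  have [C HC] := wderiv1_const iI I0 w1 (prim_wderiv oI lg1 lg).
  have cW : continuous (fun x => C + prim (g1 \_ I) x).
    by apply: contD; [exact: cont_cst|exact: prim_continuous].
  exists (fun x => C + prim (g1 \_ I) x), W2; split => //; first exact: Hc.
    by rewrite jE ltnn.
  by rewrite jE ltnNge leqnSn.
- have [g2 w2 L2'] := HV 2%N ltac:(by rewrite jM1 ltn_subRL addn1).
  have lg := L2_loc_int mI L2'.
  have [B wB] := wderiv2_wderiv1 iI I0 w2 lg.
  apply: (build _ _ wB) => [|]; last by rewrite jM1 ltnn.
  by apply: contD; [exact: cont_cst|exact: prim_continuous].
Qed.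

(** Built from the highest level downwards, since level j takes the representative of level j + 2,
    up to the factor c^2, as its second derivative. *)
Lemma profile : exists W D : nat -> R -> R,
  forall j, (j <= M.+1)%N -> profile_at (W j) (D j) (W j.+2) j.
Proof.
have H n : (n <= M.+1)%N -> exists W D : nat -> R -> R,
  forall j, (M.+1 - n <= j <= M.+1)%N -> profile_at (W j) (D j) (W j.+2) j.
  elim: n => [_|n IH nM].
    have [|W [D HW]] := @profile_one M.+1 (fun=> 0) (leqnn _); first by rewrite ltnNge leqnSn.
    exists (fun j => if j == M.+1 then W else fun=> 0), (fun=> D) => j.
    rewrite subn0 -eqn_leq => /eqP <-; rewrite eqxx.
    by case: HW => *; split => //; rewrite ltnNge leqnSn.
  have [W [D HW]] := IH (ltnW nM); pose i := (M.+1 - n.+1)%N.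
  have iE : (i.+1 = M.+1 - n)%N by rewrite /i -subSn.
  have iM : (i <= M.+1)%N by exact: leq_subr.
  have [|Wi [Di HWi]] := @profile_one i (W i.+2) iM.
    move=> iM'; have [|? ? ? _ _] := HW i.+2; first by rewrite -iE !ltnS leqnSn.
    by split.
  exists (fun j => if j == i then Wi else W j), (fun j => if j == i then Di else D j) => j.
  rewrite -/i => /andP[ij jM].
  have -> : (j.+2 == i) = false by apply/negbTE; rewrite gtn_eqF// ltnS ltnW.
  move: ij; rewrite leq_eqVlt => /orP[/eqP <-|ij]; first by rewrite eqxx.
  by rewrite gtn_eqF//; apply: HW; rewrite -iE ij.
have [W [D HW]] := H M.+1 (leqnn _); exists W, D => j jM.
by apply: HW; rewrite subnn.
Qed.

End profile.

(** * Travelling waves *)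

Section domains.
Context {R : realType}.
Variable R0 : R.
Hypothesis R00 : 0 < R0.

Lemma dom_open a : open (dom R0 a).
Proof. by case: a; [exact: rray_open|exact: itv_open]. Qed.

Lemma time_open : open (@time R).
Proof. exact: rray_open. Qed.

Lemma dom_interval a : is_interval (dom R0 a).
Proof. by case: a => x y /=; rewrite !in_itv/= ?andbT => h1 h2 z /andP[h3 h4]; move: h1 h2 h3 h4; rewrite ?in_itv/= ?andbT; lra. Qed.

Lemma dom_nonempty a : dom R0 a !=set0.
Proof.
case: a; [exists (R0 + 1)|exists (R0 / 2)]; rewrite /= in_itv/=; first by rewrite andbT ltrDl.
by move: R00; lra.
Qed.

Lemma closure_adherent (I : set R) (b : R) :
  (forall e, 0 < e -> exists2 x, I x & `|b - x| < e) -> closure I b.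
Proof. by move=> H B /nbhs_ballP[e /= e0 HB]; have [x Ix bx] := H e e0; exists x; split => //; exact: HB. Qed.

Lemma closure_dom a : closure (dom R0 a) R0.
Proof.
apply: closure_adherent => e e0; case: a.
  exists (R0 + e / 2); first by rewrite /= in_itv/= andbT ltrDl divr_gt0.
  by rewrite opprD addNKr normrN gtr0_norm ?divr_gt0//; lra.
exists (Num.max (R0 / 2) (R0 - e / 2)).
  by rewrite /= in_itv/= lt_max gt_max; apply/andP; split; [apply/orP; left|apply/andP; split]; move: (R00) e0; lra.
rewrite ger0_norm; first by rewrite ltrBlDr -ltrBlDl lt_max; apply/orP; right; lra.
by rewrite subr_ge0 ge_max; apply/andP; split; move: (R00) e0; lra.
Qed.

Lemma closure_gas0 : closure (dom R0 gas) 0.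
Proof.
apply: closure_adherent => e e0; exists (Num.min (R0 / 2) (e / 2)).
  by rewrite /= in_itv/= lt_min gt_min; apply/andP; split; [apply/andP; split|apply/orP; left]; move: (R00) e0; lra.
rewrite sub0r normrN gtr0_norm; first by rewrite gt_min; apply/orP; right; lra.
by rewrite lt_min; apply/andP; split; move: (R00) e0; lra.
Qed.

Lemma closure_time : closure (@time R) 0.
Proof.
apply: closure_adherent => e e0; exists (e / 2); first by rewrite /time /= in_itv/= andbT divr_gt0.
by rewrite sub0r normrN gtr0_norm ?divr_gt0//; lra.
Qed.

Lemma flux_profile rho a (f W D : R -> R) : continuous W -> continuous D ->
  {ae leb, forall x : R, dom R0 a x -> f x = W x} -> is_wderiv 1 (dom R0 a) f D ->
  flux R0 rho a f = (rho a * R0 ^+ 2)^-1 * (R0 * D R0 - W R0).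
Proof.
move=> cW cD fW wD; rewrite /flux; congr (_ * (R0 * _ - _)).
  apply: traceE; [exact: dom_open|exact: closure_dom|].
  by apply: continuous_is_trace => //; exact: is_wderiv_ae_unique wD (wderiv_is wD).
apply: traceE; [exact: dom_open|exact: closure_dom|].
by apply: continuous_is_trace => //; apply: ae_imp fW _ => x e Ix; rewrite e.
Qed.

Lemma trace_profile a b (f W : R -> R) : closure (dom R0 a) b -> continuous W ->
  {ae leb, forall x : R, dom R0 a x -> f x = W x} -> trace (dom R0 a) b f = W b.
Proof.
move=> cb cW fW; apply: traceE; [exact: dom_open|exact: cb|].
by apply: continuous_is_trace => //; apply: ae_imp fW _ => x e Ix; rewrite e.
Qed.

End domains.

(* [out j] and [inc j] carry the [j]-th time derivative of the right- and
   left-moving parts of the solution with data [(W 0, W 1)], as functions of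
   the travel time from [x0]. *)
Section dalembert.
Context {R : realType}.
Variables (c x0 : R) (M : nat) (W D : nat -> R -> R).
Hypothesis c0 : 0 < c.
Hypotheses (dW : forall j, (j <= M)%N -> forall x : R, is_derive x 1 (W j) (D j x))
  (cW : continuous (W M.+1)) (cD : continuous (D M))
  (dD : forall j, (j < M)%N -> forall x : R, is_derive x 1 (D j) (c ^- 2 * W j.+2 x)).

(** The companion of [W j] in d'Alembert's formula: at level 0 the primitive of the initial velocity
    divided by c^2, and at level i.+1 the space derivative of [W i], because a time derivative
    exchanges the two roles. *)
Definition Dshift j : R -> R :=
  match j with 0 => fun x => c ^- 2 * prim (W 1%N) x | i.+1 => D i end.
Definition inc j (s : R) : R := 2^-1 * (W j (c * s + x0) + c * Dshift j (c * s + x0)).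
Definition out j (s : R) : R := 2^-1 * (W j (c * s + x0) - c * Dshift j (c * s + x0)).

Lemma cont_level j : (j <= M.+1)%N -> continuous (W j).
Proof.
rewrite leq_eqVlt => /orP[/eqP ->//|]; rewrite ltnS => jM.
exact: der_continuousT (dW jM).
Qed.

Lemma Dshift_der j : (j <= M)%N -> forall x : R, is_derive x 1 (Dshift j) (c ^- 2 * W j.+1 x).
Proof.
case: j => [_|j jM] x; last exact: dD.
by apply: derZ; apply: prim_is_deriveT; exact: cont_level.
Qed.

Lemma Dshift_cont j : (j <= M.+1)%N -> continuous (Dshift j).
Proof.
rewrite leq_eqVlt => /orP[/eqP -> //|]; rewrite ltnS => jM.
exact: der_continuousT (Dshift_der jM).
Qed.

Lemma inc_der j : (j <= M)%N -> forall s : R, is_derive s 1 (inc j) (inc j.+1 s).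
Proof.
move=> jM s; apply: der_eq (derZ _ (derD (der_comp_affine (dW jM _)) (derZ c (der_comp_affine (Dshift_der jM _))))) _.
by rewrite /inc /=; field; rewrite gt_eqF.
Qed.

Lemma out_der j : (j <= M)%N -> forall s : R, is_derive s 1 (out j) (- out j.+1 s).
Proof.
move=> jM s; apply: der_eq (derZ _ (derB (der_comp_affine (dW jM _)) (derZ c (der_comp_affine (Dshift_der jM _))))) _.
by rewrite /out /=; field; rewrite gt_eqF.
Qed.

Lemma inc_cont j : (j <= M.+1)%N -> continuous (inc j).
Proof.
move=> jM; apply: contZ; apply: contD; first by apply: cont_affine; exact: cont_level.
by apply: contZ; apply: cont_affine; exact: Dshift_cont.
Qed.

Lemma out_cont j : (j <= M.+1)%N -> continuous (out j).
Proof.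
move=> jM; apply: contZ; apply: contB; first by apply: cont_affine; exact: cont_level.
by apply: contZ; apply: cont_affine; exact: Dshift_cont.
Qed.

End dalembert.

Section glue_chain.
Context {R : realType}.
Variables (b : R) (M : nat) (f g : nat -> R -> R).
Definition paste (f g : R -> R) x : R := if x <= b then f x else g x.

Lemma paste_der : (forall j, (j <= M)%N -> forall x : R, is_derive x 1 (f j) (f j.+1 x)) ->
  (forall j, (j <= M)%N -> forall x : R, is_derive x 1 (g j) (g j.+1 x)) ->
  (forall j, (j <= M.+1)%N -> f j b = g j b) ->
  forall j, (j <= M)%N -> forall x : R, is_derive x 1 (paste (f j) (g j)) (paste (f j.+1) (g j.+1) x).
Proof. by move=> df dg fg j jM x; apply: der_glue => [y|y||]; [exact: df|exact: dg|exact: fg (leqW jM)|exact: fg]. Qed.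

End glue_chain.

Lemma paste_cont {R : realType} (b : R) (f g : R -> R) : continuous f -> continuous g ->
  f b = g b -> continuous (paste b f g).
Proof.
move=> cf cg fg x; have [xb|bx|xb] := ltgtP x b.
- apply/cvgrPdist_lt => e e0; have /cvgrPdist_lt/(_ _ e0) h := cf x.
  rewrite /paste (ltW xb); near=> y; rewrite ltW; first by near: y.
  by near: y; exact: near_lt.
- apply/cvgrPdist_lt => e e0; have /cvgrPdist_lt/(_ _ e0) h := cg x.
  rewrite /paste leNgt bx /=; near=> y; rewrite leNgt ifF; first by near: y.
  by apply/negbTE; rewrite negbK; near: y; exact: near_gt.
- by rewrite -xb; apply: continuous_glue; rewrite ?xb//; [exact: cf|exact: cg].
Unshelve. all: by end_near. Qed.

(** * Exponentially weighted bounds *)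

Section weighted_bounds.
Context {R : realType}.

Lemma sqrD_le (a b : R) : (a + b) ^+ 2 <= 2 * a ^+ 2 + 2 * b ^+ 2.
Proof. by rewrite -subr_ge0 (_ : _ - _ = (a - b) ^+ 2) ?sqr_ge0//; ring. Qed.

Lemma sqrB_le (a b : R) : (a - b) ^+ 2 <= 2 * a ^+ 2 + 2 * b ^+ 2.
Proof. by rewrite -[b ^+ 2]sqrrN; exact: sqrD_le. Qed.

Implicit Types (f g : R -> R) (k gamma C t : R).

Lemma expR_der k (t : R) : is_derive t 1 (fun s => expR (k * s)) (k * expR (k * t)).
Proof.
rewrite (_ : (fun s => _) = (fun s => expR (k * s + 0))); last by apply/funext => s; rewrite addr0.
by rewrite -[in k * expR _](addr0 (k * t)); exact: (der_comp_affine (is_derive_expR (k * t + 0))).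
Qed.

Lemma expR_cont k : continuous (fun s : R => expR (k * s)).
Proof. exact: der_continuousT (expR_der k). Qed.

(** Differentiate e^((1 - k) t) f^2 and use 2 f f' <= f^2 + f'^2: the coefficient of f^2 becomes 2 -
    k, which is nonpositive. *)
Lemma growth_primitive f f' k C : 2 <= k -> (forall t : R, is_derive t 1 f (f' t)) ->
  (forall t, 0 <= t -> f' t ^+ 2 <= C * expR (k * t)) ->
  forall t, 0 <= t -> f t ^+ 2 <= (f 0 ^+ 2 + C) * expR (k * t).
Proof.
move=> k2 df H t t0.
have C0 : 0 <= C by have := H 0 (lexx _); rewrite mulr0 expR0 mulr1; apply: le_trans; exact: sqr_ge0.
have d1 (x : R) : is_derive x 1 (fun s => expR ((1 - k) * s) * f s ^+ 2)
    ((1 - k) * expR ((1 - k) * x) * f x ^+ 2 + expR ((1 - k) * x) * (2 * f x * f' x)).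
  exact: der_eq (derM (expR_der _ x) (der_sq (df x))) _.
have d2 (x : R) : is_derive x 1 (fun s => f 0 ^+ 2 - C + C * expR (1 * s)) (C * (1 * expR (1 * x))).
  by apply: der_eq (derD (der_cst x _) (derZ C (expR_der 1 x))) _; rewrite add0r.
have := der_ge0_le d1 d2 (a := 0) _ (b := t) _ t0.
rewrite !mulr0 expR0 !mul1r mulr1 subrK => /(_ (lexx _)) h.
have {}h : expR ((1 - k) * t) * f t ^+ 2 <= f 0 ^+ 2 - C + C * expR t.
  apply: h => x /andP[x0 _]; rewrite !mul1r.
  have e0 := expR_ge0 ((1 - k) * x).
  have e1 : expR ((1 - k) * x) * f' x ^+ 2 <= C * expR x.
    apply: le_trans (ler_wpM2l e0 (H x x0)) _.
    by rewrite mulrCA -expRD (_ : (1 - k) * x + k * x = x)//; ring.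
  have e2 : expR ((1 - k) * x) * (2 * f x * f' x) <= expR ((1 - k) * x) * (f x ^+ 2 + f' x ^+ 2).
    by apply: ler_wpM2l => //; have := sqr_ge0 (f x - f' x); rewrite sqrrB -mulr_natl; lra.
  have e3 : 0 <= (k - 2) * (expR ((1 - k) * x) * f x ^+ 2).
    by rewrite mulr_ge0 ?subr_ge0// mulr_ge0 ?expR_ge0 ?sqr_ge0.
  move: e1 e2 e3; rewrite mulrDr; move: (expR ((1 - k) * x)) (f x ^+ 2) => p q.
  by rewrite mulrA; lra.
have -> : f t ^+ 2 = expR ((k - 1) * t) * (expR ((1 - k) * t) * f t ^+ 2).
  by rewrite mulrA -expRD (_ : (k - 1) * t + (1 - k) * t = 0) ?expR0 ?mul1r//; ring.
apply: le_trans (ler_wpM2l (expR_ge0 _) h) _.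
have E1 : 1 <= expR t by rewrite -expR0 ler_expR.
apply: (@le_trans _ _ (expR ((k - 1) * t) * ((f 0 ^+ 2 + C) * expR t))).
  apply: ler_wpM2l; first exact: expR_ge0.
  have := ler_wpM2l (sqr_ge0 (f 0)) E1; rewrite mulrDl mulr1; lra.
by rewrite mulrCA -expRD (_ : (k - 1) * t + t = k * t)//; ring.
Qed.

(** For continuous f this is square integrability with the weight e^(- gamma t), phrased without
    improper integrals. *)
Definition wbounded gamma f := exists C, forall t, 0 <= t ->
  prim (fun s => expR (- gamma * s) * f s ^+ 2) t <= C.

Lemma wsq_cont gamma f : continuous f -> continuous (fun s => expR (- gamma * s) * f s ^+ 2).
Proof. by move=> cf; apply: contM; [exact: expR_cont|exact: cont_sq]. Qed.

Lemma wbounded_pointwise f k gamma C : k < gamma -> continuous f ->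
  (forall t, 0 <= t -> f t ^+ 2 <= C * expR (k * t)) -> wbounded gamma f.
Proof.
move=> kg cf H; have g0 : 0 < gamma - k by rewrite subr_gt0.
have C0 : 0 <= C by have := H 0 (lexx _); rewrite mulr0 expR0 mulr1; apply: le_trans; exact: sqr_ge0.
exists (C / (gamma - k)) => t t0.
have d2 (x : R) : is_derive x 1 (fun s => C / (gamma - k) - C / (gamma - k) * expR ((k - gamma) * s))
    (C * expR ((k - gamma) * x)).
  apply: der_eq (derB (der_cst x _) (derZ _ (expR_der (k - gamma) x))) _.
  by field; rewrite gt_eqF.
have := der_ge0_le (prim_is_deriveT (@wsq_cont gamma f cf)) d2 (a := 0) _ (b := t) _ t0.
rewrite prim0 mulr0 expR0 mulr1 subrr => /(_ (lexx _)) h.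
apply: (le_trans (h _)); last by rewrite gerBl mulr_ge0 ?expR_ge0// divr_ge0// ltW.
move=> x /andP[x0 _]; apply: le_trans (ler_wpM2l (expR_ge0 _) (H x x0)) _.
by rewrite mulrCA -expRD (_ : - gamma * x + k * x = (k - gamma) * x)//; ring.
Qed.

Lemma wbounded_weight f k gamma : k <= gamma -> continuous f ->
  wbounded k f -> wbounded gamma f.
Proof.
move=> kg cf [C H]; exists C => t t0; apply: le_trans (H t t0).
have := @prim_le _ _ _ 0 t (@wsq_cont gamma f cf) (@wsq_cont k f cf) t0.
rewrite !prim0 !subr0; apply => x /andP[x0 _].
by rewrite ler_wpM2r ?sqr_ge0// ler_expR !mulNr lerN2 ler_wpM2r.
Qed.

Lemma wbounded_eq f g gamma : (forall t, 0 <= t -> f t = g t) ->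
  wbounded gamma f -> wbounded gamma g.
Proof.
move=> fg [C H]; exists C => t t0; apply: le_trans (H t t0).
rewrite /prim t0 le_eqVlt; apply/orP; left; apply/eqP; apply: eqRint => x /=.
by rewrite in_itv/= => /andP[x0 _]; rewrite fg.
Qed.

Lemma wbounded_lin f g gamma a b : continuous f -> continuous g ->
  wbounded gamma f -> wbounded gamma g -> wbounded gamma (fun t => a * f t + b * g t).
Proof.
move=> cf cg [C1 H1] [C2 H2]; exists (2 * a ^+ 2 * C1 + 2 * b ^+ 2 * C2) => t t0.
pose p f s := expR (- gamma * s) * f s ^+ 2.
have c1 : continuous (p f) by exact: wsq_cont.
have c2 : continuous (p g) by exact: wsq_cont.
have c3 : continuous (p (fun t => a * f t + b * g t)).
  by apply: wsq_cont; apply: contD; exact: contZ.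
have c4 : continuous (fun s => 2 * a ^+ 2 * p f s + 2 * b ^+ 2 * p g s).
  by apply: contD; exact: contZ.
have := @prim_le _ _ _ 0 t c3 c4 t0; rewrite !prim0 !subr0 => h.
apply: le_trans (h _) _ => [x _|].
  have e0 := expR_ge0 (- gamma * x); rewrite /p.
  apply: (@le_trans _ _ (expR (- gamma * x) * (2 * a ^+ 2 * f x ^+ 2 + 2 * b ^+ 2 * g x ^+ 2))).
    by apply: ler_wpM2l => //; apply: (le_trans (sqrD_le _ _)); rewrite !exprMn !mulrA.
  by rewrite le_eqVlt; apply/orP; left; apply/eqP; ring.
rewrite primD ?primZ//; try exact: contZ.
by apply: lerD; (apply: ler_wpM2l; first by rewrite mulr_ge0 ?sqr_ge0); [exact: H1|exact: H2].
Qed.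

(* Monotone convergence along [(0, n)]. *)
Lemma ge0_integral_bounded (b C : R) f : continuous f -> (forall x, b <= x -> 0 <= f x) ->
  (forall n, prim f (b + n%:R) - prim f b <= C) ->
  (\int[leb]_(x in `]b, +oo[%classic) (f x)%:E <= C%:E)%E.
Proof.
move=> cf f0 H.
pose F (n : nat) : set R := `[b, b + n%:R]%classic.
have ndF : nondecreasing_seq F.
  move=> n p np; apply/subsetPset => x; rewrite /F /= !in_itv/= => /andP[-> /le_trans]; apply.
  by rewrite lerD2l ler_nat.
have mF n : measurable (F n) by exact: measurable_itv.
have mf n : measurable_fun (F n) (EFin \o f).
  by apply/measurable_EFinP; apply: measurable_funTS; exact: continuous_measurable_fun.
have f0' n x : F n x -> (0 <= (EFin \o f) x)%E.
  by rewrite /F /= in_itv/= lee_fin => /andP[bx _]; exact: f0.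
have cvg := ge0_nondecreasing_set_cvg_integral (mu := leb) ndF mF mf f0'.
apply: (@le_trans _ _ (\int[leb]_(x in \bigcup_n F n) (f x)%:E)%E).
  apply: ge0_subset_integral => //.
  - by apply: bigcup_measurable => n _; exact: mF.
  - by apply/measurable_EFinP; apply: measurable_funTS; exact: continuous_measurable_fun.
  - by move=> x [n _]; exact: f0'.
  - move=> x /=; rewrite in_itv/= andbT => bx; have := archi_boundP (_ : 0 <= x - b).
    rewrite subr_ge0 ltW// => /(_ isT) h; exists (Num.bound (x - b)) => //.
    by rewrite /F /= in_itv/= (ltW bx)/=; move: h; rewrite ltrBlDl => /ltW.
rewrite -(cvg_lim _ cvg)//; apply: lime_le; first by apply/cvg_ex; eexists; exact: cvg.
apply: nearW => n /=.
have <- := @Rintegral_EFin _ _ R leb (F n) (mF n) f (continuous_loc_int cf _ _).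
by rewrite lee_fin /F -prim_sub ?H ?lerDl//; exact: continuous_loc_int.
Qed.

(** Passes from bounds on the finite windows (b, b + n) to integrability on the half-line;
    nonnegativity replaces any control of the tail. *)
Lemma ge0_integrable_bounded (b C : R) f : continuous f -> (forall x, b <= x -> 0 <= f x) ->
  (forall n, prim f (b + n%:R) - prim f b <= C) ->
  leb.-integrable `]b, +oo[ (EFin \o f).
Proof.
move=> cf f0 H; apply/integrableP; split.
  by apply/measurable_EFinP; apply: measurable_funTS; exact: continuous_measurable_fun.
apply: (@le_lt_trans _ _ C%:E); last exact: ltry.
apply: le_trans (ge0_integral_bounded cf f0 H).
rewrite le_eqVlt; apply/orP; left; apply/eqP; apply: eq_integral => x /set_mem /=.
by rewrite in_itv/= andbT => bx; rewrite ger0_norm// f0// ltW.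
Qed.

Lemma wbounded_L2 f gamma : continuous f -> wbounded gamma f -> L2 (weight gamma) time f.
Proof.
move=> cf [C H]; split; first by apply: measurable_funTS; exact: continuous_measurable_fun.
apply: (@ge0_integrable_bounded 0 C) => [|x _|n].
- exact: wsq_cont.
- by rewrite mulr_ge0 ?expR_ge0 ?sqr_ge0.
- by rewrite prim0 subr0 add0r; exact: H.
Qed.

End weighted_bounds.

(** * Growth and weighted bounds for the interface solution at every level *)

Section chain_bounds.
Context {R : realType}.
Variables (T R0 cg rg rl tau sg K kap A : R) (M : nat) (F0 H : nat -> R -> R) (E : nat -> R).
Variables (F e : nat -> R -> R) (n : nat -> R -> R).
Hypotheses (cg0 : 0 < cg) (R00 : 0 < R0) (rg0 : 0 < rg) (rl0 : 0 < rl)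
  (tau0 : 0 < tau) (sg0 : 0 < sg) (K0 : 0 < K) (TE : T = R0 / cg).
Hypotheses (kap2 : 2 <= kap)
  (kapE : (sg + K) ^+ 2 * (5 * tau + 1) <= kap * K * (rl * R0 ^+ 3)).
Hypothesis chain : wave_chain T R0 rg rl tau sg M F0 H E F e.
Hypotheses (dH : forall j, (j <= M)%N -> forall t : R, is_derive t 1 (H j) (H j.+1 t))
  (cH : continuous (H M.+1))
  (dn : forall j, (j <= M)%N -> forall t : R, is_derive t 1 (n j) (- n j.+1 t))
  (cn : continuous (n M.+1)).
Hypotheses (HA : forall j t, (0 < j <= M.+1)%N -> 0 <= t -> prim (fun s => H j s ^+ 2) t <= A)
  (nA : forall j t, (0 < j <= M.+1)%N -> 0 <= t -> prim (fun s => n j s ^+ 2) t <= A).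
Let s := 2 * sg / R0.
Let y j := liq_trace T R0 sg (F j) (e j).
Hypothesis nH : forall j, (j <= M.+1)%N -> n j 0 = y j 0 - H j 0.

Let T0 : 0 < T. Proof. by rewrite TE divr_gt0. Qed.

(** The outgoing liquid wave. A negative argument refers to a wave already present at t = 0 and is
    read from the data; for t >= 0 the wave leaving the interface is the liquid trace minus the
    incoming wave. *)
Definition Gsol j := paste 0 (fun t => n j (-1 * t + 0)) (fun t => y j t - H j t).

Let chain_cont (f : nat -> R -> R) k (h : forall j, (j < k)%N -> forall t : R, is_derive t 1 (f j) (f j.+1 t)) :
  continuous (f k) -> forall j, (j <= k)%N -> continuous (f j).
Proof.
move=> cf j; rewrite leq_eqVlt => /orP[/eqP ->//|jk].
exact: der_continuousT (h j jk).
Qed.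

Lemma chain_F_cont j : (j <= M.+1)%N -> continuous (F j).
Proof. by move: j; exact: (@chain_cont F M.+1 (chain_F chain) (chain_Fcont chain)). Qed.
Lemma chain_H_cont j : (j <= M.+1)%N -> continuous (H j).
Proof. by move: j; exact: (@chain_cont H M.+1 dH cH). Qed.
Lemma chain_e_cont j : (j <= M.+2)%N -> continuous (e j).
Proof. by move: j; exact: (@chain_cont e M.+2 (chain_e chain) (chain_econt chain)). Qed.

Lemma y_cont j : (j <= M.+1)%N -> continuous (y j).
Proof.
move=> jM; apply: contD; last by apply: contZ; exact: chain_e_cont (leqW jM).
by apply: contB; apply: cont_affine; exact: chain_F_cont.
Qed.

Lemma y_der j : (j <= M)%N -> forall t : R, is_derive t 1 (y j) (y j.+1 t).
Proof. by move=> jM t; apply: liq_trace_der; [exact: (chain_F chain)|exact: (chain_e chain (leqW jM))]. Qed.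

Lemma n_cont j : (j <= M.+1)%N -> continuous (n j).
Proof.
rewrite leq_eqVlt => /orP[/eqP ->//|jk].
exact: der_continuousT (dn jk).
Qed.

Lemma Gsol_der j : (j <= M)%N -> forall t : R, is_derive t 1 (Gsol j) (Gsol j.+1 t).
Proof.
move=> jM t; apply: (@paste_der _ 0 M (fun j t => n j (-1 * t + 0)) (fun j t => y j t - H j t)) => //.
- by move=> i iM x; apply: der_eq (der_comp_affine (dn iM _)) _; ring.
- by move=> i iM x; apply: derB; [exact: y_der|exact: dH].
- by move=> i iM; rewrite mulr0 addr0 nH.
Qed.

Lemma Gsol_cont j : (j <= M.+1)%N -> continuous (Gsol j).
Proof.
move=> jM; apply: paste_cont.
- by apply: cont_affine; exact: n_cont.
- by apply: contB; [exact: y_cont|exact: chain_H_cont].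
- by rewrite mulr0 addr0 nH.
Qed.

Lemma Gsol_pos j t : (j <= M.+1)%N -> 0 <= t -> Gsol j t = y j t - H j t.
Proof.
move=> jM t0; rewrite /Gsol /paste; case: ifPn => // t1.
by rewrite (_ : t = 0) ?mulr0 ?addr0 ?nH//; apply/le_anti; rewrite t0 t1.
Qed.

Let bound_at j : (j <= M)%N -> exists2 C, 0 <= C & forall t, 0 <= t ->
  [/\ y j t ^+ 2 <= C * expR (kap * t), e j.+1 t ^+ 2 <= C * expR (kap * t),
      prim (fun s => expR (- kap * s) * y j.+1 s ^+ 2) t <= C &
      prim (fun t => F j.+1 t ^+ 2) (1 * t + T) - prim (fun t => F j.+1 t ^+ 2) (1 * t + - T)
        <= C * expR (kap * t) + T^-1 * gas_trace T (F j) t ^+ 2].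
Proof.
move=> jM.
have jM1 : (j.+1 <= M.+1)%N by [].
apply: (@energy_bound _ T R0 cg rg rl tau sg K kap A (F j) (F j.+1) (e j) (e j.+1) (e j.+2) (H j.+1)) => //.
- exact: (chain_F chain).
- exact: chain_F_cont.
- exact: (chain_e chain (leqW jM)).
- exact: (chain_e chain jM1).
- exact: chain_H_cont.
- by move=> t t0; exact: (chain_gas chain).
- by move=> t t0; exact: (chain_liq chain).
- by move=> t t0; apply: HA.
Qed.

(** The energy at level j controls [e j.+1]; eta itself, which occurs in no energy, is integrated
    from eta'. *)
Lemma e_growth j : (j <= M.+1)%N -> exists2 C, 0 <= C & forall t, 0 <= t -> e j t ^+ 2 <= C * expR (kap * t).
Proof.
case: j => [_|j jM]; last first.
  by have [C C0 HC] := bound_at jM; exists C => // t t0; have [] := HC t t0.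
have [C C0 HC] := bound_at (leq0n M); exists (e 0%N 0 ^+ 2 + C); first by rewrite addr_ge0 ?sqr_ge0.
apply: (growth_primitive kap2 (chain_e chain (leq0n _))) => t t0.
by have [] := HC t t0.
Qed.

Let g_growth j : (j <= M)%N -> exists2 C, 0 <= C & forall t, 0 <= t -> gas_trace T (F j) t ^+ 2 <= C * expR (kap * t).
Proof.
move=> jM; have [C C0 HC] := bound_at jM; have [C' C0' HC'] := e_growth (leqW jM).
exists (2 * C + 2 * s ^+ 2 * C'); first by rewrite addr_ge0// mulr_ge0// mulr_ge0 ?sqr_ge0.
move=> t t0; have [h1 _ _ _] := HC t t0; have h2 := HC' t t0.
have -> : gas_trace T (F j) t = y j t - s * e j t by rewrite /y /liq_trace addrK.
apply: (le_trans (sqrB_le _ _)); rewrite exprMn.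
have := ler_wpM2l (sqr_ge0 s) h2; move: h1; move: (expR _) => E1.
by rewrite mulrDl -!mulrA; lra.
Qed.

(** At time t the gas sees the wave between t - T and t + T, the window of the last bound in
    [energy_bound]. The gas trace left in that bound is y - s eta, already controlled. *)
Lemma gas_spatial j : (0 < j <= M.+1)%N -> exists2 C, 0 <= C & forall t z1 z2, 0 <= t ->
  t - T <= z1 -> z1 <= z2 -> z2 <= t + T ->
  prim (fun x => F j x ^+ 2) z2 - prim (fun x => F j x ^+ 2) z1 <= C * expR (kap * t).
Proof.
case: j => // j /= jM; have [C C0 HC] := bound_at jM; have [C' C0' HC'] := g_growth jM.
exists (C + T^-1 * C'); first by rewrite addr_ge0// mulr_ge0// invr_ge0 ltW.
move=> t z1 z2 t0 h1 h2 h3; have [_ _ _ h] := HC t t0; have h' := HC' t t0.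
have cF2 : continuous (fun x => F j.+1 x ^+ 2) by apply: cont_sq; exact: chain_F_cont.
have p1 := prim_mono cF2 (fun x => sqr_ge0 (F j.+1 x)) h1.
have p2 := prim_mono cF2 (fun x => sqr_ge0 (F j.+1 x)) h3.
have Ti : 0 <= T^-1 by rewrite invr_ge0 ltW.
have := ler_wpM2l Ti h'; rewrite !mul1r in h; rewrite mulrDl -mulrA; lra.
Qed.

Lemma inc_spatial j : (0 < j <= M.+1)%N -> forall t z1 z2, 0 <= t ->
  t <= z1 -> z1 <= z2 ->
  prim (fun x => H j x ^+ 2) z2 - prim (fun x => H j x ^+ 2) z1 <= A * expR (kap * t).
Proof.
move=> jM t z1 z2 t0 h1 h2.
have cH2 : continuous (fun x => H j x ^+ 2).
  by apply: cont_sq; apply: chain_H_cont; have /andP[] := jM.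
have z10 : 0 <= z1 by lra.
have z20 : 0 <= z2 by lra.
have := HA jM z20; have := prim_mono cH2 (fun x => sqr_ge0 (H j x)) z10; rewrite prim0.
have A0 : 0 <= A by have := HA jM (lexx 0); rewrite prim0.
have : A * 1 <= A * expR (kap * t).
  by apply: ler_wpM2l => //; rewrite -expR0 ler_expR mulr_ge0//; move: kap2; lra.
lra.
Qed.

(** At negative arguments the wave comes from the data and its square has integral at most A. On
    [0, t] it is y - H, and replacing the weight e^(- kap x) of the dissipation integral by 1 costs
    only the factor e^(kap t). *)
Lemma out_spatial j : (0 < j <= M.+1)%N -> exists2 C, 0 <= C & forall t z1 z2, 0 <= t ->
  z1 <= z2 -> z2 <= t ->
  prim (fun x => Gsol j x ^+ 2) z2 - prim (fun x => Gsol j x ^+ 2) z1 <= C * expR (kap * t).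
Proof.
case: j => // j /= jM; have [C C0 HC] := bound_at jM.
have jM1 : (j.+1 <= M.+1)%N by [].
have jj : (0 < j.+1 <= M.+1)%N by [].
have A0 : 0 <= A by have := HA jj (lexx 0); rewrite prim0.
exists (2 * C + 3 * A); first by rewrite addr_ge0// mulr_ge0.
move=> t z1 z2 t0 h1 h2.
have cG := Gsol_cont jM1; have cG2 := cont_sq cG.
have cy2 := cont_sq (y_cont jM1); have cH2 := cont_sq (chain_H_cont jM1).
have p1 := prim_mono cG2 (fun x => sqr_ge0 (Gsol j.+1 x)) h2.
have E1 : 1 <= expR (kap * t) by rewrite -expR0 ler_expR mulr_ge0//; move: kap2; lra.
have AE := ler_wpM2l A0 E1.
have p2 : - A <= prim (fun x => Gsol j.+1 x ^+ 2) z1.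
  have [z10|z10] := leP 0 z1.
    have := prim_mono cG2 (fun x => sqr_ge0 (Gsol j.+1 x)) z10; rewrite prim0; move: A0; lra.
  have mz : 0 <= - z1 by rewrite oppr_ge0 ltW.
  have := nA jj mz.
  have d1 (x : R) : is_derive x 1 (fun x => -1 * prim (fun x => Gsol j.+1 x ^+ 2) (-1 * x + 0))
      (Gsol j.+1 (-1 * x + 0) ^+ 2).
    by apply: der_eq (derZ (-1) (der_comp_affine (prim_is_deriveT cG2 _))) _; rewrite mulrA mulrNN !mul1r.
  have d2 := prim_is_deriveT (cont_sq (n_cont jM1)).
  have e0 : -1 * prim (fun x => Gsol j.+1 x ^+ 2) (-1 * 0 + 0) = prim (fun x => n j.+1 x ^+ 2) 0.
    by rewrite mulr0 addr0 !prim0 mulr0.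
  have <- := der_unique_ge d1 d2 e0 _ mz.
    by rewrite !mulN1r opprK addr0; lra.
  move=> x x0; rewrite /Gsol /paste ifT; last by rewrite mulN1r addr0 oppr_le0.
  by rewrite !addr0 mulrA mulrNN !mul1r.
have p3 : prim (fun x => Gsol j.+1 x ^+ 2) t <= 2 * (C * expR (kap * t)) + 2 * A.
  have [_ _ hy _] := HC t t0; have hH := HA jj t0.
  pose w x := expR (- kap * x) * y j.+1 x ^+ 2.
  have cw : continuous w by exact: wsq_cont (y_cont jM1).
  have c3 : continuous (fun x => 2 * expR (kap * t) * w x + 2 * H j.+1 x ^+ 2).
    by apply: contD; exact: contZ.
  have := @prim_le _ _ _ 0 t cG2 c3 t0; rewrite !prim0 !subr0 => h.
  apply: le_trans (h _) _ => [x /andP[x0 xt]|].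
    rewrite Gsol_pos//; apply: (le_trans (sqrB_le _ _)); rewrite lerD2r -mulrA ler_pM2l// /w mulrA -expRD.
    rewrite ler_peMl ?sqr_ge0// -expR0 ler_expR mulNr -mulrBr mulr_ge0 ?subr_ge0//.
    by move: kap2; lra.
  rewrite primD ?primZ//; try exact: contZ.
  apply: lerD; last by rewrite ler_pM2l.
  by rewrite -mulrA ler_pM2l// mulrC; apply: ler_wpM2r; rewrite ?expR_ge0.
have : prim (fun x => Gsol j.+1 x ^+ 2) z2 - prim (fun x => Gsol j.+1 x ^+ 2) z1
    <= 2 * (C * expR (kap * t)) + 3 * A by lra.
move: AE; rewrite mulr1; move: (expR _) => w AE h; apply: (le_trans h).
rewrite mulrDl; lra.
Qed.

(** At level 0 the energy bounds y pointwise. At level j.+1 the dissipation integral of level j is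
    used instead; it reaches the highest level M.+1, where the energies give no pointwise bound. *)
Lemma y_wbounded gamma j : kap < gamma -> (j <= M.+1)%N -> wbounded gamma (y j).
Proof.
move=> kg jM; have cy := y_cont jM; case: j jM cy => [_|j jM] cy.
  have [C C0 HC] := bound_at (leq0n M).
  by apply: (@wbounded_pointwise _ _ kap _ C kg cy) => t t0; have [] := HC t t0.
have [C C0 HC] := bound_at jM; apply: (wbounded_weight (ltW kg) cy).
by exists C => t t0; have [] := HC t t0.
Qed.

Lemma inc_wbounded gamma j : kap < gamma -> (0 < j <= M.+1)%N -> wbounded gamma (H j).
Proof.
move=> kg jM; have [j0 jM'] := andP jM; have cH' := chain_H_cont jM'.
apply: (@wbounded_weight _ _ 0) => //; first by move: kg kap2; lra.
exists A => t t0; apply: le_trans (HA jM t0); rewrite le_eqVlt; apply/orP; left; apply/eqP.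
by congr (prim _ t); apply/funext => x; rewrite oppr0 mul0r expR0 mul1r.
Qed.

(** At the highest order M.+2 the liquid flux condition expresses the derivative of eta through y,
    y' and the incoming wave, all of them weighted square integrable. *)
Lemma e_wbounded gamma j : kap < gamma -> (j <= M.+2)%N -> wbounded gamma (e j).
Proof.
move=> kg; rewrite leq_eqVlt => /orP[/eqP ->|jM]; last first.
  have [C C0 HC] := e_growth jM.
  by apply: (wbounded_pointwise kg _ HC); apply: chain_e_cont; exact: ltnW.
have b1 := y_wbounded kg (leqnn M.+1); have b2 := y_wbounded kg (leqnSn M).
have b3 : wbounded gamma (H M.+1) by apply: inc_wbounded => //; rewrite ltn0Sn leqnn.
have c1 := y_cont (leqnn M.+1); have c2 := y_cont (leqnSn M).
have c12 : continuous (fun t => tau * y M.+1 t + 1 * y M t) by apply: contD; exact: contZ.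
pose q := (rl * R0 ^+ 2)^-1.
apply: wbounded_eq (wbounded_lin q (- (q * (2 * tau))) c12 cH (wbounded_lin tau 1 c1 c2 b1 b2) b3) => t t0.
have := chain_liq chain (leqnn M) t0.
rewrite /liq_residual => hE.
have {hE} : rl * R0 ^+ 2 * e M.+2 t = tau * y M.+1 t + y M t - 2 * tau * H M.+1 t.
  by rewrite /y /liq_trace' /liq_trace in hE *; rewrite /gas_trace' in hE; rewrite /gas_trace in hE *; lra.
move=> /(congr1 (fun x => q * x)); rewrite mulrA mulVf ?mul1r; last by rewrite gt_eqF// mulr_gt0// exprn_gt0.
by move=> ->; ring.
Qed.

Lemma gas_wbounded gamma j : kap < gamma -> (j <= M.+1)%N -> wbounded gamma (gas_trace T (F j)).
Proof.
move=> kg jM; have c1 := y_cont jM; have c2 := chain_e_cont (leqW jM).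
apply: wbounded_eq (wbounded_lin 1 (- s) c1 c2 (y_wbounded kg jM) (e_wbounded kg (leqW jM))) => t _.
by rewrite mul1r mulNr /y /liq_trace addrK.
Qed.

End chain_bounds.

Section square_bounds.
Context {R : realType}.
Implicit Types (f g : R -> R).

Lemma prim_comp_affine f k b t : k != 0 -> continuous f ->
  prim (fun s => f (k * s + b)) t = k^-1 * (prim f (k * t + b) - prim f b).
Proof.
move=> k0 cf.
apply: (@der_unique _ _ (fun t => k^-1 * (prim f (k * t + b) - prim f b)) (fun s => f (k * s + b)) 0) => [x|x|].
- by apply: prim_is_deriveT; exact: cont_affine.
- apply: der_eq (derZ _ (derB (der_comp_affine (prim_is_deriveT cf _)) (der_cst x _))) _.
  by rewrite subr0 mulrA mulVf ?mul1r.
- by rewrite prim0 mulr0 add0r subrr mulr0.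
Qed.

Lemma prim_le_Rintegral (I : set R) f a b : measurable I -> continuous f -> (forall x, 0 <= f x) ->
  leb.-integrable I (EFin \o f) -> a <= b -> `]a, b[ `<=` I ->
  prim f b - prim f a <= \int[leb]_(x in I) f x.
Proof.
move=> mI cf f0 If ab abI; have lf := continuous_loc_int cf.
rewrite prim_sub// -Rintegral_itv_oo//; rewrite -lee_fin.
have Iab : leb.-integrable `]a, b[ (EFin \o f) by apply: integrableS If => //.
rewrite (@Rintegral_EFin _ _ R leb I mI f If).
have mab : measurable `]a, b[%classic by exact: measurable_itv.
rewrite (@Rintegral_EFin _ _ R leb _ mab f Iab).
apply: ge0_subset_integral => //; first by have /integrableP[] := If.
by move=> x _; rewrite lee_fin.
Qed.

Lemma finite_bound (P : nat -> R -> Prop) n : (forall j A B, A <= B -> P j A -> P j B) ->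
  (forall j, (j <= n)%N -> exists A, P j A) -> exists A, forall j, (j <= n)%N -> P j A.
Proof.
move=> mono; elim: n => [|n IH] H.
  by have [A HA] := H 0%N (leqnn _); exists A => j; rewrite leqn0 => /eqP ->.
have [A HA] := IH (fun j jn => H j (leqW jn)); have [B HB] := H n.+1 (leqnn _).
exists (Num.max A B) => j; rewrite leq_eqVlt => /orP[/eqP ->|jn].
  by apply: mono HB; rewrite le_max lexx orbT.
by apply: mono (HA j jn); rewrite le_max lexx.
Qed.

(** The sign e treats the incoming and the outgoing half of d'Alembert's formula at once; the travel
    time s becomes the position c s + x0. *)
Lemma dalembert_square_bound c x0 (I : set R) (W D : R -> R) : measurable I -> 0 < c ->
  continuous W -> continuous D -> L2 (cst 1) I W -> L2 (cst 1) I D ->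
  (forall x, x0 < x -> I x) ->
  exists A, forall e t, `|e| = 1 -> 0 <= t ->
    prim (fun s => (2^-1 * (W (c * s + x0) + e * (c * D (c * s + x0)))) ^+ 2) t <= A.
Proof.
move=> mI c0 cW cD LW LD HI.
pose q x := 2^-1 * W x ^+ 2 + 2^-1 * c ^+ 2 * D x ^+ 2.
have q0 x : 0 <= q x by apply: addr_ge0; apply: mulr_ge0; rewrite ?sqr_ge0// mulr_ge0 ?sqr_ge0.
have cq : continuous q by apply: contD; apply: contZ; exact: cont_sq.
have Iq : leb.-integrable I (EFin \o q).
  by apply: lebD => //; apply: lebZ => //; exact: L2_integrable.
exists (c^-1 * \int[leb]_(x in I) q x) => e t e1 t0.
have c3 : continuous (fun s => (2^-1 * (W (c * s + x0) + e * (c * D (c * s + x0)))) ^+ 2).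
  apply: cont_sq; apply: contZ; apply: contD; first exact: cont_affine.
  by do 2!apply: contZ; exact: cont_affine.
have c4 : continuous (fun s => q (c * s + x0)) by exact: cont_affine.
have := @prim_le _ _ _ 0 t c3 c4 t0; rewrite !prim0 !subr0 => h.
apply: le_trans (h _) _ => [x _|].
  rewrite exprMn; have := sqrD_le (W (c * x + x0)) (e * (c * D (c * x + x0))).
  rewrite !exprMn -[e ^+ 2](real_normK (num_real e)) e1 expr1n mul1r /q.
  have -> : (2^-1 : R) ^+ 2 = 2^-1 * 2^-1 by rewrite expr2.
  move: (W _ ^+ 2) (D _ ^+ 2) => w d; set z := (_ + _) ^+ 2 => hz.
  have -> : 2^-1 * w + 2^-1 * c ^+ 2 * d = 2^-1 * 2^-1 * (2 * w + 2 * (c ^+ 2 * d)) by field.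
  by apply: ler_wpM2l => //; rewrite mulr_ge0 ?invr_ge0.
rewrite prim_comp_affine ?gt_eqF// ler_pM2l ?invr_gt0//.
apply: prim_le_Rintegral => //; first by rewrite lerDr mulr_ge0// ltW.
by move=> x /=; rewrite in_itv/= => /andP[h1 _]; exact: HI.
Qed.

End square_bounds.

(** * Classical solution in travelling waves for admissible data *)

Section classical.
Context {R : realType}.
Variables (R0 sigma sigmas kap gamma : R) (rho c : phase -> R) (M : nat).
Variables (V0 V1 : phase -> R -> R) (eta0 zeta0 : R).
Hypotheses (R00 : 0 < R0) (rho0 : forall a, 0 < rho a) (c0 : forall a, 0 < c a)
  (sg0 : 0 < sigma) (sgs : sigma <= sigmas) (kap2 : 2 <= kap) (kapg : kap < gamma)
  (kapE : (2 * sigmas) ^+ 2 * (5 * (R0 / c liquid) + 1) <= kap * sigmas * (rho liquid * R0 ^+ 3)).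

(** The affine function slope * r + offset is the travel time r/c_g from the origin in the gas and
    (r - R0)/c_l from the interface in the liquid. With it both phases are a sum of P, moving
    inwards, and N, moving outwards. *)
Definition slope a : R := (c a)^-1.
Definition offset a : R := match a with gas => 0 | liquid => - (R0 / c liquid) end.
Definition wave (P N : phase -> nat -> R -> R) a j r t : R :=
  P a j (1 * t + (slope a * r + offset a)) + N a j (1 * t + - (slope a * r + offset a)).

Definition dom_closed a (x y : R) : Prop :=
  match a with gas => 0 <= x /\ y <= R0 | liquid => R0 <= x end.

(** All that the verification needs from the construction. [cl_spatial] bounds the squares of the
    waves over the travel times that a segment [x, y] of the closed domain sees at time t. *)
Record classical_solution (P N : phase -> nat -> R -> R) (e : nat -> R -> R) : Prop := ClassicalSolution {
  cl_P : forall a j, (j <= M)%N -> forall t : R, is_derive t 1 (P a j) (P a j.+1 t);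
  cl_N : forall a j, (j <= M)%N -> forall t : R, is_derive t 1 (N a j) (N a j.+1 t);
  cl_Pc : forall a, continuous (P a M.+1);
  cl_Nc : forall a, continuous (N a M.+1);
  cl_e : forall j, (j <= M.+1)%N -> forall t : R, is_derive t 1 (e j) (e j.+1 t);
  cl_ec : continuous (e M.+2);
  cl_e0 : e 0%N 0 = eta0;
  cl_e1 : e 1%N 0 = zeta0;
  cl_init0 : forall a, {ae leb, forall r : R, dom R0 a r -> V0 a r = wave P N a 0%N r 0};
  cl_init1 : forall a, {ae leb, forall r : R, dom R0 a r -> V1 a r = wave P N a 1%N r 0};
  cl_origin : forall t, wave P N gas 0%N 0 t = 0;
  cl_jump : forall t, 0 <= t ->
    wave P N liquid 0%N R0 t - wave P N gas 0%N R0 t = 2 * sigma / R0 * e 0%N t;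
  cl_flux : forall a t, 0 <= t -> (rho a * R0 ^+ 2)^-1 *
    (R0 * (slope a * (P a 1%N (1 * t + (slope a * R0 + offset a))
                      - N a 1%N (1 * t + - (slope a * R0 + offset a))))
     - wave P N a 0%N R0 t) = - e 2%N t;
  cl_ebound : forall j, (j <= M.+2)%N -> wbounded gamma (e j);
  cl_trace : forall a j, (j <= M.+1)%N -> wbounded gamma (wave P N a j R0);
  cl_spatial : forall a j, (0 < j <= M.+1)%N -> exists2 C, 0 <= C &
    forall t x y, 0 <= t -> x <= y -> dom_closed a x y ->
    prim (fun z => P a j z ^+ 2) (1 * t + (slope a * y + offset a))
    - prim (fun z => P a j z ^+ 2) (1 * t + (slope a * x + offset a)) <= C * expR (kap * t) /\
    prim (fun z => N a j z ^+ 2) (1 * t + - (slope a * x + offset a))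
    - prim (fun z => N a j z ^+ 2) (1 * t + - (slope a * y + offset a)) <= C * expR (kap * t) }.

Let V a j := Vseq R0 c V0 V1 a j.
Let E := Eseq R0 rho c V0 V1 eta0 zeta0.

Hypothesis dc : data_class R0 sigma rho c M.+1 V0 V1 eta0 zeta0.

Let prof a : exists W D : nat -> R -> R, forall j, (j <= M.+1)%N ->
  profile_at (dom R0 a) (c a) M (V a) (W j) (D j) (W j.+2) j.
Proof.
have [H0 H1 _] := dc.
have H := (@profile R (dom R0 a) (c a) M (V a) (@dom_interval R R0 a) (dom_nonempty R00 a) (@dom_open R R0 a) (c0 a) (fun j => erefl) (H0 a) (H1 a)).
have [W [D HW]] := H; exists W, D => j jM. exact: HW.
Qed.

Let W a := sval (cid (prof a)).
Let D a := sval (cid (svalP (cid (prof a)))).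
Let WD a j : (j <= M.+1)%N -> profile_at (dom R0 a) (c a) M (V a) (W a j) (D a j) (W a j.+2) j.
Proof. by move: j; exact: svalP (cid (svalP (cid (prof a)))). Qed.

Let dW a j : (j <= M)%N -> forall x : R, is_derive x 1 (W a j) (D a j x).
Proof. by move=> jM; have [] := prof_der (WD a (leqW jM)) jM. Qed.
Let cW a j (jM : (j <= M.+1)%N) : continuous (W a j) := prof_cont (WD a jM).
Let cD a j : (j <= M)%N -> continuous (D a j).
Proof. by move=> jM; have [] := prof_der (WD a (leqW jM)) jM. Qed.
Let dD a j : (j < M)%N -> forall x : R, is_derive x 1 (D a j) (c a ^- 2 * W a j.+2 x).
Proof. by move=> jM; exact: prof_der2 (WD a (leqW (ltnW jM))) jM. Qed.

Let p a j := inc (c a) (match a with gas => 0 | liquid => R0 end) (W a) (D a) j.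
Let n a j := out (c a) (match a with gas => 0 | liquid => R0 end) (W a) (D a) j.
Let dp a j : (j <= M)%N -> forall s : R, is_derive s 1 (p a j) (p a j.+1 s).
Proof. by move=> jM s; exact: (inc_der _ (c0 a) (@dW a) (@cW a _ (leqnn _)) (@dD a) jM s). Qed.
Let dn a j : (j <= M)%N -> forall s : R, is_derive s 1 (n a j) (- n a j.+1 s).
Proof. by move=> jM s; exact: (out_der _ (c0 a) (@dW a) (@cW a _ (leqnn _)) (@dD a) jM s). Qed.
Let cp a j : (j <= M.+1)%N -> continuous (p a j).
Proof. by move=> jM; exact: (inc_cont (@dW a) (@cW a _ (leqnn _)) (@cD a _ (leqnn M)) (@dD a) jM). Qed.
Let cn a j : (j <= M.+1)%N -> continuous (n a j).
Proof. by move=> jM; exact: (out_cont (@dW a) (@cW a _ (leqnn _)) (@cD a _ (leqnn M)) (@dD a) jM). Qed.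

Let data_trace a b j : closure (dom R0 a) b -> (j <= M.+1)%N -> trace (dom R0 a) b (V a j) = W a j b.
Proof.
by move=> cb jM; apply: trace_profile => //; [exact: cW|exact: prof_ae (WD a jM)].
Qed.

Let data_flux a j : (j <= M)%N -> flux R0 rho a (V a j) = (rho a * R0 ^+ 2)^-1 * (R0 * D a j R0 - W a j R0).
Proof.
move=> jM; have H := WD a (leqW jM); have [_ _ w _] := prof_der H jM.
apply: flux_profile => //; [exact: cW (leqW jM)|exact: cD|exact: prof_ae H].
Qed.

Let W00 j : (j <= M.+1)%N -> W gas j 0 = 0.
Proof.
move=> jM; have [_ _ H] := dc; have [h _ _] := H j jM.
by rewrite -(data_trace (closure_gas0 R00) jM).
Qed.

Let W_jump j : (j <= M.+1)%N -> W liquid j R0 - W gas j R0 = 2 * sigma / R0 * E j.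
Proof.
move=> jM; have [_ _ H] := dc; have [_ _ h] := H j jM.
by rewrite -!(data_trace (closure_dom R00 _) jM).
Qed.

Let W_flux a j : (j <= M)%N -> R0 * D a j R0 - W a j R0 = - (rho a * R0 ^+ 2 * E j.+2).
Proof.
move=> jM; have [H0 H1 H] := dc; have [_ h _] := H j (leqW jM).
(* For j <= M the class gives H^(M + 2 - j), hence at least H^2 in both phases, so the conditional
   flux identity of the data class can be applied. *)
have HV b : Hk 2 (dom R0 b) (V b j).
  have h2 := @Vseq_Hk R (dom R0 b) (c b) M (V b) (fun j => erefl) (H0 b) (H1 b) _ _ (subnKC (leqW (leqW jM))).
  move=> i i2; apply: h2; apply: leq_trans i2 _.
  by rewrite leq_subRL ?addn2 ?ltnS// leqW// leqW.
have rR b : rho b * R0 ^+ 2 != 0 by rewrite gt_eqF// mulr_gt0// exprn_gt0.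
have E2 b : E j.+2 = - flux R0 rho b (V b j).
  by case: b => //; rewrite -h//; exact: HV.
by rewrite (E2 a) data_flux// mulrN opprK mulrA divff// mul1r.
Qed.

Let s := 2 * sigma / R0.
Let T := R0 / c gas.
Let tau := R0 / c liquid.
(** The form F(t + r/c) - F(t - r/c) makes the gas field vanish at the origin. The data part of F is
    the incoming half p for s >= 0 and - n(- s) for s <= 0; the halves match at 0 because V_g^[j]
    vanishes at the origin. *)
Let F0 j := paste 0 (fun s => -1 * n gas j (-1 * s + 0)) (p gas j).

Let F0_der j : (j <= M)%N -> forall t : R, is_derive t 1 (F0 j) (F0 j.+1 t).
Proof.
move=> jM t; apply: (@paste_der _ 0 M (fun j s => -1 * n gas j (-1 * s + 0)) (p gas) _ _ _ j jM t).
- by move=> i iM x; apply: der_eq (derZ (-1) (der_comp_affine (dn gas iM _))) _; ring.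
- exact: dp.
- by move=> i iM; rewrite mulr0 addr0 /n /p /out /inc /= !mulr0 !add0r W00//; ring.
Qed.

Let F0_cont : continuous (F0 M.+1).
Proof.
apply: paste_cont.
- by apply: contZ; apply: cont_affine; exact: cn.
- exact: cp.
- by rewrite mulr0 addr0 /n /p /out /inc /= !mulr0 !add0r W00//; ring.
Qed.

Let T0 : 0 < T. Proof. by rewrite divr_gt0. Qed.
Let cT : c gas * T = R0. Proof. by rewrite /T mulrC divfK// gt_eqF. Qed.
Let F0p j x : 0 <= x -> (j <= M.+1)%N -> F0 j x = p gas j x.
Proof.
move=> x0 jM; rewrite /F0 /paste; case: ifPn => // x1.
have -> : x = 0 by apply/le_anti; rewrite x0 x1.
by rewrite mulr0 addr0 /n /p /out /inc /= !mulr0 !add0r W00//; ring.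
Qed.
Let F0m j x : 0 <= x -> F0 j (- x) = - n gas j x.
Proof. by move=> x0; rewrite /F0 /paste oppr_le0 x0 !mulN1r opprK addr0. Qed.

Let gas_diff j x : (j <= M.+1)%N -> 0 <= x -> F0 j x - F0 j (- x) = W gas j (c gas * x).
Proof. by move=> jM x0; rewrite F0p// F0m// /n /p /out /inc /= !addr0; field. Qed.
Let gas_sum j x : (j <= M)%N -> 0 <= x -> F0 j.+1 x + F0 j.+1 (- x) = c gas * D gas j (c gas * x).
Proof. by move=> jM x0; rewrite F0p// F0m// /n /p /out /inc /= !addr0; field. Qed.

Let compat_gas j : (j <= M)%N -> T * (F0 j.+1 T + F0 j.+1 (- T))
     - (F0 j T - F0 j (- T)) + rho gas * R0 ^+ 2 * E j.+2 = 0.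
Proof.
move=> jM; rewrite gas_diff ?leqW// ?ltW// gas_sum// ?ltW// cT.
by have := W_flux gas jM; rewrite mulrA (mulrC T) cT; move: (R0 * _) => u; lra.
Qed.

Let compat_liq j : (j <= M)%N ->
     tau * (F0 j.+1 T - F0 j.+1 (- T) + s * E j.+1) + (F0 j T - F0 j (- T) + s * E j)
     - rho liquid * R0 ^+ 2 * E j.+2 - 2 * tau * p liquid j.+1 0 = 0.
Proof.
move=> jM; rewrite !gas_diff ?ltW// ?leqW// cT.
have w i (iM : (i <= M.+1)%N) : W gas i R0 + s * E i = W liquid i R0.
  by rewrite -W_jump//; ring.
rewrite (w _ (leqW jM)) (w j.+1)//; have h := W_flux liquid jM.
have -> : p liquid j.+1 0 = 2^-1 * (W liquid j.+1 R0 + c liquid * D liquid j R0).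
  by rewrite /p /inc /= mulr0 add0r.
transitivity (- (R0 * D liquid j R0 - W liquid j R0) - rho liquid * R0 ^+ 2 * E j.+2).
  by rewrite /tau; field; rewrite gt_eqF.
by rewrite h; ring.
Qed.

Let chain : exists F e, wave_chain T R0 (rho gas) (rho liquid) tau sigma M F0 (p liquid) E F e.
Proof.
apply: chain_solution => //; first by rewrite divr_gt0.
- exact: dp.
- exact: cp.
Qed.

Let IR0 : measurable (dom R0 liquid). Proof. by apply: open_measurable; exact: dom_open. Qed.

Let square_bound : exists A, forall j, (j <= M)%N -> forall t, 0 <= t ->
  prim (fun s => p liquid j.+1 s ^+ 2) t <= A /\ prim (fun s => n liquid j.+1 s ^+ 2) t <= A.
Proof.
apply: (@finite_bound _ (fun j A => forall t, 0 <= t ->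
  prim (fun s => p liquid j.+1 s ^+ 2) t <= A /\ prim (fun s => n liquid j.+1 s ^+ 2) t <= A)).
  by move=> j A B AB H t t0; have [h1 h2] := H t t0; split; exact: le_trans AB.
move=> j jM; have [_ cDj _ LD] := prof_der (WD liquid (leqW jM)) jM.
have j1 : (j.+1 <= M.+1)%N by [].
have [|A HA] := dalembert_square_bound IR0 (c0 liquid) (cW j1) cDj (prof_L2 (WD liquid j1)) LD (x0 := R0).
  by move=> x h; rewrite /= in_itv/= h.
exists A => t t0; split.
  apply: le_trans (HA 1 t (normr1 _) t0); rewrite le_eqVlt; apply/orP; left; apply/eqP.
  by congr (prim _ t); apply/funext => x; rewrite /p /inc /= mul1r.
apply: le_trans (HA (-1) t _ t0); last by rewrite normrN1.
rewrite le_eqVlt; apply/orP; left; apply/eqP.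
by congr (prim _ t); apply/funext => x; rewrite /n /out /= mulN1r.
Qed.
Section with_chain.
Variables (F e : nat -> R -> R) (A : R).
Hypothesis hch : wave_chain T R0 (rho gas) (rho liquid) tau sigma M F0 (p liquid) E F e.
Hypothesis HA : forall j, (j <= M)%N -> forall t, 0 <= t ->
  prim (fun s => p liquid j.+1 s ^+ 2) t <= A /\ prim (fun s => n liquid j.+1 s ^+ 2) t <= A.

Let FE j t : (j <= M.+1)%N -> t <= T -> F j t = F0 j t := chain_F0 hch (t := t).

(** The data half and the interface half of the outgoing liquid wave meet at t = 0: this is the jump
    condition on the data at level j. *)
Let nH j : (j <= M.+1)%N -> n liquid j 0 = liq_trace T R0 sigma (F j) (e j) 0 - p liquid j 0.
Proof.
move=> jM; have TT : - T <= T by move: T0; lra.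
rewrite /liq_trace /gas_trace mulr0 !add0r !FE// (chain_e0 hch (leqW jM)) gas_diff ?ltW// cT.
rewrite -/s (_ : s * E j = W liquid j R0 - W gas j R0); last by rewrite W_jump.
by rewrite /n /p /out /inc mulr0 add0r; field.
Qed.

Definition Pwave a j := match a with gas => F j | liquid => p liquid j end.
Definition Nwave a j := match a with gas => fun t : R => -1 * F j t
  | liquid => Gsol T R0 sigma (p liquid) F e (n liquid) j end.

Let sT : slope gas * R0 + offset gas = T.
Proof. by rewrite /slope /offset addr0 mulrC. Qed.
Let s0 : slope liquid * R0 + offset liquid = 0.
Proof. by rewrite /slope /offset mulrC subrr. Qed.

Let gas_wave j t : wave Pwave Nwave gas j R0 t = gas_trace T (F j) t.
Proof. by rewrite /wave sT /gas_trace /= mulN1r. Qed.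

Let G_pos j t : (j <= M.+1)%N -> 0 <= t ->
  Nwave liquid j t = liq_trace T R0 sigma (F j) (e j) t - p liquid j t.
Proof. by move=> jM t0; exact: (Gsol_pos nH jM t0). Qed.

Let liquid_wave j t : (j <= M.+1)%N -> 0 <= t ->
  wave Pwave Nwave liquid j R0 t = liq_trace T R0 sigma (F j) (e j) t.
Proof.
move=> jM t0; rewrite /wave s0 oppr0 !addr0 mul1r G_pos//= addrC subrK//.
Qed.

(** At t = 0 every argument falls where the waves are given by the data: between - T and T in the
    gas, and at nonpositive arguments for the outgoing wave in the liquid. *)
Let init a j r : (j <= M.+1)%N -> dom R0 a r -> wave Pwave Nwave a j r 0 = W a j r.
Proof.
move=> jM; rewrite /wave mulr0 !add0r; case: a => /=; rewrite in_itv/= ?andbT.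
- move=> r0; rewrite /slope /offset; set x := (c liquid)^-1 * r + - (R0 / c liquid).
  have x0 : - x <= 0 by rewrite oppr_le0 /x mulrC subr_ge0 ler_pM2r ?invr_gt0// ltW.
  rewrite /Gsol /paste x0 addr0 mulN1r opprK /n /p /out /inc.
  rewrite (_ : c liquid * x + R0 = r); last by rewrite /x; field; rewrite gt_eqF.
  by field.
- move=> /andP[r0 rR]; rewrite /slope /offset addr0.
  have x0 : 0 <= (c gas)^-1 * r by rewrite mulr_ge0 ?invr_ge0// ltW.
  have xT : (c gas)^-1 * r <= T by rewrite /T mulrC ler_pM2r ?invr_gt0// ltW.
  rewrite mulN1r !FE//; last by move: T0; lra.
  by rewrite gas_diff// mulrA divff ?mul1r// gt_eqF.
Qed.

(** The free weight K of eta'^2 in the energy is taken to be [sigmas]: then sg + K <= 2 sigmas, and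
    the growth rate does not see sigma itself. *)
Let kapE' : (sigma + sigmas) ^+ 2 * (5 * tau + 1) <= kap * sigmas * (rho liquid * R0 ^+ 3).
Proof.
apply: le_trans kapE; have t0 : 0 < tau by rewrite divr_gt0.
have -> : 2 * sigmas = sigmas + sigmas by ring.
apply: ler_wpM2r; first by move: t0; lra.
by rewrite lerXn2r ?nnegrE ?lerD2r//; move: (sg0) (sgs); lra.
Qed.

Let K0 : 0 < sigmas. Proof. exact: lt_le_trans sgs. Qed.
Let t0' : 0 < tau. Proof. by rewrite divr_gt0. Qed.
Let HA1 j t : (0 < j <= M.+1)%N -> 0 <= t -> prim (fun s => p liquid j s ^+ 2) t <= A.
Proof. by case: j => // j /= jM t0; have [] := HA jM t0. Qed.
Let nA1 j t : (0 < j <= M.+1)%N -> 0 <= t -> prim (fun s => n liquid j s ^+ 2) t <= A.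
Proof. by case: j => // j /= jM t0; have [] := HA jM t0. Qed.
Let dpl j (jM : (j <= M)%N) := dp liquid jM.
Let dnl j (jM : (j <= M)%N) := dn liquid jM.
Let cpl : continuous (p liquid M.+1). Proof. exact: cp. Qed.
Let cnl : continuous (n liquid M.+1). Proof. exact: cn. Qed.

Lemma classical_constructed : classical_solution Pwave Nwave e.
Proof.
split.
- by case=> j jM t; [exact: dp|exact: (chain_F hch jM)].
- case=> j jM t; last exact: derZ (chain_F hch jM t).
  exact: (Gsol_der hch dpl dnl nH jM t).
- by case; [exact: cpl|exact: chain_Fcont hch].
- case; first exact: (Gsol_cont hch dpl cpl dnl cnl nH (leqnn _)).
  by apply: contZ; exact: chain_Fcont hch.
- exact: chain_e hch.
- exact: chain_econt hch.
- exact: (chain_e0 hch).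
- exact: (chain_e0 hch).
- by move=> a; apply: ae_imp (prof_ae (WD a (leq0n _))) _ => r h ar; rewrite init// -h.
- by move=> a; apply: ae_imp (prof_ae (WD a (ltn0Sn _))) _ => r h ar; rewrite init// -h.
- by move=> t; rewrite /wave /= mulr0 addr0 oppr0 mulN1r subrr.
- by move=> t t0; rewrite gas_wave liquid_wave// /liq_trace; ring.
- case=> t t0; rewrite ?gas_wave ?liquid_wave//.
  + rewrite s0 oppr0 !addr0 mul1r G_pos//=.
    have := chain_liq hch (leq0n M) t0; rewrite /liq_residual.
    rewrite (_ : liq_trace' T R0 sigma (F 1%N) (e 1%N) t = liq_trace T R0 sigma (F 1%N) (e 1%N) t)//.
    set y1 := liq_trace _ _ _ (F 1%N) _ t; set y0 := liq_trace _ _ _ _ _ t => h.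
    apply: (mulfI (_ : rho liquid * R0 ^+ 2 != 0)); first by rewrite gt_eqF// mulr_gt0// exprn_gt0.
    rewrite [LHS]mulrA divff ?mul1r; last by rewrite gt_eqF// mulr_gt0// exprn_gt0.
    rewrite (_ : R0 * (slope liquid * (p liquid 1%N t - (y1 - p liquid 1%N t))) = 2 * tau * p liquid 1%N t - tau * y1); last by rewrite /tau /slope; ring.
    by move: h; lra.
  + rewrite sT /= mulN1r opprK.
    have h := chain_gas hch (leq0n M) t0; rewrite /gas_residual in h.
    apply: (mulfI (_ : rho gas * R0 ^+ 2 != 0)); first by rewrite gt_eqF// mulr_gt0// exprn_gt0.
    rewrite [LHS]mulrA divff ?mul1r; last by rewrite gt_eqF// mulr_gt0// exprn_gt0.
    rewrite !mul1r in h; rewrite mulrA (_ : R0 * slope gas = T)//; move: h; lra.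
- by move=> j jM; exact: (e_wbounded (c0 gas) R00 (rho0 gas) (rho0 liquid) t0' K0 erefl kap2 kapE' hch dpl cpl HA1 kapg jM).
- case=> j jM; last first.
    rewrite (_ : wave _ _ _ _ _ = gas_trace T (F j)); last by apply/funext => t; exact: gas_wave.
    exact: (gas_wbounded (c0 gas) R00 (rho0 gas) (rho0 liquid) t0' K0 erefl kap2 kapE' hch dpl cpl HA1 kapg jM).
  apply: wbounded_eq (y_wbounded (c0 gas) R00 (rho0 gas) (rho0 liquid) t0' K0 erefl kap2 kapE' hch dpl cpl HA1 kapg jM).
  by move=> t t0; rewrite liquid_wave.
- have k0 a : 0 <= slope a by rewrite invr_ge0 ltW.
  case=> j jM.
    have [C C0 HC] := out_spatial (c0 gas) R00 (rho0 gas) (rho0 liquid) t0' K0 erefl kap2 kapE' hch dpl cpl dnl cnl HA1 nA1 nH jM.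
    have A0 : 0 <= A by have := HA1 jM (lexx 0); rewrite prim0.
    exists (C + A); first by rewrite addr_ge0.
    move=> t x y t0 xy Rx; have kx := ler_wpM2l (k0 liquid) xy; have kR := ler_wpM2l (k0 liquid) Rx.
    have := s0 => s0'; rewrite mulrDl.
    have h1 := mulr_ge0 C0 (expR_ge0 (kap * t)); have h2 := mulr_ge0 A0 (expR_ge0 (kap * t)).
    split.
      apply: (@le_trans _ _ (A * expR (kap * t))); last by rewrite lerDr.
      by apply: (inc_spatial kap2 dpl cpl HA1 jM) => //; rewrite mul1r; lra.
    apply: (@le_trans _ _ (C * expR (kap * t))); last by rewrite lerDl.
    by apply: HC => //; rewrite mul1r; lra.
  have [C C0 HC] := gas_spatial (c0 gas) R00 (rho0 gas) (rho0 liquid) t0' K0 erefl kap2 kapE' hch dpl cpl HA1 jM.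
  exists C => // t x y t0 xy [Rx yR]; have kx := ler_wpM2l (k0 gas) xy.
  have kR := ler_wpM2l (k0 gas) yR; have x0 := mulr_ge0 (k0 gas) Rx; have := sT => sT'.
  have sq : (fun z => Nwave gas j z ^+ 2) = (fun z => F j z ^+ 2).
    by apply/funext => z; rewrite /= mulN1r sqrrN.
  have o0 : offset gas = 0 by [].
  rewrite o0 addr0 in sT'; rewrite sT' in kR.
  rewrite -/T in HC.
  by rewrite sq o0 !addr0 !mul1r; split; apply: HC => //; move: (T0) kR kx x0; lra.
Qed.
End with_chain.

Lemma classical_exists : exists P N e, classical_solution P N e.
Proof.
have [F [e hch]] := chain; have [A HA] := square_bound.
by exists (Pwave F), (Nwave F e), e; exact: classical_constructed hch HA.
Qed.

End classical.

(** * The travelling waves are a weighted solution *)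

Section convolution.
Context {R : realType}.
Variables (I : set R) (k : R).
Hypothesis oI : open I.
Implicit Types (f psi : R -> R).
Let mI : measurable I. Proof. exact: open_measurable. Qed.

(** A travelling wave paired with a test function in one variable, as a function of the shift due to
    the other. Pairing in time has k = 1; pairing in space has k equal to plus or minus the
    slope. *)
Definition tconv f psi y : R := \int[leb]_(x in I) (f (k * x + y) * psi x).

Lemma conv_integrable f psi y : continuous f -> test_fun I psi ->
  leb.-integrable I (EFin \o (fun x => f (k * x + y) * psi x)).
Proof.
by move=> cf tp; apply: integrable_test => //; apply: continuous_locally_integrable => //; exact: cont_affine.
Qed.

Lemma conv_der f f' psi (y : R) : continuous f' -> (forall t : R, is_derive t 1 f (f' t)) ->
  test_fun I psi -> is_derive y 1 (tconv f psi) (tconv f' psi y).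
Proof.
move=> cf' df tp; have cf := der_continuousT df.
have [M M0 HM] := test_bounded_supp tp; have cp := test_continuous tp.
(* Bounds |k t + x| for t in the support of psi and x within distance 1 of y, hence the range of f'
   that the dominating function has to cover. *)
pose L := `|k| * M + `|y| + 1.
have [C C0 HC] := continuous_bounded_segment (- L) L cf'.
have Hd (z x : R) : is_derive z 1 (fun y => f (k * x + y) * psi x) (f' (k * x + z) * psi x).
  have d1 : is_derive z 1 (fun y => f (1 * y + k * x)) (1 * f' (1 * z + k * x)).
    exact: der_comp_affine (df _).
  have := derM d1 (der_cst z (psi x)); rewrite mulr0 addr0 !mul1r [z + _]addrC.
  by under eq_fun do rewrite mul1r [_ + k * x]addrC.
have Ip : leb.-integrable I (EFin \o (fun x => C * `|psi x|)).
  apply: lebZ => //; have i1 := integrable_test (continuous_locally_integrable oI (@cont_cst R 1)) tp.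
  have : leb.-integrable I (EFin \o psi) by apply: leb_eq i1 => // x _; rewrite mul1r.
  by move=> /integrable_abse; apply: eq_integrable => // x _ /=.
pose u := y - 1; pose v := y + 1.
have Ia : `]u, v[%classic y by rewrite /= in_itv/= /u /v; apply/andP; split; lra.
have intf x : `]u, v[%classic x -> leb.-integrable I (EFin \o (fun t => f (k * t + x) * psi t)).
  by move=> _; exact: conv_integrable.
have dd x t : `]u, v[%classic x -> I t -> derivable (fun y => f (k * t + y) * psi t) x 1.
  by move=> _ _; have [] := Hd x t.
have G0 t : 0 <= C * `|psi t| by rewrite mulr_ge0.
have Gub x t : `]u, v[%classic x -> I t -> `|partial1of2 (fun y t => f (k * t + y) * psi t) x t| <= C * `|psi t|.
  rewrite /= in_itv/= => /andP[ux xv] _.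
  rewrite partial1of2E; have -> := @derive_val _ _ _ _ _ _ _ (Hd x t).
  rewrite normrM; have [tM|tM] := boolP (- M <= t <= M); last first.
    by rewrite (HM t (negP tM)) normr0 !mulr0.
  apply: ler_wpM2r => //; apply: HC.
  have : `|k * t + x| <= L.
    apply: (le_trans (ler_normD _ _)); rewrite /L normrM -addrA; apply: lerD.
      by apply: ler_wpM2l => //; rewrite ler_norml.
    rewrite (_ : x = y + (x - y)); last by ring.
    apply: (le_trans (ler_normD _ _)); rewrite lerD2l ler_norml /u /v in ux xv *; lra.
  by rewrite ler_norml.
have D1 := (@derivable_under_integral R _ _ leb _ I mI y u v Ia intf dd _ G0 Ip Gub).
have D2 := (@differentiation_under_integral R _ _ leb _ I mI y u v Ia intf dd _ G0 Ip Gub).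
apply: DeriveDef => //; rewrite -derive1E D2; apply: eqRint => t _.
by rewrite partial1of2E; exact: (@derive_val _ _ _ _ _ _ _ (Hd y t)).
Qed.

Lemma conv_parts f f' psi (y : R) : k != 0 -> continuous f' -> (forall t : R, is_derive t 1 f (f' t)) ->
  test_fun I psi -> tconv f' psi y = - (k^-1 * tconv f (derive1 psi) y).
Proof.
move=> k0 cf' df tp.
have h := @test_by_parts R I psi (fun x => f (k * x + y)) (fun x => k * f' (k * x + y)) oI tp.
have h1 : continuous (fun x => k * f' (k * x + y)) by apply: contZ; exact: cont_affine.
rewrite /tconv (h h1 (fun x => der_comp_affine (df _))).
rewrite mulrN opprK.
rewrite [in RHS](@eqRint R _ (fun x => k * (f' (k * x + y) * psi x))); last by move=> x _; rewrite mulrA.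
by rewrite RintegralZl ?mulrA ?mulVf ?mul1r//; exact: conv_integrable.
Qed.

Lemma conv_cont f f' psi : k != 0 -> continuous f' -> (forall t : R, is_derive t 1 f (f' t)) ->
  test_fun I psi -> continuous (tconv f' psi).
Proof.
move=> k0 cf' df tp.
rewrite (_ : tconv f' psi = fun y => (- k^-1) * tconv f (derive1 psi) y); last first.
  by apply/funext => y; rewrite mulNr; exact: conv_parts.
apply: contZ; apply: (@der_continuousT _ _ (tconv f' (derive1 psi))) => y.
by apply: conv_der => //; exact: test_derive1.
Qed.

End convolution.

(** * Integrability on products from bounds on iterated integrals *)

Section tonelli.
Context {R : realType}.
Variables (A B : set R) (f : R * R -> R).
Hypotheses (mA : measurable A) (mB : measurable B) (mf : measurable_fun setT f)
  (f0 : forall z, 0 <= f z).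
Let mAB : measurable (A `*` B). Proof. exact: measurableX. Qed.
Let F : R * R -> \bar R := (EFin \o f) \_ (A `*` B).
Let mF : measurable_fun setT F.
Proof. by apply/(measurable_restrictT _ _).1 => //; apply/measurable_EFinP; exact: measurable_funTS. Qed.

Let F1 x y : F (x, y) = if x \in A then if y \in B then (f (x, y))%:E else 0%E else 0%E.
Proof.
rewrite /F patchE; case: (boolP (x \in A)) => [/set_mem Ax|/negP nAx].
  case: (boolP (y \in B)) => [/set_mem By|/negP nBy]; first by rewrite mem_set.
  by rewrite memNset// => -[_ /= /mem_set].
by rewrite memNset// => -[/= /mem_set].
Qed.

(** The bound is allowed to fail on a null set of x: for the field itself it is known only where the
    section of its velocity is integrable. *)
Lemma tonelli_integrable12 (g : R -> R) : leb.-integrable A (EFin \o g) ->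
  {ae leb, forall x : R, A x -> (\int[leb]_(y in B) (f (x, y))%:E <= (g x)%:E)%E} ->
  (leb \x leb)%E.-integrable (A `*` B) (EFin \o f).
Proof.
move=> Ig H; apply/(integrable_mkcond _ _) => //.
apply: (@integrable12ltyP _ _ _ _ R leb leb F mF).2.
have /integrableP[mg fing] := Ig.
rewrite integral_mkcond in fing; apply: le_lt_trans fing.
have gm : measurable_fun setT ((fun x => `|(EFin \o g) x|%E) \_ A).
  by apply/(measurable_restrictT _ _).1 => //; apply: measurableT_comp.
apply: ae_ge0_le_integral => //.
- by move=> x _; apply: integral_ge0.
- apply: (@measurable_fun_fubini_tonelli_F _ _ _ _ R leb (abse \o F)) => //=.
  exact: measurableT_comp.
- by move=> x _; apply: erestrict_ge0.
- apply: ae_imp H _ => x Hx _; rewrite patchE; case: (boolP (x \in A)) => [xA|/negP nA].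
    rewrite (_ : (\int[leb]_y `|F (x, y)|)%E = (\int[leb]_(y in B) (f (x, y))%:E)%E).
      by apply: (le_trans (Hx (set_mem xA))); rewrite /= lee_fin ler_norm.
    rewrite [RHS]integral_mkcond; apply: eq_integral => y _; rewrite F1 xA patchE.
    by case: ifP => _; rewrite ?abse0// gee0_abs// lee_fin.
  rewrite integral0_eq// => y _; rewrite F1 ifN ?abse0//; exact/negP.
Qed.

Lemma tonelli_integrable21 (g : R -> R) : leb.-integrable B (EFin \o g) ->
  (forall y : R, B y -> (\int[leb]_(x in A) (f (x, y))%:E <= (g y)%:E)%E) ->
  (leb \x leb)%E.-integrable (A `*` B) (EFin \o f).
Proof.
move=> Ig H; apply/(integrable_mkcond _ _) => //.
apply: (@integrable21ltyP _ _ _ _ R leb leb F mF).2.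
have /integrableP[mg fing] := Ig.
rewrite integral_mkcond in fing; apply: le_lt_trans fing.
have gm : measurable_fun setT ((fun x => `|(EFin \o g) x|%E) \_ B).
  by apply/(measurable_restrictT _ _).1 => //; apply: measurableT_comp.
apply: ge0_le_integral => //.
- by move=> x _; apply: integral_ge0.
- apply: (@measurable_fun_fubini_tonelli_G _ _ _ _ R leb (abse \o F)) => //=.
  exact: measurableT_comp.
- move=> y _; rewrite patchE; case: (boolP (y \in B)) => [yB|/negP nB].
    rewrite (_ : (\int[leb]_x `|F (x, y)|)%E = (\int[leb]_(x in A) (f (x, y))%:E)%E).
      by apply: (le_trans (H y (set_mem yB))); rewrite /= lee_fin ler_norm.
    rewrite [RHS]integral_mkcond; apply: eq_integral => x _; rewrite F1 yB patchE.
    by case: ifP => _; rewrite ?abse0// gee0_abs// lee_fin.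
  rewrite integral0_eq// => x _; rewrite F1 [y \in B]negbTE ?if_same ?abse0//; exact/negP.
Qed.

End tonelli.

(** * Weak formulation, initial values and regularity of the travelling waves *)

Section verification.
Context {R : realType}.
Variables (R0 sigma kap gamma : R) (rho c : phase -> R) (M : nat).
Variables (V0 V1 : phase -> R -> R) (eta0 zeta0 : R) (P N : phase -> nat -> R -> R) (e : nat -> R -> R).
Hypotheses (R00 : 0 < R0) (c0 : forall a, 0 < c a) (kap2 : 2 <= kap) (kapg : kap < gamma).
Hypotheses (HV0 : forall a, Hk M.+2 (dom R0 a) (V0 a)) (HV1 : forall a, Hk M.+1 (dom R0 a) (V1 a)).
Hypothesis cl : classical_solution R0 sigma kap gamma rho c M V0 V1 eta0 zeta0 P N e.

Let k := slope c.
Let b := offset R0 c.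
Let w := wave R0 c P N.
Let oT := @time_open R.
Let mT : measurable (@time R). Proof. exact: open_measurable. Qed.
Let oD a : open (dom R0 a) := @dom_open R R0 a.
Let mD a : measurable (dom R0 a). Proof. exact: open_measurable. Qed.
Let k0 a : 0 < k a. Proof. by rewrite invr_gt0. Qed.
Let kn a : k a != 0. Proof. by rewrite gt_eqF. Qed.
Let ck a : c a ^+ 2 * k a ^+ 2 = 1. Proof. by rewrite -exprMn divff ?expr1n// gt_eqF. Qed.

Let cP a j : (j <= M.+1)%N -> continuous (P a j).
Proof.
rewrite leq_eqVlt => /orP[/eqP ->|jM]; first exact: cl_Pc cl a.
exact: der_continuousT (cl_P cl a jM).
Qed.
Let cN a j : (j <= M.+1)%N -> continuous (N a j).
Proof.
rewrite leq_eqVlt => /orP[/eqP ->|jM]; first exact: cl_Nc cl a.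
exact: der_continuousT (cl_N cl a jM).
Qed.
Let ce j : (j <= M.+2)%N -> continuous (e j).
Proof.
rewrite leq_eqVlt => /orP[/eqP ->|jM]; first exact: cl_ec cl.
exact: der_continuousT (cl_e cl jM).
Qed.

Let wave_cont_t a j r : (j <= M.+1)%N -> continuous (w a j r).
Proof. by move=> jM; apply: contD; apply: cont_affine; [exact: cP|exact: cN]. Qed.

Let wave_der_t a j r : (j <= M)%N -> forall t : R, is_derive t 1 (w a j r) (w a j.+1 r t).
Proof.
move=> jM t; apply: der_eq (derD (der_comp_affine (cl_P cl a jM _)) (der_comp_affine (cl_N cl a jM _))) _.
by rewrite /w /wave !mul1r.
Qed.

Lemma wave_is_dt a j : (j <= M.+1)%N -> is_dt j (dom R0 a) (w a 0%N) (w a j).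
Proof.
move=> jM theta tt; apply: aeW => r _.
have [_ _ H] := @wderiv_chain R j time (fun i => w a i r) oT
  (fun i ij => wave_der_t a r (leq_trans ij jM)) (@wave_cont_t a j r jM).
exact: H.
Qed.

Section pairing_with_time.
Variables (a : phase) (theta : R -> R).
Hypothesis tt : test_fun time theta.

Let cvP j th r := tconv time 1 (P a j) th (k a * r + b a).
Let cvN j th r := tconv time 1 (N a j) th (- k a * r + - b a).

Lemma pair_wave th j r : test_fun time th -> (j <= M.+1)%N ->
  pair_t (w a j) th r = cvP j th r + cvN j th r.
Proof.
move=> tth jM; rewrite /pair_t /cvP /cvN /tconv.
rewrite (@eqRint R _ (fun t => P a j (1 * t + (k a * r + b a)) * th t
   + N a j (1 * t + (- k a * r + - b a)) * th t)); last first.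
  by move=> t _; rewrite /w /wave mulrDl opprD mulNr.
by rewrite RintegralD//; apply: conv_integrable => //; [exact: cP|exact: cN].
Qed.

Definition pair_dr r := k a * (cvP 1%N theta r - cvN 1%N theta r).

Let dP j th (r : R) : (j <= M)%N -> test_fun time th -> is_derive r 1 (cvP j th) (k a * cvP j.+1 th r).
Proof. by move=> jM tth; apply: der_comp_affine; exact: (conv_der _ oT _ (@cP a j.+1 jM) (cl_P cl a jM) tth). Qed.
Let dN j th (r : R) : (j <= M)%N -> test_fun time th -> is_derive r 1 (cvN j th) (- k a * cvN j.+1 th r).
Proof. by move=> jM tth; apply: der_comp_affine; exact: (conv_der _ oT _ (@cN a j.+1 jM) (cl_N cl a jM) tth). Qed.
Let pP j th r : (j <= M)%N -> test_fun time th -> cvP j.+1 th r = - cvP j (derive1 th) r.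
Proof. by move=> jM tth; rewrite /cvP (conv_parts oT _ (oner_neq0 _) (cP _) (cl_P cl a jM) tth)// invr1 mul1r. Qed.
Let pN j th r : (j <= M)%N -> test_fun time th -> cvN j.+1 th r = - cvN j (derive1 th) r.
Proof. by move=> jM tth; rewrite /cvN (conv_parts oT _ (oner_neq0 _) (cN _) (cl_N cl a jM) tth)// invr1 mul1r. Qed.

Lemma pair_wave_der (r : R) : is_derive r 1 (pair_t (w a 0%N) theta) (pair_dr r).
Proof.
rewrite (_ : pair_t _ _ = fun r => cvP 0%N theta r + cvN 0%N theta r); last first.
  by apply/funext => x; exact: pair_wave.
by apply: der_eq (derD (dP _ (leq0n M) tt) (dN _ (leq0n M) tt)) _; rewrite /pair_dr; ring.
Qed.

(** With M = 0 the waves are only C^1, so a second derivative cannot fall on them. One derivative is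
    first moved to theta, after which the waves are differentiated once more. *)
Lemma pair_dr_der (r : R) : is_derive r 1 pair_dr (k a ^+ 2 * pair_t (w a 0%N) (derive1n 2 theta) r).
Proof.
have t1 := test_derive1 tt; have t2 := test_derive1 t1.
rewrite (_ : pair_dr = fun r => - k a * (cvP 0%N (derive1 theta) r - cvN 0%N (derive1 theta) r)); last first.
  by apply/funext => x; rewrite /pair_dr !pP// !pN//; ring.
apply: der_eq (derZ _ (derB (dP _ (leq0n M) t1) (dN _ (leq0n M) t1))) _.
rewrite pair_wave//.
by rewrite pP// pN// /derive1n/=; ring.
Qed.

Lemma pair_dr_cont : continuous pair_dr.
Proof. exact: der_continuousT pair_dr_der. Qed.

Lemma pair_wave_cont : continuous (pair_t (w a 0%N) theta).
Proof. exact: der_continuousT pair_wave_der. Qed.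

Lemma pair_flux : flux R0 rho a (pair_t (w a 0%N) theta) =
  (rho a * R0 ^+ 2)^-1 * (R0 * pair_dr R0 - pair_t (w a 0%N) theta R0).
Proof.
apply: flux_profile => //; [exact: pair_wave_cont|exact: pair_dr_cont|exact: aeW|].
by apply: wderiv_der => //; [exact: pair_dr_cont|exact: pair_wave_der].
Qed.

Lemma pair_trace r : closure (dom R0 a) r ->
  trace (dom R0 a) r (pair_t (w a 0%N) theta) = \int[leb]_(t in time) (w a 0%N r t * theta t).
Proof. by move=> cr; rewrite (trace_profile cr pair_wave_cont)//; exact: aeW. Qed.

End pairing_with_time.

Let test_int (f theta : R -> R) : test_fun time theta -> continuous f ->
  leb.-integrable time (EFin \o (fun t : R => f t * theta t)).
Proof. by move=> tt cf; apply: integrable_test => //; exact: continuous_locally_integrable. Qed.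

Lemma classical_solves : solves_system R0 sigma rho c (fun a => w a 0%N) (e 0%N).
Proof.
move=> theta tt; split.
- move=> a phi tp; have t2 := test_derive1n 2 tt; have mDa := mD a.
  pose F i := match i with 0%N => pair_t (w a 0%N) theta | 1%N => pair_dr a theta
    | _ => fun r => k a ^+ 2 * pair_t (w a 0%N) (derive1n 2 theta) r end.
  have dF j : (j < 2)%N -> forall x : R, is_derive x 1 (F j) (F j.+1 x).
    by case: j => [|[|//]] _ x; [exact: pair_wave_der|exact: pair_dr_der].
  have cX : continuous (pair_t (w a 0%N) (derive1n 2 theta)) by exact: pair_wave_cont.
  have cF : continuous (F 2%N) by exact: contZ.
  have [_ _ H] := @wderiv_chain R 2 (dom R0 a) F (@dom_open R R0 a) dF cF.
  rewrite [X in _ - _ * X]H// sqrrN expr1n mul1r /F.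
  rewrite [X in _ - _ * X](@eqRint R _ (fun r => k a ^+ 2 * (pair_t (w a 0%N) (derive1n 2 theta) r * phi r))); last first.
    by move=> r _; rewrite mulrA.
  rewrite RintegralZl//; last by apply: integrable_test => //; exact: continuous_locally_integrable.
  by rewrite [X in _ - X]mulrA ck mul1r subrr.
- rewrite pair_trace//; last exact: closure_gas0.
  rewrite (@eqRint R _ (cst 0)); first by rewrite Rintegral_cst//= mul0r.
  by move=> t _; rewrite /w (cl_origin cl) mul0r.
- rewrite !pair_trace//; try exact: closure_dom.
  rewrite -RintegralB//; [|by apply: test_int => //; exact: wave_cont_t..].
  rewrite -RintegralZl//; last by apply: test_int => //; exact: ce.
  apply: eqRint => t; rewrite /time/= in_itv/= andbT => t0.
  by rewrite -mulrBl (cl_jump cl (ltW t0)) mulrA.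
- move=> a; rewrite pair_flux//.
  have [_ _ H] := @wderiv_chain R 2 time e oT (fun i ij => cl_e cl (leq_trans ij (isT : (2 <= M.+2)%N))) (@ce 2%N isT).
  rewrite H// sqrrN expr1n mul1r /pair_dr /pair_t /tconv.
  have i1 := test_int tt (@cont_affine _ _ 1 (k a * R0 + b a) (@cP a 1%N isT)).
  have i2 := test_int tt (@cont_affine _ _ 1 (- k a * R0 + - b a) (@cN a 1%N isT)).
  have i3 := test_int tt (@wave_cont_t a 0%N R0 (leq0n _)).
  set A := \int[leb]_(t in time) (P a 1%N _ * _); set B := \int[leb]_(t in time) (N a 1%N _ * _).
  set C := \int[leb]_(t in time) (w a 0%N R0 _ * _); set D := \int[leb]_(t in time) (e 2%N _ * _).
  pose q := (rho a * R0 ^+ 2)^-1.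
  have i4 := lebZ mT (R0 * k a) (lebB mT i1 i2).
  have -> : q * (R0 * (k a * (A - B)) - C) = \int[leb]_(t in time) (q * ((R0 * k a) *
      (P a 1%N (1 * t + (k a * R0 + b a)) * theta t - N a 1%N (1 * t + (- k a * R0 + - b a)) * theta t)
      - w a 0%N R0 t * theta t)).
    rewrite RintegralZl//; last exact: lebB.
    rewrite RintegralB// RintegralZl//; last exact: lebB.
    by rewrite RintegralB// /A /B /C mulrA.
  rewrite -[RHS]mulN1r -RintegralZl//; last by apply: test_int => //; exact: ce.
  apply: eqRint => t; rewrite /time/= in_itv/= andbT => t0.
  have := cl_flux cl a (ltW t0); rewrite -/q -/k -/b -/w => h.
  rewrite mulN1r -(mulNr (e 2%N t)) -h (_ : - k a * R0 + - b a = - (k a * R0 + b a)); last by ring.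
  by ring.
Qed.

Lemma classical_initial : initial_conditions R0 V0 V1 eta0 zeta0 (fun a => w a 0%N) (e 0%N).
Proof.
split.
- move=> a psi tp.
  pose Z j t := tconv (dom R0 a) (k a) (P a j) psi (1 * t + b a)
    + tconv (dom R0 a) (- k a) (N a j) psi (1 * t + - b a).
  have ZE j t : (j <= M.+1)%N -> pair_r (dom R0 a) (w a j) psi t = Z j t.
    move=> jM; rewrite /pair_r /Z /tconv -RintegralD; last 3 first.
    + exact: mD.
    + by apply: conv_integrable => //; exact: cP.
    + by apply: conv_integrable => //; exact: cN.
    apply: eqRint => r _; rewrite -mulrDl /w /wave -/k -/b; congr ((P a j _ + N a j _) * _); ring.
  have dZ (t : R) : is_derive t 1 (Z 0%N) (Z 1%N t).
    apply: der_eq (derD (der_comp_affine (conv_der _ (@dom_open R R0 a) _ (@cP a 1%N isT) (cl_P cl a (leq0n M)) tp))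
      (der_comp_affine (conv_der _ (@dom_open R R0 a) _ (@cN a 1%N isT) (cl_N cl a (leq0n M)) tp))) _.
    by rewrite !mul1r /Z !mul1r.
  have cZ : continuous (Z 1%N).
    apply: contD; apply: cont_affine.
      exact: (conv_cont (@dom_open R R0 a) (kn a) (@cP a 1%N isT) (cl_P cl a (leq0n M)) tp).
    apply: (conv_cont (@dom_open R R0 a) _ (@cN a 1%N isT) (cl_N cl a (leq0n M)) tp).
    by rewrite oppr_eq0.
  have cZ0 := der_continuousT dZ.
  have ZF : pair_r (dom R0 a) (w a 0%N) psi = Z 0%N by apply/funext => t; exact: ZE.
  have wZ : is_wderiv 1 time (Z 0%N) (Z 1%N) by exact: wderiv_der.
  have ini (U : R -> R) j : locally_integrable (dom R0 a) U -> (j <= M.+1)%N ->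
      {ae leb, forall r : R, dom R0 a r -> U r = w a j r 0} ->
      Z j 0 = \int[leb]_(r in dom R0 a) (U r * psi r).
    move=> lU jM h; rewrite -ZE// /pair_r.
    have cw : continuous (fun r => w a j r 0).
      have -> : (fun r => w a j r 0) = (fun r => P a j (k a * r + b a) + N a j (- k a * r + - b a)).
        by apply/funext => r; rewrite /w /wave mulr0 !add0r opprD mulNr.
      by apply: contD; apply: cont_affine; [exact: cP|exact: cN].
    have lw := continuous_locally_integrable (@dom_open R R0 a) cw.
    apply: (@ae_eq_Rintegral _ _ _ leb _ _ _ (mD a)).
    + exact: integrable_real_measurable (integrable_test lw tp).
    + exact: integrable_real_measurable (integrable_test lU tp).
    + by apply: ae_imp h _ => r hr ar; rewrite hr.
  have lV0 : locally_integrable (dom R0 a) (V0 a) by have [g [] ] := HV0 a (leq0n _).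
  have lV1 : locally_integrable (dom R0 a) (V1 a) by have [g [] ] := HV1 a (leq0n _).
  rewrite ZF; split.
    rewrite -(ini _ _ lV0 (leq0n _) (cl_init0 cl a)); apply: traceE => //; first exact: closure_time.
    by apply: continuous_is_trace => //; exact: aeW.
  rewrite -(ini _ 1%N lV1 isT (cl_init1 cl a)); apply: traceE => //; first exact: closure_time.
  by apply: continuous_is_trace => //; exact: is_wderiv_ae_unique wZ (wderiv_is wZ).
- rewrite -(cl_e0 cl); apply: traceE => //; first exact: closure_time.
  by apply: continuous_is_trace; [exact: ce|exact: aeW].
- have we : is_wderiv 1 time (e 0%N) (e 1%N).
    by apply: wderiv_der => //; [exact: ce|exact: (cl_e cl (leq0n _))].
  rewrite -(cl_e1 cl); apply: traceE => //; first exact: closure_time.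
  by apply: continuous_is_trace; [exact: ce|exact: is_wderiv_ae_unique we (wderiv_is we)].
Qed.

Let chain_Hgamma (f : nat -> R -> R) m :
  (forall j, (j < m)%N -> forall t : R, is_derive t 1 (f j) (f j.+1 t)) ->
  (forall j, (j <= m)%N -> continuous (f j)) -> (forall j, (j <= m)%N -> wbounded gamma (f j)) ->
  Hgamma gamma m (f 0%N).
Proof.
move=> df cf bf j jm; exists (f j); last by apply: wbounded_L2; [exact: cf|exact: bf].
by apply: wderiv_chain => // [i ij|]; [exact: df (leq_trans ij jm)|exact: cf].
Qed.

Let sqr_combination (al be x y : R) : (al * x + be * y) ^+ 2 <= 2 * al ^+ 2 * x ^+ 2 + 2 * be ^+ 2 * y ^+ 2.
Proof. by apply: (le_trans (sqrD_le _ _)); rewrite !exprMn !mulrA. Qed.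

Lemma dom_integral_bound a (g : R -> R) C : continuous g -> (forall r, 0 <= g r) ->
  (forall x y, x <= y -> dom_closed R0 a x y -> prim g y - prim g x <= C) ->
  (\int[leb]_(r in dom R0 a) (g r)%:E <= C%:E)%E.
Proof.
move=> cg g0 H; case: a H => H.
  apply: (ge0_integral_bounded cg) => [//|n]; apply: H; last exact: lexx.
  by rewrite lerDl.
have ig : leb.-integrable (dom R0 gas) (EFin \o g).
  by apply: integrableS (continuous_loc_int cg 0 R0) => //=; exact: subset_itv_oo_cc.
have <- := @Rintegral_EFin _ _ R leb _ (mD gas) g ig.
rewrite lee_fin Rintegral_itv_oo; last exact: continuous_loc_int.
rewrite -prim_sub ?(ltW R00)//; last exact: continuous_loc_int.
by apply: H; [exact: ltW|split].
Qed.

(** One bound for all combinations of the two waves: coefficients (1, 1) give the time derivative of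
    order j, and (slope, - slope) the space derivative of the one of order j - 1. *)
Let comb a j (al be : R) r t := al * P a j (1 * t + (k a * r + b a)) + be * N a j (1 * t + - (k a * r + b a)).

Let comb_measurable a j al be : (j <= M.+1)%N ->
  measurable_fun setT (fun z : R * R => comb a j al be z.1 z.2).
Proof.
move=> jM; have aff : measurable_fun setT (fun z : R * R => k a * z.1 + b a).
  by apply: measurable_funD => //; apply: measurable_funM.
have m1 : measurable_fun setT (fun z : R * R => 1 * z.2).
  by under eq_fun do rewrite mul1r; exact: measurable_snd.
apply: measurable_funD; apply: measurable_funM => //.
  apply: (measurableT_comp (continuous_measurable_fun (@cP a j jM))).
  exact: measurable_funD.
apply: (measurableT_comp (continuous_measurable_fun (@cN a j jM))).
exact: measurable_funB.
Qed.

Let wsq_measurable (f : R -> R -> R) : measurable_fun setT (fun z : R * R => f z.1 z.2) ->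
  measurable_fun setT (fun z : R * R => weight gamma z.2 * f z.1 z.2 ^+ 2).
Proof.
move=> mf; apply: measurable_funM; last exact: measurable_funX.
have cwt : continuous (weight gamma : R -> R) by exact: expR_cont.
have mwt : measurable_fun setT (weight gamma : R -> R) by exact: continuous_measurable_fun.
by apply: (measurableT_comp mwt); exact: measurable_snd.
Qed.

Let weight_ge0 (t x : R) : 0 <= weight gamma t * x ^+ 2.
Proof. by rewrite mulr_ge0 ?expR_ge0 ?sqr_ge0. Qed.

Let exp_integrable C : 0 <= C -> leb.-integrable time (EFin \o (fun t : R => C * expR ((kap - gamma) * t))).
Proof.
move=> C0; have [B HB] : wbounded (gamma - kap) (fun=> 1 : R).
  apply: (@wbounded_pointwise _ _ 0 _ 1); first by rewrite subr_gt0.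
    exact: cont_cst.
  by move=> t _; rewrite mul0r expR0 mulr1 expr1n.
apply: lebZ => //; apply: (@ge0_integrable_bounded _ 0 B) => [|x _|n].
- exact: expR_cont.
- exact: expR_ge0.
- rewrite prim0 subr0 add0r; apply: le_trans (HB n%:R _) => //.
  rewrite le_eqVlt; apply/orP; left; apply/eqP; congr (prim _ _).
  by apply/funext => t; rewrite expr1n mulr1 opprB.
Qed.

(** At fixed t, passing from r to the travel time turns the integrals of P^2 and N^2 over the domain
    into those bounded by [cl_spatial] and produces the factor c_a. The resulting growth e^(kap t)
    is integrable against the weight because kap < gamma. *)
Lemma wave_combination_L2 a j al be : (0 < j <= M.+1)%N ->
  L2gamma_L2 gamma (dom R0 a) (comb a j al be).
Proof.
move=> jM; have [j0 jM'] := andP jM; have [C C0 HC] := cl_spatial cl a jM.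
have mc := comb_measurable a al be jM'.
split; first exact: measurable_funTS.
pose K := c a * (2 * al ^+ 2 * C + 2 * be ^+ 2 * C).
have K0 : 0 <= K.
  apply: mulr_ge0; first exact: ltW.
  by apply: addr_ge0; apply: mulr_ge0 => //; apply: mulr_ge0; rewrite ?sqr_ge0.
apply: (tonelli_integrable21 (mD a) mT (wsq_measurable mc) (fun z => weight_ge0 _ _) (exp_integrable K0)).
move=> t; rewrite /time/= in_itv/= andbT => t0.
have cp : continuous (fun r => P a j (k a * r + (1 * t + b a))) by apply: cont_affine; exact: cP.
have cn : continuous (fun r => N a j (- k a * r + (1 * t - b a))) by apply: cont_affine; exact: cN.
have ce' r : comb a j al be r t = al * P a j (k a * r + (1 * t + b a)) + be * N a j (- k a * r + (1 * t - b a)).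
  by rewrite /comb; congr (_ * P a j _ + _ * N a j _); ring.
have cc : continuous (fun r => comb a j al be r t).
  by rewrite (funext ce'); apply: contD; exact: contZ.
apply: dom_integral_bound => [|r|x y xy dxy].
- by apply: contZ; exact: cont_sq.
- exact: weight_ge0.
have cP2 := cont_sq (@cP a j jM'); have cN2 := cont_sq (@cN a j jM').
rewrite primZ; last exact: cont_sq.
rewrite primZ; last exact: cont_sq.
rewrite -mulrBr.
have -> : K * expR ((kap - gamma) * t) = weight gamma t * (K * expR (kap * t)).
  by rewrite /weight mulrCA -expRD; congr (_ * expR _); ring.
apply: ler_wpM2l; first exact: expR_ge0.
have c4 : continuous (fun r => 2 * al ^+ 2 * P a j (k a * r + (1 * t + b a)) ^+ 2
    + 2 * be ^+ 2 * N a j (- k a * r + (1 * t - b a)) ^+ 2).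
  by apply: contD; apply: contZ; exact: cont_sq.
apply: le_trans (prim_le (cont_sq cc) c4 xy _) _.
  by move=> r _; rewrite ce'; exact: sqr_combination.
rewrite !primD; try by apply: contZ; exact: cont_sq.
rewrite !primZ; try by exact: cont_sq.
rewrite !(@prim_comp_affine _ (fun z => P a j z ^+ 2))//.
rewrite !(@prim_comp_affine _ (fun z => N a j z ^+ 2)) ?oppr_eq0//.
have [h1 h2] := HC t x y (ltW t0) xy dxy; rewrite -/k -/b in h1 h2.
have kc : (k a)^-1 = c a by rewrite invrK.
rewrite invrN kc.
have e1 z : k a * z + (1 * t + b a) = 1 * t + (k a * z + b a) by ring.
have e2 z : - k a * z + (1 * t - b a) = 1 * t + - (k a * z + b a) by ring.
rewrite !e1 !e2.
have ca0 := ltW (c0 a).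
have := ler_wpM2l (mulr_ge0 ca0 (mulr_ge0 (ler0n R 2) (sqr_ge0 al))) h1.
have := ler_wpM2l (mulr_ge0 ca0 (mulr_ge0 (ler0n R 2) (sqr_ge0 be))) h2.
rewrite /K.
set p1 := prim _ (1 * t + (k a * y + b a)); set p2 := prim _ (1 * t + (k a * x + b a)).
set n1 := prim _ (1 * t - (k a * x + b a)); set n2 := prim _ (1 * t - (k a * y + b a)).
set p3 := prim _ (1 * t + b a); set n3 := prim _ (1 * t - b a) => q1 q2.
rewrite -subr_ge0; set D := _ - _.
have -> : D = (c a * (2 * be ^+ 2) * (C * expR (kap * t)) - c a * (2 * be ^+ 2) * (n1 - n2))
   + (c a * (2 * al ^+ 2) * (C * expR (kap * t)) - c a * (2 * al ^+ 2) * (p1 - p2)).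
  by rewrite /D; ring.
by apply: addr_ge0; rewrite subr_ge0.
Qed.

Let comb1 a j r t : comb a j 1 1 r t = w a j r t.
Proof. by rewrite /comb /w /wave !mul1r. Qed.

Let wave_L2 a j : (0 < j <= M.+1)%N -> L2gamma_L2 gamma (dom R0 a) (w a j).
Proof.
move=> jM; rewrite (_ : w a j = comb a j 1 1); first exact: wave_combination_L2.
by apply/funext => r; apply/funext => t; rewrite comb1.
Qed.

(* [w_1] is square integrable by the energy estimate, and [w_0(r, .)] is
   recovered from [w_0(r, 0)] and [w_1(r, .)] by a Gronwall argument. *)
Lemma wave0_L2 a : L2gamma_L2 gamma (dom R0 a) (w a 0%N).
Proof.
have mw : measurable_fun setT (fun z : R * R => w a 0%N z.1 z.2).
  by under eq_fun do rewrite -comb1; exact: comb_measurable.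
split; first exact: measurable_funTS.
have [_ I1] := @wave_L2 a 1%N isT.
have [F1 _ F3 _ _] := RFubini (mD a) mT I1.
(* Since 2 w_0 w_1 <= w_0^2 + w_1^2, the quantity e^(- gamma t) w_0^2, plus (gamma - 1) times its
   integral over [0, t], minus the weighted integral of w_1^2, is nonincreasing in t; g is the
   resulting bound. *)
pose g x := (gamma - 1)^-1 * (w a 0%N x 0 ^+ 2 + \int[leb]_(t in time) (weight gamma t * w a 1%N x t ^+ 2)).
have g1 : 0 < gamma - 1 by move: kap2 kapg; lra.
have [g0 w0 L0] := HV0 a (leq0n _).
have V0g0 : {ae leb, forall x : R, dom R0 a x -> V0 a x = g0 x}.
  by have [lf _ _] := w0; exact: is_wderiv_ae_unique (wderiv0 lf) w0.
have cw : continuous (fun r => w a 0%N r 0).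
  have -> : (fun r => w a 0%N r 0) = (fun r => P a 0%N (k a * r + b a) + N a 0%N (- k a * r + - b a)).
    by apply/funext => r; rewrite /w /wave mulr0 !add0r opprD mulNr.
  by apply: contD; apply: cont_affine; [exact: cP|exact: cN].
have Lw : L2 (cst 1) (dom R0 a) (fun r => w a 0%N r 0).
  apply: (L2_ae (mD a) L0).
    by apply: measurable_funTS; exact: continuous_measurable_fun.
  by apply: ae_imp2 V0g0 (cl_init0 cl a) _ => r h1 h2 ar; rewrite -h1// h2.
have Ig : leb.-integrable (dom R0 a) (EFin \o g).
  by apply: lebZ => //; apply: lebD => //; exact: L2_integrable.
apply: (tonelli_integrable12 (mD a) mT (wsq_measurable mw) (fun z => weight_ge0 _ _) Ig).
apply: ae_imp F3 _ => r /[apply] Ir.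
have c1 := @wsq_cont _ gamma _ (@wave_cont_t a 1%N r isT).
have c00 := @wsq_cont _ gamma _ (@wave_cont_t a 0%N r isT).
apply: (@ge0_integral_bounded _ 0 (g r)) => [|t _|n]; [exact: c00|exact: weight_ge0|].
rewrite prim0 subr0 add0r; set p0 := prim _ _.
pose p1 := prim (fun s => expR (- gamma * s) * w a 1%N r s ^+ 2).
have p1n : p1 n%:R <= \int[leb]_(t in time) (weight gamma t * w a 1%N r t ^+ 2).
  have := @prim_le_Rintegral R time _ 0 n%:R mT c1 (fun t => weight_ge0 t _) Ir (ler0n _ n).
  by rewrite prim0 subr0; apply => t; rewrite /time /= !in_itv/= andbT => /andP[].
have d1 (t : R) : is_derive t 1 (fun t => expR (- gamma * t) * w a 0%N r t ^+ 2
     + (gamma - 1) * prim (fun s => expR (- gamma * s) * w a 0%N r s ^+ 2) t - p1 t)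
    (- gamma * expR (- gamma * t) * w a 0%N r t ^+ 2 + expR (- gamma * t) * (2 * w a 0%N r t * w a 1%N r t)
     + (gamma - 1) * (expR (- gamma * t) * w a 0%N r t ^+ 2) - expR (- gamma * t) * w a 1%N r t ^+ 2).
  apply: derB; last exact: prim_is_deriveT.
  apply: derD; last by apply: derZ; exact: prim_is_deriveT.
  by apply: derM; [exact: expR_der|apply: der_sq; exact: wave_der_t].
have n0 := ler0n R n.
have := der_ge0_le d1 (fun t : R => der_cst t (w a 0%N r 0 ^+ 2)) _ _ n0.
rewrite mulr0 expR0 mul1r /p1 !prim0 mulr0 addr0 subr0 lexx -/(p1 n%:R) -/p0 => /(_ isT) h.
have {}h : expR (- gamma * n%:R) * w a 0%N r n%:R ^+ 2 + (gamma - 1) * p0 - p1 n%:R <= w a 0%N r 0 ^+ 2.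
  apply: h => t _.
  have -> : - gamma * expR (- gamma * t) * w a 0%N r t ^+ 2 + expR (- gamma * t) * (2 * w a 0%N r t * w a 1%N r t)
     + (gamma - 1) * (expR (- gamma * t) * w a 0%N r t ^+ 2) - expR (- gamma * t) * w a 1%N r t ^+ 2
     = - (expR (- gamma * t) * (w a 0%N r t - w a 1%N r t) ^+ 2) by ring.
  by rewrite oppr_le0 mulr_ge0 ?expR_ge0 ?sqr_ge0.
rewrite /g mulrC ler_pdivlMr// mulrC.
have := weight_ge0 n%:R (w a 0%N r n%:R); rewrite /weight; lra.
Qed.

Lemma classical_regularity : solution_regularity R0 gamma M.+1 (fun a => w a 0%N) (e 0%N).
Proof.
split.
- exists (e 1%N); first by apply: wderiv_der => //; [exact: ce|exact: (cl_e cl (leq0n _))].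
  apply: (@chain_Hgamma (fun j => e j.+1)) => j jM.
  + exact: (cl_e cl).
  + exact: ce.
  + exact: (cl_ebound cl).
- apply: (@chain_Hgamma e) => j jM; [|exact: ce (leqW jM)|exact: (cl_ebound cl (leqW jM))].
  exact: (cl_e cl (ltnW jM)).
- move=> a; exists (w a 0%N R0); last first.
    by move=> theta tt; apply: pair_trace => //; exact: closure_dom.
  apply: (@chain_Hgamma (fun j => w a j R0)) => j jM; [exact: wave_der_t|exact: wave_cont_t|].
  exact: (cl_trace cl a jM).
- move=> a; split; first exact: wave0_L2.
  move=> j jM; exists (w a j); first exact: wave_is_dt.
  by case: j jM => [_|j jM]; [exact: wave0_L2|exact: wave_L2].
Qed.

Lemma classical_weighted : weighted_solution R0 sigma rho c gamma M.+1 V0 V1 eta0 zeta0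
  (fun a => w a 0%N) (e 0%N).
Proof. by split; [exact: classical_regularity|exact: classical_solves|exact: classical_initial]. Qed.

Lemma classical_H1 a j : (1 <= j <= M.+1)%N ->
  exists2 u, is_dt j.-1 (dom R0 a) (w a 0%N) u & L2gamma_H1 gamma (dom R0 a) u.
Proof.
case: j => // j /= jM; exists (w a j); first exact: wave_is_dt (ltnW jM).
split.
  by case: j jM => [_|j jM]; [exact: wave0_L2|apply: wave_L2; rewrite /= ltnW].
(* The r-derivative of the time derivative of order j: the two waves carry the travel time with
   opposite signs. *)
exists (comb a j.+1 (k a) (- k a)); first exact: wave_combination_L2.
apply: aeW => t _; apply: wderiv_der => [||r].
- exact: dom_open.
- have ce' r : comb a j.+1 (k a) (- k a) r t = k a * P a j.+1 (k a * r + (1 * t + b a)) + - k a * N a j.+1 (- k a * r + (1 * t - b a)).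
    by rewrite /comb; congr (_ * P a j.+1 _ + _ * N a j.+1 _); ring.
  by rewrite (funext ce'); apply: contD; apply: contZ; apply: cont_affine; [exact: cP|exact: cN].
- have we : (w a j)^~ t = fun r => P a j (k a * r + (1 * t + b a)) + N a j (- k a * r + (1 * t - b a)).
    by apply/funext => x; rewrite /w /wave -/k -/b; congr (P a j _ + N a j _); ring.
  rewrite we; apply: der_eq (derD (der_comp_affine (cl_P cl a jM _)) (der_comp_affine (cl_N cl a jM _))) _.
  by rewrite /comb; congr (_ * P a j.+1 _ + _ * N a j.+1 _); ring.
Qed.

End verification.

(** * Boundary values of functions with two weak derivatives *)

Section cutoff_and_strips.
Context {R : realType}.
Implicit Types (I : set R) (f g q X Y Z : R -> R) (a b t x : R).

Lemma smooth_cutoff : exists chi : R -> R, [/\ smooth chi,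
  forall t, t <= 2^-1 -> chi t = 1, forall t, 1 <= t -> chi t = 0 &
  exists2 B, 0 < B & forall t, [/\ `|chi t| <= B, `|derive1 chi t| <= B & `|derive1 (derive1 chi) t| <= B]].
Proof.
pose h := hat 2^-1 (1 : R).
have sh : smooth h by exact: smooth_hat.
have ch : continuous h := @smooth_continuous R h 0 sh.
have lh := continuous_loc_int ch.
have d (t : R) : is_derive t 1 (prim h) (h t) by exact: prim_is_deriveT.
pose m := prim h 1 - prim h 2^-1.
have half1 : (2^-1 : R) < 1 by rewrite invf_lt1// ltr1n.
have half0 : 0 < (2^-1 : R) by rewrite invr_gt0.
have m0 : 0 < m.
  have [|z] := @MVT R (prim h) h 2^-1 1 half1 (fun x _ => d x).
    by apply: continuous_subspaceT; exact: prim_continuous.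
  by rewrite in_itv/= /m => cz ->; rewrite mulr_gt0 ?subr_gt0// hat_gt0.
pose chi t := m^-1 * (prim h 1 - prim h t).
have dchi (t : R) : is_derive t 1 chi (- m^-1 * h t).
  by apply: der_eq (derZ _ (derB (der_cst t _) (d t))) _; rewrite sub0r mulrN mulNr.
have schi : smooth chi by apply: (smooth_prim _ dchi); exact: smoothZ.
have th : test_fun setT h by exact: test_hat.
have hM t : ~ (- 1 <= t <= 1) -> h t = 0.
  by move=> nt; apply: hat_out => /andP[t1 t2]; apply: nt; rewrite (ltW t2) andbT; move: half0 t1; lra.
have h'M t : ~ (- 1 <= t <= 1) -> derive1 h t = 0 by exact: derive1_out th hM.
have [B1 B10 HB1] := continuous_bounded_segment (- 1) 1 (@smooth_continuous R h 0 sh).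
have [B2 B20 HB2] := continuous_bounded_segment (- 1) 1 (@smooth_continuous R h 1 sh).
have hB t : `|h t| <= B1.
  by have [/HB1//|/negP/hM ->] := boolP (- 1 <= t <= 1); rewrite normr0.
have h'B t : `|derive1 h t| <= B2.
  by have [/HB2//|/negP/h'M ->] := boolP (- 1 <= t <= 1); rewrite normr0.
have pm t : t <= 1 -> prim h t <= prim h 1 by move=> t1; apply: prim_mono => // x; exact: hat_ge0.
have e1 t : t <= 2^-1 -> prim h t = prim h 2^-1.
  move=> t2; apply: prim_const => // y /andP[_ y1]; apply: hat_out => /andP[y2 _].
  by move: (lt_trans y1 y2); rewrite ltxx.
have e2 t : 1 <= t -> prim h t = prim h 1.
  move=> t1; apply/esym; apply: prim_const => // y /andP[y1 _]; apply: hat_out => /andP[_ y2].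
  by move: (lt_trans y1 y2); rewrite ltxx.
have chi1 t : t <= 2^-1 -> chi t = 1.
  move=> t2; rewrite /chi (e1 _ t2); have : m^-1 * m = 1 by rewrite mulVf// gt_eqF.
  exact.
have chi0 t : 1 <= t -> chi t = 0 by move=> t1; rewrite /chi e2// subrr mulr0.
have mi : 0 <= m^-1 by rewrite invr_ge0 ltW.
have chiB t : `|chi t| <= 1.
  have [t2|t2] := leP t 2^-1; first by rewrite chi1// normr1.
  have [t1|t1] := leP 1 t; first by rewrite chi0// normr0.
  rewrite ger0_norm; last by rewrite mulr_ge0// subr_ge0 pm// ltW.
  have mm : m^-1 * m = 1 by rewrite mulVf// gt_eqF.
  apply: (@le_trans _ _ (m^-1 * m)); last by rewrite mm.
  rewrite /chi ler_wpM2l// /m lerD2l lerN2.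
  by apply: prim_mono; [exact: ch|move=> x; exact: hat_ge0|exact: ltW].
exists chi; split => //.
exists (1 + m^-1 * B1 + m^-1 * B2).
  by rewrite -addrA ltr_pwDl// addr_ge0// mulr_ge0.
have b1 : 0 <= m^-1 * B1 by rewrite mulr_ge0.
have b2 : 0 <= m^-1 * B2 by rewrite mulr_ge0.
have E1 : derive1 chi = fun t => - m^-1 * h t by apply: derive1_is.
have E2 : derive1 (derive1 chi) = fun t => - m^-1 * derive1 h t.
  by rewrite E1; apply: derive1_is => t; apply: derZ; exact: (smooth_is_derive 0 t sh).
move=> t; split.
- by have := chiB t; lra.
- by rewrite E1 normrM normrN (ger0_norm mi); apply: (le_trans (ler_wpM2l mi (hB t))); lra.
- by rewrite E2 normrM normrN (ger0_norm mi); apply: (le_trans (ler_wpM2l mi (h'B t))); lra.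
Qed.

Lemma W2_rep I X Z : is_interval I -> I !=set0 -> is_wderiv 2 I X Z -> loc_int (Z \_ I) ->
  exists X1 Y1, [/\ continuous Y1, forall x : R, is_derive x 1 X1 (Y1 x),
    {ae leb, forall x : R, I x -> X x = X1 x}, is_wderiv 1 I X Y1 &
    exists B, Y1 = fun x => B + prim (Z \_ I) x].
Proof.
move=> iI I0 w lZ; have [B wB] := wderiv2_wderiv1 iI I0 w lZ.
pose Y1 x := B + prim (Z \_ I) x.
have cY : continuous Y1 by apply: contD; [exact: cont_cst|exact: prim_continuous].
have [C HC] := wderiv1_continuous iI I0 cY wB.
exists (fun x => C + prim Y1 x), Y1; split => //; last by exists B.
by move=> x; apply: der_eq (derD (der_cst x C) (prim_is_deriveT cY x)) _; rewrite add0r.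
Qed.

Lemma loc_int_mul g q : loc_int g -> continuous q -> loc_int (fun x => g x * q x).
Proof. by move=> lg cq a b; exact: integrable_mul_continuous. Qed.

(* Green's formula for [X'' = Z] on a subinterval of [I] reaching its ends. *)
Lemma W2_green I X Z X1 Y1 B q q' q'' al be : locally_integrable I X ->
  loc_int (Z \_ I) -> continuous Y1 -> (forall x : R, is_derive x 1 X1 (Y1 x)) ->
  {ae leb, forall x : R, I x -> X x = X1 x} -> Y1 = (fun x => B + prim (Z \_ I) x) ->
  continuous q'' -> (forall x : R, is_derive x 1 q (q' x)) ->
  (forall x : R, is_derive x 1 q' (q'' x)) -> al <= be -> `]al, be[ `<=` I ->
  \int[leb]_(x in `]al, be[) (Z x * q x) - \int[leb]_(x in `]al, be[) (X x * q'' x) =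
  Y1 be * q be - Y1 al * q al - X1 be * q' be + X1 al * q' al.
Proof.
move=> lX lZ cY dX XX YE cq'' dq dq' ab abI.
have cq' := der_continuousT dq'; have cq := der_continuousT dq; have cX := der_continuousT dX.
have mab : measurable `]al, be[%classic by exact: measurable_itv.
have [mX oI _] := lX; have mI : measurable I by exact: open_measurable.
have e1 : \int[leb]_(x in `]al, be[) (Z x * q x) = \int[leb]_(x in `[al, be]) ((Z \_ I) x * q x).
  rewrite -Rintegral_itv_oo; last exact: loc_int_mul.
  by apply: eqRint => x xab; rewrite patchE mem_set//; exact: abI.
have e2 : \int[leb]_(x in `]al, be[) (X x * q'' x) = \int[leb]_(x in `[al, be]) (X1 x * q'' x).
  rewrite -Rintegral_itv_oo; last by apply: continuous_loc_int; exact: contM.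
  apply: (@ae_eq_Rintegral _ _ _ leb _ _ _ mab).
  - apply: measurable_funM; first exact: measurable_funS mI abI mX.
    by apply: measurable_funTS; exact: continuous_measurable_fun.
  - by apply: measurable_funTS; apply: continuous_measurable_fun; exact: contM.
  - by apply: ae_imp XX _ => x h xab; rewrite h//; exact: abI.
rewrite e1 e2 (prim_ibp ab lZ cq' dq).
have i1 : leb.-integrable `[al, be] (EFin \o (fun x => Y1 x * q' x)).
  by apply: continuous_loc_int; exact: contM.
have i2 : leb.-integrable `[al, be] (EFin \o (fun x => B * q' x)).
  by apply: continuous_loc_int; exact: contZ.
have i3 : leb.-integrable `[al, be] (EFin \o (fun x => X1 x * q'' x)).
  by apply: continuous_loc_int; exact: contM.
have mab' : measurable `[al, be]%classic by exact: measurable_itv.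
have e3 : \int[leb]_(x in `[al, be]) (prim (Z \_ I) x * q' x) =
    \int[leb]_(x in `[al, be]) (Y1 x * q' x) - B * (q be - q al).
  rewrite -(FTC_segment cq' dq ab) -RintegralZl//; last exact: continuous_loc_int.
  by rewrite -RintegralB//; apply: eqRint => x _; rewrite YE; ring.
have e4 : \int[leb]_(x in `[al, be]) (Y1 x * q' x) + \int[leb]_(x in `[al, be]) (X1 x * q'' x) =
    X1 be * q' be - X1 al * q' al.
  rewrite -RintegralD//; apply: (@FTC_segment _ _ (fun x => X1 x * q' x)) => //.
  - by apply: contD; exact: contM.
  - by move=> x; exact: derM.
by rewrite e3 YE; move: e4; rewrite YE => e4; move: (\int[leb]_(x in _) (_ * q' x)) e4 => A e4; lra.
Qed.

End cutoff_and_strips.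

Section cubic.
Context {R : realType}.
Variables (b a0 a1 a2 a3 : R).
Definition cubic (r : R) := a0 + (1 * r + - b) * (a1 + (1 * r + - b) * (a2 + (1 * r + - b) * a3)).
Definition cubic' (r : R) := a1 + (1 * r + - b) * (2 * a2 + (1 * r + - b) * (3 * a3)).
Definition cubic'' (r : R) := 2 * a2 + (1 * r + - b) * (6 * a3).
Lemma cubic_der (r : R) : is_derive r 1 cubic (cubic' r).
Proof.
have d := der_affine r 1 (- b).
apply: der_eq (derD (der_cst r a0) (derM d (derD (der_cst r a1) (derM d (derD (der_cst r a2) (derM d (der_cst r a3))))))) _.
by rewrite /cubic'; ring.
Qed.
Lemma cubic'_der (r : R) : is_derive r 1 cubic' (cubic'' r).
Proof.
have d := der_affine r 1 (- b).
apply: der_eq (derD (der_cst r a1) (derM d (derD (der_cst r (2 * a2)) (derM d (der_cst r (3 * a3)))))) _.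
by rewrite /cubic''; ring.
Qed.
Lemma cubic''_cont : continuous cubic''.
Proof.
apply: (@der_continuousT _ _ (fun=> 6 * a3)) => r.
by apply: der_eq (derD (der_cst r (2 * a2)) (derM (der_affine r 1 (- b)) (der_cst r (6 * a3)))) _; ring.
Qed.
End cubic.

Section strip.
Context {R : realType}.
(* [left] tells on which side of the domain its end [b] lies. *)
Variables (left : bool) (b l : R).
Hypothesis l0 : 0 < l.
Definition sgn : R := if left then 1 else -1.
Definition strip : set R := if left then `]b, b + l[%classic else `]b - l, b[%classic.
Let k := sgn / l.
(* Hermite cubics vanishing to second order at the far end of the strip: Green's
   formula against them isolates [X'(b)], respectively [X(b)]. *)
Definition hermite0 := cubic b 1 0 (- (3 * k ^+ 2)) (2 * k ^+ 3).
Definition hermite0'' := cubic'' b (- (3 * k ^+ 2)) (2 * k ^+ 3).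
Definition hermite1 := cubic b 0 1 (- (2 * k)) (k ^+ 2).
Definition hermite1'' := cubic'' b (- (2 * k)) (k ^+ 2).

Lemma strip_measurable : measurable strip.
Proof. by rewrite /strip; case: left; exact: measurable_itv. Qed.

Lemma W2_boundary (I : set R) (X Z X1 Y1 : R -> R) B : locally_integrable I X ->
  loc_int (Z \_ I) -> continuous Y1 -> (forall x : R, is_derive x 1 X1 (Y1 x)) ->
  {ae leb, forall x : R, I x -> X x = X1 x} -> Y1 = (fun x => B + prim (Z \_ I) x) ->
  strip `<=` I ->
  X1 b = sgn * (\int[leb]_(x in strip) (Z x * hermite1 x) - \int[leb]_(x in strip) (X x * hermite1'' x)) /\
  Y1 b = sgn * (\int[leb]_(x in strip) (X x * hermite0'' x) - \int[leb]_(x in strip) (Z x * hermite0 x)).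
Proof.
move=> lX lZ cY dX XX YE sI.
have G a0 a1 a2 a3 al be := @W2_green R I X Z X1 Y1 B (cubic b a0 a1 a2 a3) (cubic' b a1 a2 a3) (cubic'' b a2 a3) al be
  lX lZ cY dX XX YE (@cubic''_cont R b a2 a3) (cubic_der b a0 a1 a2 a3) (cubic'_der b a1 a2 a3).
have lE : l != 0 by rewrite gt_eqF.
move: sI; rewrite /hermite0 /hermite1 /hermite0'' /hermite1'' /k /sgn /strip; case: left => sI.
- have bl : b <= b + l by rewrite lerDl ltW.
  have G1 := G 0 1 (- (2 * (1 / l))) ((1 / l) ^+ 2) _ _ bl sI.
  have G0 := G 1 0 (- (3 * (1 / l) ^+ 2)) (2 * (1 / l) ^+ 3) _ _ bl sI.
  by split; [rewrite G1|rewrite -[X in 1 * X]opprB G0]; rewrite /cubic /cubic'; field.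
- have bl : b - l <= b by rewrite gerBl ltW.
  have G1 := G 0 1 (- (2 * (-1 / l))) ((-1 / l) ^+ 2) _ _ bl sI.
  have G0 := G 1 0 (- (3 * (-1 / l) ^+ 2)) (2 * (-1 / l) ^+ 3) _ _ bl sI.
  by split; [rewrite G1|rewrite -[X in -1 * X]opprB G0]; rewrite /cubic /cubic'; field.
Qed.

Lemma strip_dist r : strip r -> `|1 * r + - b| <= l.
Proof.
rewrite /strip mul1r ler_norml; case: left; rewrite /= in_itv/= => /andP[h1 h2]; move: l0 h1 h2 => *; apply/andP; split; lra.
Qed.

Let kl : `|k| = l^-1.
Proof. by rewrite /k normrM normfV (gtr0_norm l0) /sgn; case: left; rewrite ?normrN normr1 mul1r. Qed.

(** In the variable y = k (r - b), which has modulus at most 1 on the strip, the cubics have fixed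
    coefficients, and only the powers of l from scaling remain. *)
Lemma hermite_bounds r : strip r ->
  [/\ `|hermite1 r| <= 4 * l, `|hermite1'' r| <= 10 / l, `|hermite0 r| <= 6 & `|hermite0'' r| <= 18 / l ^+ 2].
Proof.
move=> /strip_dist; rewrite /hermite0 /hermite0'' /hermite1 /hermite1'' /cubic /cubic''.
move: (1 * r + - b) => z hz; pose y := k * z.
have lE : l != 0 by rewrite gt_eqF.
have kE : k * l * sgn = 1 by rewrite /k /sgn; case: left; field.
have hy : `|y| <= 1.
  rewrite /y normrM kl; have := ler_wpM2l (_ : 0 <= l^-1) hz; rewrite invr_ge0 (ltW l0) => /(_ isT).
  by rewrite mulVf.
have y2 : `|y ^+ 2| <= 1 by rewrite normrX exprn_ile1.
have y3 : `|y ^+ 3| <= 1 by rewrite normrX exprn_ile1.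
have N1 (a p : R) : 0 <= a -> `|p| <= 1 -> `|a * p| <= a by move=> a0 p1; rewrite normrM (ger0_norm a0) ler_piMr.
split.
- have -> : 0 + z * (1 + z * (- (2 * k) + z * k ^+ 2)) = z * (1 + (- (2 * y)) + y ^+ 2) by rewrite /y; ring.
  rewrite normrM mulrC; apply: ler_pM => //.
  apply: (le_trans (ler_normD _ _)); have := ler_normB 1 (2 * y); have := N1 2 y ltac:(by []) hy.
  by rewrite normr1; lra.
- have -> : 2 * - (2 * k) + z * (6 * k ^+ 2) = k * (6 * y - 4) by rewrite /y; ring.
  rewrite normrM kl mulrC ler_pM2r ?invr_gt0//.
  apply: (le_trans (ler_normB _ _)); have := N1 6 y ltac:(by []) hy; rewrite (ger0_norm (_ : 0 <= 4))//; lra.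
- have -> : 1 + z * (0 + z * (- (3 * k ^+ 2) + z * (2 * k ^+ 3))) = 1 - 3 * y ^+ 2 + 2 * y ^+ 3 by rewrite /y; ring.
  apply: (le_trans (ler_normD _ _)); have := ler_normB 1 (3 * y ^+ 2).
  by have := N1 3 _ ltac:(by []) y2; have := N1 2 _ ltac:(by []) y3; rewrite normr1; lra.
- have -> : 2 * - (3 * k ^+ 2) + z * (6 * (2 * k ^+ 3)) = k ^+ 2 * (12 * y - 6) by rewrite /y; ring.
  rewrite normrM normrX kl exprVn mulrC ler_pM2r ?invr_gt0 ?exprn_gt0//.
  apply: (le_trans (ler_normB _ _)); have := N1 12 y ltac:(by []) hy; rewrite (ger0_norm (_ : 0 <= 6))//; lra.
Qed.

End strip.

(** * Injectivity of the Laplace transform *)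

Section lerch.
Context {R : realType}.
Implicit Types (g : R -> R) (x y t : R).

Lemma ae_neq x : {ae leb, forall t : R, t <> x}.
Proof.
exists [set x]; split; [exact: measurable_set1|exact: lebesgue_measure_set1|].
by move=> t /= /contrapT.
Qed.

Lemma exp_series_bound (z : R) n : `|series (exp_coeff z) n| <= expR `|z|.
Proof.
apply: (@le_trans _ _ (series (exp_coeff `|z|) n)).
  rewrite /series /= (le_trans (ler_norm_sum _ _ _))//; apply: ler_sum => i _.
  by rewrite /exp_coeff /= normrM normrX [`|_^-1|]ger0_norm// invr_ge0.
apply: nondecreasing_cvgn_le; last exact: is_cvg_series_exp_coeff.
apply/nondecreasing_seqP => k; rewrite /series /= big_nat_recr//= lerDl.
exact: exp_coeff_ge0.
Qed.

Let mT : measurable (@time R). Proof. exact: open_measurable time_open. Qed.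

Section vanishing_transform.
Variable g : R -> R.
Hypotheses (Ig : leb.-integrable time (EFin \o g))
  (Hg : forall n : nat, \int[leb]_(t in time) (g t * expR (- n%:R * t)) = 0).
Let mg : measurable_fun time g := integrable_real_measurable Ig.

Let Iexp (f : R -> R) C : continuous f -> (forall t, 0 <= t -> `|f t| <= C) ->
  leb.-integrable time (EFin \o (fun t => g t * f t)).
Proof.
move=> cf fC; apply: (leb_le mT _ (lebZ mT C (integrable_norm Ig))).
  by apply: measurable_funM => //; apply: measurable_funTS; exact: continuous_measurable_fun.
move=> t; rewrite /time /= in_itv/= andbT normrM mulrC => t0.
by apply: ler_wpM2r => //; apply: fC; exact: ltW.
Qed.

(** The hypothesis at the integers n N kills every power of e^(- N t), hence every partial sum of
    the exponential series at y e^(- N t). *)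
Let partial y N n : leb.-integrable time (EFin \o (fun t => g t * series (exp_coeff (y * expR (- N%:R * t))) n)) /\
  \int[leb]_(t in time) (g t * series (exp_coeff (y * expR (- N%:R * t))) n) = 0.
Proof.
elim: n => [|n [I0 E0]].
  have e t : g t * series (exp_coeff (y * expR (- N%:R * t))) 0%N = 0.
    by rewrite /series /= big_geq// mulr0.
  split; first by apply: leb_eq (lebZ mT 0 Ig) => // t _; rewrite e mul0r.
  by rewrite (@eqRint R _ (cst 0)) ?Rintegral_cst//= ?mul0r// => t _; rewrite e.
pose c := y ^+ n / n`!%:R.
have step t : g t * series (exp_coeff (y * expR (- N%:R * t))) n.+1 =
    g t * series (exp_coeff (y * expR (- N%:R * t))) n + c * (g t * expR (- (n * N)%:R * t)).
  rewrite /series /= big_nat_recr//= mulrDr; congr (_ + _).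
  rewrite /exp_coeff /= exprMn -expRM_natl (_ : n%:R * (- N%:R * t) = - (n * N)%:R * t) ?/c; last by rewrite natrM; ring.
  by ring.
have I1 : leb.-integrable time (EFin \o (fun t => g t * expR (- (n * N)%:R * t))).
  apply: (@Iexp _ 1); first exact: expR_cont.
  by move=> t t0; rewrite ger0_norm ?expR_ge0// -expR0 ler_expR mulNr oppr_le0 mulr_ge0.
split; first by apply: leb_eq (lebD mT I0 (lebZ mT c I1)) => // t _; rewrite step.
rewrite (eqRint (fun t _ => step t)) RintegralD//; last exact: lebZ.
by rewrite RintegralZl// Hg E0 mulr0 addr0.
Qed.

Let full y N : \int[leb]_(t in time) (g t * expR (y * expR (- N%:R * t))) = 0.
Proof.
have [] := @dominated_Rintegral _ _ R leb time (fun n t => g t * series (exp_coeff (y * expR (- N%:R * t))) n)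
  (fun t => g t * expR (y * expR (- N%:R * t))) (fun t => expR `|y| * `|g t|) mT.
- by move=> n; have [I0 _] := partial y N n; exact: integrable_real_measurable I0.
- by move=> t _; apply: cvgMr; exact: is_cvg_series_exp_coeff.
- by apply: lebZ => //; exact: integrable_norm.
- move=> n t; rewrite /time /= in_itv/= andbT normrM mulrC => t0.
  apply: ler_wpM2r => //; apply: (le_trans (exp_series_bound _ _)).
  rewrite ler_expR normrM ler_piMr// ger0_norm ?expR_ge0// -expR0 ler_expR mulNr oppr_le0 mulr_ge0// ltW//.
move=> _ /cvg_lim <-//; apply/esym.
rewrite (_ : (fun n => _) = fun=> 0); first by rewrite lim_cst.
by apply/funext => n; have [_] := partial y N n.
Qed.

(** Pointwise limit of exp(- e^(N (x - t))): the value e^(-1) at t = x is what the sequence takes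
    there for every N, and occurs only on a null set. *)
Let step x t : R := if x < t then 1 else if t < x then 0 else expR (-1).

Let geom (q : R) : q < 0 -> expR (n%:R * q) @[n --> \oo] --> (0 : R).
Proof.
move=> q0; rewrite (_ : (fun n => _) = fun n : nat => expR q ^+ n); last first.
  by apply/funext => n; rewrite expRM_natl.
by apply: cvg_expr; rewrite ger0_norm ?expR_ge0// expR_lt1.
Qed.

Let step_cvg x t : expR (- expR (n%:R * (x - t))) @[n --> \oo] --> step x t.
Proof.
rewrite /step; have [xt|tx|<-] := ltgtP x t.
- have q0 : x - t < 0 by rewrite subr_lt0.
  rewrite -[X in _ --> X]expR0 -oppr0.
  apply: continuous_cvg; first exact: continuous_expR.
  by apply: cvgN; exact: geom.
- have q0 : t - x < 0 by rewrite subr_lt0.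
  apply: (@squeeze_cvgr _ _ _ _ (fun=> 0) (fun n => expR (n%:R * (t - x)))).
  + near=> n; rewrite expR_ge0 /= ler_expR -[leRHS]opprK lerN2 -mulrN opprB.
    by apply: le_trans (expR_ge1Dx _); rewrite lerDr.
  + exact: cvg_cst.
  + exact: geom.
- under eq_fun do rewrite subrr mulr0 expR0.
  exact: cvg_cst.
Unshelve. all: by end_near. Qed.

Let tail x : leb.-integrable time (EFin \o (fun t => g t * step x t)) /\
  \int[leb]_(t in time) (g t * step x t) = 0.
Proof.
have e n t : expR (- expR (n%:R * (x - t))) = expR (- expR (n%:R * x) * expR (- n%:R * t)).
  have -> : expR (n%:R * (x - t)) = expR (n%:R * x) * expR (- n%:R * t).
    by rewrite -expRD; congr expR; ring.
  by congr expR; ring.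
have [] := @dominated_Rintegral _ _ R leb time (fun n t => g t * expR (- expR (n%:R * (x - t))))
  (fun t => g t * step x t) (fun t => `|g t|) mT.
- move=> n; apply: measurable_funM => //; apply: measurable_funTS; apply: continuous_measurable_fun.
  under eq_fun do rewrite e.
  apply: (@cont_comp _ expR (fun t => - expR (n%:R * x) * expR (- n%:R * t))); first exact: cont_expR.
  by apply: contZ; exact: expR_cont.
- by move=> t _; apply: cvgMr; exact: step_cvg.
- exact: integrable_norm.
- move=> n t _; rewrite normrM ler_piMr// ger0_norm ?expR_ge0// -expR0 ler_expR oppr_le0 expR_ge0//.
move=> I1 /cvg_lim h; split=> //; rewrite -h//.
rewrite (_ : (fun n => _) = fun=> 0); first by rewrite lim_cst.
by apply/funext => n; rewrite (eqRint (fun t _ => congr1 (fun z => g t * z) (e n t))); exact: full.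
Qed.

(* [exp(- e^(N (x - t)))] is a limit of combinations of the exponentials [e^(- n t)],
   and tends to the indicator of [t > x] as [N] goes to infinity. *)
Lemma lerch : {ae leb, forall t : R, time t -> g t = 0}.
Proof.
apply: ae_exhaust time_open _ => a b ab abT.
have Iab : leb.-integrable `[a, b] (EFin \o g) by exact: integrableS Ig.
apply: ae_zero_prim => // x /andP[ax xb].
have [I1 E1] := tail a; have [I2 E2] := tail x.
have axT : `[a, x] `<=` @time R.
  by move=> t /=; rewrite in_itv/= => /andP[h1 h2]; apply: abT; rewrite /= in_itv/= h1 (le_trans h2).
transitivity (\int[leb]_(t in time) ((g \_ `[a, x]) t)).
  rewrite (@Rintegral_supp _ _ _ leb time `[a, x] (g \_ `[a, x])).
  - by apply: eqRint => t h; rewrite patchE mem_set.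
  - by move=> t _ h; rewrite patchE memNset.
  - by move=> t h /(_ (axT _ h)).
rewrite (@ae_eq_Rintegral _ _ _ leb time _ (fun t => g t * step a t - g t * step x t)) //.
- by rewrite RintegralB// E1 E2 subrr.
- apply: measurable_funTS; apply/(measurable_restrictT _ _).1; first exact: measurable_itv.
  by apply: measurable_funS axT mg.
- exact: integrable_real_measurable (lebB mT I1 I2).
- apply: ae_imp2 (ae_neq a) (ae_neq x) _ => t ta tx tT; rewrite patchE /step.
  have [h|h] := pselect (`[a, x]%classic t).
    rewrite mem_set//; move: h; rewrite /= in_itv/= => /andP[h1 h2].
    have -> : a < t by rewrite lt_neqAle h1 andbT eq_sym; apply/eqP.
    have -> : t < x by rewrite lt_neqAle h2 andbT; apply/eqP.
    by rewrite ltNge h2/= mulr1 mulr0 subr0.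
  rewrite memNset//.
  have [at'|ta'|/esym//] := ltgtP a t; have [xt'|tx'|/esym//] := ltgtP x t; rewrite ?subrr//.
    by exfalso; apply: h; rewrite /= in_itv/= !ltW.
  by move: (lt_trans xt' ta'); rewrite ltNge ax.
Qed.
End vanishing_transform.
End lerch.

(** * Pairings of square-integrable fields *)

Lemma prod_integrable_le {R : realType} (D : set (R * R)) (f g : R * R -> R) : measurable D ->
  measurable_fun D f -> (leb \x leb)%E.-integrable D (EFin \o g) ->
  (forall z, D z -> `|f z| <= g z) -> (leb \x leb)%E.-integrable D (EFin \o f).
Proof. by move=> mD mf Ig fg; apply: (@integrable_real_le _ _ R (leb \x leb)%E D mD f g). Qed.

Section bounded_pieces.
Context {R : realType}.
Variable I : set R.
Hypothesis oI : open I.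
Let mI : measurable I. Proof. exact: open_measurable. Qed.
(** On an unbounded I a square integrable function need not be integrable, so integrals are taken on
    bounded pieces. Unlike compact subsets of I these reach its finite ends, which keeps boundary
    values within reach. *)
Definition piece (n : nat) : set R := I `&` `]- n%:R, n%:R[%classic.

Lemma piece_measurable n : measurable (piece n).
Proof. by apply: measurableI => //; exact: measurable_itv. Qed.

Lemma archi_bound (x y : R) : exists n : nat, `|x| < n%:R /\ `|y| < n%:R.
Proof.
exists (Num.bound (`|x| + `|y|)); have := archi_boundP (_ : 0 <= `|x| + `|y|).
rewrite addr_ge0// => /(_ isT) h; split; apply: le_lt_trans h; rewrite ?lerDl ?lerDr//.
Qed.

Lemma piece_integrable (g : R -> R) : (forall n, leb.-integrable (piece n) (EFin \o g)) ->
  locally_integrable I g /\ loc_int (g \_ I).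
Proof.
move=> H.
have mg : measurable_fun I g.
  rewrite (_ : I = \bigcup_n piece n).
    by apply/measurable_fun_bigcup => n; [exact: piece_measurable|exact: integrable_real_measurable (H n)].
  apply/seteqP; split=> [x Ix|x [n _ []]//].
  have [n [xn _]] := archi_bound x x; exists n => //; split => //.
  by rewrite /= in_itv/= -ltr_norml.
have lI : loc_int (g \_ I).
  move=> a b; have [n [an bn]] := archi_bound a b.
  have mab : measurable `[a, b]%classic by exact: measurable_itv.
  have abn : `[a, b] `<=` `]- n%:R, n%:R[%classic.
    move=> x /=; rewrite !in_itv/= => /andP[ax xb]; move: an bn; rewrite !ltr_norml => /andP[h1 _] /andP[_ h2].
    by rewrite (lt_le_trans h1)//= (le_lt_trans xb).
  have i1 : leb.-integrable `]- n%:R, n%:R[ (EFin \o (g \_ I)).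
    have i2 : leb.-integrable setT ((EFin \o g) \_ (piece n)) by apply: (integrable_mkcond _ _).1 => //; exact: piece_measurable.
    apply: (@eq_integrable _ _ _ leb _ _ ((EFin \o g) \_ (piece n))).
    - exact: measurable_itv.
    - move=> x /set_mem xn /=; rewrite /= !patchE.
      case: (boolP (x \in I)) => [/set_mem Ix|/negP nI]; first by rewrite mem_set.
      by rewrite memNset// => -[/mem_set].
    - by apply: integrableS i2 => //; exact: measurable_itv.
  by apply: integrableS i1 => //; exact: measurable_itv.
split => //; split => // K KI cK.
have [M [Mr HM]] := compact_bounded cK.
have [n [n1 _]] := archi_bound (M + 1) 0.
have Kn : K `<=` piece n.
  move=> x Kx; split; first exact: KI.
  rewrite /= in_itv/= -ltr_norml; apply: le_lt_trans n1; apply: le_trans (ler_norm _).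
  by apply: (HM (M + 1)) => //; rewrite ltrDl.
have mK : measurable K by exact: compact_measurable.
by have /integrableP[] : leb.-integrable K (EFin \o g) by apply: integrableS (H n) => //; exact: piece_measurable.
Qed.

End bounded_pieces.

Section pairings.
Context {R : realType}.
Variables (I : set R) (gamma : R).
Hypotheses (oI : open I) (g0 : 0 < gamma).
Let mI : measurable I. Proof. exact: open_measurable. Qed.
Let mT : measurable (@time R). Proof. exact: open_measurable time_open. Qed.

(** With this decay |v k| is bounded by e^(- gamma t) (v^2 + C^2), which is integrable in time. Both
    test functions and e^(- s t) with s >= gamma are covered. *)
Definition admissible (k : R -> R) := measurable_fun time k /\
  exists C, forall t, 0 < t -> `|k t| <= C * expR (- gamma * t).

Lemma exp_time_integrable : leb.-integrable time (EFin \o (fun t : R => expR (- gamma * t))).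
Proof.
apply: (@ge0_integrable_bounded _ 0 gamma^-1) => [|x _|n]; [exact: expR_cont|exact: expR_ge0|].
rewrite prim0 subr0 add0r.
have d (t : R) : is_derive t 1 (fun t => gamma^-1 - gamma^-1 * expR (- gamma * t)) (expR (- gamma * t)).
  apply: der_eq (derB (der_cst t _) (derZ _ (expR_der (- gamma) t))) _.
  by field; rewrite gt_eqF.
have := prim_is_prim (@expR_cont _ (- gamma)) d n%:R; rewrite /= mulr0 expR0 mulr1 subrr add0r => <-.
by rewrite gerBl mulr_ge0 ?expR_ge0// invr_ge0 ltW.
Qed.

Section one_field.
Variable f : R -> R -> R.
Hypothesis Lf : L2gamma_L2 gamma I f.

Lemma pair_integrable n k : admissible k ->
  (leb \x leb)%E.-integrable (piece I n `*` time) (EFin \o (fun z : R * R => f z.1 z.2 * k z.2)).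
Proof.
move=> [mk [C HC]]; have [mf If] := Lf.
have mE := piece_measurable oI n.
have mET : measurable (piece I n `*` time : set (R * R)) by exact: measurableX.
have sub : piece I n `*` time `<=` I `*` @time R by move=> z [[Iz _] tz].
have mIT : measurable (I `*` time : set (R * R)) by exact: measurableX.
have i1 : (leb \x leb)%E.-integrable (piece I n `*` time) (EFin \o (fun z : R * R => weight gamma z.2 * f z.1 z.2 ^+ 2)).
  by apply: integrableS If.
have i2 : (leb \x leb)%E.-integrable (piece I n `*` time) (EFin \o (fun z : R * R => 1 * (C ^+ 2 * expR (- gamma * z.2)))).
  apply: (@integrable_tensor R (piece I n) time (fun=> 1) (fun t => C ^+ 2 * expR (- gamma * t)) mE mT).
    apply: (@integrableS _ _ _ leb `[- n%:R, n%:R]) => //; last exact: (continuous_loc_int (@cont_cst R 1)).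
    by move=> x [_ /=]; rewrite !in_itv/= => /andP[h1 h2]; rewrite !ltW.
  by apply: lebZ => //; exact: exp_time_integrable.
have i3 := @integrable_realD _ _ R (leb \x leb)%E _ mET _ _ i1 i2.
refine (prod_integrable_le mET _ i3 _).
  apply: measurable_funM; first exact: measurable_funS mIT sub mf.
  exact: measurable_fun_snd.
move=> [r t] [_ /=]; rewrite /time /= in_itv/= andbT => t0.
rewrite mul1r normrM; have kC := HC t t0; set F := f r t; set e := expR (- gamma * t) in kC *.
have e0 : 0 < e by exact: expR_gt0.
have C0 : 0 <= C by move: (le_trans (normr_ge0 _) kC); rewrite pmulr_lge0.
apply: (@le_trans _ _ (`|F| * (C * e))); first by apply: ler_wpM2l.
rewrite /weight -/e mulrA mulrC -(real_normK (num_real F)) [C ^+ 2 * e]mulrC -mulrDr.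
rewrite ler_pM2l//; have := sqr_ge0 (`|F| - C); rewrite sqrrB.
have : 0 <= `|F| * C by rewrite mulr_ge0.
by rewrite mulr2n; lra.
Qed.

Lemma pair_t_piece k : admissible k ->
  (forall n, leb.-integrable (piece I n) (EFin \o pair_t f k)) /\
  {ae leb, forall r : R, I r -> leb.-integrable time (EFin \o (fun t => f r t * k t))}.
Proof.
move=> ak; have H n := RFubini (piece_measurable oI n) mT (pair_integrable n ak).
split; first by move=> n; have [] := H n.
have : {ae leb, forall r : R, forall n, piece I n r -> leb.-integrable time (EFin \o (fun t => f r t * k t))}.
  by apply: ae_foralln => n; have [_ _ h _ _] := H n.
move=> h; apply: ae_imp h _ => r hr Ir; have [n [rn _]] := archi_bound r r.
by apply: (hr n); split => //; rewrite /= in_itv/= -ltr_norml.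
Qed.

Lemma pair_t_loc k : admissible k ->
  locally_integrable I (pair_t f k) /\ loc_int (pair_t f k \_ I).
Proof. by move=> ak; apply: piece_integrable => //; have [] := pair_t_piece ak. Qed.

(** Besides test functions this covers a Hermite cubic cut off to a strip along the boundary, which
    is neither smooth nor supported in a compact subset of I. *)
Definition multiplier (a : R -> R) := measurable_fun I a /\
  exists n C, (forall r, `|a r| <= C) /\ (forall r, I r -> ~ piece I n r -> a r = 0).

Lemma pair_multiplier_integrable (a k : R -> R) n C : measurable_fun I a -> (forall r, `|a r| <= C) ->
  admissible k ->
  (leb \x leb)%E.-integrable (piece I n `*` time) (EFin \o (fun z : R * R => f z.1 z.2 * k z.2 * a z.1)).
Proof.
move=> ma aC ak; have i := pair_integrable n ak.
have mE := piece_measurable oI n.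
have mET : measurable (piece I n `*` time : set (R * R)) by exact: measurableX.
have i3 := @integrable_realZ _ _ R (leb \x leb)%E _ mET C _ (integrable_norm i).
refine (prod_integrable_le mET _ i3 _).
  apply: measurable_funM; first exact: integrable_real_measurable i.
  apply: measurable_fun_fst => //; apply: measurable_funS ma => //.
  by move=> x [].
by move=> [r t] _ /=; rewrite normrM mulrC; apply: ler_wpM2r.
Qed.

Lemma admissible_exp : admissible (fun t => expR (- gamma * t)).
Proof.
split; first by apply: measurable_funTS; apply: continuous_measurable_fun; exact: expR_cont.
by exists 1 => t _; rewrite mul1r ger0_norm ?expR_ge0.
Qed.

Lemma admissible_indic (M : R) : admissible (fun t => if t < M then 1 else 0).
Proof.
split.
  apply: measurable_funTS; apply: measurable_fun_ifT => //; apply: measurable_fun_ltr => //; exact: measurable_id.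
exists (expR (gamma * `|M|)) => t t0; rewrite -expRD.
case: ifPn => [tM|_]; last by rewrite normr0 expR_ge0.
rewrite normr1 -expR0 ler_expR; have := ler_norm M; have : gamma * t <= gamma * `|M|.
  by rewrite ler_pM2l//; apply: ltW; apply: lt_le_trans tM (ler_norm _).
lra.
Qed.

Lemma pair_r_piece a : multiplier a ->
  (forall n, leb.-integrable (piece time n) (EFin \o pair_r I f a)) /\
  {ae leb, forall t : R, time t -> leb.-integrable I (EFin \o (fun r => f r t * a r))}.
Proof.
move=> [ma [n [C [aC a0]]]].
have mE := piece_measurable oI n.
have EI : piece I n `<=` I by move=> x [].
have red t : pair_r I f a t = \int[leb]_(r in piece I n) (f r t * a r).
  apply: Rintegral_supp => r; first by move=> h1 h2; rewrite a0// mulr0.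
  by move=> [].
split.
  (* The indicator of t < N is admissible, so Fubini's theorem yields integrability of the pairing
     on the bounded window without a weight. *)
  move=> N; have i := pair_multiplier_integrable n ma aC (admissible_indic N%:R).
  have [_ i2 _ _ _] := RFubini mE mT i.
  have mN : measurable (piece (@time R) N) by apply: piece_measurable; exact: time_open.
  have i3 : leb.-integrable (piece time N) (EFin \o (fun t => \int[leb]_(r in piece I n) (f r t * (if t < N%:R then 1 else 0) * a r))).
    by apply: integrableS i2 => // x [].
  apply: leb_eq i3 => // t [_ /=]; rewrite in_itv/= => /andP[_ tN]; rewrite red tN.
  by apply: eqRint => r _; rewrite mulr1.
have i := pair_multiplier_integrable n ma aC admissible_exp.
have [_ _ _ i4 _] := RFubini mE mT i.
apply: ae_imp i4 _ => t + tT => /(_ tT) h.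
have h' : leb.-integrable (piece I n) (EFin \o (fun r => f r t * a r)).
  apply: leb_eq (lebZ mE (expR (gamma * t)) h) => // r _ /=.
  have ee : expR (gamma * t) * expR (- gamma * t) = 1 by rewrite -expRD mulNr subrr expR0.
  by rewrite mulrA [X in X * _](_ : _ = f r t) // mulrCA ee mulr1.
apply: (@integrable_supp _ _ _ leb (piece I n) I) => // r.
  by move=> [].
by move=> h1 h2; rewrite a0// mulr0.
Qed.

Lemma pair_r_loc a : multiplier a ->
  locally_integrable time (pair_r I f a) /\ loc_int (pair_r I f a \_ time).
Proof. by move=> ha; apply: piece_integrable; [exact: time_open|have [] := pair_r_piece ha]. Qed.

Lemma pair_swap a k : multiplier a -> admissible k ->
  [/\ leb.-integrable I (EFin \o (fun r => pair_t f k r * a r)),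
      leb.-integrable time (EFin \o (fun t => pair_r I f a t * k t)) &
      \int[leb]_(r in I) (pair_t f k r * a r) = \int[leb]_(t in time) (pair_r I f a t * k t)].
Proof.
move=> ha ak; have [ma [n [C [aC a0]]]] := ha.
have mE := piece_measurable oI n.
have EI : piece I n `<=` I by move=> x [].
have [I1 I2 I3 I4 I5] := RFubini mE mT (pair_multiplier_integrable n ma aC ak).
have [px pxi] := pair_t_piece ak; have [pr pri] := pair_r_piece ha.
have [lX _] := pair_t_loc ak; have [lP _] := pair_r_loc ha.
have mX : measurable_fun I (pair_t f k) by have [] := lX.
have mP : measurable_fun time (pair_r I f a) by have [] := lP.
have mk : measurable_fun time k by have [] := ak.
have e1 : {ae leb, forall r : R, piece I n r -> \int[leb]_(t in time) (f r t * k t * a r) = pair_t f k r * a r}.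
  by apply: ae_imp pxi _ => r h Er; rewrite /pair_t RintegralZr//; apply: h; exact: EI.
have red t : pair_r I f a t = \int[leb]_(r in piece I n) (f r t * a r).
  apply: Rintegral_supp => r; first by move=> h1 h2; rewrite a0// mulr0.
  by move=> [].
have e2 : {ae leb, forall t : R, time t -> \int[leb]_(r in piece I n) (f r t * k t * a r) = pair_r I f a t * k t}.
  apply: ae_imp pri _ => t h tT; rewrite red -RintegralZr//.
    by apply: eqRint => r _; rewrite mulrAC.
  by apply: integrableS (h tT).
have mXa : measurable_fun (piece I n) (fun r => pair_t f k r * a r).
  by apply: measurable_funS EI _ => //; exact: measurable_funM.
have mPk : measurable_fun time (fun t => pair_r I f a t * k t) by exact: measurable_funM.
have ae_int (A : set R) (g h : R -> R) : measurable A -> leb.-integrable A (EFin \o g) -> measurable_fun A h ->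
    {ae leb, forall x : R, A x -> g x = h x} -> leb.-integrable A (EFin \o h).
  move=> mA ig mh gh; have /integrableP[mg fg] := ig; apply/integrableP; split; first exact/measurable_EFinP.
  apply: le_lt_trans fg; rewrite le_eqVlt; apply/orP; left; apply/eqP.
  apply: ge0_ae_eq_integral => //.
  - by apply: measurableT_comp => //; exact/measurable_EFinP.
  - exact: measurableT_comp.
  - by apply: ae_imp gh _ => x e Ax /=; rewrite e.
split.
- apply: (@integrable_supp _ _ _ leb (piece I n) I) => //; last exact: ae_int e1.
  + by move=> r [].
  + by move=> r h1 h2; rewrite a0// mulr0.
- exact: ae_int e2.
rewrite (@Rintegral_supp _ _ _ leb I (piece I n)); last 2 first.
- by move=> r h1 h2; rewrite a0// mulr0.
- by move=> r [].
rewrite -(@ae_eq_Rintegral _ _ _ leb _ _ _ mE (integrable_real_measurable I1) mXa e1).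
rewrite -(@ae_eq_Rintegral _ _ _ leb _ _ _ mT (integrable_real_measurable I2) mPk e2).
exact: I5.
Qed.

End one_field.

End pairings.

Section traces.
Context {R : realType}.
Implicit Types (I : set R) (f g h : R -> R).

Lemma is_traceB I b f g h y z : is_trace I b f y -> is_trace I b g z ->
  {ae leb, forall x : R, I x -> f x - g x = h x} -> is_trace I b h (y - z).
Proof.
move=> [F [cF Ff <-]] [G [cG Gg <-]] e; exists (fun x => F x - G x); split => //.
  by move=> x; apply: cvgB; [exact: cF|exact: cG].
apply: ae_imp2 (ae_imp2 Ff Gg (fun x p q => conj p q)) e _ => x [e1 e2] e3 Ix.
by rewrite e1// e2// e3.
Qed.

Lemma is_trace_ae I b f g y : is_trace I b f y ->
  {ae leb, forall x : R, I x -> f x = g x} -> is_trace I b g y.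
Proof.
move=> [F [cF Ff <-]] e; exists F; split => //.
by apply: ae_imp2 Ff e _ => x e1 e2 Ix; rewrite e1// e2.
Qed.

Lemma trace_is I b f y : is_trace I b f y -> is_trace I b f (trace I b f).
Proof. by move=> H; apply: (@getPex _ [set y | is_trace I b f y]); exists y. Qed.

Lemma time_interval : is_interval (@time R).
Proof. exact: interval_is_interval. Qed.

Lemma time_nonempty : (@time R) !=set0.
Proof. by exists 1; rewrite /time /= in_itv/= andbT. Qed.

Lemma wderiv1_prim (f q : R -> R) : is_wderiv 1 time f q -> loc_int (q \_ time) ->
  is_trace time 0 f 0 -> {ae leb, forall t : R, time t -> f t = prim (q \_ time) t}.
Proof.
move=> fq lq tr; have [_ lI _] := fq.
have [C HC] := wderiv1_const time_interval time_nonempty fq (prim_wderiv time_open lI lq).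
have C0 : C = 0.
  have cF : continuous (fun t : R => C + prim (q \_ time) t).
    by move=> t; apply: continuousD; [exact: cst_continuous|exact: prim_continuous].
  have HC' : {ae leb, forall t : R, time t -> C + prim (q \_ time) t = f t} by apply: ae_imp HC _ => t h tT; rewrite h.
  have := continuous_is_trace 0 cF HC'.
  by rewrite prim0 addr0 => tr'; exact: is_trace_unique time_open closure_time tr' tr.
by apply: ae_imp HC _ => t h tT; rewrite h// C0 add0r.
Qed.

End traces.

(** * Weighted integration by parts on the half-line *)

Section half_line.
Context {R : realType}.
Implicit Types (f g k q : R -> R).
Let mT : measurable (@time R). Proof. exact: open_measurable time_open. Qed.

Definition expbound (s : R) k := exists C, forall t, 0 <= t -> `|k t| <= C * expR (- s * t).

Lemma expbound_admissible gamma s k : gamma <= s -> continuous k -> expbound s k -> admissible gamma k.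
Proof.
move=> gs ck [C HC]; split; first by apply: measurable_funTS; exact: continuous_measurable_fun.
have C0 : 0 <= C by have := HC 0 (lexx _); rewrite mulr0 expR0 mulr1; exact: le_trans.
exists C => t /ltW t0; apply: le_trans (HC t t0) _; apply: ler_wpM2l => //.
by rewrite ler_expR !mulNr lerN2 ler_wpM2r.
Qed.

Lemma expR_cvg0 (q : R) : q < 0 -> expR (n%:R * q) @[n --> \oo] --> (0 : R).
Proof.
move=> q0; rewrite (_ : (fun n => _) = fun n : nat => expR q ^+ n); last first.
  by apply/funext => n; rewrite expRM_natl.
by apply: cvg_expr; rewrite ger0_norm ?expR_ge0// expR_lt1.
Qed.

Lemma measurable_step (a : R) : measurable_fun setT (fun x : R => if x <= a then 1 else 0 : R).
Proof. by apply: measurable_fun_ifT => //; apply: measurable_fun_ler => //; exact: measurable_id. Qed.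

(** Puts integrals over the segments [0, n] on the common domain [time], where dominated convergence
    applies. *)
Lemma Rint_cut a f : \int[leb]_(t in `[0, a]) (f \_ time) t =
  \int[leb]_(t in time) (f t * (if t <= a then 1 else 0)).
Proof.
pose g t := (f \_ time) t * (if t <= a then 1 else 0).
have -> : \int[leb]_(t in `[0, a]) (f \_ time) t = \int[leb]_(t in `[0, a]) g t.
  by apply: eqRint => t /=; rewrite in_itv/= /g => /andP[_ ->]; rewrite mulr1.
have -> : \int[leb]_(t in time) (f t * (if t <= a then 1 else 0)) = \int[leb]_(t in time) g t.
  by apply: eqRint => t tT; rewrite /g patchE mem_set.
apply: Rintegral_supp => t; rewrite /time /= !in_itv/= andbT /g.
  by move=> _ /negP nt; rewrite patchE memNset ?mul0r// /time /= in_itv/= andbT; exact/negP.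
by move=> t0 /negP; rewrite (ltW t0)/= => /negbTE ->; rewrite mulr0.
Qed.

Lemma cut_integrable a f : leb.-integrable time (EFin \o f) ->
  leb.-integrable time (EFin \o (fun t => f t * (if t <= a then 1 else 0))).
Proof.
move=> If; apply: (leb_le mT _ (integrable_norm If)).
  apply: measurable_funM; first exact: integrable_real_measurable If.
  by apply: measurable_funTS; exact: measurable_step.
by move=> t _ /=; case: ifP => _; rewrite ?mulr1// mulr0 normr0.
Qed.

Lemma Rint_cut_cvg f : leb.-integrable time (EFin \o f) ->
  \int[leb]_(t in `[0, n%:R]) (f \_ time) t @[n --> \oo] --> \int[leb]_(t in time) f t.
Proof.
move=> If.
under eq_fun do rewrite Rint_cut.
apply: (@dominated_Rintegral _ _ R leb time (fun n t => f t * (if t <= n%:R then 1 else 0)) f (fun t => `|f t|) mT _ _ (integrable_norm If) _).2.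
- by move=> n; exact: integrable_real_measurable (cut_integrable _ If).
- move=> t _; apply: cvg_near_cst; near=> n.
  rewrite ifT ?mulr1//; near: n; exact: nbhs_infty_ger.
- by move=> n t _ /=; case: ifP => _; rewrite ?mulr1// mulr0 normr0.
Unshelve. all: by end_near.
Qed.

Section growth.
Variables (gamma s : R) (q : R -> R).
Hypotheses (g0 : 0 < gamma) (gs : gamma < s) (lq : loc_int (q \_ time))
  (Iq : leb.-integrable time (EFin \o (fun t => q t * expR (- gamma * t)))).

Let mq : measurable_fun time q.
Proof.
have mw := integrable_real_measurable Iq.
rewrite (_ : q = fun t => (q t * expR (- gamma * t)) * expR (gamma * t)).
  by apply: measurable_funM mw _; apply: measurable_funTS; apply: continuous_measurable_fun; exact: expR_cont.
by apply/funext => t; rewrite -mulrA -expRD mulNr addNr expR0 mulr1.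
Qed.

Lemma prim_growth : exists2 A, 0 <= A & forall t, 0 <= t -> `|prim (q \_ time) t| <= A * expR (gamma * t).
Proof.
exists (\int[leb]_(t in time) `|q t * expR (- gamma * t)|); first by apply: Rintegral_ge0 => // t _.
move=> t t0; have := prim_sub t0 lq; rewrite prim0 subr0 => ->; rewrite Rint_cut.
have IA := integrable_norm Iq.
have le1 x : time x -> `|q x * (if x <= t then 1 else 0)| <= expR (gamma * t) * `|q x * expR (- gamma * x)|.
  move=> _; case: ifP => xt; last by rewrite mulr0 normr0 mulr_ge0 ?expR_ge0.
  rewrite mulr1 normrM [`|expR _|]ger0_norm ?expR_ge0// mulrCA -expRD ler_peMr//.
  by rewrite -expR0 ler_expR mulNr -mulrBr mulr_ge0 ?subr_ge0// ltW.
have I1 : leb.-integrable time (EFin \o (fun x => q x * (if x <= t then 1 else 0))).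
  apply: leb_le le1 => //; last exact: lebZ.
  by apply: measurable_funM => //; apply: measurable_funTS; exact: measurable_step.
have h1 := @le_normr_Rintegral _ _ R leb _ _ mT I1.
apply: (le_trans h1).
have h2 := @RintegralZl _ _ R leb time (fun x => `|q x * expR (- gamma * x)|) (expR (gamma * t)) mT IA.
rewrite mulrC -h2; apply: (@le_Rintegral _ _ R leb) => //; [exact: integrable_norm I1|exact: lebZ].
Qed.

Lemma weighted_mul_integrable k : continuous k -> expbound s k ->
  leb.-integrable time (EFin \o (fun t => q t * k t)).
Proof.
move=> ck [C HC]; apply: (leb_le mT _ (lebZ mT C (integrable_norm Iq))).
  by apply: measurable_funM => //; apply: measurable_funTS; exact: continuous_measurable_fun.
move=> t; rewrite /time /= in_itv/= andbT => /ltW t0.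
have C0 : 0 <= C by have := HC 0 (lexx _); rewrite mulr0 expR0 mulr1; exact: le_trans.
rewrite !normrM mulrCA; apply: ler_wpM2l => //; apply: le_trans (HC t t0) _.
rewrite ger0_norm ?expR_ge0//; apply: ler_wpM2l => //.
by rewrite ler_expR !mulNr lerN2 ler_wpM2r// ltW.
Qed.

(** The primitive of q grows at most like e^(gamma t), so gamma < s makes the boundary term at
    infinity vanish; the one at 0 vanishes because the primitive starts at 0. *)
Lemma ibp_half_line k k' : continuous k' -> (forall t : R, is_derive t 1 k (k' t)) ->
  expbound s k -> expbound s k' ->
  \int[leb]_(t in time) (prim (q \_ time) t * k' t) = - \int[leb]_(t in time) (q t * k t).
Proof.
move=> ck' dk bk bk'; have ck := der_continuousT dk; have [A A0 HA] := prim_growth.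
pose Q := prim (q \_ time).
have cQ : continuous Q by exact: prim_continuous.
have bQ (k0 : R -> R) : expbound s k0 -> exists D, forall t, 0 <= t -> `|Q t * k0 t| <= D * expR (- (s - gamma) * t).
  move=> [C HC]; exists (A * C) => t t0; rewrite normrM.
  have -> : expR (- (s - gamma) * t) = expR (gamma * t) * expR (- s * t) by rewrite -expRD; congr expR; ring.
  by rewrite mulrACA; apply: ler_pM => //; [exact: HA|exact: HC].
have I1 := weighted_mul_integrable ck bk.
have I2 : leb.-integrable time (EFin \o (fun t => Q t * k' t)).
  have [D HD] := bQ _ bk'; have sg0 : 0 < s - gamma by rewrite subr_gt0.
  apply: (leb_le mT _ (lebZ mT D (exp_time_integrable sg0))).
    apply: measurable_funTS; apply: continuous_measurable_fun => t; apply: continuousM; [exact: cQ|exact: ck'].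
  by move=> t; rewrite /time /= in_itv/= andbT => /ltW; exact: HD.
have L1 := Rint_cut_cvg I1; have L2 := Rint_cut_cvg I2.
have L3 : Q n%:R * k n%:R @[n --> \oo] --> (0 : R).
  have [D HD] := bQ _ bk.
  have sg0 : - (s - gamma) < 0 by rewrite oppr_lt0 subr_gt0.
  have L := expR_cvg0 sg0.
  have L' : D * expR (n%:R * - (s - gamma)) @[n --> \oo] --> (0 : R).
    by rewrite -(mulr0 D); apply: cvgMr.
  apply/norm_cvg0P; apply: (squeeze_cvgr _ (cvg_cst 0) L').
  near=> n; rewrite normr_ge0/=; apply: le_trans (HD _ (ler0n _ n)) _.
  by rewrite [_ * n%:R]mulrC.
have E (n : nat) : \int[leb]_(t in `[0, n%:R]) ((fun t => q t * k t) \_ time) t =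
    Q n%:R * k n%:R - \int[leb]_(t in `[0, n%:R]) ((fun t => Q t * k' t) \_ time) t.
  have := prim_ibp (ler0n R n) lq ck' dk; rewrite prim0 mul0r subr0 -/Q => e.
  have -> : \int[leb]_(t in `[0, n%:R]) ((fun t => Q t * k' t) \_ time) t = \int[leb]_(t in `[0, n%:R]) (Q t * k' t).
    apply: eqRint => t; rewrite /= in_itv/= => /andP[t0 _]; rewrite patchE.
    case: ifPn => //; rewrite notin_setE /time /= in_itv/= andbT => /negP; rewrite -leNgt => t0'.
    have -> : t = 0 by apply/le_anti; rewrite t0 t0'.
    by rewrite /Q prim0 mul0r.
  rewrite -e; apply: eqRint => t _; rewrite !patchE; by case: ifP; rewrite ?mul0r.
have L4 : Q n%:R * k n%:R - \int[leb]_(t in `[0, n%:R]) ((fun t => Q t * k' t) \_ time) t @[n --> \oo]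
    --> 0 - \int[leb]_(t in time) (Q t * k' t) by exact: cvgB.
rewrite sub0r in L4.
have e : \int[leb]_(t in time) (q t * k t) = - \int[leb]_(t in time) (Q t * k' t).
  apply: cvg_unique L1 _; first exact: Rhausdorff.
  by move: L4; under eq_fun do rewrite -E.
by rewrite e opprK.
Unshelve. all: by end_near.
Qed.

End growth.
End half_line.

(** * Truncations of e^(- s t) *)

Section cutoff_family.
Context {R : realType}.
Variables (chi : R -> R) (B : R).
Hypotheses (schi : smooth chi) (chi1 : forall t, t <= 2^-1 -> chi t = 1)
  (chi0 : forall t, 1 <= t -> chi t = 0) (B0 : 0 < B)
  (chiB : forall t, [/\ `|chi t| <= B, `|derive1 chi t| <= B & `|derive1 (derive1 chi) t| <= B]).
Variable s : R.
Hypothesis s0 : 0 < s.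
Implicit Types (a t : R).

(* [kap a] joins [e^(-s t)], for [a = 0], to functions supported in [[0, 1/a]];
   [kap a - kap b] is a test function on [(0, oo)] for [0 < a <= b]. *)
Definition kap a t := expR (- s * t) * chi (a * t + 0).
Definition kap1 a t := expR (- s * t) * (a * derive1 chi (a * t + 0) - s * chi (a * t + 0)).
Definition kap2 a t := expR (- s * t) *
  (a ^+ 2 * derive1 (derive1 chi) (a * t + 0) - 2 * s * a * derive1 chi (a * t + 0) + s ^+ 2 * chi (a * t + 0)).

Lemma kap_der a t : is_derive t 1 (kap a) (kap1 a t).
Proof.
have d : is_derive t 1 (fun t => chi (a * t + 0)) (a * derive1 chi (a * t + 0)).
  by apply: der_comp_affine; exact: (@smooth_is_derive R chi 0).
by apply: der_eq (derM (expR_der (- s) t) d) _; rewrite /kap1; ring.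
Qed.

Lemma kap1_der a t : is_derive t 1 (kap1 a) (kap2 a t).
Proof.
have d : is_derive t 1 (fun t => chi (a * t + 0)) (a * derive1 chi (a * t + 0)).
  by apply: der_comp_affine; exact: (@smooth_is_derive R chi 0).
have d' : is_derive t 1 (fun t => derive1 chi (a * t + 0)) (a * derive1 (derive1 chi) (a * t + 0)).
  by apply: der_comp_affine; exact: (@smooth_is_derive R chi 1).
by apply: der_eq (derM (expR_der (- s) t) (derB (derZ a d') (derZ s d))) _; rewrite /kap2; ring.
Qed.

Let cchi j : continuous (derive1n j chi). Proof. exact: smooth_continuous. Qed.

Let cbr (a t : R) (f : R -> R) : continuous f -> {for t, continuous (fun t => f (a * t + 0))}.
Proof. by move=> cf; apply: continuous_comp; [exact: (der_continuous (der_affine t a 0))|exact: cf]. Qed.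

Lemma kap_cont a : continuous (kap a). Proof. exact: der_continuousT (kap_der a). Qed.
Lemma kap1_cont a : continuous (kap1 a). Proof. exact: der_continuousT (kap1_der a). Qed.

Lemma kap_smooth a : smooth (kap a).
Proof.
apply: smoothM; last exact: smooth_comp_affine.
rewrite (_ : (fun x => _) = fun x => expR (- s * x + 0)); last by apply/funext => x; rewrite addr0.
exact: (smooth_comp_affine _ _ smooth_expR).
Qed.

Lemma kap_derive2 a : derive1n 2 (kap a) = kap2 a.
Proof. by rewrite /= (derive1_is (kap_der a)) (derive1_is (kap1_der a)). Qed.

Lemma kap2_cont a : continuous (kap2 a).
Proof. by rewrite -kap_derive2; exact: smooth_continuous (kap_smooth a). Qed.

Lemma kap_zero t : kap 0 t = expR (- s * t).
Proof. by rewrite /kap mul0r add0r chi1 ?mulr1// invr_ge0. Qed.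

Lemma kap_le a t : `|kap a t| <= B * expR (- s * t).
Proof.
rewrite /kap normrM ger0_norm ?expR_ge0// mulrC ler_wpM2r ?expR_ge0//.
by have [] := chiB (a * t + 0).
Qed.

Lemma kap1_le a t : 0 <= a -> `|kap1 a t| <= (a + s) * B * expR (- s * t).
Proof.
move=> a0; rewrite /kap1 normrM ger0_norm ?expR_ge0// mulrC ler_wpM2r ?expR_ge0//.
have [h0 h1 _] := chiB (a * t + 0).
apply: le_trans (ler_normB _ _) _; rewrite !normrM (ger0_norm a0) (gtr0_norm s0) mulrDl.
by apply: lerD; apply: ler_wpM2l => //; exact: ltW.
Qed.

Lemma kap2_le a t : 0 <= a -> `|kap2 a t| <= (a + s) ^+ 2 * B * expR (- s * t).
Proof.
move=> a0; rewrite /kap2 normrM ger0_norm ?expR_ge0// mulrC ler_wpM2r ?expR_ge0//.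
have [h0 h1 h2] := chiB (a * t + 0).
apply: le_trans (ler_normD _ _) _; apply: (@le_trans _ _ (a ^+ 2 * B + 2 * s * a * B + s ^+ 2 * B)); last by rewrite le_eqVlt; apply/orP; left; apply/eqP; ring.
apply: lerD; last by rewrite normrM ger0_norm ?sqr_ge0// ler_wpM2l// sqr_ge0.
apply: le_trans (ler_normB _ _) _; apply: lerD; first by rewrite normrM ger0_norm ?sqr_ge0// ler_wpM2l// sqr_ge0.
have sa : 0 <= 2 * s * a by rewrite mulr_ge0// mulr_ge0// ltW.
by rewrite normrM (ger0_norm sa) ler_wpM2l.
Qed.

Lemma kap_expbound a : 0 <= a -> [/\ expbound s (kap a), expbound s (kap1 a) & expbound s (kap2 a)].
Proof.
move=> a0; split.
- by exists B => t _; exact: kap_le.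
- by exists ((a + s) * B) => t _; exact: kap1_le.
- by exists ((a + s) ^+ 2 * B) => t _; exact: kap2_le.
Qed.

Let tail0 (f : R -> R) : smooth f -> (forall t, 1 <= t -> f t = 0) -> forall t, 1 < t -> derive1 f t = 0.
Proof.
move=> sf f0 t t1; suff d : is_derive t 1 f 0 by rewrite derive1E; apply: derive_val.
have dn : \forall y \near t, (fun=> 0) y = f y.
  by near=> y; rewrite f0//; apply: ltW; near: y; exact: lt_nbhsr.
by apply: near_eq_is_derive dn (der_cst t 0) => //; rewrite oner_neq0.
Unshelve. all: by end_near.
Qed.

Lemma kap_tail a t : 0 < a -> a^-1 < t -> [/\ kap a t = 0, kap1 a t = 0 & kap2 a t = 0].
Proof.
move=> a0 at1; have h : 1 < a * t + 0 by rewrite addr0 -(mulfV (lt0r_neq0 a0)) ltr_pM2l.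
have z1 := tail0 schi chi0 h.
have z2 : derive1 (derive1 chi) (a * t + 0) = 0.
  have c1 (x : R) : 1 < x -> derive1 chi x = 0 by exact: tail0.
  rewrite derive1E; apply: derive_val; apply: near_eq_is_derive (der_cst (a * t + 0) 0).
  by near=> y; rewrite c1//; near: y; exact: lt_nbhsr.
by rewrite /kap /kap1 /kap2 z1 z2 (chi0 (ltW h)) !mulr0 !subr0 !addr0 !mulr0.
Unshelve. all: by end_near.
Qed.

Lemma kap_test a b : 0 < a -> a <= b -> test_fun time (fun t => kap a t - kap b t).
Proof.
move=> a0 ab; have b0 : 0 < b := lt_le_trans a0 ab.
(* For t <= 1/(2 b) both cut-offs equal 1 and the two functions cancel; for t >= 1/a both vanish. *)
apply: (@test_segment_fun R time _ ((2 * b)^-1) (a^-1)).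
- by apply: smoothB; exact: kap_smooth.
- move=> t; rewrite /time /= !in_itv/= andbT => /andP[h _]; apply: lt_le_trans h.
  by rewrite invr_gt0 mulr_gt0.
move=> t nt; have [h|h] := leP (a^-1) t.
  have at1 : 1 <= a * t + 0 by rewrite addr0 -(mulfV (lt0r_neq0 a0)) ler_pM2l.
  have bt1 : 1 <= b * t + 0.
    apply: (le_trans at1); rewrite !addr0 ler_wpM2r//; apply: le_trans h; by rewrite invr_ge0 ltW.
  by rewrite /kap !chi0// !mulr0 subr0.
have h2 : t < (2 * b)^-1.
  by rewrite ltNge; apply/negP => h2; apply: nt; rewrite h2 ltW.
have bt : b * t + 0 <= 2^-1.
  rewrite addr0; have := ltW h2; rewrite -(ler_pM2l b0) invfM mulrCA mulfV ?lt0r_neq0// mulr1.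
  by [].
have at_ : a * t + 0 <= 2^-1.
  rewrite addr0; have [t0|t0] := leP 0 t.
    by apply: le_trans (_ : b * t <= _); [rewrite ler_wpM2r|rewrite -[b * t]addr0].
  apply: (@le_trans _ _ 0); last by rewrite invr_ge0.
  by apply: mulr_ge0_le0; exact: ltW.
by rewrite /kap !chi1// subrr.
Qed.

Let inv_cvg0 : (n.+1%:R^-1 : R) @[n --> \oo] --> (0 : R).
Proof. exact: cvg_harmonic. Qed.

Let c_cvg (f : R -> R) t : continuous f -> f (n.+1%:R^-1 * t + 0) @[n --> \oo] --> f (0 * t + 0).
Proof.
move=> cf; have cg : {for (0 : R), continuous (fun a => f (t * a + 0))} by exact: cbr.
have := cvg_comp _ _ inv_cvg0 cg; rewrite mul0r mulr0 /comp /=.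
by under eq_fun do rewrite mulrC.
Qed.

Lemma kap_cvg t : kap (n.+1%:R^-1) t @[n --> \oo] --> kap 0 t.
Proof. by apply: cvgM; [exact: cvg_cst|exact: (@c_cvg chi t (@cchi 0))]. Qed.

Lemma kap2_cvg t : kap2 (n.+1%:R^-1) t @[n --> \oo] --> kap2 0 t.
Proof.
apply: cvgM; first exact: cvg_cst.
apply: cvgD; last by apply: cvgM; [exact: cvg_cst|exact: (@c_cvg chi t (@cchi 0))].
apply: cvgB; apply: cvgM; [|exact: (@c_cvg (derive1 (derive1 chi)) t (@cchi 2))| |exact: (@c_cvg (derive1 chi) t (@cchi 1))].
  exact: (cvg_comp _ _ inv_cvg0 (@exprn_continuous R 2 0)).
by apply: cvgM; [exact: cvg_cst|exact: inv_cvg0].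
Qed.

Lemma kap_cvg0 t : 0 < t -> kap n.+1%:R t @[n --> \oo] --> (0 : R).
Proof.
move=> t0; apply: cvg_near_cst; near=> n.
have h : t^-1 <= n.+1%:R.
  rewrite -natr1; apply: (@le_trans _ _ n%:R); last by rewrite lerDl.
  by near: n; exact: nbhs_infty_ger.
have h1 : 1 <= n.+1%:R * t + 0 by rewrite addr0 -ler_pdivrMr// div1r.
by rewrite /kap (chi0 h1) mulr0.
Unshelve. all: by end_near.
Qed.

(** The primitive of [kap a] that vanishes beyond 1/a. It has size O(1/a) for t >= 0 and allows a
    time derivative to be moved onto the velocity. *)
Definition antider a t := prim (kap a) t - prim (kap a) a^-1.

Lemma antider_der a t : is_derive t 1 (antider a) (kap a t).
Proof.
by apply: der_eq (derB (prim_is_deriveT (@kap_cont a) t) (der_cst t _)) _; rewrite subr0.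
Qed.

Lemma antider_le a t : 0 < a -> 0 <= t -> `|antider a t| <= B / a.
Proof.
move=> a0 t0; have Ba : 0 <= B / a by rewrite divr_ge0// ltW.
have [h|h] := leP t a^-1.
  have [c /andP[tc _] e] := der_mvt (prim_is_deriveT (@kap_cont a)) h.
  rewrite /antider distrC e normrM [X in _ * X]ger0_norm ?subr_ge0//.
  apply: ler_pM => //; first by rewrite subr_ge0.
    apply: le_trans (kap_le a c) _; rewrite ler_piMr ?(ltW B0)//.
    by rewrite -expR0 ler_expR mulNr oppr_le0 mulr_ge0 ?(ltW s0)// (le_trans t0).
  by rewrite gerBl.
have [c /andP[ac _] e] := der_mvt (prim_is_deriveT (@kap_cont a)) (ltW h).
by rewrite /antider e /kap chi0 ?mulr0 ?mul0r ?normr0// addr0 -(mulfV (lt0r_neq0 a0)) ler_pM2l.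
Qed.

Lemma antider_tail a t : 0 < a -> a^-1 <= t -> antider a t = 0.
Proof.
move=> a0 h; have [c /andP[ac _] e] := der_mvt (prim_is_deriveT (@kap_cont a)) h.
by rewrite /antider e /kap chi0 ?mulr0 ?mul0r// addr0 -(mulfV (lt0r_neq0 a0)) ler_pM2l.
Qed.

Lemma antider_expbound a : 0 < a -> expbound s (antider a).
Proof.
move=> a0; exists (B / a * expR (s / a)) => t t0.
have Ba : 0 <= B / a by rewrite divr_ge0// ltW.
have [h|h] := leP a^-1 t.
  by rewrite antider_tail// normr0 mulr_ge0 ?expR_ge0// mulr_ge0 ?expR_ge0.
apply: le_trans (antider_le a0 t0) _; rewrite -mulrA -expRD ler_peMr//.
rewrite -expR0 ler_expR mulNr -mulrBr mulr_ge0 ?(ltW s0)// subr_ge0; exact: ltW.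
Qed.

End cutoff_family.

Section test_bounds.
Context {R : realType}.
Implicit Types (I : set R) (phi : R -> R).

Lemma test_bounded I phi : test_fun I phi -> exists C, forall x, `|phi x| <= C.
Proof.
move=> tp; have [_ [K [cK _ K0]]] := tp.
have cphi : continuous phi := @smooth_continuous R phi 0 (test_smooth tp).
have cI : compact (phi @` K).
  by apply: continuous_compact => //; exact: continuous_subspaceT.
have [M [_ HM]] := compact_bounded cI.
exists (Num.max 0 (M + 1)) => x; have [Kx|nKx] := pselect (K x); last by rewrite K0// normr0 le_max lexx.
by rewrite le_max (HM (M + 1)) ?orbT// ?ltrDl//; exists x.
Qed.

Lemma test_multiplier I phi : test_fun I phi -> multiplier I phi.
Proof.
move=> tp; have cphi : continuous phi := @smooth_continuous R phi 0 (test_smooth tp).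
split; first by apply: measurable_funTS; exact: continuous_measurable_fun.
have [C HC] := test_bounded tp; have [M M0 HM] := test_bounded_supp tp.
have [n [_ Mn]] := archi_bound 0 M.
exists n, C; split => // r Ir nr; apply: HM => /andP[h1 h2]; apply: nr; split => //.
rewrite /= in_itv/=; move: Mn; rewrite (gtr0_norm M0) => Mn.
by rewrite (lt_le_trans _ h1) ?ltrN2// (le_lt_trans h2).
Qed.

Lemma test_expbound (s : R) phi : 0 <= s -> test_fun time phi -> expbound s phi.
Proof.
move=> s0 tp; have [C HC] := test_bounded tp; have [M M0 HM] := test_bounded_supp tp.
have C0 : 0 <= C by apply: le_trans (HC 0).
exists (C * expR (s * M)) => t t0; rewrite -mulrA -expRD.
have [tM|Mt] := leP t M.
  apply: le_trans (HC t) _; rewrite ler_peMr// -expR0 ler_expR mulNr -mulrBr.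
  by rewrite mulr_ge0// subr_ge0.
by rewrite HM ?normr0 ?mulr_ge0 ?expR_ge0// => /andP[_]; rewrite leNgt Mt.
Qed.

End test_bounds.

Section decaying.
Context {R : realType}.
Definition decaying (s : R) (k k' : R -> R) := [/\ continuous k',
  forall t : R, is_derive t 1 k (k' t), expbound s k & expbound s k'].
End decaying.

(** * Pairing a field at rest with functions that do not vanish at t = 0 *)

Section weak_field.
Context {R : realType}.
Variables (I : set R) (gamma s c : R) (u w : R -> R -> R).
Hypotheses (oI : open I) (iI : is_interval I) (I0 : I !=set0) (g0 : 0 < gamma) (gs : gamma < s) (c0 : 0 < c).
Hypotheses (Lu : L2gamma_L2 gamma I u) (Lw : L2gamma_L2 gamma I w) (uw : is_dt 1 I u w).
Hypothesis wave : forall theta phi, test_fun time theta -> test_fun I phi ->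
  \int[leb]_(r in I) (pair_t u (derive1n 2 theta) r * phi r) =
  c ^+ 2 * \int[leb]_(r in I) (pair_t u theta r * derive1n 2 phi r).
Hypothesis init : forall psi, test_fun I psi ->
  is_trace time 0 (pair_r I u psi) 0 /\ is_trace time 0 (pair_r I w psi) 0.
Let mI : measurable I. Proof. exact: open_measurable. Qed.
Let mT : measurable (@time R). Proof. exact: open_measurable time_open. Qed.
Let s0 : 0 < s := lt_trans g0 gs.

Lemma exp_admissible k : continuous k -> expbound s k -> admissible gamma k.
Proof. exact: expbound_admissible (ltW gs). Qed.

Lemma test_admissible theta : test_fun time theta -> admissible gamma theta.
Proof.
move=> tt; apply: exp_admissible; last exact: test_expbound (ltW s0) tt.
exact: (@smooth_continuous R theta 0 (test_smooth tt)).
Qed.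

Let swap f k psi (Lf : L2gamma_L2 gamma I f) (tp : test_fun I psi) (ak : admissible gamma k) :=
  pair_swap oI g0 Lf (test_multiplier tp) ak.

Lemma pair_r_weighted f psi : L2gamma_L2 gamma I f -> multiplier I psi ->
  leb.-integrable time (EFin \o (fun t => pair_r I f psi t * expR (- gamma * t))).
Proof. by move=> Lf mp; have [_ + _] := pair_swap oI g0 Lf mp (admissible_exp gamma). Qed.

Lemma pair_r_wderiv1 psi : test_fun I psi -> is_wderiv 1 time (pair_r I u psi) (pair_r I w psi).
Proof.
move=> tp; have [lu _] := pair_r_loc oI g0 Lu (test_multiplier tp).
have [lw _] := pair_r_loc oI g0 Lw (test_multiplier tp).
split => // theta tt; rewrite expr1 mulN1r.
have a1 := test_admissible (test_derive1n 1 tt); have a0 := test_admissible tt.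
have [i1 _ <-] := swap Lu tp a1; have [i2 _ <-] := swap Lw tp a0.
rewrite -[RHS]mulN1r -(@RintegralZl _ _ R leb _ _ (-1) mI i2).
apply: ae_eq_Rintegral => //; first exact: integrable_real_measurable i1.
  exact: integrable_real_measurable (lebZ mI (-1) i2).
by apply: ae_imp (uw tt) _ => r h Ir; rewrite h// expr1 mulrA.
Qed.

Lemma pair_r_wderiv2 psi : test_fun I psi ->
  is_wderiv 2 time (pair_r I u psi) (fun t => c ^+ 2 * pair_r I u (derive1n 2 psi) t).
Proof.
move=> tp; have tp2 := test_derive1n 2 tp.
have [lu _] := pair_r_loc oI g0 Lu (test_multiplier tp).
have [lu2 _] := pair_r_loc oI g0 Lu (test_multiplier tp2).
split => //; first exact: locally_integrableZ.
move=> theta tt; rewrite sqrrN expr1n mul1r.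
have [_ _ <-] := swap Lu tp (test_admissible (test_derive1n 2 tt)).
have [_ i e] := swap Lu tp2 (test_admissible tt).
rewrite (wave tt tp) e -(@RintegralZl _ _ R leb _ _ (c ^+ 2) mT i).
by apply: eqRint => t _; rewrite mulrA.
Qed.

Lemma pair_r_prim psi : test_fun I psi ->
  {ae leb, forall t : R, time t -> pair_r I u psi t = prim (pair_r I w psi \_ time) t}.
Proof.
move=> tp; have [_ lw] := pair_r_loc oI g0 Lw (test_multiplier tp).
exact: wderiv1_prim (pair_r_wderiv1 tp) lw (init tp).1.
Qed.

Lemma pair_r_prim2 psi : test_fun I psi ->
  {ae leb, forall t : R, time t -> pair_r I w psi t =
     prim ((fun t => c ^+ 2 * pair_r I u (derive1n 2 psi) t) \_ time) t}.
Proof.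
move=> tp; have tp2 := test_derive1n 2 tp.
have [lu2 lu2'] := pair_r_loc oI g0 Lu (test_multiplier tp2).
have [lw _] := pair_r_loc oI g0 Lw (test_multiplier tp).
set G := (fun t => _ * _).
have lG : loc_int (G \_ time).
  rewrite (_ : G \_ time = fun t => c ^+ 2 * (pair_r I u (derive1n 2 psi) \_ time) t); first exact: loc_intZ.
  by apply/funext => t; rewrite !patchE; case: ifP => // _; rewrite mulr0.
have [B HB] := wderiv2_wderiv1 time_interval time_nonempty (pair_r_wderiv2 tp) lG.
have e := is_wderiv_ae_unique (pair_r_wderiv1 tp) HB.
have cF : continuous (fun t : R => B + prim (G \_ time) t).
  by move=> t; apply: continuousD; [exact: cst_continuous|exact: prim_continuous].
have e' : {ae leb, forall t : R, time t -> B + prim (G \_ time) t = pair_r I w psi t}.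
  by apply: ae_imp e _ => t h tT; rewrite h.
have := continuous_is_trace 0 cF e'; rewrite prim0 addr0 => tr.
have B0 := is_trace_unique time_open closure_time tr (init tp).2.
by apply: ae_imp e _ => t h tT; rewrite h// B0 add0r.
Qed.

Let parts f F k k' : loc_int (f \_ time) -> measurable_fun time F ->
  leb.-integrable time (EFin \o (fun t => f t * expR (- gamma * t))) ->
  {ae leb, forall t : R, time t -> F t = prim (f \_ time) t} -> decaying s k k' ->
  \int[leb]_(t in time) (F t * k' t) = - \int[leb]_(t in time) (f t * k t).
Proof.
move=> lf mF If e [ck' dk bk bk']; rewrite -(ibp_half_line g0 gs lf If ck' dk bk bk').
have mk' : measurable_fun time k' by apply: measurable_funTS; exact: continuous_measurable_fun.
have mp : measurable_fun time (prim (f \_ time)).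
  by apply: measurable_funTS; apply: continuous_measurable_fun; exact: prim_continuous.
apply: ae_eq_Rintegral => //; [exact: measurable_funM|exact: measurable_funM|].
by apply: ae_imp e _ => t h tT; rewrite h.
Qed.

Let parts_u psi k k' : test_fun I psi -> decaying s k k' ->
  \int[leb]_(t in time) (pair_r I u psi t * k' t) = - \int[leb]_(t in time) (pair_r I w psi t * k t).
Proof.
move=> tp dk; have mp := test_multiplier tp.
have [_ lw] := pair_r_loc oI g0 Lw mp; have [[mu _ _] _] := pair_r_loc oI g0 Lu mp.
exact: parts lw mu (pair_r_weighted Lw mp) (pair_r_prim tp) dk.
Qed.

Let parts_w psi k k' : test_fun I psi -> decaying s k k' ->
  \int[leb]_(t in time) (pair_r I w psi t * k' t) =
  - (c ^+ 2 * \int[leb]_(t in time) (pair_r I u (derive1n 2 psi) t * k t)).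
Proof.
move=> tp dk; have mp := test_multiplier tp; have mp2 := test_multiplier (test_derive1n 2 tp).
have [_ lu] := pair_r_loc oI g0 Lu mp2; have [[mw _ _] _] := pair_r_loc oI g0 Lw mp.
have I2 := pair_r_weighted Lu mp2; have [ck' ddk bk bk'] := dk; have ck := der_continuousT ddk.
have Ik := weighted_mul_integrable gs I2 ck bk.
have lG : loc_int ((fun t => c ^+ 2 * pair_r I u (derive1n 2 psi) t) \_ time).
  rewrite (_ : _ \_ time = fun t => c ^+ 2 * (pair_r I u (derive1n 2 psi) \_ time) t); first exact: loc_intZ.
  by apply/funext => t; rewrite !patchE; case: ifP => // _; rewrite mulr0.
have IG : leb.-integrable time (EFin \o (fun t => c ^+ 2 * pair_r I u (derive1n 2 psi) t * expR (- gamma * t))).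
  by apply: leb_eq (lebZ mT (c ^+ 2) I2) => // t _; rewrite mulrA.
rewrite (parts lG mw IG (pair_r_prim2 tp) dk); congr (- _).
rewrite -(@RintegralZl _ _ R leb _ _ (c ^+ 2) mT Ik).
by apply: eqRint => t _; rewrite mulrA.
Qed.

(** The velocity is defined through test functions that vanish near t = 0, whereas k need not vanish
    there. The boundary term at t = 0 can be read only after pairing with a test function in r,
    where the zero initial value removes it; the fundamental lemma then removes the pairing. *)
Lemma pair_t_derivative k k' : decaying s k k' ->
  {ae leb, forall r : R, I r -> pair_t u k' r = - pair_t w k r}.
Proof.
move=> dk; have [ck' ddk bk bk'] := dk; have ck := der_continuousT ddk.
have ak := exp_admissible ck bk; have ak' := exp_admissible ck' bk'.
have [lu _] := pair_t_loc oI g0 Lu ak'; have [lw _] := pair_t_loc oI g0 Lw ak.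
pose D r := pair_t u k' r + pair_t w k r.
have lD : locally_integrable I D by exact: locally_integrableD.
suff H : {ae leb, forall r : R, I r -> D r = 0}.
  by apply: ae_imp H _ => r h Ir; apply/eqP; rewrite -addr_eq0; apply/eqP; exact: h.
apply: fundamental_lemma => // phi tp.
have [i1 _ e1] := swap Lu tp ak'; have [i2 _ e2] := swap Lw tp ak.
rewrite (@eqRint _ _ (fun r => pair_t u k' r * phi r + pair_t w k r * phi r)); last by move=> r _; rewrite mulrDl.
by rewrite (@RintegralD _ _ R leb _ _ _ mI i1 i2) e1 e2 (parts_u tp dk) addNr.
Qed.

(** Two integrations by parts in time; the boundary terms at t = 0 vanish by the two initial
    conditions, one for each. *)
Lemma pair_t_wderiv2 k k' k'' : decaying s k k' -> decaying s k' k'' ->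
  is_wderiv 2 I (pair_t u k) (fun r => c ^- 2 * pair_t u k'' r).
Proof.
move=> dk dk'; have [ck' ddk bk _] := dk; have ck := der_continuousT ddk.
have [ck'' _ _ bk''] := dk'.
have ak := exp_admissible ck bk; have ak'' := exp_admissible ck'' bk''.
have [lu _] := pair_t_loc oI g0 Lu ak; have [lu2 _] := pair_t_loc oI g0 Lu ak''.
split => //; first exact: locally_integrableZ.
move=> phi tp; rewrite sqrrN expr1n mul1r.
have [_ _ e1] := swap Lu (test_derive1n 2 tp) ak; have [i2 _ e2] := swap Lu tp ak''.
rewrite [in RHS](@eqRint _ _ (fun r => c ^- 2 * (pair_t u k'' r * phi r))); last by move=> r _; rewrite mulrA.
rewrite e1 (@RintegralZl _ _ R leb _ _ (c ^- 2) mI i2) e2 (parts_u tp dk') (parts_w tp dk) opprK mulrA mulVf ?mul1r//.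
by rewrite expf_neq0// gt_eqF.
Qed.

End weak_field.

(** * Boundary values of the Laplace transform *)

Section classical_representatives.
Context {R : realType}.
Variable I : set R.
Hypothesis oI : open I.
Implicit Types (f X Y : R -> R).

(** A C^1 representative on the whole line together with its derivative, so that boundary values and
    slopes at the ends of I are point values. *)
Definition c1rep f X Y := [/\ continuous Y, forall x : R, is_derive x 1 X (Y x) &
  {ae leb, forall x : R, I x -> f x = X x}].

Lemma c1rep_unique b f X Y X' Y' : closure I b -> c1rep f X Y -> c1rep f X' Y' ->
  X b = X' b /\ Y b = Y' b.
Proof.
move=> clb [cY dX fX] [cY' dX' fX'].
have cX := der_continuousT dX; have cX' := der_continuousT dX'.
have sym g : {ae leb, forall x : R, I x -> f x = g x} -> {ae leb, forall x : R, I x -> g x = f x}.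
  by move=> h; apply: ae_imp h _ => x e Ix; rewrite e.
have EX x : closure I x -> X x = X' x.
  move=> cx; apply: (is_trace_unique oI cx); exact: continuous_is_trace (sym _ _).
split; first exact: EX.
have EY x : I x -> Y x = Y' x.
  move=> Ix; have dX1 : is_derive x 1 X (Y' x).
    apply: near_eq_is_derive (dX' x); near=> y; apply/esym/EX/subset_closure.
    by near: y; exact: open_nbhs_nbhs.
  by have e1 := @derive_val _ _ _ _ _ _ _ (dX x); have e2 := @derive_val _ _ _ _ _ _ _ dX1; rewrite -e1 -e2.
apply: (is_trace_unique (f := Y) oI clb); first by apply: continuous_is_trace => //; apply: aeW.
by apply: continuous_is_trace => //; apply: aeW => x Ix; rewrite EY.
Unshelve. all: by end_near.
Qed.

Lemma c1repB f X Y f' X' Y' h : c1rep f X Y -> c1rep f' X' Y' ->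
  {ae leb, forall x : R, I x -> f x - f' x = h x} ->
  c1rep h (fun x => X x - X' x) (fun x => Y x - Y' x).
Proof.
move=> [cY dX fX] [cY' dX' fX'] e; split.
- by move=> x; apply: continuousB; [exact: cY|exact: cY'].
- by move=> x; exact: derB.
apply: ae_imp2 (ae_imp2 fX fX' (fun x p q => conj p q)) e _ => x [e1 e2] e3 Ix.
by rewrite -e3// e1// e2.
Qed.

End classical_representatives.

Section ae_monotone.
Context {R : realType}.
Variable D : set R.
Hypothesis mD : measurable D.
Implicit Types (f g : R -> R).

(** The pointwise maximum of f and g dominates f everywhere and equals g almost everywhere. *)
Lemma ae_le_Rintegral f g : leb.-integrable D (EFin \o f) -> leb.-integrable D (EFin \o g) ->
  {ae leb, forall x : R, D x -> f x <= g x} -> \int[leb]_(x in D) f x <= \int[leb]_(x in D) g x.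
Proof.
move=> If Ig fg; have mf := integrable_real_measurable If; have mg := integrable_real_measurable Ig.
have mm : measurable_fun D (fun x => Num.max (f x) (g x)) by exact: measurable_maxr.
have Im : leb.-integrable D (EFin \o (fun x => Num.max (f x) (g x))).
  apply: (leb_le mD mm (lebD mD (integrable_norm If) (integrable_norm Ig))) => x _ /=.
  by rewrite /Num.max; case: ifP => _; rewrite ?lerDl ?lerDr.
rewrite [leRHS](@ae_eq_Rintegral _ _ R leb D g _ mD mg mm); last first.
  by apply: ae_imp fg _ => x h Dx; rewrite max_r//; exact: h.
by apply: (@le_Rintegral _ _ R leb) => // x _; rewrite le_max lexx.
Qed.

Lemma ae_norm_Rintegral f g : measurable_fun D f -> leb.-integrable D (EFin \o g) ->
  leb.-integrable D (EFin \o f) ->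
  {ae leb, forall x : R, D x -> `|f x| <= g x} -> `|\int[leb]_(x in D) f x| <= \int[leb]_(x in D) g x.
Proof.
move=> mf Ig If fg; have h := @le_normr_Rintegral _ _ R leb _ _ mD If.
by apply: (le_trans h); apply: ae_le_Rintegral => //; exact: (integrable_norm If).
Qed.

End ae_monotone.

Section weighted_scalar.
Context {R : realType}.
Variables (gamma s : R).
Hypotheses (g0 : 0 < gamma) (gs : gamma < s).
Let mT : measurable (@time R). Proof. exact: open_measurable time_open. Qed.

Lemma L2_weight_integrable (h : R -> R) : L2 (weight gamma) time h ->
  leb.-integrable time (EFin \o (fun t => h t * expR (- gamma * t))).
Proof.
move=> [mh Ih]; have I1 : leb.-integrable time (EFin \o (fun t => weight gamma t * h t ^+ 2)) by [].
apply: (leb_le mT _ (lebD mT I1 (exp_time_integrable g0))).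
  by apply: measurable_funM => //; apply: measurable_funTS; apply: continuous_measurable_fun; exact: expR_cont.
move=> t _; rewrite /weight normrM [`|expR _|]ger0_norm ?expR_ge0//.
have h1 : `|h t| <= h t ^+ 2 + 1.
  rewrite -(real_normK (num_real (h t))); have := sqr_ge0 (`|h t| - 1).
  by rewrite sqrrB mulr1 expr1n mulr2n; have := normr_ge0 (h t); lra.
by have := ler_wpM2l (expR_ge0 (- gamma * t)) h1; rewrite mulrDr mulr1 [_ * `|_|]mulrC.
Qed.

Lemma weighted_limit (p : R -> R) (kn : nat -> R -> R) (k : R -> R) C :
  leb.-integrable time (EFin \o (fun t => p t * expR (- gamma * t))) ->
  measurable_fun time p -> (forall n, continuous (kn n)) ->
  (forall n t, 0 < t -> `|kn n t| <= C * expR (- s * t)) ->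
  (forall t, 0 < t -> kn n t @[n --> \oo] --> k t) ->
  \int[leb]_(t in time) (p t * kn n t) @[n --> \oo] --> \int[leb]_(t in time) (p t * k t).
Proof.
move=> Ip mp ckn kC kk.
apply: (@dominated_Rintegral _ _ R leb time (fun n t => p t * kn n t) (fun t => p t * k t)
  (fun t => C * `|p t * expR (- gamma * t)|) mT _ _ (lebZ mT C (integrable_norm Ip)) _).2.
- by move=> n; apply: measurable_funM => //; apply: measurable_funTS; exact: continuous_measurable_fun.
- move=> t; rewrite /time /= in_itv/= andbT => t0; apply: cvgM; [exact: cvg_cst|exact: kk].
move=> n t; rewrite /time /= in_itv/= andbT => t0; have h := kC n t t0.
have C0 : 0 <= C by move: (le_trans (normr_ge0 _) h); rewrite pmulr_lge0// expR_gt0.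
rewrite !normrM mulrCA; apply: ler_wpM2l => //; apply: le_trans h _; apply: ler_wpM2l => //.
by rewrite ger0_norm ?expR_ge0// ler_expR !mulNr lerN2 ler_wpM2r// ltW.
Qed.

End weighted_scalar.

Section strips.
Context {R : realType}.
Variables (left : bool) (b l : R).
Hypothesis l0 : 0 < l.

Lemma strip_bounded : exists n : nat, strip left b l `<=` `]- n%:R, n%:R[%classic.
Proof.
have [n [h1 h2]] := archi_bound (b - l) (b + l); exists n => r.
move: h1 h2; rewrite !ltr_norml => /andP[h1 _] /andP[_ h2].
by rewrite /strip; case: left; rewrite /= !in_itv/= => /andP[r1 r2]; apply/andP; split; lra.
Qed.

Lemma strip_multiplier I (h : R -> R) : strip left b l `<=` I -> continuous h ->
  multiplier I (h \_ (strip left b l)).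
Proof.
move=> sI ch; have mS := @strip_measurable R left b l.
split.
  apply: measurable_funTS; apply: (measurable_restrictT h mS).1.
  by apply: measurable_funTS; exact: continuous_measurable_fun.
have [n hn] := strip_bounded.
have cK : compact (h @` `[b - l, b + l]).
  by apply: continuous_compact; [exact: continuous_subspaceT|exact: segment_compact].
have [M [_ HM]] := compact_bounded cK.
exists n, (Num.max 0 (M + 1)); split=> [r|r Ir nr]; rewrite patchE.
  case: ifPn => [/set_mem rs|_]; last by rewrite normr0 le_max lexx.
  rewrite le_max (HM (M + 1)) ?orbT// ?ltrDl//; exists r => //.
  have := strip_dist l0 rs; rewrite mul1r ler_norml /= in_itv/= => /andP[r1 r2]; apply/andP; split; lra.
rewrite memNset// => rs; apply: nr; split => //; exact: hn.
Qed.

Lemma strip_Rint I (f h : R -> R) : strip left b l `<=` I ->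
  \int[leb]_(r in strip left b l) (f r * h r) = \int[leb]_(r in I) (f r * (h \_ (strip left b l)) r).
Proof.
move=> sI; rewrite -[RHS](@Rintegral_supp _ _ _ leb (strip left b l)).
- by apply: eqRint => r rs; rewrite patchE mem_set.
- by move=> r /sI.
- by move=> r _ nr; rewrite patchE memNset// mulr0.
Qed.

Lemma strip_length (k : R) : \int[leb]_(r in strip left b l) k = k * l.
Proof.
have d (x : R) : is_derive x 1 (fun r => k * r + 0) k by exact: der_affine.
have lk := continuous_loc_int (@cont_cst R k).
rewrite /strip; case: left; rewrite Rintegral_itv_oo// (FTC_segment (@cont_cst R k) d) ?lerDl ?gerBl ?ltW//; ring.
Qed.

Lemma strip_notin : ~ strip left b l b.
Proof. by rewrite /strip; case: left; rewrite /= in_itv/= ltxx ?andbF. Qed.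

End strips.

(** * Boundary values read on shrinking strips *)

Section boundary_functional.
Context {R : realType}.
Variables (I : set R) (gamma s c : R) (u w : R -> R -> R) (chi : R -> R) (B : R).
Hypotheses (oI : open I) (g0 : 0 < gamma) (gs : gamma < s) (c0 : 0 < c).
Hypotheses (Lu : L2gamma_L2 gamma I u) (Lw : L2gamma_L2 gamma I w).
Hypothesis der_uw : forall k k', decaying s k k' ->
  {ae leb, forall r : R, I r -> pair_t u k' r = - pair_t w k r}.
Hypotheses (schi : smooth chi) (chi1 : forall t, t <= 2^-1 -> chi t = 1)
  (chi0 : forall t, 1 <= t -> chi t = 0) (B0 : 0 < B)
  (chiB : forall t, [/\ `|chi t| <= B, `|derive1 chi t| <= B & `|derive1 (derive1 chi) t| <= B]).
Variables (left : bool) (b l1 : R) (P Q : R -> R -> R) (sg1 sg2 : R).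
Hypotheses (l10 : 0 < l1) (stripI : forall l, 0 < l -> l <= l1 -> strip left b l `<=` I)
  (cP : forall l, continuous (P l)) (cQ : forall l, continuous (Q l))
  (PB : forall l r, 0 < l -> l <= 1 -> strip left b l r -> `|P l r| <= 6)
  (QB : forall l r, 0 < l -> l <= 1 -> strip left b l r -> `|Q l r| <= 18 / l ^+ 2)
  (sg1B : `|sg1| <= 1) (sg2B : `|sg2| <= 1).
Let mI : measurable I. Proof. exact: open_measurable. Qed.
Let mT : measurable (@time R). Proof. exact: open_measurable time_open. Qed.
Let s0 : 0 < s := lt_trans g0 gs.
Let mS l : measurable (strip left b l). Proof. exact: strip_measurable. Qed.

Let K a := kap chi s a.
Let K1 a := kap1 chi s a.
Let K2 a := kap2 chi s a.

Lemma kap_decaying a : 0 <= a -> decaying s (K a) (K1 a) /\ decaying s (K1 a) (K2 a).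
Proof.
move=> a0; have [b0 b1 b2] := kap_expbound chiB s0 a0.
have d0 (t : R) : is_derive t 1 (K a) (K1 a t) by exact: kap_der.
have d1 (t : R) : is_derive t 1 (K1 a) (K2 a t) by exact: kap1_der.
have c1 : continuous (K1 a) by exact: kap1_cont.
have c2 : continuous (K2 a) by exact: kap2_cont.
by split; split.
Qed.

Lemma antider_decaying a : 0 < a -> decaying s (antider chi s a) (K a).
Proof.
move=> a0; split; first exact: kap_cont.
- by move=> t; exact: antider_der.
- exact: (antider_expbound schi chi0 B0 chiB s0 a0).
- by have [] := kap_expbound chiB s0 (ltW a0).
Qed.

(** The strip formula of [W2_boundary] for X = <u, kap a>, whose second derivative is c^(-2) <u,
    kap2 a>. P and Q stand for a Hermite cubic and its second derivative, so that the boundary value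
    and the boundary slope are treated by one argument. *)
Definition bfun l a : R :=
  sg1 * \int[leb]_(r in strip left b l) (c ^- 2 * pair_t u (K2 a) r * P l r) +
  sg2 * \int[leb]_(r in strip left b l) (pair_t u (K a) r * Q l r).

Let adm a : 0 <= a -> admissible gamma (K a) /\ admissible gamma (K2 a).
Proof.
move=> a0; have [b0 _ b2] := kap_expbound chiB s0 a0.
by split; apply: (expbound_admissible (ltW gs)) => //; [exact: kap_cont|exact: kap2_cont].
Qed.

Let strip_swap l k h : 0 < l -> l <= l1 -> continuous h -> admissible gamma k ->
  leb.-integrable (strip left b l) (EFin \o (fun r => pair_t u k r * h r)) /\
  \int[leb]_(r in strip left b l) (pair_t u k r * h r) =
  \int[leb]_(t in time) (pair_r I u (h \_ (strip left b l)) t * k t).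
Proof.
move=> l0 ll ch ak; have sI := stripI l0 ll.
have [i1 _ e] := pair_swap oI g0 Lu (strip_multiplier l0 sI ch) ak.
split; last by rewrite (strip_Rint _ _ sI).
have i2 : leb.-integrable (strip left b l) (EFin \o (fun r => pair_t u k r * (h \_ (strip left b l)) r)).
  by have := @integrableS _ _ R leb I (strip left b l) _ mI (mS l) sI i1.
by apply: leb_eq i2 => // r rs; rewrite patchE mem_set.
Qed.

Let strip_limit l h (kn : nat -> R -> R) (k : R -> R) C : 0 < l -> l <= l1 -> continuous h ->
  (forall n, continuous (kn n)) -> (forall n t, `|kn n t| <= C * expR (- s * t)) ->
  continuous k -> expbound s k -> (forall t, kn n t @[n --> \oo] --> k t) ->
  \int[leb]_(r in strip left b l) (pair_t u (kn n) r * h r) @[n --> \oo] -->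
  \int[leb]_(r in strip left b l) (pair_t u k r * h r).
Proof.
move=> l0 ll ch ckn kC ck bk kk.
have an n : admissible gamma (kn n) by apply: (expbound_admissible (ltW gs)) => //; exists C => t _.
have ak : admissible gamma k by exact: (expbound_admissible (ltW gs)).
rewrite (strip_swap l0 ll ch ak).2; under eq_fun do rewrite (strip_swap l0 ll ch (an _)).2.
have mp := strip_multiplier l0 (stripI l0 ll) ch.
have [[mpr _ _] _] := pair_r_loc oI g0 Lu mp.
exact: (weighted_limit gs (pair_r_weighted oI g0 Lu mp) mpr ckn (fun n t _ => kC n t) (fun t _ => kk t)).
Qed.

Let inv_le1 n : 0 <= (n.+1%:R^-1 : R) <= 1.
Proof. by rewrite invr_ge0 ler0n/= invf_le1// ler1n. Qed.

Lemma bfun_limit : bfun l1 n.+1%:R^-1 @[n --> \oo] --> bfun l1 0.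
Proof.
have [b0 _ b2] := kap_expbound chiB s0 (lexx 0).
have pull a : 0 <= a -> \int[leb]_(r in strip left b l1) (c ^- 2 * pair_t u (K2 a) r * P l1 r) =
    c ^- 2 * \int[leb]_(r in strip left b l1) (pair_t u (K2 a) r * P l1 r).
  move=> a0; have [i _] := strip_swap l10 (lexx _) (@cP l1) (adm a0).2.
  by rewrite -(@RintegralZl _ _ R leb _ _ (c ^- 2) (mS l1) i); apply: eqRint => r _; rewrite mulrA.
rewrite /bfun pull//; under eq_fun do rewrite (pull _ (andP (inv_le1 _)).1).
apply: cvgD; apply: cvgM; [exact: cvg_cst| |exact: cvg_cst|].
  apply: cvgM; first exact: cvg_cst.
  apply: (@strip_limit l1 (P l1) _ _ ((1 + s) ^+ 2 * B)) => //.
  - by move=> n; exact: kap2_cont.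
  - move=> n t; have /andP[i0 i1] := inv_le1 n; apply: (le_trans (kap2_le chiB s0 t i0)).
    rewrite ler_wpM2r ?expR_ge0// ler_wpM2r ?(ltW B0)// lerXn2r ?nnegrE ?addr_ge0 ?(ltW s0)//.
    by rewrite lerD2r.
  - exact: kap2_cont.
  - by move=> t; exact: kap2_cvg.
apply: (@strip_limit l1 (Q l1) _ _ B) => //.
- by move=> n; exact: kap_cont.
- by move=> n t; exact: kap_le.
- exact: kap_cont.
- by move=> t; exact: kap_cvg.
Qed.

Definition velocity_energy r := \int[leb]_(t in time) (weight gamma t * w r t ^+ 2).

Lemma energy_facts : leb.-integrable I (EFin \o velocity_energy) /\
  {ae leb, forall r : R, I r -> leb.-integrable time (EFin \o (fun t => weight gamma t * w r t ^+ 2))}.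
Proof.
have [_ IE] := Lw.
have IE' : (leb \x leb)%E.-integrable (I `*` time) (EFin \o (fun z : R * R => weight gamma z.2 * w z.1 z.2 ^+ 2)) by [].
by have [? _ ? _ _] := RFubini mI mT IE'.
Qed.

(* AM-GM, [|w| <= (e + w^2 / e) / 2]; with [e] of order [1/d] both terms are small
   on a strip of width [d], since the energy of [w] is integrable in [r]. *)
Lemma pair_small k KK d e : continuous k -> expbound s k -> 0 <= KK -> 0 < d -> d <= 1 -> 0 < e ->
  (forall t, 0 <= t -> `|k t| <= KK) -> (forall t, d < t -> k t = 0) ->
  {ae leb, forall r : R, I r -> `|pair_t w k r| <= KK / 2 * (e * d + e^-1 * expR gamma * velocity_energy r)}.
Proof.
move=> ck bk KK0 d0 d1 e0 kK kd.
have ak : admissible gamma k by exact: (expbound_admissible (ltW gs)).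
have [_ a1] := pair_t_piece oI g0 Lw ak; have [_ a2] := energy_facts.
have Istep : leb.-integrable time (EFin \o (fun t : R => if t <= d then 1 else 0)).
  apply: (leb_le mT _ (lebZ mT (expR gamma) (exp_time_integrable g0))).
    by apply: measurable_funTS; exact: measurable_step.
  move=> t _; case: ifP => [td|_]; last by rewrite normr0 mulr_ge0 ?expR_ge0.
  rewrite normr1 -expRD -expR0 ler_expR mulNr -[X in X - _]mulr1 -mulrBr mulr_ge0 ?(ltW g0)// subr_ge0.
  exact: le_trans td d1.
have Estep : \int[leb]_(t in time) (if t <= d then 1 else 0 : R) = d.
  have e1 := Rint_cut d (fun=> 1 : R).
  rewrite (@eqRint _ _ (fun t : R => 1 * (if t <= d then 1 else 0))) => [|t _]; last by rewrite mul1r.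
  have dd (x : R) : is_derive x 1 (fun r : R => 1 * r + 0) 1 by exact: der_affine.
  rewrite -e1 -[RHS](_ : 1 * d + 0 - (1 * 0 + 0) = d); last by ring.
  rewrite -(FTC_segment (@cont_cst R 1) dd (ltW d0)).
  have mseg : measurable `[(0 : R), d]%classic by exact: measurable_itv.
  apply: ae_eq_Rintegral => //.
    by apply: measurable_funTS; apply: (measurable_restrictT (fun=> 1 : R) mT).1.
  apply: ae_imp (ae_neq 0) _ => t tn; rewrite /= in_itv/= => /andP[t0 _].
  by rewrite patchE mem_set// /time /= in_itv/= andbT lt_def t0 andbT; apply/eqP.
apply: ae_imp2 a1 a2 _ => r i1 i2 Ir; have {}i1 := i1 Ir; have {}i2 := i2 Ir.
have Ib := lebZ mT (KK / 2) (lebD mT (lebZ mT e Istep) (lebZ mT (e^-1 * expR gamma) i2)).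
have -> : KK / 2 * (e * d + e^-1 * expR gamma * velocity_energy r) = \int[leb]_(t in time)
   (KK / 2 * (e * (if t <= d then 1 else 0) + e^-1 * expR gamma * (weight gamma t * w r t ^+ 2))).
  rewrite (@RintegralZl _ _ R leb _ _ _ mT (lebD mT (lebZ mT e Istep) (lebZ mT (e^-1 * expR gamma) i2))).
  rewrite (@RintegralD _ _ R leb _ _ _ mT (lebZ mT e Istep) (lebZ mT (e^-1 * expR gamma) i2)).
  by rewrite (@RintegralZl _ _ R leb _ _ _ mT Istep) (@RintegralZl _ _ R leb _ _ _ mT i2) Estep.
have h1 := @le_normr_Rintegral _ _ R leb _ _ mT i1.
apply: (le_trans h1); apply: (@le_Rintegral _ _ R leb) => //; first exact: (integrable_norm i1).
move=> t; rewrite /time /= in_itv/= andbT => t0; rewrite normrM.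
have e2 : 0 <= e^-1 * expR gamma by rewrite mulr_ge0 ?expR_ge0 ?invr_ge0 ?ltW.
have [td|dt] := leP t d; last first.
  rewrite kd// normr0 mulr0; apply: mulr_ge0; first by rewrite divr_ge0.
  by rewrite mulr0 add0r; apply: mulr_ge0 => //; apply: mulr_ge0; [exact: expR_ge0|exact: sqr_ge0].
have we : 1 <= expR gamma * weight gamma t.
  rewrite /weight -expRD -expR0 ler_expR mulNr -[X in X - _]mulr1 -mulrBr mulr_ge0 ?(ltW g0)// subr_ge0.
  exact: le_trans td d1.
have e3 : e^-1 * w r t ^+ 2 <= e^-1 * expR gamma * (weight gamma t * w r t ^+ 2).
  by rewrite -!mulrA ler_wpM2l ?invr_ge0 ?(ltW e0)// mulrA ler_peMl// sqr_ge0.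
have key : `|w r t| <= 2^-1 * (e + e^-1 * expR gamma * (weight gamma t * w r t ^+ 2)).
  rewrite [leRHS]mulrC ler_pdivlMr//; apply: (@le_trans _ _ (e + e^-1 * w r t ^+ 2)); last by rewrite lerD2l.
rewrite -(real_normK (num_real (w r t))); move: (`|w r t|) => y.
have := mulr_ge0 (ltW (_ : 0 < e^-1)) (sqr_ge0 (y - e)); rewrite invr_gt0 => /(_ e0).
have -> : e^-1 * (y - e) ^+ 2 = e^-1 * y ^+ 2 + e - y * 2 by field; rewrite gt_eqF.
  lra.
rewrite mulr1 -mulrA mulrC; apply: ler_pM => //; exact: kK (ltW t0).
Qed.

Let strip_bound l f h KK d e H : 0 < l -> l <= l1 -> l <= 1 -> leb.-integrable (strip left b l) (EFin \o (fun r => f r * h r)) ->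
  0 <= KK -> 0 <= H -> 0 < e -> 0 < d ->
  {ae leb, forall r : R, I r -> `|f r| <= KK / 2 * (e * d + e^-1 * expR gamma * velocity_energy r)} ->
  (forall r, strip left b l r -> `|h r| <= H) ->
  `|\int[leb]_(r in strip left b l) (f r * h r)| <=
    H * KK / 2 * (e * d * l + e^-1 * expR gamma * \int[leb]_(r in strip left b l) velocity_energy r).
Proof.
move=> l0 ll l1' Ifh KK0 H0 e0 d0 fb hb; have sI := stripI l0 ll.
have IE : leb.-integrable (strip left b l) (EFin \o velocity_energy).
  by have := @integrableS _ _ R leb I (strip left b l) _ mI (mS l) sI energy_facts.1.
have Ic : leb.-integrable (strip left b l) (EFin \o (fun=> e * d)).
  have Iseg : leb.-integrable `[b - l, b + l] (EFin \o (fun=> e * d)) by exact: (continuous_loc_int (@cont_cst R (e * d))).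
  have sseg : strip left b l `<=` `[b - l, b + l].
    move=> r rs; have := strip_dist l0 rs; rewrite mul1r ler_norml /= in_itv/= => /andP[r1 r2].
    by apply/andP; split; lra.
  by have := @integrableS _ _ R leb _ (strip left b l) _ (measurable_itv _) (mS l) sseg Iseg.
have IeE := lebZ (mS l) (e^-1 * expR gamma) IE.
have Isum := lebD (mS l) Ic IeE.
have -> : H * KK / 2 * (e * d * l + e^-1 * expR gamma * \int[leb]_(r in strip left b l) velocity_energy r) =
  \int[leb]_(r in strip left b l) (H * KK / 2 * (e * d + e^-1 * expR gamma * velocity_energy r)).
  rewrite (@RintegralZl _ _ R leb _ _ _ (mS l) Isum) (@RintegralD _ _ R leb _ _ _ (mS l) Ic IeE).
  by rewrite (@RintegralZl _ _ R leb _ _ _ (mS l) IE) (strip_length _ _ l0).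
apply: ae_norm_Rintegral => //; [exact: integrable_real_measurable Ifh|exact: lebZ|].
apply: ae_imp fb _ => r hr rs; rewrite normrM mulrC -!mulrA; apply: ler_pM => //; first exact: hb.
by have := hr (sI _ rs); rewrite -!mulrA.
Qed.

Let J n := \int[leb]_(r in strip left b n.+1%:R^-1) velocity_energy r.

Lemma energy_strip_cvg : J n @[n --> \oo] --> (0 : R).
Proof.
have [IE _] := energy_facts.
have [N hN] : exists N : nat, forall n, (N <= n)%N -> n.+1%:R^-1 <= l1.
  have [N [hN _]] := archi_bound l1^-1 0; exists N => n Nn.
  rewrite -[l1]invrK lef_pV2 ?posrE ?invr_gt0//.
  apply: le_trans (ler_norm _) _; apply: (le_trans (ltW hN)); rewrite ler_nat; exact: leqW.
pose cutn n r : R := velocity_energy r * ((fun=> 1 : R) \_ (strip left b n.+1%:R^-1)) r.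
have JE n : (N <= n)%N -> J n = \int[leb]_(r in I) cutn n r.
  move=> Nn; have i0 : 0 < (n.+1%:R^-1 : R) by rewrite invr_gt0.
  rewrite -(@strip_Rint _ _ _ _ I velocity_energy (fun=> 1) (stripI i0 (hN _ Nn))).
  by apply: eqRint => r _; rewrite mulr1.
have L : \int[leb]_(r in I) cutn n r @[n --> \oo] --> \int[leb]_(r in I) (0 : R).
  apply: (@dominated_Rintegral _ _ R leb I cutn (fun=> 0) (fun r => `|velocity_energy r|) mI _ _ (integrable_norm IE) _).2.
  - move=> n; apply: measurable_funM; first exact: integrable_real_measurable IE.
    by apply: measurable_funTS; apply: (measurable_restrictT (fun=> 1 : R) (mS _)).1.
  - move=> r _; apply: cvg_near_cst; near=> n; rewrite /cutn patchE.
    case: ifPn => [/set_mem rs|_]; last by rewrite mulr0.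
    exfalso; have [rb|rb] := eqVneq r b; first by move: rs; rewrite rb; exact: strip_notin.
    have rb0 : 0 < `|r - b| by rewrite normr_gt0 subr_eq0.
    have := strip_dist (_ : 0 < n.+1%:R^-1) rs; rewrite invr_gt0 ltr0n mul1r => /(_ isT).
    rewrite leNgt => /negP; apply.
    rewrite -[`|_|]invrK ltf_pV2 ?posrE ?invr_gt0// -natr1; apply: (@le_lt_trans _ _ n%:R); last by rewrite ltrDl.
    by near: n; exact: nbhs_infty_ger.
  - move=> n r _; rewrite /cutn patchE; case: ifP => _; rewrite ?mulr1// mulr0 normr0//.
rewrite (_ : \int[leb]_(_ in I) (0 : R) = 0) in L; last by rewrite /Rintegral integral0.
apply: cvg_trans L; apply: near_eq_cvg; near=> n; rewrite JE//.
by near: n; exact: nbhs_infty_ge.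
Unshelve. all: by end_near.
Qed.

(** On a strip of width 1/a, with a = n.+1, one time derivative is moved onto w: [kap2 a] becomes
    [kap1 a], of size O(a), and [kap a] becomes [antider a], of size O(1/a), both vanishing beyond t
    = 1/a. With P = O(1), Q = O(a^2) and the AM-GM parameter e a, both integrals are at most C (e +
    J/e) up to the factor e^gamma, where J is the energy of w over the strip. J tends to 0 and e is
    arbitrary. *)
Lemma bfun_small : bfun n.+1%:R^-1 n.+1%:R @[n --> \oo] --> (0 : R).
Proof.
have [N hN] : exists N : nat, forall n, (N <= n)%N -> n.+1%:R^-1 <= l1.
  have [N [hN _]] := archi_bound l1^-1 0; exists N => n Nn.
  rewrite -[l1]invrK lef_pV2 ?posrE ?invr_gt0//.
  apply: le_trans (ler_norm _) _; apply: (le_trans (ltW hN)); rewrite ler_nat; exact: leqW.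
pose C := 3 * c ^- 2 * ((1 + s) * B) + 9 * B.
have c2 : 0 <= c ^- 2 by rewrite invr_ge0 sqr_ge0.
have C0 : 0 < C.
  apply: ltr_wpDl; last by apply: mulr_gt0.
  by apply: mulr_ge0; [apply: mulr_ge0|apply: mulr_ge0; rewrite ?addr_ge0 ?(ltW s0) ?(ltW B0)].
have main n e : (N <= n)%N -> 0 < e -> `|bfun n.+1%:R^-1 n.+1%:R| <= C * (e + e^-1 * expR gamma * J n).
  move=> Nn e0; set a : R := n.+1%:R; have a0 : 0 < a by [].
  have a1 : 1 <= a by rewrite /a ler1n.
  have d0 : 0 < a^-1 by rewrite invr_gt0.
  have d1 : a^-1 <= 1 by rewrite invf_le1.
  have dl := hN n Nn.
  have [dK dK1] := kap_decaying (ltW a0); have dA := antider_decaying a0.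
  have [aK aK2] := adm (ltW a0); have [bK bK1 bK2] := kap_expbound chiB s0 (ltW a0).
  have ea0 : 0 < e * a by rewrite mulr_gt0.
  have z1 : 0 <= (a + s) * B by rewrite mulr_ge0 ?addr_ge0 ?(ltW s0) ?(ltW B0) ?(ltW a0).
  have z2 : 0 <= B / a by rewrite divr_ge0 ?(ltW B0) ?(ltW a0).
  have e1 : {ae leb, forall r : R, I r -> `|pair_t u (K2 a) r| <= (a + s) * B / 2 * (e * a * a^-1 + (e * a)^-1 * expR gamma * velocity_energy r)}.
    apply: ae_imp2 (der_uw dK1) (@pair_small (K1 a) ((a + s) * B) a^-1 (e * a) _ bK1 z1 d0 d1 ea0 _ _) _.
    - exact: kap1_cont.
    - move=> t t0; apply: (le_trans (kap1_le chiB s0 t (ltW a0))).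
      by rewrite ler_piMr// -expR0 ler_expR mulNr oppr_le0 mulr_ge0// ltW.
    - by move=> t at_; have [_ + _] := kap_tail schi chi0 s a0 at_.
    - by move=> r h1 h2 Ir; rewrite h1// normrN; exact: h2.
  have e2 : {ae leb, forall r : R, I r -> `|pair_t u (K a) r| <= B / a / 2 * (e * a * a^-1 + (e * a)^-1 * expR gamma * velocity_energy r)}.
    apply: ae_imp2 (der_uw dA) (@pair_small (antider chi s a) (B / a) a^-1 (e * a) _ (antider_expbound schi chi0 B0 chiB s0 a0) z2 d0 d1 ea0 _ _) _.
    - exact: der_continuousT (antider_der _ _ _).
    - by move=> t t0; exact: (antider_le schi chi0 B0 chiB s0 a0 t0).
    - by move=> t /ltW at_; exact: (antider_tail schi chi0 s a0 at_).
    - by move=> r h1 h2 Ir; rewrite h1// normrN; exact: h2.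
  have [i1 _] := strip_swap d0 dl (@cP a^-1) aK2; have [i2 _] := strip_swap d0 dl (@cQ a^-1) aK.
  have B1 := strip_bound d0 dl d1 i1 z1 (ler0n _ 6) ea0 d0 e1 (fun r => PB d0 d1).
  have q0 : 0 <= 18 / a^-1 ^+ 2 by rewrite divr_ge0// sqr_ge0.
  have B2 := strip_bound d0 dl d1 i2 z2 q0 ea0 d0 e2 (fun r => QB d0 d1).
  have pull : \int[leb]_(r in strip left b a^-1) (c ^- 2 * pair_t u (K2 a) r * P a^-1 r) =
      c ^- 2 * \int[leb]_(r in strip left b a^-1) (pair_t u (K2 a) r * P a^-1 r).
    by rewrite -(@RintegralZl _ _ R leb _ _ (c ^- 2) (mS _) i1); apply: eqRint => r _; rewrite mulrA.
  rewrite /bfun pull; move: B1 B2.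
  set X1 := \int[leb]_(r in _) _; set X2 := \int[leb]_(r in _) _.
  rewrite -/(J n); have J0 : 0 <= J n.
    by apply: Rintegral_ge0 => r _; apply: Rintegral_ge0 => t _; rewrite mulr_ge0 ?sqr_ge0 ?expR_ge0.
  have aE : a != 0 by rewrite gt_eqF.
  have eE : e != 0 by rewrite gt_eqF.
  set y := e + e^-1 * expR gamma * J n.
  have y0 : 0 <= y by apply: addr_ge0; [exact: ltW|apply: mulr_ge0 => //; apply: mulr_ge0; rewrite ?expR_ge0// invr_ge0 ltW].
  have alg1 (x z v g q p : R) : x != 0 -> z != 0 ->
      6 * ((x + v) * q) / 2 * (z * x / x / x + (z * x)^-1 * g * p) = 3 * ((1 + v / x) * q) * (z + z^-1 * g * p).
    by move=> x0 z0; field; rewrite ?x0 ?z0.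
  have alg2 (x z g q p : R) : x != 0 -> z != 0 ->
      18 / x^-1 ^+ 2 * (q / x) / 2 * (z * x / x / x + (z * x)^-1 * g * p) = 9 * q * (z + z^-1 * g * p).
    by move=> x0 z0; field; rewrite ?x0 ?z0.
  rewrite (alg1 _ _ _ _ _ _ aE eE) (alg2 _ _ _ _ _ aE eE) -/y.
  move=> B1 B2; apply: le_trans (ler_normD _ _) _; rewrite /C mulrDl; apply: lerD.
    rewrite normrM; apply: (@le_trans _ _ (1 * `|c ^- 2 * X1|)); first by apply: ler_wpM2r.
    rewrite mul1r normrM (ger0_norm c2) -!mulrA mulrCA; apply: ler_wpM2l => //; apply: (le_trans B1).
    rewrite -!mulrA ler_wpM2l//; apply: ler_wpM2r; first by apply: mulr_ge0 => //; exact: ltW.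
    by rewrite lerD2l ler_pdivrMr// ler_peMr// ltW.
  by rewrite normrM; apply: le_trans B2; rewrite ler_piMl.
apply/cvgrPdist_le => ee ee0.
pose e := ee / (2 * C); have e0 : 0 < e by rewrite divr_gt0// mulr_gt0.
have EJ : C * (e^-1 * expR gamma * J n) @[n --> \oo] --> (0 : R).
  rewrite -(mulr0 (C * (e^-1 * expR gamma))); under eq_fun do rewrite mulrA.
  by apply: cvgMr; exact: energy_strip_cvg.
have half0 : 0 < ee / 2 by rewrite divr_gt0.
near=> n; rewrite sub0r normrN; apply: (le_trans (main n e _ e0)).
  by near: n; exact: nbhs_infty_ge.
have h1 : `|0 - C * (e^-1 * expR gamma * J n)| < ee / 2.
  by near: n; move/cvgrPdist_lt: EJ; apply.
rewrite mulrDr; have -> : C * e = ee / 2 by rewrite /e; field; rewrite gt_eqF.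
rewrite sub0r normrN in h1; have := ler_norm (C * (e^-1 * expR gamma * J n)); lra.
Unshelve. all: by end_near.
Qed.

(** The difference of [kap] at 1/n and at n is a test function, for which the boundary value is
    known, and it tends to e^(- s t). The contribution of [kap] at n alone is negligible: by [same]
    it can be computed on a strip of width 1/n, where [bfun_small] applies. *)
Lemma boundary_value (h : R -> R) : L2 (weight gamma) time h ->
  (forall a l, 0 <= a -> 0 < l -> l <= l1 -> bfun l a = bfun l1 a) ->
  (forall a a', 0 < a -> a <= a' -> bfun l1 a - bfun l1 a' = \int[leb]_(t in time) (h t * (K a t - K a' t))) ->
  bfun l1 0 = \int[leb]_(t in time) (h t * expR (- s * t)).
Proof.
move=> Lh same diff.
have Ih := L2_weight_integrable g0 Lh; have [mh _] := Lh.
have l1n n : 0 < (n.+1%:R^-1 : R) by rewrite invr_gt0.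
have Lsmall : bfun l1 n.+1%:R @[n --> \oo] --> (0 : R).
  apply: cvg_trans bfun_small; apply: near_eq_cvg; near=> n; apply: same => //.
  rewrite -[l1]invrK lef_pV2 ?posrE ?invr_gt0// -natr1; apply: (@le_trans _ _ n%:R); last by rewrite lerDl.
  by near: n; exact: nbhs_infty_ger.
have L1 : bfun l1 n.+1%:R^-1 - bfun l1 n.+1%:R @[n --> \oo] --> bfun l1 0 - 0.
  by apply: cvgB; [exact: bfun_limit|exact: Lsmall].
have L2' : \int[leb]_(t in time) (h t * (K n.+1%:R^-1 t - K n.+1%:R t)) @[n --> \oo] -->
    \int[leb]_(t in time) (h t * expR (- s * t)).
  apply: (weighted_limit gs (C := 2 * B) Ih mh).
  - by move=> n t; apply: continuousB; exact: kap_cont.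
  - move=> n t t0; apply: le_trans (ler_normB _ _) _; rewrite -mulrA mulr2n mulrDl mul1r.
    by apply: lerD; exact: kap_le.
  move=> t t0; rewrite -(kap_zero chi1 s t) -[X in _ --> X]subr0; apply: cvgB; first exact: kap_cvg.
  exact: kap_cvg0.
have eD : (fun n : nat => bfun l1 n.+1%:R^-1 - bfun l1 n.+1%:R) =
    (fun n : nat => \int[leb]_(t in time) (h t * (K n.+1%:R^-1 t - K n.+1%:R t))).
  apply/funext => n; apply: diff (l1n n) _.
  by apply: (@le_trans _ _ 1); [have /andP[] := inv_le1 n|rewrite ler1n].
rewrite subr0 eD in L1; exact: (cvg_unique (@Rhausdorff R) L1 L2').
Unshelve. all: by end_near.
Qed.

End boundary_functional.

(** * The transformed equation *)

(* A homogeneous wave field at rest at [t = 0]; [w] is its velocity. *)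
Record null_field {R : realType} (I : set R) (gamma c : R) (u w : R -> R -> R) : Prop := NullField {
  null_L2 : L2gamma_L2 gamma I u;
  null_dL2 : L2gamma_L2 gamma I w;
  null_dt : is_dt 1 I u w;
  null_wave : forall theta phi, test_fun time theta -> test_fun I phi ->
    \int[leb]_(r in I) (pair_t u (derive1n 2 theta) r * phi r) =
    c ^+ 2 * \int[leb]_(r in I) (pair_t u theta r * derive1n 2 phi r);
  null_init : forall psi, test_fun I psi ->
    is_trace time 0 (pair_r I u psi) 0 /\ is_trace time 0 (pair_r I w psi) 0 }.

Section laplace_field.
Context {R : realType}.
Variables (I : set R) (gamma s c : R) (u w : R -> R -> R).
Hypotheses (oI : open I) (iI : is_interval I) (I0 : I !=set0) (g0 : 0 < gamma) (gs : gamma < s) (c0 : 0 < c).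
Hypothesis nf : null_field I gamma c u w.
Let mT : measurable (@time R). Proof. exact: open_measurable time_open. Qed.
Let s0 : 0 < s := lt_trans g0 gs.
Let Lu := null_L2 nf.
Let Lw := null_dL2 nf.

Definition laplace r := pair_t u (fun t => expR (- s * t)) r.

Let es : R -> R := fun t => expR (- s * t).
Let aes : admissible gamma es.
Proof.
apply: (expbound_admissible (ltW gs)); first exact: expR_cont.
by exists 1 => t _; rewrite mul1r ger0_norm ?expR_ge0.
Qed.

Lemma laplace_loc : locally_integrable I laplace /\ loc_int (laplace \_ I).
Proof. by have := pair_t_loc oI g0 Lu aes. Qed.

(** Here [velocity_energy] is applied to u itself. The bound is an integrable function of r plus a
    constant, which suffices to exclude a growing exponential in the liquid. *)
Lemma laplace_bound : {ae leb, forall r : R, I r -> `|laplace r| <= velocity_energy gamma u r + \int[leb]_(t in time) expR (- gamma * t)}.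
Proof.
have [_ a1] := pair_t_piece oI g0 Lu aes; have [_ a2] := energy_facts oI Lu.
have Ie := exp_time_integrable g0.
apply: ae_imp2 a1 a2 _ => r + + Ir => /(_ Ir) i1 /(_ Ir) i2.
have h1 := @le_normr_Rintegral _ _ R leb _ _ mT i1.
apply: (le_trans h1).
rewrite -(@RintegralD _ _ R leb _ _ _ mT i2 Ie).
apply: (@le_Rintegral _ _ R leb) => //; [exact: (integrable_norm i1)|exact: lebD|].
move=> t; rewrite /time /= in_itv/= andbT => t0; rewrite normrM /es [`|expR _|]ger0_norm ?expR_ge0//.
have h2 : `|u r t| <= u r t ^+ 2 + 1.
  rewrite -(real_normK (num_real (u r t))); have := sqr_ge0 (`|u r t| - 1).
  by rewrite sqrrB mulr1 expr1n mulr2n; have := normr_ge0 (u r t); lra.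
apply: (@le_trans _ _ (`|u r t| * expR (- gamma * t))).
  by apply: ler_wpM2l => //; rewrite ler_expR !mulNr lerN2 ler_wpM2r// ltW.
by have := ler_wpM2l (expR_ge0 (- gamma * t)) h2; rewrite mulrDr mulr1 [_ * `|_|]mulrC.
Qed.

Let der_uw k k' : decaying s k k' -> {ae leb, forall r : R, I r -> pair_t u k' r = - pair_t w k r}.
Proof. by move=> dk; have := pair_t_derivative oI g0 gs Lu Lw (null_dt nf) (null_init nf) dk. Qed.

Lemma laplace_wave : is_wderiv 2 I laplace (fun r => (s / c) ^+ 2 * laplace r).
Proof.
have d0 (t : R) : is_derive t 1 (fun t => expR (- s * t)) (- s * es t) by exact: expR_der.
have d1 (t : R) : is_derive t 1 (fun t => - s * es t) (s ^+ 2 * es t).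
  by apply: der_eq (derZ (- s) (d0 t)) _; rewrite mulrA mulrNN.
have ce : continuous es by exact: expR_cont.
have b0 : expbound s es by exists 1 => t _; rewrite mul1r ger0_norm ?expR_ge0.
have bz z : expbound s (fun t => z * es t).
  by exists `|z| => t _; rewrite normrM [`|es _|]ger0_norm ?expR_ge0.
have cz z : continuous (fun t => z * es t) by move=> t; apply: continuousM; [exact: cst_continuous|exact: ce].
have D0 : decaying s es (fun t => - s * es t) by split.
have D1 : decaying s (fun t => - s * es t) (fun t => s ^+ 2 * es t) by split.
have H := pair_t_wderiv2 oI g0 gs c0 Lu Lw (null_dt nf) (null_wave nf) (null_init nf) D0 D1.
have [lX _] := laplace_loc.
apply: (wderiv_congr H) => //; first exact: locally_integrableZ.
  by apply: aeW.
have [_ a1] := pair_t_piece oI g0 Lu aes.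
apply: ae_imp a1 _ => r + Ir => /(_ Ir) i1.
have -> : pair_t u (fun t => s ^+ 2 * es t) r = s ^+ 2 * laplace r.
  rewrite /laplace /pair_t -(@RintegralZl _ _ R leb _ _ _ mT i1).
  by apply: eqRint => t _; rewrite mulrCA.
by rewrite mulrA; congr (_ * _); rewrite expr_div_n mulrC.
Qed.

(** A single representative serves every end of I and every h. This gives the transforms of the
    trace and of the slope at R0 and, in the gas, also the value at the origin. *)
Lemma laplace_boundary : exists X Y, c1rep I laplace X Y /\
  forall left b l1, 0 < l1 -> (forall l, 0 < l -> l <= l1 -> strip left b l `<=` I) ->
  (forall h, L2 (weight gamma) time h ->
     (forall theta X Y, test_fun time theta -> c1rep I (pair_t u theta) X Y ->
        X b = \int[leb]_(t in time) (h t * theta t)) ->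
     X b = \int[leb]_(t in time) (h t * expR (- s * t))) /\
  (forall h, L2 (weight gamma) time h ->
     (forall theta X Y, test_fun time theta -> c1rep I (pair_t u theta) X Y ->
        Y b = \int[leb]_(t in time) (h t * theta t)) ->
     Y b = \int[leb]_(t in time) (h t * expR (- s * t))).
Proof.
have [chi [schi chi1 chi0 [B B0 chiB]]] := @smooth_cutoff R.
pose K a := kap chi s a; pose K2 a := kap2 chi s a.
pose bx left b l a := bfun s c u chi left b (hermite1 left b) (hermite1'' left b) (sgn left) (- sgn left) l a.
pose bY left b l a := bfun s c u chi left b (hermite0 left b) (hermite0'' left b) (- sgn left) (sgn left) l a.
have adm a : 0 <= a -> admissible gamma (K a) /\ admissible gamma (K2 a).
  move=> a0; have [b0 _ b2] := kap_expbound chiB s0 a0.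
  by split; apply: (expbound_admissible (ltW gs)) => //; [exact: kap_cont|exact: kap2_cont].
have rep a : 0 <= a -> exists X Y, c1rep I (pair_t u (K a)) X Y /\
    forall left b l, 0 < l -> strip left b l `<=` I -> X b = bx left b l a /\ Y b = bY left b l a.
  move=> a0; have [dK dK1] := kap_decaying g0 gs schi chiB a0; have [aK aK2] := adm a a0.
  have H := pair_t_wderiv2 oI g0 gs c0 Lu Lw (null_dt nf) (null_wave nf) (null_init nf) dK dK1.
  have [lX _] := pair_t_loc oI g0 Lu aK; have [_ lZ'] := pair_t_loc oI g0 Lu aK2.
  have lZ : loc_int ((fun r => c ^- 2 * pair_t u (K2 a) r) \_ I).
    rewrite (_ : _ \_ I = fun t => c ^- 2 * (pair_t u (K2 a) \_ I) t); first exact: loc_intZ.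
    by apply/funext => t; rewrite !patchE; case: ifP => // _; rewrite mulr0.
  have [X [Y [cY dX XX _ [B1 YE]]]] := W2_rep iI I0 H lZ.
  exists X, Y; split => // left b l l0 sI.
  have [-> ->] := W2_boundary l0 lX lZ cY dX XX YE sI.
  rewrite /bx /bY /bfun -/(K a) -/(K2 a); split.
    by rewrite mulrBr mulNr.
  by rewrite mulrBr addrC mulNr.
have [X [Y [XY HXY]]] := rep 0 (lexx _).
have K0 : K 0 = es by apply/funext => t; exact: kap_zero.
exists X, Y; split; first by move: XY; rewrite K0.
have lin a a' : 0 <= a -> 0 <= a' -> {ae leb, forall r : R, I r ->
    pair_t u (K a) r - pair_t u (K a') r = pair_t u (fun t => K a t - K a' t) r}.
  move=> a0 a0'; have [_ h1] := pair_t_piece oI g0 Lu (adm a a0).1.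
  have [_ h2] := pair_t_piece oI g0 Lu (adm a' a0').1.
  apply: ae_imp2 h1 h2 _ => r + + Ir => /(_ Ir) i1 /(_ Ir) i2.
  rewrite /pair_t -(@RintegralB _ _ R leb _ _ _ mT i1 i2).
  by apply: eqRint => t _; rewrite mulrBr.
have sgn1 (left : bool) : `|sgn left : R| <= 1 by rewrite /sgn; case: left; rewrite ?normrN normr1.
have sgn2 (left : bool) : `|- sgn left : R| <= 1 by rewrite normrN.
move=> left b l1 l10 stripI; split => h Lh Hh.
- have [-> _] := HXY left b l1 l10 (stripI _ l10 (lexx _)).
  apply: (@boundary_value R I gamma s c u w chi B oI g0 gs Lu Lw (@der_uw) schi chi1 chi0 B0 chiB left b l1
    (hermite1 left b) (hermite1'' left b) (sgn left) (- sgn left) l10 stripI) => //.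
  + by move=> l; exact: der_continuousT (cubic_der _ _ _ _ _).
  + by move=> l; exact: cubic''_cont.
  + move=> l r l0 l1' rs; have [h1 _ _ _] := hermite_bounds l0 rs.
    by apply: (le_trans h1); apply: (@le_trans _ _ 4); rewrite ?ler_nat// ler_piMr.
  + move=> l r l0 l1' rs; have [_ h1 _ _] := hermite_bounds l0 rs.
    apply: (le_trans h1); rewrite ler_pdivrMr// expr2 invfM mulrA mulfVK ?gt_eqF// ler_pdivlMr//.
    by apply: (@le_trans _ _ 10); rewrite ?ler_nat// ler_piMr.
  + move=> a l a0 l0 ll; have [X1 [Y1 [_ H]]] := rep a a0.
    have [e1 _] := H left b l l0 (stripI _ l0 ll).
    have [e2 _] := H left b l1 l10 (stripI _ l10 (lexx _)).
    exact: etrans (esym e1) e2.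
  move=> a a' a0 aa'; have a0' := ltW (lt_le_trans a0 aa').
  have [X1 [Y1 [R1 H1]]] := rep a (ltW a0); have [X2 [Y2 [R2 H2]]] := rep a' a0'.
  have [e1 _] := H1 left b l1 l10 (stripI _ l10 (lexx _)).
  have [e2 _] := H2 left b l1 l10 (stripI _ l10 (lexx _)).
  rewrite -/(bx left b l1 a) -/(bx left b l1 a') -e1 -e2.
  exact: (Hh _ _ _ (kap_test schi chi1 chi0 s a0 aa') (c1repB R1 R2 (lin a a' (ltW a0) a0'))).
have [_ ->] := HXY left b l1 l10 (stripI _ l10 (lexx _)).
apply: (@boundary_value R I gamma s c u w chi B oI g0 gs Lu Lw (@der_uw) schi chi1 chi0 B0 chiB left b l1
  (hermite0 left b) (hermite0'' left b) (- sgn left) (sgn left) l10 stripI) => //.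
- by move=> l; exact: der_continuousT (cubic_der _ _ _ _ _).
- by move=> l; exact: cubic''_cont.
- by move=> l r l0 l1' rs; have [_ _ h1 _] := hermite_bounds l0 rs.
- by move=> l r l0 l1' rs; have [_ _ _ h1] := hermite_bounds l0 rs.
- move=> a l a0 l0 ll; have [X1 [Y1 [_ H]]] := rep a a0.
  have [_ e1] := H left b l l0 (stripI _ l0 ll).
  have [_ e2] := H left b l1 l10 (stripI _ l10 (lexx _)).
  exact: etrans (esym e1) e2.
move=> a a' a0 aa'; have a0' := ltW (lt_le_trans a0 aa').
have [X1 [Y1 [R1 H1]]] := rep a (ltW a0); have [X2 [Y2 [R2 H2]]] := rep a' a0'.
have [_ e1] := H1 left b l1 l10 (stripI _ l10 (lexx _)).
have [_ e2] := H2 left b l1 l10 (stripI _ l10 (lexx _)).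
rewrite -/(bY left b l1 a) -/(bY left b l1 a') -e1 -e2.
exact: (Hh _ _ _ (kap_test schi chi1 chi0 s a0 aa') (c1repB R1 R2 (lin a a' (ltW a0) a0'))).
Qed.

End laplace_field.

(** * Solutions of the transformed equation on an interval *)

Section second_order_ode.
Context {R : realType}.
Variables (I : set R) (k : R).
Hypotheses (oI : open I) (iI : is_interval I) (I0 : I !=set0) (k0 : 0 < k).

Lemma continuous_restrict_loc_int (g : R -> R) : continuous g -> loc_int (g \_ I).
Proof.
move=> cg a b; have mI : measurable I by exact: open_measurable.
have mab : measurable `[a, b]%classic by exact: measurable_itv.
apply: (leb_le mab _ (integrable_norm (continuous_loc_int cg a b))).
  apply: measurable_funTS; apply: (measurable_restrictT g mI).1.
  by apply: measurable_funTS; exact: continuous_measurable_fun.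
by move=> x _; rewrite patchE /=; case: ifP => // _; rewrite normr0.
Qed.

Lemma exponential_solutions (f X Y : R -> R) : c1rep I f X Y ->
  is_wderiv 2 I f (fun r => k ^+ 2 * f r) -> exists A D, forall x, closure I x ->
  X x = A * expR (k * x) + D * expR (- k * x) /\ Y x = k * (A * expR (k * x) - D * expR (- k * x)).
Proof.
move=> XY fw; have [cY dX fX] := XY; have cX := der_continuousT dX.
have ckX : continuous (fun r : R => k ^+ 2 * X r : R).
  exact: der_continuousT (fun x => derZ (k ^+ 2) (dX x)).
have Xw : is_wderiv 2 I X (fun r => k ^+ 2 * X r).
  apply: (wderiv_congr fw) => //; [exact: continuous_locally_integrable|exact: continuous_locally_integrable|].
  by apply: ae_imp fX _ => r h Ir; rewrite h.
have [B HB] := wderiv2_continuous iI I0 ckX Xw (continuous_restrict_loc_int ckX).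
pose Y2 := fun x => B + prim (fun r => k ^+ 2 * X r) x.
have dY2 (x : R) : is_derive x 1 Y2 (k ^+ 2 * X x).
  by apply: der_eq (derD (der_cst x B) (prim_is_deriveT ckX x)) _; rewrite add0r.
have cY2 := der_continuousT dY2.
have [C HC] := wderiv1_continuous iI I0 cY2 HB.
pose X2 := fun x => C + prim Y2 x.
have dX2 (x : R) : is_derive x 1 X2 (Y2 x).
  by apply: der_eq (derD (der_cst x C) (prim_is_deriveT cY2 x)) _; rewrite add0r.
have XX2 : c1rep I X X2 Y2 by split.
have XX : c1rep I X X Y by split => //; apply: aeW.
have EX x : closure I x -> X x = X2 x by move=> cx; have [] := c1rep_unique oI cx XX XX2.
have EY x : closure I x -> Y x = Y2 x by move=> cx; have [] := c1rep_unique oI cx XX XX2.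
(* The operator d^2 - k^2 factors into first-order operators: with kk = k or - k, the product (Y2 +
   kk X2) e^(- kk x) is constant on I, hence on its closure. *)
have const kk : kk ^+ 2 = k ^+ 2 -> exists z, forall x, closure I x -> Y2 x + kk * X2 x = z * expR (kk * x).
  move=> kkE; pose Z x := (Y2 x + kk * X2 x) * expR (- kk * x).
  have dZ (x : R) : is_derive x 1 Z (k ^+ 2 * (X x - X2 x) * expR (- kk * x)).
    apply: der_eq (derM (derD (dY2 x) (derZ kk (dX2 x))) (expR_der (- kk) x)) _.
    by rewrite -kkE; ring.
  have cZ := der_continuousT dZ; have [r0 Ir0] := I0.
  have step x y : I x -> I y -> x <= y -> Z x = Z y.
    move=> Ix Iy xy; have [e /andP[xe ey] e1] := der_mvt dZ xy.
    have Ie : I e by have := iI Ix Iy (_ : x <= e <= y); rewrite xe ey; apply.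
    by apply/eqP; rewrite eq_sym -subr_eq0 e1 (EX e (subset_closure Ie)) subrr mulr0 !mul0r.
  have ZI x : I x -> Z x = Z r0.
    by move=> Ix; have [h|/ltW h] := leP x r0; [exact: step|apply/esym; exact: step].
  exists (Z r0) => x cx.
  have <- : Z x = Z r0.
    apply: (is_trace_unique (f := Z) oI cx); first by apply: continuous_is_trace => //; apply: aeW.
    exists (fun=> Z r0); split => //; first by apply: continuous_subspaceT; exact: cst_continuous.
    by apply: aeW => y Iy; rewrite ZI.
  by rewrite /Z -mulrA -expRD mulNr addNr expR0 mulr1.
have [z1 H1] := const k erefl; have [z2 H2] := const (- k) (sqrrN k).
exists (z1 / (2 * k)), (- (z2 / (2 * k))) => x cx.
have kE : k != 0 by rewrite gt_eqF.
have := H1 x cx; have := H2 x cx; rewrite EX// EY//; move: (X2 x) (Y2 x) (expR _) (expR _) => p q e1 e2 h2 h1.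
have -> : z1 / (2 * k) * e1 = (z1 * e1) / (2 * k) by field.
have -> : - (z2 / (2 * k)) * e2 = - (z2 * e2) / (2 * k) by field.
by rewrite -h1 -h2; split; field.
Qed.

End second_order_ode.

(** * Exclusion of the growing exponential in the liquid *)

Section liquid_decay.
Context {R : realType}.
Variables (R0 k : R).
Hypotheses (k0 : 0 < k).

Lemma quadratic_growth_zero (a p q : R) : 0 <= a -> 0 <= p ->
  (forall n : nat, a * n%:R ^+ 2 <= p + q * n%:R) -> a = 0.
Proof.
move=> a0 p0 H; apply/eqP; rewrite eq_le a0 andbT leNgt; apply/negP => apos.
have [n [n1 n2]] := archi_bound ((p + `|q|) / a) 1.
have n1' : p + `|q| < a * n%:R.
  have := le_lt_trans (ler_norm _) n1; rewrite ltr_pdivrMr// mulrC//.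
have n2' : 1 < n%:R :> R by rewrite -[X in X < _]normr1.
have := H n; rewrite leNgt => /negP; apply.
rewrite expr2 mulrA; apply: (@le_lt_trans _ _ ((p + `|q|) * n%:R)).
  rewrite mulrDl; apply: lerD; first by rewrite ler_peMr// ltW.
  by apply: ler_wpM2r => //; exact: ler_norm.
by rewrite ltr_pM2r// (lt_trans _ n2').
Qed.

(** Integrate |A| e^(k r) <= E + C + |D| over ]R0, R0 + n[. The right-hand side grows at most
    linearly in n, while the left-hand side grows at least like n^2, already by a quadratic lower
    bound of the exponential. *)
Lemma no_growth (A D C : R) (X E : R -> R) : 0 <= R0 -> 0 <= C ->
  leb.-integrable `]R0, +oo[ (EFin \o E) -> (forall r, 0 <= E r) -> continuous X ->
  (forall r, R0 < r -> X r = A * expR (k * r) + D * expR (- k * r)) ->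
  {ae leb, forall r : R, R0 < r -> `|X r| <= E r + C} -> A = 0.
Proof.
move=> R00 C0 IE E0 cX XE Xb.
have mJ : measurable `]R0, +oo[%classic by exact: measurable_itv.
pose G := \int[leb]_(r in `]R0, +oo[) E r.
have main n : `|A| * k / 4 * n%:R ^+ 2 <= G + (C + `|D|) * n%:R.
  pose b : R := R0 + n%:R; have Rb : R0 <= b by rewrite lerDl.
  have mK : measurable `]R0, b[%classic by exact: measurable_itv.
  have KJ : `]R0, b[ `<=` `]R0, +oo[ by move=> x /=; rewrite !in_itv/= => /andP[->].
  have IEK : leb.-integrable `]R0, b[ (EFin \o E) by have := @integrableS _ _ R leb _ _ _ mJ mK KJ IE.
  have loK (g : R -> R) : continuous g -> leb.-integrable `]R0, b[ (EFin \o g).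
    move=> cg; have sub : `]R0, b[ `<=` `[R0, b] by move=> x /=; rewrite !in_itv/= => /andP[/ltW -> /ltW ->].
    by have := @integrableS _ _ R leb _ _ _ (measurable_itv _) mK sub (continuous_loc_int cg R0 b).
  have cg : continuous (fun r : R => `|A| * expR (k * r) : R).
    exact: der_continuousT (fun x => derZ `|A| (expR_der k x)).
  have Ic := loK _ (@cont_cst R (C + `|D|)).
  have le1 : \int[leb]_(r in `]R0, b[) (`|A| * expR (k * r)) <= \int[leb]_(r in `]R0, b[) (E r + (C + `|D|)).
    apply: ae_le_Rintegral => //; [exact: loK|exact: lebD|].
    apply: ae_imp Xb _ => r h; rewrite /= in_itv/= => /andP[r1 _]; have {}h := h r1.
    have r0 : 0 <= r := ltW (le_lt_trans R00 r1).
    have -> : `|A| * expR (k * r) = `|X r - D * expR (- k * r)|.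
      by rewrite XE// addrK normrM [`|expR _|]ger0_norm ?expR_ge0.
    apply: le_trans (ler_normB _ _) _; rewrite addrA; apply: lerD => //.
    rewrite normrM [`|expR _|]ger0_norm ?expR_ge0// ler_piMr// -expR0 ler_expR mulNr oppr_le0.
    by rewrite mulr_ge0// ltW.
  have d1 (x : R) : is_derive x 1 (fun r => `|A| / k * expR (k * r)) (`|A| * expR (k * x)).
    by apply: der_eq (derZ _ (expR_der k x)) _; field; rewrite gt_eqF.
  have d2 (x : R) : is_derive x 1 (fun r => (C + `|D|) * r + 0) (C + `|D|) by exact: der_affine.
  have e1 : \int[leb]_(r in `]R0, b[) (`|A| * expR (k * r)) = `|A| / k * expR (k * b) - `|A| / k * expR (k * R0).
    by rewrite (Rintegral_itv_oo _ _ (continuous_loc_int cg)) (FTC_segment cg d1).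
  have e2 : \int[leb]_(r in `]R0, b[) (E r + (C + `|D|)) <= G + (C + `|D|) * n%:R.
    rewrite (@RintegralD _ _ R leb _ _ _ mK IEK Ic); apply: lerD; last first.
      rewrite (Rintegral_itv_oo _ _ (continuous_loc_int (@cont_cst R _))) (FTC_segment (@cont_cst R _) d2 Rb).
      by rewrite /b le_eqVlt; apply/orP; left; apply/eqP; ring.
    pose g r := E r * ((fun=> 1 : R) \_ (`]R0, b[)) r.
    have mE : measurable_fun `]R0, +oo[ E by exact: integrable_real_measurable IE.
    have m1 : measurable_fun `]R0, +oo[ ((fun=> 1 : R) \_ (`]R0, b[)).
      by apply: measurable_funTS; apply: (measurable_restrictT (fun=> 1 : R) mK).1.
    have gE r : 0 <= g r <= E r.
      by rewrite /g patchE; case: ifP => _; rewrite ?mulr1 ?mulr0 ?lexx E0.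
    have -> : \int[leb]_(r in `]R0, b[) E r = \int[leb]_(r in `]R0, +oo[) g r.
      rewrite -[RHS](@Rintegral_supp _ _ _ leb (`]R0, b[%classic)).
      - by apply: eqRint => r rK; rewrite /g patchE mem_set// mulr1.
      - by move=> r /KJ.
      - by move=> r _ nr; rewrite /g patchE memNset// mulr0.
    apply: (@le_Rintegral _ _ R leb) => //.
      apply: (leb_le mJ _ IE); first exact: measurable_funM.
      by move=> r _; have /andP[g0 g1] := gE r; rewrite ger0_norm.
    by move=> r _; have /andP[] := gE r.
  apply: le_trans e2; apply: le_trans le1; rewrite e1 -mulrBr /b.
  have -> : expR (k * (R0 + n%:R)) - expR (k * R0) = expR (k * R0) * (expR (k * n%:R) - 1).
    by rewrite mulrDr expRD mulrBr mulr1.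
  have z0 : 0 <= k * R0 by rewrite mulr_ge0// ltW.
  have E1 : 1 <= expR (k * R0) by rewrite -expR0 ler_expR.
  have E2 : k ^+ 2 / 4 * n%:R ^+ 2 <= expR (k * n%:R) - 1.
    have -> : expR (k * n%:R) = expR (k * n%:R / 2) ^+ 2.
      by rewrite expr2 -expRD; congr expR; field.
    have h := expR_ge1Dx (k * n%:R / 2).
    have h0 : 0 <= k * n%:R / 2 by rewrite divr_ge0// mulr_ge0// ltW.
    have -> : k ^+ 2 / 4 * n%:R ^+ 2 = (k * n%:R / 2) ^+ 2 by field.
    move: h h0; move: (k * n%:R / 2) (expR _) => y e h h0.
    have : (1 + y) ^+ 2 <= e ^+ 2 by rewrite lerXn2r ?nnegrE//; lra.
    rewrite !expr2; nra.
  have -> : `|A| * k / 4 * n%:R ^+ 2 = `|A| / k * (k ^+ 2 / 4 * n%:R ^+ 2) by field; rewrite gt_eqF.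
  apply: ler_wpM2l; first by rewrite divr_ge0// ltW.
  apply: (le_trans E2); rewrite ler_peMl//; apply: le_trans E2; apply: mulr_ge0; rewrite ?sqr_ge0//.
  by rewrite divr_ge0// sqr_ge0.
have G0 : 0 <= G by apply: Rintegral_ge0.
have Ak : 0 <= `|A| * k / 4 by rewrite divr_ge0// mulr_ge0// ltW.
have := quadratic_growth_zero Ak G0 main => /eqP; rewrite mulf_eq0 invr_eq0 pnatr_eq0 orbF mulf_eq0 (gt_eqF k0) orbF.
by rewrite normr_eq0 => /eqP.
Qed.

End liquid_decay.

(** * Uniqueness *)

Section product_null.
Context {R : realType}.

(** The nonzero set of v is measurable because v is, and its measure is the integral of the measures
    of its sections. *)
Lemma ae_product (A B : set R) (v : R -> R -> R) : measurable A -> measurable B ->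
  measurable_fun (A `*` B) (fun z : R * R => v z.1 z.2) ->
  {ae leb, forall x : R, A x -> {ae leb, forall y : R, B y -> v x y = 0}} ->
  {ae (leb \x leb)%E, forall z : R * R, (A `*` B) z -> v z.1 z.2 = 0}.
Proof.
move=> mA mB mv H; have mAB : measurable (A `*` B : set (R * R)) by exact: measurableX.
pose N : set (R * R) := (A `*` B) `&` (fun z => v z.1 z.2) @^-1` [set~ 0].
have mN : measurable N by apply: mv => //; exact: measurableC.
exists N; split => //; last first.
  move=> z /= nz; split; first by apply: contrapT => h; apply: nz => /h.
  by move=> /= h; apply: nz => _.
rewrite /product_measure1 /=; rewrite -[RHS](@integral0 _ _ R leb setT).
apply: ge0_ae_eq_integral => //; first exact: measurable_fun_xsection.
apply: ae_imp H _ => x h _ /=.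
have [Ax|nAx] := pselect (A x); last first.
  rewrite (_ : xsection N x = set0) ?measure0//; apply/seteqP; split => // y; rewrite /xsection /= => /set_mem[[+ _] _] //.
apply: measure_negligible; first exact: measurable_xsection.
apply: negligibleS (h Ax) => y; rewrite /xsection /= => /set_mem[[_ By] /= vn] hh; exact: vn (hh By).
Qed.

End product_null.

Section weighted_laplace.
Context {R : realType}.
Variables (gamma s : R).
Hypotheses (g0 : 0 < gamma) (gs : gamma < s).
Let mT : measurable (@time R). Proof. exact: open_measurable time_open. Qed.
Lemma L2_weight_loc_int (q : R -> R) : L2 (weight gamma) time q -> loc_int (q \_ time).
Proof.
move=> Lq; have Iq := L2_weight_integrable g0 Lq.
have l1 : loc_int ((fun t => q t * expR (- gamma * t)) \_ time).
  move=> a b; have I1 : leb.-integrable setT ((EFin \o (fun t => q t * expR (- gamma * t))) \_ time).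
    by apply: (integrable_mkcond _ _).1.
  have I2 := @integrableS _ _ R leb _ `[a, b]%classic _ measurableT (measurable_itv _) (@subsetT _ _) I1.
  by apply: eq_integrable I2 => // x _ /=; rewrite !patchE; case: ifP.
have := loc_int_mul l1 (@expR_cont _ gamma); congr loc_int; apply/funext => t.
rewrite !patchE; case: ifP => _; last by rewrite mul0r.
by rewrite -mulrA -expRD mulNr addNr expR0 mulr1.
Qed.

Lemma L2_weight_locally (q : R -> R) : L2 (weight gamma) time q -> locally_integrable time q.
Proof.
move=> Lq; have lq := L2_weight_loc_int Lq.
have [] // := @piece_integrable R time time_open q => n.
have mP : measurable (piece (@time R) n) by apply: piece_measurable; exact: time_open.
have sub : piece (@time R) n `<=` `[- n%:R, n%:R].
  by move=> x [_]; rewrite /= !in_itv/= => /andP[/ltW -> /ltW ->].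
have I1 := @integrableS _ _ R leb _ _ _ (measurable_itv _) mP sub (lq _ _).
by apply: leb_eq I1 => // x [xt _]; rewrite patchE mem_set.
Qed.

Lemma exp_expbound (z : R) : expbound s (fun t => z * expR (- s * t)).
Proof. by exists `|z| => t _; rewrite normrM [`|expR _|]ger0_norm ?expR_ge0. Qed.

Lemma L2_weight_exp (q : R -> R) : L2 (weight gamma) time q ->
  leb.-integrable time (EFin \o (fun t => q t * expR (- s * t))).
Proof.
move=> Lq; apply: (weighted_mul_integrable gs (L2_weight_integrable g0 Lq)); first exact: expR_cont.
by have := exp_expbound 1; under eq_fun do rewrite mul1r.
Qed.

Lemma laplace_derivative (f q : R -> R) : L2 (weight gamma) time f -> L2 (weight gamma) time q ->
  is_wderiv 1 time f q -> is_trace time 0 f 0 ->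
  \int[leb]_(t in time) (q t * expR (- s * t)) = s * \int[leb]_(t in time) (f t * expR (- s * t)).
Proof.
move=> Lf Lq fq tr; have [mf _] := Lf; have lq := L2_weight_loc_int Lq; have Iq := L2_weight_integrable g0 Lq.
have e := wderiv1_prim fq lq tr.
have ck (z : R) : continuous (fun t : R => z * expR (- s * t) : R).
  exact: der_continuousT (fun x => derZ z (expR_der (- s) x)).
have H := ibp_half_line g0 gs lq Iq (ck (- s)) (expR_der (- s)) _ (exp_expbound (- s)).
have b1 : expbound s (fun t => expR (- s * t)) by have := exp_expbound 1; under eq_fun do rewrite mul1r.
have {}H := H b1.
have cP : continuous (prim (q \_ time)) by exact: prim_continuous.
have mp : measurable_fun time (prim (q \_ time)) by apply: measurable_funTS; exact: continuous_measurable_fun.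
have me : measurable_fun time (fun t : R => - s * expR (- s * t)).
  by apply: measurable_funTS; apply: continuous_measurable_fun; exact: ck.
have e1 : \int[leb]_(t in time) (f t * (- s * expR (- s * t))) = - \int[leb]_(t in time) (q t * expR (- s * t)).
  rewrite -H; apply: ae_eq_Rintegral => //; [exact: measurable_funM|exact: measurable_funM|].
  by apply: ae_imp e _ => t h tT; rewrite h.
have If := L2_weight_exp Lf.
rewrite -[LHS]opprK -e1 -(@RintegralZl _ _ R leb _ _ s mT If).
have -> : \int[leb]_(t in time) (f t * (- s * expR (- s * t))) = \int[leb]_(t in time) (- s * (f t * expR (- s * t))).
  by apply: eqRint => t _; rewrite mulrCA.
by rewrite (@RintegralZl _ _ R leb _ _ (- s) mT If) (@RintegralZl _ _ R leb _ _ s mT If) mulNr opprK.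
Qed.

Lemma L2_weight_lin (f g : R -> R) (x y : R) : L2 (weight gamma) time f -> L2 (weight gamma) time g ->
  L2 (weight gamma) time (fun t => x * f t + y * g t).
Proof.
move=> [mf If] [mg Ig].
have If' : leb.-integrable time (EFin \o (fun t => weight gamma t * f t ^+ 2)) by [].
have Ig' : leb.-integrable time (EFin \o (fun t => weight gamma t * g t ^+ 2)) by [].
have mw : measurable_fun time (weight gamma) by apply: measurable_funTS; apply: continuous_measurable_fun; exact: expR_cont.
have mh : measurable_fun time (fun t => x * f t + y * g t).
  by apply: measurable_funD; apply: measurable_funM.
split => //.
apply: (leb_le mT _ (lebD mT (lebZ mT (2 * x ^+ 2) If') (lebZ mT (2 * y ^+ 2) Ig'))).
  by apply: measurable_funM => //; exact: measurable_funX.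
move=> t _; rewrite ger0_norm; last by rewrite mulr_ge0 ?expR_ge0 ?sqr_ge0.
have := ler_wpM2l (expR_ge0 (- gamma * t)) (sqrD_le (x * f t) (y * g t)); rewrite -/(weight gamma t) => h.
by apply: (le_trans h); rewrite !exprMn le_eqVlt; apply/orP; left; apply/eqP; ring.
Qed.

Lemma L2_weight0 : L2 (weight gamma) time (fun=> 0 : R).
Proof.
split => //; apply: eq_integrable (integrable0 _ _) => // t _; by rewrite expr0n/= mulr0.
Qed.

End weighted_laplace.

(** * Vanishing of a solution with zero data *)

Section null_solution.
Context {R : realType}.
Variables (R0 sigma gamma : R) (rho c : phase -> R) (u w : phase -> R -> R -> R)
  (eta eta1 eta2 : R -> R) (h : phase -> R -> R).
Hypotheses (R00 : 0 < R0) (sigma0 : 0 < sigma) (g0 : 0 < gamma)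
  (rho0 : forall a, 0 < rho a) (c0 : forall a, 0 < c a).

(** The conditions satisfied by the difference of two solutions: [eta1] and [eta2] are the
    derivatives of eta, and [h a] is the trace at R0. The boundary conditions are demanded of every
    C^1 representative; by [c1rep_unique] it is enough to know them for one. *)
Record null_solution : Prop := NullSolution {
  ns_field : forall a, null_field (dom R0 a) gamma (c a) (u a) (w a);
  ns_eta : [/\ L2 (weight gamma) time eta, L2 (weight gamma) time eta1 & L2 (weight gamma) time eta2];
  ns_der : is_wderiv 1 time eta eta1 /\ is_wderiv 1 time eta1 eta2;
  ns_rest : is_trace time 0 eta 0 /\ is_trace time 0 eta1 0;
  ns_h : forall a, L2 (weight gamma) time (h a);
  ns_boundary : forall theta a X Y, test_fun time theta -> c1rep (dom R0 a) (pair_t (u a) theta) X Y ->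
    [/\ X R0 = \int[leb]_(t in time) (h a t * theta t),
        R0 * Y R0 - X R0 = - (rho a * R0 ^+ 2) * \int[leb]_(t in time) (eta2 t * theta t) &
        a = gas -> X 0 = 0];
  ns_jump : forall theta, test_fun time theta ->
    \int[leb]_(t in time) (h liquid t * theta t) - \int[leb]_(t in time) (h gas t * theta t) =
    2 * sigma / R0 * \int[leb]_(t in time) (eta t * theta t) }.

Hypothesis ns : null_solution.
Let mT : measurable (@time R). Proof. exact: open_measurable time_open. Qed.

Section one_frequency.
Variable s : R.
Hypotheses (gs : gamma < s) (s1 : 1 <= s) (sg : c gas <= R0 * s)
  (sl : 2 * sigma * (1 + R0 / c liquid) < rho liquid * R0 ^+ 3 * s).
Let s0 : 0 < s := lt_le_trans ltr01 s1.
Let es (t : R) : R := expR (- s * t).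
Let hat (f : R -> R) := \int[leb]_(t in time) (f t * es t).

Let hatD (f g : R -> R) x y : L2 (weight gamma) time f -> L2 (weight gamma) time g ->
  hat (fun t => x * f t + y * g t) = x * hat f + y * hat g.
Proof.
move=> Lf Lg; have If := L2_weight_exp g0 gs Lf; have Ig := L2_weight_exp g0 gs Lg.
rewrite /hat -(@RintegralZl _ _ R leb _ _ x mT If) -(@RintegralZl _ _ R leb _ _ y mT Ig).
rewrite -(@RintegralD _ _ R leb _ _ _ mT (lebZ mT x If) (lebZ mT y Ig)).
by apply: eqRint => t _; rewrite mulrDl !mulrA.
Qed.

Let testD (f g th : R -> R) x y : L2 (weight gamma) time f -> L2 (weight gamma) time g -> test_fun time th ->
  \int[leb]_(t in time) ((x * f t + y * g t) * th t) =
  x * \int[leb]_(t in time) (f t * th t) + y * \int[leb]_(t in time) (g t * th t).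
Proof.
move=> Lf Lg tt.
have ct : continuous th := @smooth_continuous R th 0 (test_smooth tt).
have bt := test_expbound (ltW s0) tt.
have If := weighted_mul_integrable gs (L2_weight_integrable g0 Lf) ct bt.
have Ig := weighted_mul_integrable gs (L2_weight_integrable g0 Lg) ct bt.
rewrite -(@RintegralZl _ _ R leb _ _ x mT If) -(@RintegralZl _ _ R leb _ _ y mT Ig).
rewrite -(@RintegralD _ _ R leb _ _ _ mT (lebZ mT x If) (lebZ mT y Ig)).
by apply: eqRint => t _; rewrite mulrDl !mulrA.
Qed.

Let hat_eta2 : hat eta2 = s ^+ 2 * hat eta.
Proof.
have [L0 L1 L2'] := ns_eta ns; have [d0 d1] := ns_der ns; have [r0 r1] := ns_rest ns.
by rewrite /hat (laplace_derivative g0 gs L1 L2' d1 r1) (laplace_derivative g0 gs L0 L1 d0 r0) mulrA expr2.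
Qed.

(** The jump condition is known against test functions only; the fundamental lemma makes it an
    identity almost everywhere, which may then be integrated against e^(- s t). *)
Let hat_jump : hat (h liquid) - hat (h gas) = 2 * sigma / R0 * hat eta.
Proof.
have [Le _ _] := ns_eta ns; have Lh := ns_h ns.
pose D t := 1 * (1 * h liquid t + -1 * h gas t) + (- (2 * sigma / R0)) * eta t.
have L1 := L2_weight_lin 1 (-1) (Lh liquid) (Lh gas).
have LD : L2 (weight gamma) time D by exact: L2_weight_lin.
have D0 : {ae leb, forall t : R, time t -> D t = 0}.
  apply: fundamental_lemma => [|th tt]; first exact: L2_weight_locally g0 _ LD.
  rewrite testD// testD// !mul1r mulN1r (ns_jump ns tt) mulNr; exact: subrr.
have : hat D = 0.
  have mD0 : measurable_fun time (fun t => D t * es t).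
    by apply: measurable_funM; [case: LD|apply: measurable_funTS; apply: continuous_measurable_fun; exact: expR_cont].
  rewrite /hat (@ae_eq_Rintegral _ _ R leb time _ (fun=> 0) mT mD0) //.
    by rewrite /Rintegral integral0.
  by apply: ae_imp D0 _ => t e tT; rewrite e// mul0r.
by rewrite hatD// hatD// !mul1r mulN1r mulNr => /eqP; rewrite subr_eq0 => /eqP.
Qed.

Let stripE a left b : (a = liquid /\ left = true /\ b = R0) \/ (a = gas /\ ((left = false /\ b = R0) \/ (left = true /\ b = 0))) ->
  forall l, 0 < l -> l <= R0 -> strip left b l `<=` dom R0 a.
Proof.
move=> H l l0 lR r; case: H => [[-> [-> ->]]|[-> [[-> ->]|[-> ->]]]]; rewrite /strip /= !in_itv/= => /andP[h1 h2].
- by rewrite h1.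
- by rewrite h2 andbT; apply: le_lt_trans h1; rewrite subr_ge0.
- by rewrite h1/= (lt_le_trans h2)// add0r.
Qed.

Let boundary a : exists X Y A D, [/\ c1rep (dom R0 a) (laplace s (u a)) X Y,
  (forall x, closure (dom R0 a) x -> X x = A * expR (s / c a * x) + D * expR (- (s / c a) * x) /\
     Y x = s / c a * (A * expR (s / c a * x) - D * expR (- (s / c a) * x))),
  X R0 = hat (h a), R0 * Y R0 - X R0 = - (rho a * R0 ^+ 2) * (s ^+ 2 * hat eta) & a = gas -> X 0 = 0].
Proof.
have nf := ns_field ns a; have oD := @dom_open R R0 a; have iD := @dom_interval R R0 a.
have neD := dom_nonempty R00 a; have [Le _ Le2] := ns_eta ns; have Lh := ns_h ns a.
have [X [Y [XY HXY]]] := laplace_boundary oD iD neD g0 gs (c0 a) nf.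
have k0 : 0 < s / c a by rewrite divr_gt0.
have [A [D HAD]] := exponential_solutions oD iD neD k0 XY (laplace_wave oD g0 gs (c0 a) nf).
pose left := if a is liquid then true else false.
have sR := @stripE a left R0; have sR' l : 0 < l -> l <= R0 -> strip left R0 l `<=` dom R0 a.
  by apply: sR; rewrite /left; case: (a); [left|right; split => //; left].
have [Hx Hy] := HXY left R0 R0 R00 sR'.
have xE : X R0 = hat (h a).
  by apply: Hx => // th X' Y' tt r'; have [] := ns_boundary ns tt r'.
(* The flux condition solved for the slope at R0, written as the pairing of a single weighted
   function, as [laplace_boundary] requires. *)
pose g t := R0^-1 * h a t + (- (rho a * R0)) * eta2 t.
have Lg : L2 (weight gamma) time g by exact: L2_weight_lin.
have yE : Y R0 = hat g.
  apply: Hy => // th X' Y' tt r'; have [e1 e2 _] := ns_boundary ns tt r'.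
  rewrite testD// -e1; have RE : R0 != 0 by rewrite gt_eqF.
  have -> : - (rho a * R0) * \int[leb]_(t in time) (eta2 t * th t) = R0^-1 * (R0 * Y' R0 - X' R0).
    by rewrite e2; field.
  by field.
exists X, Y, A, D; split => //.
- rewrite yE hatD// -hat_eta2 xE; have RE : R0 != 0 by rewrite gt_eqF.
  by field.
move=> aE; have sR0 l : 0 < l -> l <= R0 -> strip true 0 l `<=` dom R0 a.
  by rewrite aE; apply: stripE; right; split => //; right.
have [Hx0 _] := HXY true 0 R0 R00 sR0.
rewrite (Hx0 (fun=> 0) (L2_weight0 gamma)).
  by rewrite /Rintegral; under eq_integral do rewrite mul0r; rewrite integral0.
move=> th X' Y' tt r'; have [_ _ /(_ aE) ->] := ns_boundary ns tt r'.
by rewrite /Rintegral; under eq_integral do rewrite mul0r; rewrite integral0.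
Qed.

(** In the gas the trace is Ag (E - E') and the flux is Ag cf, with E - E' >= 0 and cf > 0, so the
    flux condition ties the sign of the trace to that of - hat eta. In the liquid the trace is z hat
    eta, with z > 2 sigma / R0 by [sl]. The jump condition multiplied by hat eta then gives (z - 2
    sigma / R0) (hat eta)^2 <= 0. *)
Lemma laplace_vanish : hat eta = 0 /\
  forall a, {ae leb, forall r : R, dom R0 a r -> laplace s (u a) r = 0}.
Proof.
have [Xl [Yl [Al [Dl [[cYl dXl fXl] Hl xl yl _]]]]] := boundary liquid.
have [Xg [Yg [Ag [Dg [[cYg dXg fXg] Hg xg yg /(_ erefl) xg0]]]]] := boundary gas.
set kl := s / c liquid in Hl; set kg := s / c gas in Hg.
have kl0 : 0 < kl by rewrite divr_gt0.
have kg0 : 0 < kg by rewrite divr_gt0.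
have cR a : closure (dom R0 a) R0 by exact: closure_dom.
have Al0 : Al = 0.
  have C0 : 0 <= \int[leb]_(t in time) expR (- gamma * t) by apply: Rintegral_ge0 => t _; exact: expR_ge0.
  apply: (@no_growth R R0 kl kl0 Al Dl _ Xl (velocity_energy gamma (u liquid)) (ltW R00) C0).
  - by have [] := energy_facts (@dom_open R R0 liquid) (null_L2 (ns_field ns liquid)).
  - by move=> r; apply: Rintegral_ge0 => t _; rewrite mulr_ge0 ?expR_ge0 ?sqr_ge0.
  - exact: der_continuousT dXl.
  - move=> r rR; have [] // := Hl r; apply: subset_closure; by rewrite /= in_itv/= rR.
  apply: ae_imp2 fXl (laplace_bound (@dom_open R R0 liquid) g0 gs (ns_field ns liquid)) _ => r e1 e2 rR.
  have Dr : dom R0 liquid r by rewrite /= in_itv/= rR.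
  by rewrite -e1//; exact: e2.
have [XlE YlE] := Hl R0 (cR liquid); have [XgE YgE] := Hg R0 (cR gas).
have [Xg0E _] := Hg 0 (closure_gas0 R00).
rewrite Al0 in XlE YlE; rewrite xg0 mulr0 !mulr0 expR0 !mulr1 in Xg0E.
have DgE : Dg = - Ag by apply/eqP; rewrite -addr_eq0 addrC -Xg0E.
pose E := expR (kg * R0); pose E' := expR (- kg * R0).
have E'0 : 0 < E' by exact: expR_gt0.
have EE : E' <= E by rewrite ler_expR mulNr; have := mulr_ge0 (ltW kg0) (ltW R00); lra.
have kgR : 1 <= R0 * kg by rewrite /kg mulrA ler_pdivlMr// mul1r.
(* The value of R0 X' - X at R0 for X = e^(kg r) - e^(- kg r); it is positive because kg R0 >= 1,
   which is the lower bound [sg] on s. *)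
pose cf := R0 * kg * (E + E') - (E - E').
have cf0 : 0 < cf.
  have : 1 * (E + E') <= R0 * kg * (E + E') by rewrite ler_wpM2r// addr_ge0// ltW// expR_gt0.
  rewrite /cf; lra.
have eg : Ag * cf = - (rho gas * R0 ^+ 2) * (s ^+ 2 * hat eta).
  by rewrite -yg YgE XgE DgE -/E -/E' /cf; ring.
have hg : hat (h gas) = Ag * (E - E') by rewrite -xg XgE DgE -/E -/E'; ring.
have el : hat (h liquid) * (1 + R0 * kl) = rho liquid * R0 ^+ 2 * (s ^+ 2 * hat eta).
  have : Yl R0 = - kl * Xl R0 by rewrite YlE XlE; ring.
  by rewrite -xl => yx; rewrite yx in yl; rewrite -[RHS]opprK -mulNr -yl; ring.
set et := hat eta in el eg *.
have jump := hat_jump; rewrite hg -/et in jump.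
have sgn_g : Ag * (E - E') * et <= 0.
  have z : 0 < rho gas * R0 ^+ 2 * s ^+ 2 by rewrite !mulr_gt0// ?exprn_gt0.
  have : Ag * (E - E') * et * (rho gas * R0 ^+ 2 * s ^+ 2) = - (Ag ^+ 2 * (E - E') * cf).
    have -> : Ag * (E - E') * et * (rho gas * R0 ^+ 2 * s ^+ 2) = - (Ag * (E - E')) * (- (rho gas * R0 ^+ 2) * (s ^+ 2 * et)) by ring.
    by rewrite -eg; ring.
  move=> e; rewrite -(pmulr_lle0 _ z) e oppr_le0; apply: mulr_ge0; last exact: ltW.
  by apply: mulr_ge0; [exact: sqr_ge0|rewrite subr_ge0].
have et0 : et = 0.
  have kR : 0 < 1 + R0 * kl by rewrite addr_gt0// mulr_gt0.
  pose z := rho liquid * R0 ^+ 2 * s ^+ 2 / (1 + R0 * kl).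
  have hl : hat (h liquid) = z * et.
    apply: (mulIf (lt0r_neq0 kR)); rewrite el /z; field; exact: lt0r_neq0.
  have zbig : 2 * sigma / R0 < z.
    rewrite /z ltr_pdivlMr// mulrAC ltr_pdivrMr//.
    have q : 2 * sigma * (1 + R0 * kl) <= 2 * sigma * (1 + R0 / c liquid) * s.
      rewrite -[leRHS]mulrA; apply: ler_wpM2l; first by rewrite mulr_ge0// ltW.
      rewrite mulrDl mul1r; apply: lerD => //; rewrite /kl le_eqVlt; apply/orP; left; apply/eqP; field.
      exact: lt0r_neq0.
    apply: (le_lt_trans q).
    have -> : rho liquid * R0 ^+ 2 * s ^+ 2 * R0 = rho liquid * R0 ^+ 3 * s * s by ring.
    by rewrite ltr_pM2r.
  have : (z - 2 * sigma / R0) * et ^+ 2 <= 0.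
    have -> : (z - 2 * sigma / R0) * et ^+ 2 = (hat (h liquid) - 2 * sigma / R0 * et) * et by rewrite hl; ring.
    by rewrite -jump; rewrite [X in X * _](_ : _ = Ag * (E - E'))//; ring.
  rewrite pmulr_rle0 ?subr_gt0// => et2; apply/eqP; rewrite -sqrf_eq0 eq_le et2 sqr_ge0//.
split => //.
have Ag0 : Ag = 0.
  by move: eg; rewrite et0 !mulr0 => /eqP; rewrite mulf_eq0 (gt_eqF cf0) orbF => /eqP.
have Xl0 : Dl = 0.
  have : hat (h liquid) = 0 by move: jump; rewrite et0 Ag0 mul0r mulr0 subr0.
  by rewrite -xl XlE mul0r add0r => /eqP; rewrite mulf_eq0 (gt_eqF (expR_gt0 _)) orbF => /eqP.
case.
- apply: ae_imp fXl _ => r e Dr; rewrite e//; have [-> _] := Hl r (subset_closure Dr).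
  by rewrite Al0 Xl0 !mul0r addr0.
apply: ae_imp fXg _ => r e Dr; rewrite e//; have [-> _] := Hg r (subset_closure Dr).
by rewrite DgE Ag0 oppr0 !mul0r addr0.
Qed.

End one_frequency.

Lemma null_solution_zero : {ae leb, forall t : R, time t -> eta t = 0} /\
  forall a, {ae (leb \x leb)%E, forall z : R * R, (dom R0 a `*` time) z -> u a z.1 z.2 = 0}.
Proof.
(* Exceeds the sum of all lower bounds on the frequency, so that each S + n qualifies. *)
pose S := 1 + (gamma + 1) + `|c gas / R0| + `|2 * sigma * (1 + R0 / c liquid) / (rho liquid * R0 ^+ 3)|.
have S1 n : [/\ gamma < S + n%:R, 1 <= S + n%:R, c gas <= R0 * (S + n%:R) &
  2 * sigma * (1 + R0 / c liquid) < rho liquid * R0 ^+ 3 * (S + n%:R)].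
  have n0 : 0 <= n%:R :> R by [].
  have a1 := ler_norm (c gas / R0); have b1 := normr_ge0 (c gas / R0).
  set q := 2 * sigma * (1 + R0 / c liquid) / (rho liquid * R0 ^+ 3) in S *.
  have a2 := ler_norm q; have b2 := normr_ge0 q.
  have rR : 0 < rho liquid * R0 ^+ 3 by rewrite mulr_gt0// exprn_gt0.
  rewrite /S; split.
  - move: (g0) => gg; lra.
  - move: (g0) => gg; lra.
  - rewrite mulrC -ler_pdivrMr//; move: (g0) => gg; lra.
  rewrite [ltRHS]mulrC -ltr_pdivrMr// -/q; move: (g0) => gg; lra.
have van n := let: And4 p1 p2 p3 p4 := S1 n in laplace_vanish p1 p2 p3 p4.
have S0 : gamma < S by have [+ _ _ _] := S1 0%N; rewrite addr0.
have eE (t : R) (n : nat) : expR (- S * t) * expR (- n%:R * t) = expR (- (S + n%:R) * t).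
  by rewrite -expRD; congr expR; ring.
have cancel (x t : R) : x * expR (- S * t) = 0 -> x = 0.
  by move=> /eqP; rewrite mulf_eq0 (gt_eqF (expR_gt0 _)) orbF => /eqP.
split.
  have [Le _ _] := ns_eta ns; have I1 := L2_weight_exp g0 S0 Le.
  have H : {ae leb, forall t : R, time t -> eta t * expR (- S * t) = 0}.
    apply: lerch I1 _ => n; have [<- _] := van n.
    by apply: eqRint => t _; rewrite -mulrA eE.
  by apply: ae_imp H _ => t e tT; apply: (cancel _ t); exact: e.
move=> a; have oD := @dom_open R R0 a; have mD : measurable (dom R0 a) by exact: open_measurable.
have nf := ns_field ns a; have [mu _] := null_L2 nf.
apply: ae_product => //.
have aS : admissible gamma (fun t => expR (- S * t)).
  apply: (expbound_admissible (ltW S0)); first exact: expR_cont.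
  by exists 1 => t _; rewrite mul1r ger0_norm ?expR_ge0.
have [_ i1] := pair_t_piece oD g0 (null_L2 nf) aS.
(* The exceptional set of r depends on the frequency; Lerch's theorem uses only the countably many S
   + n, so a common null set can be chosen. *)
have H : {ae leb, forall r : R, forall n, dom R0 a r -> laplace (S + n%:R) (u a) r = 0}.
  by apply: ae_foralln => n; have [_ +] := van n; apply.
apply: ae_imp2 i1 H _ => r + e Dr => /(_ Dr) Ir.
have H2 : {ae leb, forall t : R, time t -> u a r t * expR (- S * t) = 0}.
  apply: lerch Ir _ => n; rewrite -(e n Dr).
  by apply: eqRint => t _; rewrite -mulrA eE.
by apply: ae_imp H2 _ => t e' tT; apply: (cancel _ t); exact: e'.
Qed.

End null_solution.

(** * Differences of weighted solutions *)

Section weak_solutions.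
Context {R : realType}.
Variables (R0 sigma gamma : R) (rho c : phase -> R) (M : nat) (V0 V1 : phase -> R -> R) (eta0 zeta0 : R).
Hypotheses (R00 : 0 < R0) (sigma0 : 0 < sigma) (g0 : 0 < gamma)
  (rho0 : forall a, 0 < rho a) (c0 : forall a, 0 < c a).
Let mT : measurable (@time R). Proof. exact: open_measurable time_open. Qed.
Let gs : gamma < gamma + 1. Proof. by rewrite ltrDl. Qed.

Lemma L2_weight_ae (f g : R -> R) : measurable_fun time f -> L2 (weight gamma) time g ->
  {ae leb, forall t : R, time t -> f t = g t} -> L2 (weight gamma) time f.
Proof.
move=> mf [mg Ig] e; split => //.
have mw : measurable_fun time (weight gamma) by apply: measurable_funTS; apply: continuous_measurable_fun; exact: expR_cont.
have mF : measurable_fun time (fun t => weight gamma t * f t ^+ 2).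
  by apply: measurable_funM => //; exact: measurable_funX.
have mG : measurable_fun time (fun t => weight gamma t * g t ^+ 2).
  by apply: measurable_funM => //; exact: measurable_funX.
apply/integrableP; split; first exact/measurable_EFinP.
have /integrableP[_] := Ig; apply: le_lt_trans; rewrite le_eqVlt; apply/orP; left; apply/eqP.
apply: ge0_ae_eq_integral => //.
- by apply: measurableT_comp => //; exact/measurable_EFinP.
- by apply: measurableT_comp => //; exact/measurable_EFinP.
by apply: ae_imp e _ => t h tT /=; rewrite h.
Qed.

Lemma Hgamma_L2 k (f : R -> R) : Hgamma gamma k f -> L2 (weight gamma) time f.
Proof.
move=> /(_ 0%N isT)[g fg Lg]; have [lf _ _] := fg; have [mf _ _] := lf.
exact: L2_weight_ae mf Lg (is_wderiv_ae_unique (wderiv0 lf) fg).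
Qed.

(** The content of a weighted solution with its derivatives, traces and representatives named
    instead of selected by choice; in this form the conditions are stable under subtraction. *)
Record weak_solution (v w : phase -> R -> R -> R) (eta eta1 eta2 : R -> R) (h : phase -> R -> R) : Prop := WeakSolution {
  ws_L2 : forall a, L2gamma_L2 gamma (dom R0 a) (v a) /\ L2gamma_L2 gamma (dom R0 a) (w a);
  ws_dt : forall a, is_dt 1 (dom R0 a) (v a) (w a);
  ws_wave : forall a theta phi, test_fun time theta -> test_fun (dom R0 a) phi ->
    \int[leb]_(r in dom R0 a) (pair_t (v a) (derive1n 2 theta) r * phi r) =
    c a ^+ 2 * \int[leb]_(r in dom R0 a) (pair_t (v a) theta r * derive1n 2 phi r);
  ws_init : forall a psi, test_fun (dom R0 a) psi ->
    is_trace time 0 (pair_r (dom R0 a) (v a) psi) (\int[leb]_(r in dom R0 a) (V0 a r * psi r)) /\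
    is_trace time 0 (pair_r (dom R0 a) (w a) psi) (\int[leb]_(r in dom R0 a) (V1 a r * psi r));
  ws_eta : [/\ L2 (weight gamma) time eta, L2 (weight gamma) time eta1 & L2 (weight gamma) time eta2];
  ws_der : is_wderiv 1 time eta eta1 /\ is_wderiv 1 time eta1 eta2;
  ws_start : is_trace time 0 eta eta0 /\ is_trace time 0 eta1 zeta0;
  ws_h : forall a, L2 (weight gamma) time (h a);
  ws_boundary : forall theta a, test_fun time theta -> exists X Y,
    [/\ c1rep (dom R0 a) (pair_t (v a) theta) X Y,
        X R0 = \int[leb]_(t in time) (h a t * theta t),
        R0 * Y R0 - X R0 = - (rho a * R0 ^+ 2) * \int[leb]_(t in time) (eta2 t * theta t) &
        a = gas -> X 0 = 0];
  ws_jump : forall theta, test_fun time theta ->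
    \int[leb]_(t in time) (h liquid t * theta t) - \int[leb]_(t in time) (h gas t * theta t) =
    2 * sigma / R0 * \int[leb]_(t in time) (eta t * theta t) }.

(** [trace] and [wderiv] choose a value, which is meaningful only where one exists. Existence is
    derived from weak differentiability: in t for eta and for the pairings with psi, in r for the
    pairings with theta. The regularity of eta' at order 1 provides [eta2]. *)
Lemma weighted_weak v eta : weighted_solution R0 sigma rho c gamma M.+1 V0 V1 eta0 zeta0 v eta ->
  exists w eta1 eta2 h, weak_solution v w eta eta1 eta2 h.
Proof.
move=> [[[deta ed Hd] He Hh Hv] Hs [Hi i0 i1]].
have [h Hh'] : exists h : phase -> R -> R, forall a, Hgamma gamma M.+1 (h a) /\ forall theta, test_fun time theta ->
    trace (dom R0 a) R0 (pair_t (v a) theta) = \int[leb]_(t in time) (h a t * theta t).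
  have [hl Hl] := Hh liquid; have [hg Hg] := Hh gas.
  by exists (fun a => if a is liquid then hl else hg); case.
have [w Hw] : exists w : phase -> R -> R -> R, forall a, is_dt 1 (dom R0 a) (v a) (w a) /\ L2gamma_L2 gamma (dom R0 a) (w a).
  have [_ /(_ 1%N isT)[wl dl Ll]] := Hv liquid; have [_ /(_ 1%N isT)[wg dg Lg]] := Hv gas.
  by exists (fun a => if a is liquid then wl else wg); case.
have [eta2 dd2 Leta2] := Hd 1%N isT.
have Lv a : L2gamma_L2 gamma (dom R0 a) (v a) by have [] := Hv a.
have wave a theta phi : test_fun time theta -> test_fun (dom R0 a) phi ->
    \int[leb]_(r in dom R0 a) (pair_t (v a) (derive1n 2 theta) r * phi r) =
    c a ^+ 2 * \int[leb]_(r in dom R0 a) (pair_t (v a) theta r * derive1n 2 phi r).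
  by move=> tt tp; apply/eqP; rewrite -subr_eq0; apply/eqP; have [+ _ _ _] := Hs _ tt; exact.
have Le := Hgamma_L2 He; have Ld := Hgamma_L2 Hd.
have eta_tt theta : test_fun time theta ->
    \int[leb]_(t in time) (eta t * derive1n 2 theta t) = \int[leb]_(t in time) (eta2 t * theta t).
  move=> tt; have [_ _ h1] := ed; have [_ _ h2] := dd2.
  have := h1 _ (test_derive1n 1 tt); rewrite expr1 mulN1r => e1.
  have := h2 _ tt; rewrite expr1 mulN1r => e2.
  rewrite -[RHS]opprK -e2 -e1; by [].
exists w, deta, eta2, h; split => //.
- by move=> a; split => //; have [] := Hw a.
- by move=> a; have [] := Hw a.
- move=> a psi tp; have oD := @dom_open R R0 a; have [wdt Lw] := Hw a.
  have W1 := pair_r_wderiv1 oD g0 gs (Lv a) Lw wdt tp.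
  have W2 := pair_r_wderiv2 oD g0 gs (Lv a) (@wave a) tp.
  have [_ lu2'] := pair_r_loc oD g0 (Lv a) (test_multiplier (test_derive1n 2 tp)).
  have lG : loc_int ((fun t => c a ^+ 2 * pair_r (dom R0 a) (v a) (derive1n 2 psi) t) \_ time).
    rewrite (_ : _ \_ time = fun t => c a ^+ 2 * (pair_r (dom R0 a) (v a) (derive1n 2 psi) \_ time) t); first exact: loc_intZ.
    by apply/funext => t; rewrite !patchE; case: ifP => // _; rewrite mulr0.
  have [X [Y [cY dX XX WY _]]] := W2_rep time_interval time_nonempty W2 lG.
  have cX := der_continuousT dX.
  have XX' : {ae leb, forall t : R, time t -> X t = pair_r (dom R0 a) (v a) psi t}.
    by apply: ae_imp XX _ => t e tT; rewrite e.
  have T1 := continuous_is_trace 0 cX XX'.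
  have YY : {ae leb, forall t : R, time t -> Y t = pair_r (dom R0 a) (w a) psi t}.
    exact: is_wderiv_ae_unique WY W1.
  have T2 := continuous_is_trace 0 cY YY.
  have [<- <-] := Hi a psi tp; split; first exact: trace_is T1.
  have YZ : {ae leb, forall t : R, time t -> Y t = wderiv 1 time (pair_r (dom R0 a) (v a) psi) t}.
    exact: is_wderiv_ae_unique WY (wderiv_is W1).
  rewrite (traceE time_open closure_time (continuous_is_trace 0 cY YZ)).
  exact: T2.
- have tr f q : is_wderiv 1 time f q -> L2 (weight gamma) time q -> exists y, is_trace time 0 f y.
    move=> fq Lq; have lq := L2_weight_loc_int g0 Lq; have [_ lI _] := fq.
    have [C HC] := wderiv1_const time_interval time_nonempty fq (prim_wderiv time_open lI lq).
    have cF : continuous (fun t : R => C + prim (q \_ time) t).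
      by move=> t; apply: continuousD; [exact: cst_continuous|exact: prim_continuous].
    exists (C + prim (q \_ time) 0); apply: continuous_is_trace cF _.
    by apply: ae_imp HC _ => t e tT; rewrite e.
  have [y T1] := tr _ _ ed Ld; have [z T2] := tr _ _ dd2 Leta2.
  split; first by rewrite -i0; exact: trace_is T1.
  have e1 : {ae leb, forall t : R, time t -> deta t = wderiv 1 time eta t}.
    exact: is_wderiv_ae_unique ed (wderiv_is ed).
  rewrite -i1 (traceE time_open closure_time (is_trace_ae T2 e1)); exact: T2.
- by move=> a; have [/Hgamma_L2] := Hh' a.
- move=> theta a tt; have oD := @dom_open R R0 a; have tt2 := test_derive1n 2 tt.
  have at0 := test_admissible g0 gs tt; have at2 := test_admissible g0 gs tt2.
  have [lX _] := pair_t_loc oD g0 (Lv a) at0; have [lX2 lZ'] := pair_t_loc oD g0 (Lv a) at2.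
  have lZ : loc_int ((fun r => c a ^- 2 * pair_t (v a) (derive1n 2 theta) r) \_ (dom R0 a)).
    rewrite (_ : _ \_ _ = fun t => c a ^- 2 * (pair_t (v a) (derive1n 2 theta) \_ (dom R0 a)) t); first exact: loc_intZ.
    by apply/funext => t; rewrite !patchE; case: ifP => // _; rewrite mulr0.
  have H : is_wderiv 2 (dom R0 a) (pair_t (v a) theta) (fun r => c a ^- 2 * pair_t (v a) (derive1n 2 theta) r).
    split => //; first exact: locally_integrableZ.
    move=> phi tp; rewrite sqrrN expr1n mul1r.
    rewrite [in RHS](@eqRint _ _ (fun r => c a ^- 2 * (pair_t (v a) (derive1n 2 theta) r * phi r))); last by move=> r _; rewrite mulrA.
    have mD : measurable (dom R0 a) by exact: open_measurable.
    rewrite (@RintegralZl _ _ R leb _ _ (c a ^- 2) mD (integrable_test lX2 tp)) (wave _ _ _ tt tp) mulrA mulVf ?mul1r//.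
    by rewrite expf_neq0// gt_eqF.
  have [X [Y [cY dX XX WY _]]] := W2_rep (@dom_interval R R0 a) (dom_nonempty R00 a) H lZ.
  have cX := der_continuousT dX; exists X, Y.
  have [_ s2 s3 s4] := Hs _ tt.
  have xE : X R0 = \int[leb]_(t in time) (h a t * theta t).
    by have [_ <- //] := Hh' a; apply/esym; apply: trace_profile => //; exact: closure_dom.
  split => //.
    have := s4 a; rewrite (flux_profile R00 rho cX cY XX WY) eta_tt// => fl.
    have rR : rho a * R0 ^+ 2 != 0 by rewrite mulf_neq0 ?expf_neq0 ?gt_eqF.
    by rewrite mulNr -mulrN -fl mulrA mulfV// mul1r.
  move=> ag; have e : trace (dom R0 a) 0 (pair_t (v a) theta) = X 0.
    by apply: trace_profile => //; rewrite ag; exact: closure_gas0.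
  by rewrite -e ag.
move=> theta tt; have [_ _ + _] := Hs _ tt.
by have [_ ->//] := Hh' liquid; have [_ ->//] := Hh' gas.
Qed.

Lemma L2gammaB (I : set R) (f g : R -> R -> R) : measurable I -> L2gamma_L2 gamma I f -> L2gamma_L2 gamma I g ->
  L2gamma_L2 gamma I (fun r t => f r t - g r t).
Proof.
move=> mI [mf If] [mg Ig].
have mIT : measurable (I `*` time : set (R * R)) by exact: measurableX.
have mh : measurable_fun (I `*` time) (fun z : R * R => f z.1 z.2 - g z.1 z.2) by exact: measurable_funB.
split => //.
have If' : (leb \x leb)%E.-integrable (I `*` time) (EFin \o (fun z : R * R => weight gamma z.2 * f z.1 z.2 ^+ 2)) by [].
have Ig' : (leb \x leb)%E.-integrable (I `*` time) (EFin \o (fun z : R * R => weight gamma z.2 * g z.1 z.2 ^+ 2)) by [].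
have I1 := @integrable_realZ _ _ R (leb \x leb)%E _ mIT 2 _ If'.
have I2 := @integrable_realZ _ _ R (leb \x leb)%E _ mIT 2 _ Ig'.
have I3 := @integrable_realD _ _ R (leb \x leb)%E _ mIT _ _ I1 I2.
apply: (prod_integrable_le mIT _ I3).
  apply: measurable_funM; last exact: measurable_funX.
  apply: (@measurable_fun_snd R I time (weight gamma) mT).
  by apply: measurable_funTS; apply: continuous_measurable_fun; exact: expR_cont.
move=> z _; rewrite ger0_norm; last by rewrite mulr_ge0 ?expR_ge0 ?sqr_ge0.
have := ler_wpM2l (expR_ge0 (- gamma * z.2)) (sqrB_le (f z.1 z.2) (g z.1 z.2)); rewrite -/(weight gamma z.2) => h.
by apply: (le_trans h); rewrite le_eqVlt; apply/orP; left; apply/eqP; ring.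
Qed.

Section difference_of_fields.
Variables (I : set R) (f g : R -> R -> R).
Hypotheses (oI : open I) (Lf : L2gamma_L2 gamma I f) (Lg : L2gamma_L2 gamma I g).

Lemma pair_tB k : admissible gamma k ->
  {ae leb, forall r : R, I r -> pair_t f k r - pair_t g k r = pair_t (fun r t => f r t - g r t) k r}.
Proof.
move=> ak; have [_ h1] := pair_t_piece oI g0 Lf ak; have [_ h2] := pair_t_piece oI g0 Lg ak.
apply: ae_imp2 h1 h2 _ => r + + Ir => /(_ Ir) i1 /(_ Ir) i2.
rewrite /pair_t -(@RintegralB _ _ R leb _ _ _ mT i1 i2).
by apply: eqRint => t _; rewrite mulrBl.
Qed.

Lemma pair_rB a : multiplier I a ->
  {ae leb, forall t : R, time t -> pair_r I f a t - pair_r I g a t = pair_r I (fun r t => f r t - g r t) a t}.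
Proof.
move=> ma; have [_ h1] := pair_r_piece oI g0 Lf ma; have [_ h2] := pair_r_piece oI g0 Lg ma.
have mI : measurable I by exact: open_measurable.
apply: ae_imp2 h1 h2 _ => t + + tT => /(_ tT) i1 /(_ tT) i2.
rewrite /pair_r -(@RintegralB _ _ R leb _ _ _ mI i1 i2).
by apply: eqRint => r _; rewrite mulrBl.
Qed.

Lemma integral_pair_tB k phi : admissible gamma k -> test_fun I phi ->
  \int[leb]_(r in I) (pair_t (fun r t => f r t - g r t) k r * phi r) =
  \int[leb]_(r in I) (pair_t f k r * phi r) - \int[leb]_(r in I) (pair_t g k r * phi r).
Proof.
move=> ak tp; have mI : measurable I by exact: open_measurable.
have [lf _] := pair_t_loc oI g0 Lf ak; have [lg _] := pair_t_loc oI g0 Lg ak.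
have [lh _] := pair_t_loc oI g0 (L2gammaB mI Lf Lg) ak.
have i1 := integrable_test lf tp; have i2 := integrable_test lg tp; have i3 := integrable_test lh tp.
rewrite -(@RintegralB _ _ R leb _ _ _ mI i1 i2).
apply: ae_eq_Rintegral => //; first exact: integrable_real_measurable i3.
  exact: integrable_real_measurable (lebB mI i1 i2).
by apply: ae_imp (pair_tB ak) _ => r h Ir; rewrite -h// mulrBl.
Qed.

End difference_of_fields.

Lemma L2_weightB (f g : R -> R) : L2 (weight gamma) time f -> L2 (weight gamma) time g ->
  L2 (weight gamma) time (fun t => f t - g t).
Proof.
move=> Lf Lg; have := L2_weight_lin 1 (-1) Lf Lg; congr (L2 _ _ _).
by apply/funext => t; rewrite mul1r mulN1r.
Qed.

Lemma integral_testB (f g th : R -> R) : L2 (weight gamma) time f -> L2 (weight gamma) time g -> test_fun time th ->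
  \int[leb]_(t in time) ((f t - g t) * th t) =
  \int[leb]_(t in time) (f t * th t) - \int[leb]_(t in time) (g t * th t).
Proof.
move=> Lf Lg tt.
have i1 := integrable_test (L2_weight_locally g0 Lf) tt.
have i2 := integrable_test (L2_weight_locally g0 Lg) tt.
by rewrite -(@RintegralB _ _ R leb _ _ _ mT i1 i2); apply: eqRint => t _; rewrite mulrBl.
Qed.

Lemma wderiv1B (f g f1 g1 : R -> R) : is_wderiv 1 time f f1 -> is_wderiv 1 time g g1 ->
  is_wderiv 1 time (fun t => f t - g t) (fun t => f1 t - g1 t).
Proof.
move=> [lf lf1 Hf] [lg lg1 Hg]; have lB (p q : R -> R) : locally_integrable time p -> locally_integrable time q ->
    locally_integrable time (fun t => p t - q t).
  move=> lp lq; have := locally_integrableD lp (locally_integrableZ (-1) lq).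
  by congr (locally_integrable _ _); apply/funext => t /=; rewrite mulN1r.
split; [exact: lB|exact: lB|] => th tt.
have B (p q k : R -> R) : locally_integrable time p -> locally_integrable time q -> test_fun time k ->
   \int[leb]_(t in time) ((p t - q t) * k t) = \int[leb]_(t in time) (p t * k t) - \int[leb]_(t in time) (q t * k t).
  move=> lp lq tk; rewrite -(@RintegralB _ _ R leb _ _ _ mT (integrable_test lp tk) (integrable_test lq tk)).
  by apply: eqRint => t _; rewrite mulrBl.
by rewrite B//; [rewrite Hf// Hg// B// mulrBr|exact: test_derive1n].
Qed.

Lemma weak_difference v w eta eta1 eta2 h v' w' zeta zeta1 zeta2 k :
  weak_solution v w eta eta1 eta2 h -> weak_solution v' w' zeta zeta1 zeta2 k ->
  null_solution R0 sigma gamma rho c (fun a r t => v a r t - v' a r t) (fun a r t => w a r t - w' a r t)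
    (fun t => eta t - zeta t) (fun t => eta1 t - zeta1 t) (fun t => eta2 t - zeta2 t)
    (fun a t => h a t - k a t).
Proof.
move=> S S'; have mD a : measurable (dom R0 a) by exact: open_measurable (@dom_open R R0 a).
have oD a := @dom_open R R0 a.
have L a : [/\ L2gamma_L2 gamma (dom R0 a) (v a), L2gamma_L2 gamma (dom R0 a) (w a),
    L2gamma_L2 gamma (dom R0 a) (v' a) & L2gamma_L2 gamma (dom R0 a) (w' a)].
  by have [? ?] := ws_L2 S a; have [? ?] := ws_L2 S' a.
have [e0 e1 e2] := ws_eta S; have [z0 z1 z2] := ws_eta S'.
split.
- move=> a; have [Lv Lw Lv' Lw'] := L a; split.
  + exact: L2gammaB.
  + exact: L2gammaB.
  + move=> th tt; have a1 := test_admissible g0 gs (test_derive1n 1 tt); have a0 := test_admissible g0 gs tt.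
    have A1 := pair_tB (oD a) Lv Lv' a1; have A2 := pair_tB (oD a) Lw Lw' a0.
    have A3 : {ae leb, forall r : R, dom R0 a r -> pair_t (v a) (derive1n 1 th) r = (-1) ^+ 1 * pair_t (w a) th r} by exact: ws_dt S a th tt.
    have A4 : {ae leb, forall r : R, dom R0 a r -> pair_t (v' a) (derive1n 1 th) r = (-1) ^+ 1 * pair_t (w' a) th r} by exact: ws_dt S' a th tt.
    have A12 := ae_imp2 A1 A2 (fun x p q => conj p q); have A34 := ae_imp2 A3 A4 (fun x p q => conj p q).
    apply: ae_imp2 A12 A34 _ => r [p q] [p' q'] Dr.
    by rewrite -p// -q// p'// q'// mulrBr.
  + move=> th phi tt tp; have a2 := test_admissible g0 gs (test_derive1n 2 tt); have a0 := test_admissible g0 gs tt.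
    rewrite !(integral_pair_tB (oD a) Lv Lv')//; last exact: test_derive1n.
    by rewrite (ws_wave S tt tp) (ws_wave S' tt tp) mulrBr.
  move=> psi tp; have [t1 t2] := ws_init S tp; have [t1' t2'] := ws_init S' tp; have mp := test_multiplier tp.
  have := is_traceB t1 t1' (pair_rB (oD a) Lv Lv' mp); have := is_traceB t2 t2' (pair_rB (oD a) Lw Lw' mp).
  by rewrite !subrr.
- by split; exact: L2_weightB.
- by have [d0 d1] := ws_der S; have [d0' d1'] := ws_der S'; split; exact: wderiv1B.
- have [t0 t1] := ws_start S; have [t0' t1'] := ws_start S'.
  have refl (p q : R -> R) : {ae leb, forall t : R, time t -> p t - q t = p t - q t} by apply: aeW.
  have := is_traceB t0 t0' (refl _ _); have := is_traceB t1 t1' (refl _ _).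
  by rewrite !subrr.
- by move=> a; apply: L2_weightB; [exact: ws_h S a|exact: ws_h S' a].
- move=> th a X Y tt XY; have [Lv _ Lv' _] := L a; have a0 := test_admissible g0 gs tt.
  have [X1 [Y1 [R1 x1 y1 o1]]] := ws_boundary S a tt; have [X2 [Y2 [R2 x2 y2 o2]]] := ws_boundary S' a tt.
  have RB := c1repB R1 R2 (pair_tB (oD a) Lv Lv' a0).
  have [ex ey] := c1rep_unique (oD a) (closure_dom R00 a) XY RB.
  split.
  + by rewrite ex x1 x2 integral_testB//; [exact: ws_h S a|exact: ws_h S' a].
  + rewrite ex ey integral_testB// [in RHS]mulrBr -y1 -y2; ring.
  move=> ag; have cl0 : closure (dom R0 a) 0 by rewrite ag; exact: closure_gas0.
  by have [-> _] := c1rep_unique (oD a) cl0 XY RB; rewrite o1// o2// subrr.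
move=> th tt; rewrite !integral_testB//; try (by have := ws_h S; exact); try (by have := ws_h S'; exact).
by have := ws_jump S tt; have := ws_jump S' tt; rewrite mulrBr => <- <-; ring.
Qed.

Lemma weighted_unique v eta v' eta' :
  weighted_solution R0 sigma rho c gamma M.+1 V0 V1 eta0 zeta0 v eta ->
  weighted_solution R0 sigma rho c gamma M.+1 V0 V1 eta0 zeta0 v' eta' ->
  (forall a, {ae (leb \x leb)%E, forall z : R * R, (dom R0 a `*` time) z -> v' a z.1 z.2 = v a z.1 z.2}) /\
  {ae leb, forall t : R, time t -> eta' t = eta t}.
Proof.
move=> /weighted_weak[w [e1 [e2 [h S]]]] /weighted_weak[w' [f1 [f2 [k S']]]].
have [E U] := null_solution_zero R00 sigma0 g0 rho0 c0 (weak_difference S' S).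
split; last by apply: ae_imp E _ => t e tT; apply/eqP; rewrite -subr_eq0; apply/eqP; exact: e.
by move=> a; apply: ae_imp (U a) _ => z e zD; apply/eqP; rewrite -subr_eq0; apply/eqP; exact: e.
Qed.

End weak_solutions.

Theorem theorem3p2 (R : realType) (R0 : R) (rhos cs : phase -> R) (sigmas : R)
    (R0_gt0 : 0 < R0) (rhos_gt0 : forall a, 0 < rhos a)
    (cs_gt0 : forall a, 0 < cs a) (sigmas_gt0 : 0 < sigmas) :
  exists2 gammas : R, 0 < gammas &
  forall (rho c : phase -> R) (sigma : R),
    (forall a, rhos a <= rho a) -> (forall a, cs a <= c a) ->
    0 < sigma -> sigma <= sigmas ->
  forall (m : nat) (gamma : R), (1 <= m)%N -> gammas < gamma ->
  forall (V0 V1 : phase -> R -> R) (eta0 zeta0 : R),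
    data_class R0 sigma rho c m V0 V1 eta0 zeta0 ->
  exists (v : phase -> R -> R -> R) (eta : R -> R),
    [/\ weighted_solution R0 sigma rho c gamma m V0 V1 eta0 zeta0 v eta,
        forall (v' : phase -> R -> R -> R) (eta' : R -> R),
          weighted_solution R0 sigma rho c gamma m V0 V1 eta0 zeta0 v' eta' ->
          (forall a, {ae (leb \x leb)%E, forall z : R * R,
             (dom R0 a `*` time) z -> v' a z.1 z.2 = v a z.1 z.2}) /\
          {ae leb, forall t : R, time t -> eta' t = eta t} &
        forall (a : phase) (j : nat), (1 <= j <= m)%N ->
          exists2 w, is_dt j.-1 (dom R0 a) (v a) w
            & L2gamma_H1 gamma (dom R0 a) w].
Proof.
(* The least q with (2 sigmas)^2 (5 tau + 1) <= q sigmas rho_l R0^3 when c_l and rho_l take their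
   lower bounds, where tau = R0 / c_l; this is the absorption condition of the energy estimate with
   weight K = sigmas. The summand 2 of the threshold serves the requirement 2 <= kap. *)
pose q := 4 * sigmas * (5 * (R0 / cs liquid) + 1) / (rhos liquid * R0 ^+ 3).
have den : 0 < rhos liquid * R0 ^+ 3 by rewrite mulr_gt0// exprn_gt0.
have q0 : 0 < q.
  by rewrite divr_gt0// mulr_gt0 ?mulr_gt0// addr_gt0// mulr_gt0// divr_gt0.
exists (2 + q); first by rewrite addr_gt0.
move=> rho c sigma rhoE cE sg0 sgs m gamma m1 kapg V0 V1 eta0 zeta0 dc.
(* With m = M.+1, the data have both fluxes at the levels 0 to M, which are the levels of the
   interface equations solved above. *)
case: m m1 dc => // M _ dc; set kap := 2 + q in kapg *.
have kap2 : 2 <= kap by rewrite lerDl ltW.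
have rho0 a : 0 < rho a := lt_le_trans (rhos_gt0 a) (rhoE a).
have c0 a : 0 < c a := lt_le_trans (cs_gt0 a) (cE a).
have kapE : (2 * sigmas) ^+ 2 * (5 * (R0 / c liquid) + 1) <= kap * sigmas * (rho liquid * R0 ^+ 3).
  apply: (@le_trans _ _ ((2 * sigmas) ^+ 2 * (5 * (R0 / cs liquid) + 1))).
    rewrite ler_wpM2l ?sqr_ge0// lerD2r ler_wpM2l// ler_wpM2l ?(ltW R0_gt0)//.
    by rewrite lef_pV2 ?posrE.
  have -> : (2 * sigmas) ^+ 2 * (5 * (R0 / cs liquid) + 1) = q * sigmas * (rhos liquid * R0 ^+ 3).
    rewrite /q; have r1 : rhos liquid != 0 by rewrite gt_eqF.
    have r2 : R0 != 0 by rewrite gt_eqF.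
    have r3 : cs liquid != 0 by rewrite gt_eqF.
    by field; rewrite r1 r2 r3.
  have sq : 0 <= kap * sigmas by rewrite mulr_ge0 ?(ltW sigmas_gt0)// (le_trans _ kap2).
  apply: (@le_trans _ _ (kap * sigmas * (rhos liquid * R0 ^+ 3))).
    by rewrite ler_wpM2r ?(ltW den)// ler_wpM2r ?(ltW sigmas_gt0)// /kap lerDr.
  by rewrite ler_wpM2l// ler_wpM2r// exprn_ge0// ltW.
have [HV0 HV1 _] := dc.
have [P [N [e cl]]] := classical_exists R0_gt0 rho0 c0 sg0 sgs kap2 kapg kapE dc.
have W := classical_weighted R0_gt0 c0 kap2 kapg HV0 HV1 cl.
have g0 : 0 < gamma by apply: lt_trans kapg; exact: lt_le_trans kap2.
exists (fun a => wave R0 c P N a 0), (e 0%N); split => //.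
  by move=> v' eta' W'; have [Hv He] := weighted_unique R0_gt0 sg0 g0 rho0 c0 W W'.
by move=> a j jM; exact: classical_H1 R0_gt0 c0 kap2 kapg HV0 cl a j jM.
Qed.
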